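(* The weak (resp. full) opacity with respect to the first $N$ observations decision problem, restricted to observable event-recording automata (oERAs), is PSPACE-complete.
   Context: A timed automaton (TA) is a tuple $\mathcal{A}=(\Sigma,L,\ell_0,L_{priv},L_f,X,I,E)$ where $\Sigma$ is a finite set of actions, $L$ a finite set of locations, $\ell_0\in L$ the initial location, $L_{priv}\subseteq L$ the set of private locations, $L_f\subseteq L$ the set of final locations, $X$ a finite set of clocks, $I$ assigns to each location an invariant, and $E$ is a finite set of edges $(\ell,g,a,R,\ell')$ with $\ell,\ell'\in L$, $a\in\Sigma\cup\{\varepsilon\}$ (where $\varepsilon$ is an unobservable action), $R\subseteq X$ the set of clocks to reset, and $g$ a guard. Invariants and guards are conjunctions of constraints $x\bowtie d$ with $x\in X$, $d\in\mathbb{Z}$, ${\bowtie}\in\{<,\le,=,\ge,>\}$. A clock valuation is a map $\mu:X\to\mathbb{R}_{\ge0}$; a configuration is a pair $(\ell,\mu)$ with $\mu\models I(\ell)$; the initial configuration is $(\ell_0,\mathbf{0})$. A delay $d\ge0$ leads from $(\ell,\mu)$ to $(\ell,\mu+d)$ provided $\mu+d'\models I(\ell)$ for all $d'\in[0,d]$; an edge $(\ell,g,a,R,\ell')$ leads from $(\ell,\mu)$ to $(\ell',\mu')$ if $\mu\models g$, $\mu'$ is $\mu$ with the clocks of $R$ set to $0$, and $\mu'\models I(\ell')$. A run is a finite sequence $(\ell_0,\mu_0),(d_0,e_0),(\ell_1,\mu_1),\dots,(\ell_n,\mu_n)$ starting in the initial configuration, where each step is a delay $d_i$ followed by taking edge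 $e_i$, with $\ell_n\in L_f$ and $\ell_i\notin L_f$ for $i<n$. A timed word is a finite sequence of pairs $(a,t)\in\Sigma\times\mathbb{R}_{\ge0}$ with non-decreasing timestamps. The trace of a run is the timed word consisting, in order, of the pairs $(a_i,\sum_{j\le i}d_j)$ for the edges $e_i$ whose action $a_i$ is not $\varepsilon$. A run is private if it visits some location of $L_{priv}$ and public otherwise; $\mathrm{PrivTr}(\mathcal{A})$ and $\mathrm{PubTr}(\mathcal{A})$ denote the sets of traces of private, resp. public, runs. An observable event-recording automaton (oERA) is a TA such that the set of clocks is $X=\{x_a\mid a\in\Sigma\}$, every edge with action $a\in\Sigma$ resets exactly $\{x_a\}$, and every edge with action $\varepsilon$ resets no clock. For $N\in\mathbb{N}$ and a timed word $w$, let $\pi_N(w)$ be the prefix of $w$ consisting of its first $\min(N,|w|)$ letters. The weak (resp. full) opacity with respect to the first $N$ observations decision problem asks, given a TA $\mathcal{A}$ and $N$ (in binary), whether $\pi_N(\mathrm{PrivTr}(\mathcal{A}))\subseteq\pi_N(\mathrm{PubTr}(\mathcal{A}))$ (resp. whether $\pi_N(\mathrm{PrivTr}(\mathcal{A}))=\pi_N(\mathrm{PubTr}(\mathcal{A}))$). *)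

(* Defs.v *)
From Corelib Require Import BinNums.
From HB Require Import structures.
From mathcomp Require Import all_boot all_order all_algebra.
From mathcomp Require Import classical_sets reals.

Set Implicit Arguments.
Unset Strict Implicit.
Unset Printing Implicit Defensive.

Import Order.TTheory GRing.Theory Num.Theory.

Local Open Scope ring_scope.
Local Open Scope classical_set_scope.

(** * Timed automata *)

Inductive cmp := CLt | CLe | CEq | CGe | CGt.

Definition nat_of_cmp (c : cmp) : nat :=
  match c with CLt => 0 | CLe => 1 | CEq => 2 | CGe => 3 | CGt => 4 end.

Definition cmp_of_nat (n : nat) : option cmp :=
  match n with
  | 0 => Some CLt | 1 => Some CLe | 2 => Some CEq | 3 => Some CGe
  | 4 => Some CGt | _ => None
  end%N.

Lemma nat_of_cmpK : pcancel nat_of_cmp cmp_of_nat. Proof. by case. Qed.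

HB.instance Definition _ := Equality.copy cmp (pcan_type nat_of_cmpK).

Definition cmp_rel (R : realType) (c : cmp) : rel R :=
  match c with
  | CLt => fun u v => u < v
  | CLe => fun u v => u <= v
  | CEq => fun u v => u == v
  | CGe => fun u v => u >= v
  | CGt => fun u v => u > v
  end.

(* [(x, c, d)] is the constraint "x c d"; a guard is the conjunction of the
   constraints it lists. *)
Definition constraint (X : finType) := (X * cmp * int)%type.
Definition guard (X : finType) := seq (constraint X).

(* The action [None] is the unobservable epsilon. *)
Record edge (Sigma L X : finType) := Edge {
  esrc : L;
  eguard : guard X;
  eact : option Sigma;
  ereset : {set X};
  etgt : L
}.

Definition edge_tuple (Sigma L X : finType) (e : edge Sigma L X) :=
  (esrc e, eguard e, eact e, ereset e, etgt e).

Definition tuple_edge (Sigma L X : finType)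
    (u : L * guard X * option Sigma * {set X} * L) : edge Sigma L X :=
  let: (l, g, a, r, l') := u in Edge l g a r l'.

Lemma edge_tupleK (Sigma L X : finType) :
  cancel (@edge_tuple Sigma L X) (@tuple_edge Sigma L X).
Proof. by case. Qed.

HB.instance Definition _ (Sigma L X : finType) :=
  Equality.copy (edge Sigma L X) (can_type (@edge_tupleK Sigma L X)).

(* [ta_edges] lists the set E; it is only used through membership. *)
Record TA (Sigma L X : finType) := MkTA {
  ta_init : L;
  ta_priv : {set L};
  ta_final : {set L};
  ta_inv : {ffun L -> guard X};
  ta_edges : seq (edge Sigma L X)
}.

Section Semantics.
Variables (R : realType) (Sigma L X : finType).
Implicit Types (A : TA Sigma L X) (mu : {ffun X -> R}) (g : guard X).

Definition sat mu g : bool :=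
  all (fun c : constraint X =>
    let: (x, op, d) := c in cmp_rel op (mu x) (d%:~R : R)) g.

Definition delay mu (d : R) : {ffun X -> R} := [ffun x => mu x + d].

Definition reset mu (r : {set X}) : {ffun X -> R} :=
  [ffun x => if x \in r then 0 else mu x].

(* Clocks start at 0 and delays are nonnegative, so all the valuations occurring
   in a run are nonnegative. *)
Definition config := (L * {ffun X -> R})%type.

Definition is_config A (c : config) : Prop := sat c.2 (ta_inv A c.1).

Definition init_config A : config := (ta_init A, [ffun => 0]).

Definition delay_ok A (c : config) (d : R) : Prop :=
  0 <= d /\
  forall d', 0 <= d' -> d' <= d -> sat (delay c.2 d') (ta_inv A c.1).

Definition edge_ok A (c : config) (e : edge Sigma L X) (c' : config) : Prop :=
  [/\ e \in ta_edges A,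
      c.1 = esrc e,
      sat c.2 (eguard e),
      c' = (etgt e, reset c.2 (ereset e))
    & is_config A c'].

(* The run c_0, (d_0, e_0), c_1, ..., (d_{n-1}, e_{n-1}), c_n is represented by
   the sequence of the triples (d_i, e_i, c_{i+1}), c_0 being [init_config]. *)
Definition step := (R * edge Sigma L X * config)%type.

Fixpoint is_run_from A (c : config) (r : seq step) : Prop :=
  match r with
  | [::] => c.1 \in ta_final A
  | (d, e, c') :: r' =>
      [/\ c.1 \notin ta_final A,
          delay_ok A c d,
          edge_ok A (c.1, delay c.2 d) e c'
        & is_run_from A c' r']
  end.

Definition is_run A (r : seq step) : Prop :=
  is_config A (init_config A) /\ is_run_from A (init_config A) r.

Definition run_locs A (r : seq step) : seq L :=
  ta_init A :: [seq s.2.1 | s <- r].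

Definition private A (r : seq step) : bool :=
  has (fun l => l \in ta_priv A) (run_locs A r).

Definition tword := seq (Sigma * R).

Fixpoint trace_from (t : R) (r : seq step) : tword :=
  match r with
  | [::] => [::]
  | (d, e, _) :: r' =>
      let w := trace_from (t + d) r' in
      if eact e is Some a then (a, t + d) :: w else w
  end.

Definition trace (r : seq step) : tword := trace_from 0 r.

Definition PrivTr A : set tword :=
  trace @` [set r | is_run A r /\ private A r].

Definition PubTr A : set tword :=
  trace @` [set r | is_run A r /\ ~~ private A r].

(* [take N] is the projection of timed words on their first N letters. *)
Definition weakly_opaque A (N : nat) : Prop :=
  take N @` PrivTr A `<=` take N @` PubTr A.

Definition fully_opaque A (N : nat) : Prop :=
  take N @` PrivTr A = take N @` PubTr A.

(* The bijection x maps the action a to its clock x_a. *)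
Definition is_oERA A : Prop :=
  exists2 x : Sigma -> X, bijective x &
    forall e, e \in ta_edges A ->
      if eact e is Some a then ereset e = finset.set1 (x a)
      else ereset e = finset.set0.

End Semantics.

(** * Instances of the decision problems and their encoding *)

(* As an input, a timed automaton has {0, ..., n-1} for each of its three
   carriers, with its own n. *)
Record instance := Instance {
  nact : nat;
  nloc : nat;
  nclk : nat;
  inst_ta : TA 'I_nact 'I_nloc 'I_nclk;
  inst_N : nat
}.

Inductive sym := S0 | S1 | Sep | Open | Close.

Definition ord_of_sym (s : sym) : 'I_5 :=
  match s with
  | S0 => inord 0 | S1 => inord 1 | Sep => inord 2 | Open => inord 3
  | Close => inord 4
  end.

Definition sym_of_ord (i : 'I_5) : sym :=
  match val i with
  | 0 => S0 | 1 => S1 | 2 => Sep | 3 => Open | _ => Close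
  end%N.

Lemma ord_of_symK : cancel ord_of_sym sym_of_ord.
Proof. by case; rewrite /sym_of_ord /= inordK. Qed.

HB.instance Definition _ := Finite.copy sym (can_type ord_of_symK).

(* Binary digits, least significant first. *)
Fixpoint pos_bits (p : positive) : seq sym :=
  match p with
  | xH => [:: S1]
  | xO p' => S0 :: pos_bits p'
  | xI p' => S1 :: pos_bits p'
  end.

Definition enc_bin (n : nat) : seq sym :=
  (if bin_of_nat n is Npos p then pos_bits p else [::]) ++ [:: Sep].

Definition enc_int (z : int) : seq sym :=
  (if z is Posz _ then S0 else S1) :: enc_bin `|z|%N.

(* N and the constants of the guards are written in binary. Cardinalities and
   elements of the three carriers are written in unary: a listing of a carrier
   takes at least one symbol for each of its elements, so compared with binary
   names this only changes the length of an instance polynomially. *)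
Definition enc_unary (n : nat) : seq sym := nseq n S1 ++ [:: Sep].

Definition enc_seq (T : Type) (enc : T -> seq sym) (s : seq T) : seq sym :=
  Open :: flatten (map enc s) ++ [:: Close].

Definition enc_ord (n : nat) (i : 'I_n) : seq sym := enc_unary i.

Definition enc_set (n : nat) (S : {set 'I_n}) : seq sym :=
  enc_seq (@enc_ord n) (enum S).

Definition enc_constraint (n : nat) (c : constraint 'I_n) : seq sym :=
  let: (x, op, d) := c in
  enc_ord x ++ enc_unary (nat_of_cmp op) ++ enc_int d.

Definition enc_guard (n : nat) (g : guard 'I_n) : seq sym :=
  enc_seq (@enc_constraint n) g.

Definition enc_act (n : nat) (a : option 'I_n) : seq sym :=
  if a is Some i then S1 :: enc_ord i else [:: S0].

Definition enc_edge (k n m : nat) (e : edge 'I_k 'I_n 'I_m) : seq sym :=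
  enc_ord (esrc e) ++ enc_guard (eguard e) ++ enc_act (eact e)
    ++ enc_set (ereset e) ++ enc_ord (etgt e).

Definition enc_ta (k n m : nat) (A : TA 'I_k 'I_n 'I_m) : seq sym :=
  enc_unary k ++ enc_unary n ++ enc_unary m
    ++ enc_ord (ta_init A) ++ enc_set (ta_priv A) ++ enc_set (ta_final A)
    ++ enc_seq (@enc_guard m) [seq ta_inv A l | l <- enum 'I_n]
    ++ enc_seq (@enc_edge k n m) (ta_edges A).

Definition encode (i : instance) : seq sym :=
  enc_ta (inst_ta i) ++ enc_bin (inst_N i).

Definition prefix_code (T : Type) (enc : T -> seq sym) :=
  forall x y s t, enc x ++ s = enc y ++ t -> x = y /\ s = t.

Lemma enc_unary_prefix : prefix_code enc_unary.
Proof.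
rewrite /enc_unary => + + s t; elim=> [|x IH] [|y] //= [].
  by move=> ->.
by move/IH=> [-> ->].
Qed.

Lemma pos_bits_prefix p q s t :
  pos_bits p ++ Sep :: s = pos_bits q ++ Sep :: t -> p = q /\ s = t.
Proof.
elim: p q => [p IH|p IH|] [q|q|] //=.
- by case=> /IH [-> ->].
- by case; case: p {IH}.
- by case=> /IH [-> ->].
- by case; case: q.
- by case=> ->.
Qed.

Lemma enc_bin_prefix : prefix_code enc_bin.
Proof.
move=> x y s t; rewrite /enc_bin -!catA /= => E.
suff [/(can_inj bin_of_natK)] : bin_of_nat x = bin_of_nat y /\ s = t by [].
move: E; case: (bin_of_nat x) (bin_of_nat y) => [|p] [|q] //=.
- by case=> ->.
- by case: q.
- by case: p.
- by move/pos_bits_prefix=> [-> ->].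
Qed.

Lemma enc_int_prefix : prefix_code enc_int.
Proof.
by case=> x [] y s t //= [] /enc_bin_prefix [] // => [-> ->|[->] ->].
Qed.

Lemma enc_ord_prefix n : prefix_code (@enc_ord n).
Proof. by move=> x y s t /enc_unary_prefix [/val_inj -> ->]. Qed.

Lemma enc_seq_prefix (T : Type) (enc : T -> seq sym) :
  prefix_code enc -> (forall x s, head Close (enc x ++ s) <> Close) ->
  prefix_code (enc_seq enc).
Proof.
rewrite /enc_seq => encP encC + + s t; elim=> [|x r IH] [|y r'] //= [].
- by move=> ->.
- by rewrite -!catA => E; case: (encC y (flatten (map enc r') ++ [:: Close] ++ t)); rewrite -E.
- by rewrite -!catA => E; case: (encC x (flatten (map enc r) ++ [:: Close] ++ s)); rewrite E.
- rewrite -!catA => /encP [-> E].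
  by have [|-> ->] := IH r'; rewrite //= -!catA E.
Qed.

Lemma head_unary n s : head Close (enc_unary n ++ s) <> Close.
Proof. by case: n. Qed.

Lemma enc_set_prefix n : prefix_code (@enc_set n).
Proof.
have P := enc_seq_prefix (@enc_ord_prefix n) (fun i => @head_unary i).
move=> x y s t /P [E ->].
by split=> //; apply/setP => i; rewrite -mem_enum E mem_enum.
Qed.

Lemma enc_constraintE n (x : 'I_n) o d s : enc_constraint (x, o, d) ++ s =
  enc_ord x ++ (enc_unary (nat_of_cmp o) ++ (enc_int d ++ s)).
Proof. by rewrite /enc_constraint !catA. Qed.

Lemma enc_guard_prefix n : prefix_code (@enc_guard n).
Proof.
apply: enc_seq_prefix => [|[[x o] d] s]; last first.
  by rewrite enc_constraintE; apply: (@head_unary x).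
case=> [[x o] d] [[x' o'] d'] s t; rewrite !enc_constraintE.
move=> /enc_ord_prefix [-> /enc_unary_prefix [/(pcan_inj nat_of_cmpK) ->]].
by move=> /enc_int_prefix [-> ->].
Qed.

Lemma enc_act_prefix n : prefix_code (@enc_act n).
Proof. by case=> [x|] [y|] s t //= [] => [/enc_ord_prefix [-> ->]|->]. Qed.

Lemma enc_edgeE k n m (e : edge 'I_k 'I_n 'I_m) s : enc_edge e ++ s =
  enc_ord (esrc e) ++ (enc_guard (eguard e) ++ (enc_act (eact e)
    ++ (enc_set (ereset e) ++ (enc_ord (etgt e) ++ s)))).
Proof. by rewrite /enc_edge !catA. Qed.

Lemma enc_edge_prefix k n m : prefix_code (@enc_edge k n m).
Proof.
case=> [a b c d e] [a' b' c' d' e'] s t; rewrite !enc_edgeE /=.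
by move=> /enc_ord_prefix [-> /enc_guard_prefix [-> /enc_act_prefix
  [-> /enc_set_prefix [-> /enc_ord_prefix [-> ->]]]]].
Qed.

Lemma encodeE k n m (A : TA 'I_k 'I_n 'I_m) N : encode (Instance A N) =
  enc_unary k ++ (enc_unary n ++ (enc_unary m
    ++ (enc_ord (ta_init A) ++ (enc_set (ta_priv A) ++ (enc_set (ta_final A)
    ++ (enc_seq (@enc_guard m) [seq ta_inv A l | l <- enum 'I_n]
    ++ (enc_seq (@enc_edge k n m) (ta_edges A) ++ enc_bin N))))))).
Proof. by rewrite /encode /enc_ta !catA. Qed.

(* [encode] is injective: membership in the languages below depends only on the
   instance that the word describes. *)
Lemma encode_inj : injective encode.
Proof.
case=> [k n m A N] [k' n' m' A' N']; rewrite !encodeE.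
case/enc_unary_prefix=> Ek; case/enc_unary_prefix=> En; case/enc_unary_prefix=> Em.
case: k' / Ek A' => A'; case: n' / En A' => A'; case: m' / Em A' => A'.
case: A A' => [i p f v E] [i' p' f' v' E'] /=.
case/enc_ord_prefix=> ->; case/enc_set_prefix=> ->; case/enc_set_prefix=> ->.
have Pg := enc_seq_prefix (@enc_guard_prefix m) (fun _ _ => ltac:(done)).
have Pe : prefix_code (enc_seq (@enc_edge k n m)).
  apply: enc_seq_prefix; first exact: enc_edge_prefix.
  by move=> e s; rewrite enc_edgeE; apply: (@head_unary (esrc e)).
case/Pg=> Ev; case/Pe=> ->.
rewrite -[enc_bin N]cats0 -[enc_bin N']cats0 => /enc_bin_prefix [-> _].
congr (Instance (MkTA _ _ _ _ _) _).
apply/ffunP=> l; move/eq_in_map: Ev; apply; exact: mem_enum.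
Qed.

Definition weak_opacity_oERA (R : realType) : set (seq sym) :=
  encode @` [set i | is_oERA (inst_ta i) /\
                     weakly_opaque R (inst_ta i) (inst_N i)].

Definition full_opacity_oERA (R : realType) : set (seq sym) :=
  encode @` [set i | is_oERA (inst_ta i) /\
                     fully_opaque R (inst_ta i) (inst_N i)].

(** * Turing machines and complexity *)

(* A tape, infinite in both directions, is given by the cells visited so far:
   those to the left of the head (nearest first), the scanned one, and those to
   its right; [None] is the blank. *)
Record tape (G : Type) := Tape {
  tape_left : seq (option G);
  tape_head : option G;
  tape_right : seq (option G)
}.

Inductive move := MoveL | Stay | MoveR.

Definition tape_act (G : Type) (t : tape G) (wm : option G * move) : tape G :=
  let: (b, mv) := wm in
  match mv with
  | Stay => Tape (tape_left t) b (tape_right t)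
  | MoveL => Tape (behead (tape_left t)) (head None (tape_left t)) (b :: tape_right t)
  | MoveR => Tape (b :: tape_left t) (head None (tape_right t)) (behead (tape_right t))
  end.

Definition tape_size (G : Type) (t : tape G) : nat :=
  (size (tape_left t) + size (tape_right t)).+1.

Definition blank_tape (G : Type) : tape G := Tape [::] None [::].

Definition input_tape (G : Type) (w : seq G) : tape G :=
  Tape [::] (ohead w) (map Some (behead w)).

(* Deterministic Turing machines with [tm_aux].+1 tapes over the alphabet G. *)
Record TM (G : finType) := MkTM {
  tm_aux : nat;
  tm_state : finType;
  tm_start : tm_state;
  tm_halt : {set tm_state};
  tm_accept : {set tm_state};
  tm_delta : tm_state -> {ffun 'I_tm_aux.+1 -> option G} ->
             tm_state * {ffun 'I_tm_aux.+1 -> option G * move}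
}.

Section Machines.
Variables (G : finType) (M : TM G).

Definition tm_config := (tm_state M * {ffun 'I_(tm_aux M).+1 -> tape G})%type.

Definition tm_init (w : seq G) : tm_config :=
  (tm_start M, [ffun i => if i == ord0 then input_tape w else blank_tape G]).

Definition halted (c : tm_config) : bool := c.1 \in tm_halt M.

Definition tm_step (c : tm_config) : tm_config :=
  if halted c then c else
  let: (q, act) := tm_delta c.1 [ffun i => tape_head (c.2 i)] in
  (q, [ffun i => tape_act (c.2 i) (act i)]).

Definition tm_run (t : nat) (w : seq G) : tm_config :=
  iter t tm_step (tm_init w).

Definition tm_space (c : tm_config) : nat := (\sum_i tape_size (c.2 i))%N.

(* The output is on the first tape, from the scanned cell to the right. *)
Definition has_output (c : tm_config) (v : seq G) : Prop :=
  exists n, tape_head (c.2 ord0) :: tape_right (c.2 ord0) = map Some v ++ nseq n None.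

End Machines.

Definition poly_bound (c k n : nat) : nat := (c * n ^ k + c)%N.

Definition in_PSPACE (B : finType) (K : set (seq B)) : Prop :=
  exists (G : finType) (inj : B -> G) (M : TM G) (c k : nat),
    injective inj /\
    forall w : seq B,
      (exists t, halted (tm_run M t (map inj w)) /\
         ((tm_run M t (map inj w)).1 \in tm_accept M <-> K w)) /\
      (forall t, (tm_space (tm_run M t (map inj w))
                    <= poly_bound c k (size w))%N).

Definition poly_time_computable (B C : finType) (f : seq B -> seq C) : Prop :=
  exists (G : finType) (inB : B -> G) (inC : C -> G) (M : TM G) (c k : nat),
    [/\ injective inB,
        injective inC
      & forall w : seq B,
          exists t, [/\ (t <= poly_bound c k (size w))%N,
            halted (tm_run M t (map inB w))
          & has_output (tm_run M t (map inB w)) (map inC (f w))]].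

Definition poly_reducible (B C : finType)
    (K : set (seq B)) (K' : set (seq C)) : Prop :=
  exists2 f : seq B -> seq C,
    poly_time_computable f & forall w, K w <-> K' (f w).

Definition PSPACE_hard (C : finType) (K' : set (seq C)) : Prop :=
  forall (B : finType) (K : set (seq B)), in_PSPACE K -> poly_reducible K K'.

Definition PSPACE_complete (C : finType) (K : set (seq C)) : Prop :=
  in_PSPACE K /\ PSPACE_hard K.

(* Main.v *)
(* Membership.  In an oERA a timed word determines the clock values, so opacity is a
   game on triples (observations left, clock values, set of locations reachable with
   the given observations): it fails iff some word leads to a triple from which a
   private run can end and no public one can, or conversely.  Real clock values may be
   replaced by integers counting units of 1/(2(n+1)) for n clocks, since only the order
   of the differences with the guard constants matters.  Triples then have
   polynomially many bits and reachability is decided in polynomial space by Savitch's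
   recursion, the subset reachability inside a triple being nested in it.  Everything is
   phrased with numbers, and a closure calculus of functions computable in polynomial
   space, compiled to Turing machines, replaces explicit machines.

   Hardness.  With N = 0 and all locations private, both problems ask whether no final
   location is reachable.  A machine working in space s is simulated by an oERA whose
   location stores the control state and the head positions; the cells are visited
   cyclically, once per time unit, and the action (cell, symbol) is read off as the only
   clock of that cell that is equal to 1, the others being at least 2. *)
From Corelib Require Import BinNums PosDef.
From HB Require Import structures.
From mathcomp Require Import all_boot all_order all_algebra.
From mathcomp Require Import classical_sets reals.
From mathcomp Require boolp zify lra.
Require Import Defs.

Set Implicit Arguments.
Unset Strict Implicit.
Unset Printing Implicit Defensive.

(** Two features of oERAs shape the membership proof. Between two observations no clock is reset, so
    one valuation, that of the last observation, and the time elapsed since describe the clocks of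
    all runs over the word at once; this is why a triple needs a single valuation. Once the N
    observations are spent, later actions no longer show in the trace and runs over the same word
    may disagree on their clocks; but then only the existence of some run matters, and plain
    reachability takes over. The unit 1/(2(n+1)) has a simple origin: the fractional parts of n
    clocks together with 0 take at most n+1 values, replaced by their ranks, and doubling the ranks
    leaves an odd instant strictly between any two critical ones. No input is parsed: the machine
    searches all numerical codes of instances for one whose encoding is the input. A Boolean, true
    for the weak question, lets one proof serve both problems. In the hardness proof, delays are
    chosen freely by the run, yet a wrong guess can only block it: the clock of the true content of
    a cell is always younger by at least 1 than the other clocks of that cell. *)

Module Programs.
From mathcomp Require Import zify.

(** * Structured programs on tapes *)

Section TapePrograms.
Variables (G : finType) (K : nat).
Notation heads := {ffun 'I_K.+1 -> option G}.
Notation acts := {ffun 'I_K.+1 -> option G * move}.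
Notation tapes := {ffun 'I_K.+1 -> tape G}.

Inductive prog :=
| PAct of heads -> acts
| PSeq of prog & prog
| PWhile of (heads -> bool) & prog
| PIf of (heads -> bool) & prog & prog.

Fixpoint pstate (p : prog) : finType :=
  match p with
  | PAct _ => unit
  | PSeq p q => (pstate p + pstate q)%type
  | PWhile _ p => option (pstate p)
  | PIf _ p q => option (pstate p + pstate q)%type
  end.

Fixpoint pentry (p : prog) : pstate p :=
  match p with
  | PAct _ => tt
  | PSeq p q => inl (pentry p)
  | PWhile _ p => None
  | PIf _ p q => None
  end.

Definition idle (h : heads) : acts := [ffun i => (h i, Stay)].

(** The successor [None] means termination. Loops and conditionals have an additional state [None]
    of their own, in which the test is made while the tapes stay as they are. *)
Fixpoint pdelta (p : prog) : pstate p -> heads -> option (pstate p) * acts :=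
  match p with
  | PAct f => fun _ h => (None, f h)
  | PSeq p q => fun s h =>
      match s with
      | inl s => let: (o, a) := pdelta s h in
          (Some (if o is Some s' then inl s' else inr (pentry q)), a)
      | inr s => let: (o, a) := pdelta s h in (omap inr o, a)
      end
  | PWhile t p => fun s h =>
      match s with
      | None => (if t h then Some (Some (pentry p)) else None, idle h)
      | Some s => let: (o, a) := pdelta s h in (Some o, a)
      end
  | PIf t p q => fun s h =>
      match s with
      | None => (Some (Some (if t h then inl (pentry p) else inr (pentry q))),
                 idle h)
      | Some (inl s) => let: (o, a) := pdelta s h in
          (omap (Some \o inl) o, a)
      | Some (inr s) => let: (o, a) := pdelta s h in
          (omap (Some \o inr) o, a)
      end
  end.

Definition theads (T : tapes) : heads := [ffun i => tape_head (T i)].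
Definition tact (T : tapes) (a : acts) : tapes := [ffun i => tape_act (T i) (a i)].

Lemma tact_idle T : tact T (idle (theads T)) = T.
Proof. by apply/ffunP=> i; rewrite !ffunE; case: (T i). Qed.

Definition pstep p (c : option (pstate p) * tapes) : option (pstate p) * tapes :=
  if c.1 is Some s then
    let: (o, a) := pdelta s (theads c.2) in (o, tact c.2 a)
  else c.

Definition pexec p (T : tapes) n (T' : tapes) : Prop :=
  iter n (@pstep p) (Some (pentry p), T) = (None, T').

Lemma iter_pstep_None p n T : iter n (@pstep p) (None, T) = (None, T).
Proof. by elim: n => //= n ->. Qed.

Lemma pexec_le p T n m T' : n <= m -> pexec p T n T' -> pexec p T m T'.
Proof.
move=> nm; rewrite /pexec -(subnK nm) iterD => ->.
exact: iter_pstep_None.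
Qed.

(** An embedding of states that commutes with the transitions carries a terminating execution over.
    [f None] need not be [None]: it is where the surrounding program resumes. The count may drop,
    since steps made after termination are discarded. *)
Lemma pstep_lift p p' (f : option (pstate p) -> option (pstate p')) n s T T' :
  (forall s, exists2 s', f (Some s) = Some s' &
     forall h, pdelta s' h = (f (pdelta s h).1, (pdelta s h).2)) ->
  iter n (@pstep p) (Some s, T) = (None, T') ->
  exists2 m, m <= n & iter m (@pstep p') (f (Some s), T) = (f None, T').
Proof.
move=> lift; elim: n s T => [|n IH] s T; first by [].
rewrite iterSr; have [s' fs fD] := lift s.
rewrite [in X in iter _ _ X]/pstep /=; case E: (pdelta s (theads T)) => [[s1|] a].
  move/IH=> [m mn mE]; exists m.+1; first by rewrite ltnS.
  by rewrite iterSr fs [in X in iter _ _ X]/pstep /= fD E.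
rewrite iter_pstep_None => -[<-]; exists 1; first by [].
by rewrite fs /= /pstep /= fD E.
Qed.

Lemma pexec_act f T : pexec (PAct f) T 1 (tact T (f (theads T))).
Proof. by []. Qed.

Lemma pexec_seq p q T n T1 m T2 :
  pexec p T n T1 -> pexec q T1 m T2 -> pexec (PSeq p q) T (n + m) T2.
Proof.
move=> pE qE.
pose fp (o : option (pstate p)) : option (pstate (PSeq p q)) :=
  Some (if o is Some s then inl s else inr (pentry q)).
have [s|m1 m1n E1] := pstep_lift (f := fp) _ pE.
  by exists (inl s) => // h /=; case: (pdelta s h).
have [s|m2 m2n E2] := pstep_lift (p' := PSeq p q) (f := omap inr) _ qE.
  by exists (inr s) => // h /=; case: (pdelta s h).
apply: (pexec_le (leq_add m1n m2n)).
by rewrite /pexec addnC iterD [pentry _]/= -[Some (inl _)]/(fp (Some _)) E1.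
Qed.

Lemma pexec_while0 (t : heads -> bool) p T : ~~ t (theads T) -> pexec (PWhile t p) T 1 T.
Proof. by move=> /negPf tF; rewrite /pexec /= /pstep /= tF tact_idle. Qed.

Lemma pexec_whileS (t : heads -> bool) p T n T1 m T2 : t (theads T) ->
  pexec p T n T1 -> pexec (PWhile t p) T1 m T2 ->
  pexec (PWhile t p) T (n + m).+1 T2.
Proof.
move=> tT pE wE.
have [s|m1 m1n E1] := pstep_lift (p' := PWhile t p) (f := Some) _ pE.
  by exists (Some s) => // h /=; case: (pdelta s h).
have : (m + m1).+1 <= (n + m).+1 by rewrite addnC ltnS leq_add2r.
move/pexec_le; apply; rewrite /pexec iterSr {2}/pstep /= tT tact_idle.
by rewrite iterD E1.
Qed.

Lemma pexec_if (t : heads -> bool) p q T n T' :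
  pexec (if t (theads T) then p else q) T n T' -> pexec (PIf t p q) T n.+1 T'.
Proof.
move=> E.
suff [m mn E1] : exists2 m, m <= n & iter m (@pstep (PIf t p q))
    (Some (Some (if t (theads T) then inl (pentry p) else inr (pentry q))), T)
    = (None, T').
  apply: (@pexec_le _ _ m.+1) => //.
  by rewrite /pexec iterSr {2}/pstep /= tact_idle.
move: E; case: (t _) => E.
  have [s|m mn E1] := pstep_lift (p' := PIf t p q) (f := omap (Some \o inl)) _ E.
    by exists (Some (inl s)) => // h /=; case: (pdelta s h).
  by exists m.
have [s|m mn E1] := pstep_lift (p' := PIf t p q) (f := omap (Some \o inr)) _ E.
  by exists (Some (inr s)) => // h /=; case: (pdelta s h).
by exists m.
Qed.

Section Machine.
Variables (p : prog) (out : 'I_K.+1) (yes : option G).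

(** After termination one more step turns the symbol scanned on tape [out] into the verdict, which
    is one of the two halting states. *)
Definition prog_delta (s : option (pstate p) + bool) (h : heads) :
    (option (pstate p) + bool) * acts :=
  match s with
  | inl (Some q) => let: (o, a) := pdelta q h in (inl o, a)
  | inl None => (inr (h out == yes), idle h)
  | inr b => (inr b, idle h)
  end.

Definition prog_tm : TM G :=
  @MkTM G K (option (pstate p) + bool)%type (inl (Some (pentry p)))
    [set s | if s is inr _ then true else false] [set inr true] prog_delta.

Lemma prog_tm_halted b n (T : tapes) :
  iter n (@tm_step _ prog_tm) (inr b, T) = (inr b, T).
Proof.
by elim: n => //= n ->; rewrite /tm_step /halted inE.
Qed.

Lemma prog_tm_exec T n T' : pexec p T n T' ->
  iter n.+1 (@tm_step _ prog_tm) (inl (Some (pentry p)), T) =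
    (inr (tape_head (T' out) == yes), T').
Proof.
have tmE s T1 : @tm_step _ prog_tm (inl (Some s), T1) =
    let: (o, a) := pdelta s (theads T1) in (inl o, tact T1 a).
  rewrite /tm_step /halted inE /= -/(theads T1).
  by case: (pdelta s _).
have tmN T1 : @tm_step _ prog_tm (inl None, T1) = (inr (tape_head (T1 out) == yes), T1).
  rewrite /tm_step /halted inE /= ffunE.
  by congr (_, _); rewrite -/(theads T1) -/(tact T1 _) tact_idle.
rewrite /pexec; move: (Some _) T; elim: n => [|n IH] o T.
  by move=> [-> ->]; rewrite /= tmN.
rewrite iterSr iterSr; case: o => [s|].
  by rewrite tmE -[pstep _]/(let: (o, a) := _ in _) /=; case: (pdelta s _) => [o a] E; apply: IH E.
by rewrite iter_pstep_None => -[->]; rewrite tmN prog_tm_halted.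
Qed.

End Machine.

End TapePrograms.

Section Space.
Variables (G : finType) (M : TM G).

Lemma tape_act_size (t : tape G) a : tape_size t <= tape_size (tape_act t a).
Proof.
by case: t a => l h r [b []]; rewrite /tape_size //= ?size_behead; lia.
Qed.

Lemma tm_space_step (c : tm_config M) : tm_space c <= tm_space (tm_step c).
Proof.
rewrite /tm_step; case: ifP => // _.
case: (tm_delta _ _) => q a; apply: leq_sum => i _.
by rewrite ffunE tape_act_size.
Qed.

Lemma tm_space_le n m w : n <= m -> tm_space (tm_run M n w) <= tm_space (tm_run M m w).
Proof.
move=> /subnK <-; elim: (m - n) => // k IH.
by rewrite addSn; apply: leq_trans IH (tm_space_step _).
Qed.

Lemma tm_run_halted n m w : n <= m -> halted (tm_run M n w) -> tm_run M m w = tm_run M n w.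
Proof.
move=> /subnK <- H; elim: (m - n) => // k IH.
by rewrite addSn /tm_run iterS -/(tm_run M _ w) IH /tm_step H.
Qed.

(* Visited cells are never released, so the space used is read off the halting configuration. *)
Lemma tm_space_halted n m w : halted (tm_run M n w) ->
  tm_space (tm_run M m w) <= tm_space (tm_run M n w).
Proof.
move=> H; case: (leqP m n) => [/tm_space_le //|nm].
by rewrite (tm_run_halted (ltnW nm) H).
Qed.

End Space.

End Programs.
Import Programs.

Module Commands.
From mathcomp Require Import zify.

(** * Register programs *)

Section Commands.
Variables (B C : finType).

Inductive cmd :=
| CSkip
| CInc of nat
| CDec of nat
| CSeq of cmd & cmd
| CWhile of nat & cmd
| CEmit of C
| CInput of (B -> cmd)
| CRewind.

(* [sleft] is the part of the input to the left of the head, nearest symbol first. *)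
Record store := Store {
  sreg : nat -> nat; sleft : seq B; sright : seq B; sout : seq C }.

Definition set_reg (s : store) r v :=
  Store (fun r' => if r' == r then v else sreg s r') (sleft s) (sright s) (sout s).

(** The bound [bd] on register values is what controls space: written in binary, a register takes
    logarithmically many cells in [bd], however long the execution lasts. The input is consumed from
    its last letter to its first. *)
Inductive exec (bd : nat) : cmd -> store -> nat -> store -> Prop :=
| ESkip s : exec bd CSkip s 1 s
| EInc r s : sreg s r < bd -> exec bd (CInc r) s 1 (set_reg s r (sreg s r).+1)
| EDec r s : 0 < sreg s r -> sreg s r <= bd ->
    exec bd (CDec r) s 1 (set_reg s r (sreg s r).-1)
| ESeq c1 c2 s t1 s1 t2 s2 : exec bd c1 s t1 s1 -> exec bd c2 s1 t2 s2 ->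
    exec bd (CSeq c1 c2) s (t1 + t2).+1 s2
| EWhile0 r c s : sreg s r = 0 -> exec bd (CWhile r c) s 1 s
| EWhileS r c s t1 s1 t2 s2 : 0 < sreg s r ->
    exec bd c s t1 s1 -> exec bd (CWhile r c) s1 t2 s2 ->
    exec bd (CWhile r c) s (t1 + t2).+1 s2
| EEmit x s : exec bd (CEmit x) s 1
    (Store (sreg s) (sleft s) (sright s) (x :: sout s))
| EInput0 f s : sleft s = [::] -> exec bd (CInput f) s 1 s
| EInputS f b l s t1 s1 t2 s2 : sleft s = b :: l ->
    exec bd (f b) (Store (sreg s) l (b :: sright s) (sout s)) t1 s1 ->
    exec bd (CInput f) s1 t2 s2 ->
    exec bd (CInput f) s (t1 + t2).+1 s2
| ERewind s : exec bd CRewind s (size (sright s)).+1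
    (Store (sreg s) (catrev (sright s) (sleft s)) [::] (sout s)).

Fixpoint wf_cmd (R : nat) (c : cmd) : Prop :=
  match c with
  | CInc r | CDec r => r < R
  | CSeq c1 c2 => wf_cmd R c1 /\ wf_cmd R c2
  | CWhile r c => r < R /\ wf_cmd R c
  | CInput f => forall b, wf_cmd R (f b)
  | _ => True
  end.

Fixpoint regs (c : cmd) : nat :=
  match c with
  | CInc r | CDec r => r.+1
  | CSeq c1 c2 => maxn (regs c1) (regs c2)
  | CWhile r c => maxn r.+1 (regs c)
  | CInput f => \max_(b : B) regs (f b)
  | _ => 0
  end.

Lemma wf_regs c R : regs c <= R -> wf_cmd R c.
Proof.
elim: c => [|r|r|c1 IH1 c2 IH2|r c IH|x|f IH|] //=.
- by rewrite geq_max => /andP[/IH1 ? /IH2].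
- by rewrite geq_max => /andP[? /IH].
- by move=> fR b; apply: IH; apply: leq_trans fR; apply: leq_bigmax_cond.
Qed.

End Commands.
Arguments CSkip {B C}.
Arguments CInc {B C}.
Arguments CDec {B C}.
Arguments CRewind {B C}.
Arguments CEmit {B C}.

Section Single.
Variables (G : finType) (K : nat).
Notation heads := {ffun 'I_K.+1 -> option G}.
Notation acts := {ffun 'I_K.+1 -> option G * move}.
Notation tapes := {ffun 'I_K.+1 -> tape G}.
Implicit Types (i : 'I_K.+1) (t : tape G) (T : tapes).

(* The tape with [l] to the left of the head, and [s] from the head on. *)
Definition mk (l s : seq (option G)) := Tape l (head None s) (behead s).

Lemma mkK t : mk (tape_left t) (tape_head t :: tape_right t) = t.
Proof. by case: t. Qed.

Definition upd T i t : tapes := [ffun j => if j == i then t else T j].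

Lemma updii T i t : upd T i t i = t. Proof. by rewrite ffunE eqxx. Qed.
Lemma updij T i j t : j != i -> upd T i t j = T j.
Proof. by rewrite ffunE => /negPf ->. Qed.
Lemma upd2 T i t t' : upd (upd T i t) i t' = upd T i t'.
Proof. by apply/ffunP=> j; rewrite !ffunE; case: eqP. Qed.
Lemma upd_id T i : upd T i (T i) = T.
Proof. by apply/ffunP=> j; rewrite !ffunE; case: eqP => [->|]. Qed.

Definition on i (f : option G -> option G * move) : prog G K :=
  PAct (fun h => [ffun j => if j == i then f (h j) else (h j, Stay)]).

Lemma on_exec i f T t :
  pexec (on i f) (upd T i t) 1 (upd T i (tape_act t (f (tape_head t)))).
Proof.
apply: eq_ind (pexec_act _ _) _ _; apply/ffunP=> j.
by rewrite !ffunE; case: eqP => // _; case: (T j).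
Qed.

Lemma onR_exec i f T l s : (f (head None s)).2 = MoveR ->
  pexec (on i f) (upd T i (mk l s)) 1
    (upd T i (mk ((f (head None s)).1 :: l) (behead s))).
Proof. by move=> fR; have := on_exec i f T (mk l s); case: (f _) fR => a [] //=. Qed.

Lemma onL_exec i f T x l s : (f (head None s)).2 = MoveL ->
  pexec (on i f) (upd T i (mk (x :: l) s)) 1
    (upd T i (mk l (x :: (f (head None s)).1 :: behead s))).
Proof. by move=> fR; have := on_exec i f T (mk (x :: l) s); case: (f _) fR => a [] //=. Qed.

Lemma head_upd i T l s : theads (upd T i (mk l s)) i = head None s.
Proof. by rewrite !ffunE eqxx. Qed.

Definition go (mv : move) (x : option G) := (x, mv).

Definition retL i := PWhile (fun h => h i != None) (on i (go MoveL)).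

Lemma retL_exec i T (u : seq G) x l s :
  pexec (retL i) (upd T i (mk (map Some u ++ None :: l) (Some x :: s)))
    (2 * size u + 3) (upd T i (mk l (None :: catrev (map Some u) (Some x :: s)))).
Proof.
elim: u x s => [|y u IH] x s.
  apply: (pexec_whileS (n := 1) (m := 1)); first by rewrite head_upd.
    exact: onL_exec.
  by apply: pexec_while0; rewrite head_upd.
rewrite [size _]/= mulnS -addnA.
apply: (@pexec_whileS _ _ _ _ _ 1); first by rewrite head_upd.
  exact: onL_exec.
exact: IH.
Qed.

Lemma retL_none i T l s : pexec (retL i) (upd T i (mk l (None :: s))) 1
  (upd T i (mk l (None :: s))).
Proof. by apply: pexec_while0; rewrite head_upd. Qed.

Lemma retL_cat i T (u : seq G) l s :
  pexec (PSeq (on i (go MoveL)) (retL i))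
    (upd T i (mk (map Some u ++ None :: l) s))
    (2 * size u + 4)
    (upd T i (mk l (None :: catrev (map Some u) (head None s :: behead s)))).
Proof.
rewrite addnS -add1n; case: u => [|x u].
  apply: pexec_seq; first exact: onL_exec.
  by apply: pexec_le (retL_none _ _ _ _).
apply: pexec_seq; first exact: onL_exec.
by apply: pexec_le (retL_exec _ _ _ _ _ _) => /=; lia.
Qed.

End Single.

Arguments retL {G K}.

Fixpoint bval (bs : seq bool) : nat := if bs is b :: bs' then b + 2 * bval bs' else 0.

Lemma bval_lt bs : bval bs < 2 ^ size bs.
Proof. by elim: bs => //= b bs IH; rewrite expnS; case: b => /=; lia. Qed.

Lemma bval_zeros k : bval (nseq k false) = 0.
Proof. by elim: k => //= k ->. Qed.

Lemma bval_inc k bs : ~~ head false bs ->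
  bval (nseq k false ++ true :: behead bs) = (bval (nseq k true ++ bs)).+1.
Proof. by elim: k => [|k IH] /= H; [case: bs H => [|[]] //=|rewrite IH //; lia]. Qed.

Lemma bval_dec k bs :
  (bval (nseq k true ++ false :: bs)).+1 = bval (nseq k false ++ true :: bs).
Proof. by elim: k => [|k /= <-] //=; lia. Qed.

Lemma split_run (b : bool) bs :
  exists k bs', bs = nseq k b ++ bs' /\ head (~~ b) bs' = ~~ b.
Proof.
elim: bs => [|c bs [k [bs' [-> H]]]]; first by exists 0, [::].
case: (eqVneq c b) => [->|cb]; first by exists k.+1, bs'.
by exists 0, (c :: nseq k b ++ bs'); split=> //=; case: c b cb {H} => [] [].
Qed.

(** * Binary counters on tapes *)

Section Registers.
Variables (G : finType) (K : nat) (bit : bool -> G).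
Hypothesis bit_inj : injective bit.
Notation tapes := {ffun 'I_K.+1 -> tape G}.
Implicit Types (i : 'I_K.+1) (T : tapes).

Notation bits := (map (fun b => Some (bit b))).

(** Digits stand least significant first, to the right of a blank on which the head rests and to
    which [retL] returns. Zeros in the leading places are allowed, since a decrement may leave them;
    [m] counts the visited blanks behind the digits. *)
Definition rep L (v : nat) (t : tape G) := exists bs m,
  [/\ t = mk [::] (None :: bits bs ++ nseq m None), bval bs = v,
      size bs <= L & size bs + m <= L.+1].

Definition skip_run i (b c : bool) :=
  PWhile (fun h => h i == Some (bit b)) (on i (fun=> (Some (bit c), MoveR))).

Lemma head_bits bs m (b : bool) : head (~~ b) bs = ~~ b ->
  head None (bits bs ++ nseq m None) != Some (bit b).
Proof.
case: bs => [_|c bs /= ->]; first by case: m.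
by apply/eqP => -[/bit_inj]; case: b.
Qed.

Lemma skip_run_exec i T b c k u bs m : head (~~ b) bs = ~~ b ->
  pexec (skip_run i b c)
    (upd T i (mk (bits u ++ [:: None]) (bits (nseq k b ++ bs) ++ nseq m None)))
    (2 * k + 1)
    (upd T i (mk (bits (nseq k c ++ u) ++ [:: None]) (bits bs ++ nseq m None))).
Proof.
move=> H; elim: k u => [|k IH] u.
  by apply: pexec_while0; rewrite head_upd head_bits.
rewrite mulnS -addnA; apply: (@pexec_whileS _ _ _ _ _ 1).
- by rewrite head_upd /=.
- exact: onR_exec.
rewrite -[bits (nseq k.+1 c ++ u)]/(Some (bit c) :: bits (nseq k c ++ u)).
have -> : Some (bit c) :: bits (nseq k c ++ u) = bits (nseq k c ++ c :: u).
  by elim: k {IH} => //= k ->.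
exact: (IH (c :: u)).
Qed.

Lemma catrev_bits k (c : bool) s : catrev (bits (nseq k c)) s = bits (nseq k c) ++ s.
Proof.
elim: k s => //= k IH s; rewrite IH.
by elim: k {IH} => //= k ->.
Qed.

Lemma bits_map bs : bits bs = map Some (map bit bs).
Proof. by rewrite -map_comp. Qed.

(* Both the increment ([b = true]) and the decrement ([b = false]) replace the
   run of [b]'s in front by a run of [~~ b]'s, and the next bit by [b]. *)
Definition carry i b :=
  PSeq (on i (go MoveR)) (PSeq (skip_run i b (~~ b))
    (PSeq (on i (fun=> (Some (bit b), Stay))) (PSeq (on i (go MoveL)) (retL i)))).

Lemma carry_exec i T b k bs m : head (~~ b) bs = ~~ b ->
  pexec (carry i b)
    (upd T i (mk [::] (None :: bits (nseq k b ++ bs) ++ nseq m None)))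
    (4 * k + 7)
    (upd T i (mk [::] (None :: bits (nseq k (~~ b) ++ b :: behead bs) ++
       nseq (if bs is [::] then m.-1 else m) None))).
Proof.
move=> H; have -> : 4 * k + 7 = 1 + ((2 * k + 1) + (1 + (2 * size (map bit (nseq k (~~ b))) + 4))).
  by rewrite size_map size_nseq; lia.
apply: pexec_seq; first exact: onR_exec.
apply: pexec_seq; first exact: (@skip_run_exec i T b (~~ b) k [::]).
apply: pexec_seq; first exact: on_exec.
rewrite cats0 bits_map.
apply: eq_ind (@retL_cat _ _ i T (map bit (nseq k (~~ b))) [::]
  (Some (bit b) :: behead (bits bs ++ nseq m None))) _ _.
congr (upd _ _ (mk _ (_ :: _))).
rewrite -bits_map catrev_bits map_cat -catA; congr (_ ++ _ :: _).
by case: bs {H} => //; case: m.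
Qed.

Lemma rep_inc L v i T t : rep L v t -> v.+1 < 2 ^ L ->
  exists2 t', pexec (carry i true) (upd T i t) (4 * L + 7) (upd T i t') & rep L v.+1 t'.
Proof.
case=> bs [m [-> <- sL mL]] vL; have [k [bs' [E H]]] := split_run true bs.
have S : size bs = k + size bs' by rewrite E size_cat size_nseq.
eexists; first by rewrite E; apply: pexec_le (carry_exec _ _ _ _ H); lia.
eexists _, _; split; first by [].
- by rewrite bval_inc -?E //; case: bs' H {E S} => //= b _ ->.
- rewrite size_cat size_nseq /= size_behead.
  case: bs' E S H => [|b bs'] /= E S H; last by lia.
  (* All [k] digits are 1, so the string grows; the bound on the new value leaves room for one more
     digit. *)
  suff : 2 ^ k < 2 ^ L by rewrite ltn_exp2l //; lia.
  apply: leq_ltn_trans vL; rewrite E cats0.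
  by elim: k {E S} => //= k IH; rewrite expnS; lia.
- rewrite size_cat size_nseq /= size_behead.
  by case: bs' E S H => [|b bs'] /= E S H; lia.
Qed.

Lemma rep_dec L v i T t : rep L v t -> 0 < v ->
  exists2 t', pexec (carry i false) (upd T i t) (4 * L + 7) (upd T i t') & rep L v.-1 t'.
Proof.
case=> bs [m [-> <- sL mL]] v0; have [k [bs' [E H]]] := split_run false bs.
have S : size bs = k + size bs' by rewrite E size_cat size_nseq.
case: bs' E S H => [|b bs'] /= E S H.
  by rewrite E cats0 bval_zeros in v0.
eexists; first by rewrite E; apply: pexec_le (@carry_exec i T false k (b :: bs') m H); lia.
eexists _, _; split; first by [].
- by rewrite E H -bval_dec.
- by rewrite size_cat size_nseq /=; lia.
- by rewrite size_cat size_nseq /=; lia.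
Qed.

(** Zero test. As leading zeros may be present, the first digit is not enough: the register is zero
    exactly when skipping all zeros ends on a blank. *)
Definition probe i := PSeq (on i (go MoveR)) (skip_run i false false).
Definition unprobe i : prog G K := PSeq (on i (go MoveL)) (retL i).

Lemma rep_probe L v i T t : rep L v t -> exists2 t',
  pexec (probe i) (upd T i t) (2 * L + 2) (upd T i t') &
  [/\ tape_head t' = (if v == 0 then None else Some (bit true)), tape_size t' <= L + 3
  & exists2 t'', pexec (unprobe i) (upd T i t') (2 * L + 4) (upd T i t'') & rep L v t''].
Proof.
case=> bs [m [-> <- sL mL]]; have [k [bs' [E H]]] := split_run false bs.
have S : size bs = k + size bs' by rewrite E size_cat size_nseq.
eexists.
  apply: (@pexec_le _ _ _ _ (1 + (2 * k + 1))); first by lia.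
  apply: pexec_seq; first exact: onR_exec.
  by rewrite E; apply: (@skip_run_exec i T false false k [::]).
split.
- rewrite E; case: bs' H {E S} => [_|b bs' /= ->] /=.
    by rewrite cats0 bval_zeros; case: m {mL}.
  by case: eqP => // Z0; exfalso; elim: k Z0 => //= k IH; lia.
- rewrite /tape_size /= size_behead !size_cat !size_map size_cat !size_nseq /=; lia.
eexists.
  rewrite cats0 bits_map; apply: pexec_le (retL_cat _ _ _ _ _).
  by rewrite size_map size_nseq; lia.
(* Without any digit 1 the head stopped on the blank behind the digits, possibly visiting it for the
   first time. *)
exists bs, (if bs' is [::] then maxn m 1 else m); split=> //.
  congr (mk _ (_ :: _)); rewrite -bits_map catrev_bits E map_cat -catA.
  by congr (_ ++ _); case: bs' {H E S} => //; case: m {mL}.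
by case: bs' H E S => [|b bs'] H E /= S; lia.
Qed.

Lemma rep0 L : rep L 0 (blank_tape G).
Proof. by exists [::], 0. Qed.

Lemma rep_size L v t : rep L v t -> tape_size t <= L.+2.
Proof.
case=> bs [m [-> _ _ H]]; rewrite /tape_size /= size_cat size_map size_nseq; lia.
Qed.

End Registers.

End Commands.
Import Commands.

(** * Register programs carried out on tapes *)

Module Simulation.
From mathcomp Require Import zify.

(** Unrolls one round of a loop together with what follows it: the induction on executions treats a
    loop and its closing move as one program. *)
Lemma pexec_while_seq (G : finType) K (t : {ffun 'I_K.+1 -> option G} -> bool)
    p q T n T1 m T2 : t (theads T) ->
  pexec p T n T1 -> pexec (PSeq (PWhile t p) q) T1 m T2 ->
  pexec (PSeq (PWhile t p) q) T (n + m).+1 T2.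
Proof.
move=> tT pE wE.
pose f (o : option (pstate p)) : option (pstate (PSeq (PWhile t p) q)) :=
  Some (inl o).
have [s|m1 m1n E1] := pstep_lift (f := f) _ pE.
  by exists (inl (Some s)) => // h /=; case: (pdelta s h).
have : (m + m1).+1 <= (n + m).+1 by rewrite addnC ltnS leq_add2r.
move/pexec_le; apply; rewrite /pexec iterSr {2}/pstep /= tT tact_idle.
by rewrite iterD -[Some (inl _)]/(f (Some _)) E1.
Qed.

Section Translate.
Variables (B C : finType) (R : nat).

Definition alphabet : finType := (B + C + bool)%type.
Definition bitG (b : bool) : alphabet := inr b.
Definition inG (b : B) : alphabet := inl (inl b).
Definition outG (c : C) : alphabet := inl (inr c).

Lemma bitG_inj : injective bitG. Proof. by move=> b c []. Qed.

Notation prg := (prog alphabet R.+1).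
(** Tape 0 receives the output, tape 1 a copy of the input, and tape [r.+2] holds register [r]. *)
Definition tp k : 'I_R.+2 := inord k.
Definition pskip : prg := PAct (@idle alphabet R.+1).

(** The loop tests a probed register, so the body is enclosed between the return of the head and a
    new probe. *)
Definition wloop i (p : prg) : prg :=
  PSeq (PWhile (fun h => h i == Some (bitG true))
          (PSeq (unprobe _ i) (PSeq p (probe bitG i)))) (unprobe _ i).

Definition iloop (p : prg) : prg :=
  PSeq (PWhile (fun h => h (tp 1) != None) (PSeq p (on (tp 1) (go MoveL))))
    (on (tp 1) (go MoveR)).

Definition dispatch (f : B -> prg) (s : seq B) : prg :=
  foldr (fun b p => PIf (fun h => h (tp 1) == Some (inG b)) (f b) p) pskip s.

Fixpoint tr (c : cmd B C) : prg :=
  match c with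
  | CSkip => pskip
  | CInc r => carry bitG (tp r.+2) true
  | CDec r => carry bitG (tp r.+2) false
  | CSeq c1 c2 => PSeq (tr c1) (tr c2)
  | CWhile r c => PSeq (probe bitG (tp r.+2)) (wloop (tp r.+2) (tr c))
  | CEmit x => PSeq (on (tp 0) (go MoveL)) (on (tp 0) (fun=> (Some (outG x), Stay)))
  | CInput f => PSeq (on (tp 1) (go MoveL)) (iloop (dispatch (fun b => tr (f b)) (enum B)))
  | CRewind => PWhile (fun h => h (tp 1) != None) (on (tp 1) (go MoveR))
  end.

Variables (bd L Z N : nat).
Hypothesis bdL : bd < 2 ^ L.
Notation tapes := {ffun 'I_R.+2 -> tape alphabet}.
Implicit Types (s : store B C) (T : tapes).

Definition inS b := Some (inG b).
Definition outS c := Some (outG c).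

(** The output is emitted leftwards on tape 0, over the original input; what is left of the latter
    lies to the left of the head, where the output convention does not look. [Z] and [N] bound the
    cells of the first two tapes for the space estimate. *)
Definition inv s T :=
  [/\ exists l j, [/\ T (tp 0) = mk l (map outS (sout s) ++ nseq j None), 0 < j
        & size l + j <= Z],
      exists j, [/\ T (tp 1) = mk (map inS (sleft s) ++ [:: None])
                                  (map inS (sright s) ++ nseq j None), 0 < j
        & size (sleft s) + size (sright s) + j <= N.+1]
    & forall r, r < R -> rep bitG L (sreg s r) (T (tp r.+2))].

Lemma tp_eq a b : a < R.+2 -> b < R.+2 -> (tp a == tp b) = (a == b).
Proof. by move=> aR bR; rewrite -val_eqE /= !inordK. Qed.

Lemma inv_reg s T r v t : inv s T -> r < R -> rep bitG L v t ->
  inv (set_reg s r v) (upd T (tp r.+2) t).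
Proof.
case=> I0 I1 IR rR vt; split.
- by rewrite updij ?tp_eq.
- by rewrite updij ?tp_eq.
- move=> r' r'R /=; rewrite ffunE tp_eq ?ltnS // !eqSS.
  by case: eqP => // _; apply: IR.
Qed.

Lemma inv_reg_id s T r t : inv s T -> r < R -> rep bitG L (sreg s r) t ->
  inv s (upd T (tp r.+2) t).
Proof.
move=> I rR /(inv_reg I rR) [I0 I1 IR]; split=> // r' r'R.
by have /= := IR _ r'R; case: (eqVneq r' r) => [->|].
Qed.

(** Covers the tape steps around one command: a carry, a probe with its return, or the dispatch on
    an input letter. *)
Definition unit_time := 8 * L + 2 * #|B| + 30.

Definition done_in n (p : prg) T s' := exists2 T', pexec p T n T' & inv s' T'.

Lemma done_le n m p T s' : n <= m -> done_in n p T s' -> done_in m p T s'.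
Proof. by move=> nm [T' E I]; exists T' => //; apply: pexec_le E. Qed.

Definition popped T := upd T (tp 1) (tape_act (T (tp 1)) (go MoveL (tape_head (T (tp 1))))).

(** At the test of a loop [inv] does not hold: the register is probed, or the head has moved to the
    next letter. For loops the statement therefore starts at the test, which is also where the
    induction hypothesis for the remaining rounds applies. The decrement in [(2 * t).-1] reserves
    one [unit_time] for getting there. *)
Definition run_ok (c : cmd B C) s t s' :=
  forall T, inv s T ->
  match c with
  | CWhile r c => forall t1,
      tape_head t1 = (if sreg s r == 0 then None else Some (bitG true)) ->
      (exists2 t2, pexec (unprobe _ (tp r.+2)) (upd T (tp r.+2) t1) (2 * L + 4)
         (upd T (tp r.+2) t2) & rep bitG L (sreg s r) t2) ->
      done_in ((2 * t).-1 * unit_time) (wloop (tp r.+2) (tr c)) (upd T (tp r.+2) t1) s'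
  | CInput f =>
      done_in ((2 * t).-1 * unit_time) (iloop (dispatch (fun b => tr (f b)) (enum B)))
        (popped T) s'
  | _ => done_in ((2 * t).-1 * unit_time) (tr c) T s'
  end.

Lemma run_ok_full c s t s' T : run_ok c s t s' -> wf_cmd R c -> inv s T ->
  0 < t -> done_in (2 * t * unit_time) (tr c) T s'.
Proof.
move=> ok wf I t0.
have E1 : 2 * t * unit_time = unit_time + (2 * t).-1 * unit_time.
  by rewrite -mulSn prednK //; lia.
have {ok} := ok T I; case: c wf => [_|r _|r _|c1 c2 _|r c [rR wf]|x _|f wf|_];
  try by apply: done_le; rewrite E1 leq_addl.
- case: (I) => _ _ /(_ _ rR) rp ok.
  have [t1 E [h1 _ H1]] := rep_probe bitG_inj (tp r.+2) T rp.
  have [T' ET' I'] := ok _ h1 H1; exists T' => //.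
  rewrite -[T in pexec _ T](upd_id T (tp r.+2)).
  apply: (@pexec_le _ _ _ _ ((2 * L + 2) + (2 * t).-1 * unit_time)).
    by rewrite E1 leq_add2r /unit_time; lia.
  exact: pexec_seq E ET'.
- case=> T' ET' I'; exists T' => //.
  apply: (@pexec_le _ _ _ _ (1 + (2 * t).-1 * unit_time)).
    by rewrite E1 leq_add2r /unit_time; lia.
  apply: pexec_seq ET'.
  by have := on_exec (tp 1) (go MoveL) T (T (tp 1)); rewrite upd_id.
Qed.

Lemma dispatch_exec f (s : seq B) T b n T' : b \in s -> tape_head (T (tp 1)) = inS b ->
  pexec (f b) T n T' -> pexec (dispatch f s) T (n + size s) T'.
Proof.
move=> bs hb E; elim: s bs => //= c s IH; rewrite inE addnS.
case: (eqVneq b c) => [<- _|bc /= bs].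
  apply: pexec_if; rewrite ffunE hb eqxx.
  by apply: pexec_le E; rewrite leq_addr.
apply: pexec_if; rewrite ffunE hb; case: eqP => [[/eqP]|_]; last exact: IH.
by rewrite (negPf bc).
Qed.

Lemma iter_timeE n : 0 < n -> (2 * n).-1 * unit_time = unit_time + (2 * n.-1) * unit_time.
Proof. by case: n => // n _; rewrite -mulSn; congr (_ * _); lia. Qed.

Lemma exec_pos c s t s' : exec bd c s t s' -> 0 < t.
Proof. by case. Qed.

Lemma exec_run_ok c s t s' : exec bd c s t s' -> wf_cmd R c -> run_ok c s t s'.
Proof.
elim=> {c s t s'}.
- move=> s _ T I; exists T => //.
  apply: eq_ind (pexec_le _ (pexec_act _ _)) _ (tact_idle T); rewrite /unit_time; lia.
- move=> r s rb rR T I; have [_ _ /(_ _ rR) rp] := I.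
  have [t' E rt] := rep_inc bitG_inj (tp r.+2) T rp (leq_ltn_trans rb bdL).
  exists (upd T (tp r.+2) t'); last exact: inv_reg.
  rewrite upd_id in E; apply: pexec_le E; rewrite /unit_time; lia.
- move=> r s r0 rb rR T I; have [_ _ /(_ _ rR) rp] := I.
  have [t' E rt] := rep_dec bitG_inj (tp r.+2) T rp r0.
  exists (upd T (tp r.+2) t'); last exact: inv_reg.
  rewrite upd_id in E; apply: pexec_le E; rewrite /unit_time; lia.
- move=> c1 c2 s n1 s1 n2 s2 E1 IH1 E2 IH2 [w1 w2] T I.
  have [T1 P1 I1] := run_ok_full (IH1 w1) w1 I (exec_pos E1).
  have [T2 P2 I2] := run_ok_full (IH2 w2) w2 I1 (exec_pos E2).
  exists T2 => //; apply: pexec_le (pexec_seq P1 P2).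
  by rewrite -mulnDl leq_mul2r; apply/orP; right; lia.
- move=> r c s r0 [rR wf] T I t1 h1 [t2 E2 R2]; rewrite r0 /= in h1.
  exists (upd T (tp r.+2) t2); last exact: inv_reg_id.
  apply: (@pexec_le _ _ _ _ (1 + (2 * L + 4))); first by rewrite /unit_time; lia.
  by apply: pexec_seq E2; apply: pexec_while0; rewrite ffunE updii h1.
- move=> r c s n1 s1 n2 s2 r0 E1 IH1 E2 IH2 [rR wf] T I t1 h1 [t2 P2 R2].
  rewrite -[_ == 0]negbK -lt0n r0 /= in h1.
  have I2 := inv_reg_id I rR R2.
  have [T3 P3 I3] := run_ok_full (IH1 wf) wf I2 (exec_pos E1).
  have [_ _ /(_ _ rR) rp3] := I3.
  have [t4 P4 [h4 _ H4]] := rep_probe bitG_inj (tp r.+2) T3 rp3.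
  have [T5 P5 I5] := IH2 (conj rR wf) _ I3 _ h4 H4.
  exists T5 => //.
  apply: pexec_le; last first.
    apply: pexec_while_seq P5; first by rewrite ffunE updii h1.
    apply: pexec_seq P2 _; apply: pexec_seq P3 _.
    by rewrite upd_id in P4; exact: P4.
  have n20 := exec_pos E2.
  rewrite (_ : (2 * (n1 + n2).+1).-1 = 2 * n1 + (2 * n2).-1 + 2); last by lia.
  have U1 : 4 * L + 7 <= unit_time by rewrite /unit_time; lia.
  rewrite !mulnDl; move: (2 * n1 * unit_time) ((2 * n2).-1 * unit_time) => a b; lia.
- move=> x s _ T [[l [j [T0 j0 lj]]] I1 IR].
  pose t' := mk (behead l) (map outS (x :: sout s) ++ nseq j None).
  exists (upd T (tp 0) t').
    apply: (@pexec_le _ _ _ _ (1 + 1)); first by rewrite /unit_time; lia.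
    rewrite -{1}(upd_id T (tp 0)); apply: pexec_seq; first exact: on_exec.
    apply: eq_ind (on_exec _ _ _ _) _ _; congr upd.
    rewrite T0 /t'; case: l {T0 lj t'} => [|y l]; case: (sout s) => [|z o];
      case: j j0 => // j _ /=.
  split.
  + exists (behead l), j; rewrite updii /t'; split=> //.
    by apply: leq_trans lj; rewrite leq_add2r size_behead leq_pred.
  + by rewrite updij ?tp_eq.
  + by move=> r rR; rewrite updij ?tp_eq //; apply: IR.
- move=> f s l0 wf T [I0 [j [T1 j0 jN]] IR].
  rewrite /popped T1 l0 /=.
  exists (upd T (tp 1) (mk [:: None] (map inS (sright s) ++ nseq j None))).
    apply: (@pexec_le _ _ _ _ (1 + 1)); first by rewrite /unit_time; lia.
    apply: pexec_seq; first by apply: pexec_while0; rewrite ffunE updii.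
    exact: on_exec.
  split.
  + by rewrite updij ?tp_eq.
  + by exists j; rewrite ?updii ?l0 //; rewrite l0 in jN.
  + by move=> r rR; rewrite updij ?tp_eq //; apply: IR.
- move=> f b l s n1 s1 n2 s2 sl E1 IH1 E2 IH2 wf T [I0 [j [T1 j0 jN]] IR].
  rewrite sl in T1 jN.
  have I' : inv (Store (sreg s) l (b :: sright s) (sout s)) (popped T).
    split.
    + by rewrite updij ?tp_eq.
    + rewrite /popped updii T1 /=; exists j; split=> //; last by rewrite addnS.
      by case: (sright s) => // /=; case: j j0 {T1 jN}.
    + by move=> r rR; rewrite updij ?tp_eq //; apply: IR.
  have hb : tape_head (popped T (tp 1)) = inS b by rewrite updii T1.
  have [T2 P2 I2] := run_ok_full (IH1 (wf b)) (wf b) I' (exec_pos E1).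
  have [T3 P3 I3] := IH2 wf _ I2.
  exists T3 => //; apply: pexec_le; last first.
    apply: pexec_while_seq P3; first by rewrite ffunE hb.
    apply: pexec_seq.
      apply: (dispatch_exec (f := fun b => tr (f b))) P2 => //.
      exact: mem_enum.
    have := on_exec (tp 1) (go MoveL) T2 (T2 (tp 1)); rewrite upd_id; exact.
  have n20 := exec_pos E2; have cB : size (enum B) = #|B| by rewrite cardE.
  rewrite (_ : (2 * (n1 + n2).+1).-1 = 2 * n1 + (2 * n2).-1 + 2); last by lia.
  have U1 : size (enum B) + 3 <= unit_time by rewrite cB /unit_time; lia.
  rewrite !mulnDl; move: (2 * n1 * unit_time) ((2 * n2).-1 * unit_time) => a c; lia.
- move=> s _ T [I0 [j [T1 j0 jN]] IR].
  exists (upd T (tp 1) (mk (map inS (catrev (sright s) (sleft s)) ++ [:: None]) (nseq j None))).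
    rewrite -{1}(upd_id T (tp 1)) T1.
    apply: (@pexec_le _ _ _ _ (2 * size (sright s) + 1)).
      rewrite (_ : (2 * _).-1 = 2 * size (sright s) + 1); last by lia.
      by rewrite leq_pmulr // /unit_time; lia.
    elim: (sright s) (sleft s) => [|b r IH] l.
      by apply: pexec_while0; rewrite head_upd; case: j {T1 jN} j0.
    rewrite [size _]/= mulnS -addnA; apply: (@pexec_whileS _ _ _ _ _ 1).
    + by rewrite head_upd.
    + exact: onR_exec.
    + exact: IH (b :: l).
  split.
  + by rewrite updij ?tp_eq.
  + by exists j; split; rewrite ?updii //= catrevE size_cat size_rev; lia.
  + by move=> r rR; rewrite updij ?tp_eq //; apply: IR.
Qed.

Lemma exec_tapes c s t s' T : exec bd c s t s' -> wf_cmd R c -> inv s T ->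
  exists2 T', pexec (tr c) T (2 * t * unit_time) T' & inv s' T'.
Proof.
by move=> E wf I; apply: run_ok_full (exec_run_ok E wf) wf I (exec_pos E).
Qed.

(** The first move leaves a blank before the copy on tape 1; it is the marker at which the loops
    reading the input backwards stop. *)
Definition prelude : prg :=
  PSeq (on (tp 1) (go MoveR))
    (PWhile (fun h => h (tp 0) != None)
      (PAct (fun h => [ffun i => if (i == tp 0) || (i == tp 1)
                              then (h (tp 0), MoveR) else (h i, Stay)]))).

Definition start_store (w : seq B) : store B C := Store (fun=> 0) (rev w) [::] [::].
Definition start_tapes (w : seq B) : tapes :=
  [ffun i => if i == ord0 then input_tape (map inG w) else blank_tape alphabet].

Lemma tp0 : tp 0 = ord0. Proof. by apply/val_inj; rewrite /= inordK. Qed.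

Lemma prelude_exec (w : seq B) : size w < Z -> size w <= N ->
  exists2 T', pexec prelude (start_tapes w) (2 * size w + 2) T' & inv (start_store w) T'.
Proof.
move=> wZ wN.
pose TT u v : tapes := [ffun i => if i == tp 0 then mk (map inS u) (map inS v)
  else if i == tp 1 then mk (map inS u ++ [:: None]) [::] else blank_tape alphabet].
exists (TT (rev w) [::]).
  have -> : 2 * size w + 2 = 1 + (2 * size w + 1) by lia.
  apply: pexec_seq.
    apply: eq_ind (pexec_act _ _) _ _.
    instantiate (1 := TT [::] w); apply/ffunP=> i; rewrite !ffunE -tp0.
    case: eqP => [->|_]; first by rewrite tp_eq //= ?eqxx; case: (w) => //= b l; rewrite -map_comp.
    by case: (eqVneq i (tp 1)).
  rewrite -[rev w]/(catrev w [::]); suff: forall u, pexec (PWhile (fun h => h (tp 0) != None) (PAct (fun h => [ffun i => if (i == tp 0) || (i == tp 1)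
      then (h (tp 0), MoveR) else (h i, Stay)]))) (TT u w) (2 * size w + 1) (TT (catrev w u) [::]) by exact.
  elim: w {wZ wN} => [|b w IH] u.
    by apply: pexec_while0; rewrite !ffunE eqxx.
  rewrite [size _]/= mulnS -addnA; apply: (@pexec_whileS _ _ _ _ _ 1 (TT (b :: u) w)).
  + by rewrite !ffunE eqxx.
  + apply: eq_ind (pexec_act _ _) _ _; apply/ffunP=> i; rewrite !ffunE eqxx.
    case: (eqVneq i (tp 0)) => [->|i0]; first by rewrite ?eqxx.
    by rewrite ?(negPf i0); case: (eqVneq i (tp 1)).
  + exact: IH.
split=> /=.
- exists (map inS (rev w)), 1; split=> //; first by rewrite ffunE eqxx.
  by rewrite size_map size_rev addn1.
- exists 1; split=> //; first by rewrite ffunE eqxx tp_eq.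
  by rewrite size_rev addn0 addn1.
- by move=> r rR; rewrite ffunE !tp_eq //; apply: rep0.
Qed.

Lemma cmd_exec c w t s' : exec bd c (start_store w) t s' -> wf_cmd R c ->
  size w < Z -> size w <= N ->
  exists2 T', pexec (PSeq prelude (tr c)) (start_tapes w)
    (2 * size w + 2 + 2 * t * unit_time) T' & inv s' T'.
Proof.
move=> E wf wZ wN; have [T1 P1 I1] := prelude_exec wZ wN.
have [T2 P2 I2] := exec_tapes E wf I1.
by exists T2 => //; apply: pexec_seq P1 P2.
Qed.

End Translate.

(** * Polynomial bounds *)

Lemma leq_exp2r_weak m n e : m <= n -> m ^ e <= n ^ e.
Proof. by case: e => // e mn; rewrite leq_exp2r. Qed.

(** The base [n.+1] is positive, so powers are monotone in the exponent and sums and products need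
    no separate constant term. *)
Definition poly (p : nat -> nat) := exists c k, forall n, p n <= c * n.+1 ^ k.

Lemma poly_poly_bound p : poly p -> exists c k, forall n, p n <= poly_bound c k n.
Proof.
case=> c [k pP]; exists (c * 2 ^ k), k => n; apply: leq_trans (pP n) _.
rewrite /poly_bound -mulnA -mulnDr leq_mul2l; apply/orP; right.
case: n {pP} => [|n]; first by rewrite exp1n -[1]muln1 (leq_trans _ (leq_addl _ _)) ?expn_gt0.
by apply: leq_trans (leq_addr _ _); rewrite -expnMn leq_exp2r_weak //; lia.
Qed.

Lemma poly_le p q : (forall n, p n <= q n) -> poly q -> poly p.
Proof. by move=> pq [c [k qP]]; exists c, k => n; apply: leq_trans (pq n) (qP n). Qed.

End Simulation.
Import Simulation.

(** * Closure of polynomial bounds; space and time of register programs *)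

Module Resources.
From mathcomp Require Import zify.

Lemma poly_const c : poly (fun=> c).
Proof. by exists c, 0 => n; rewrite muln1. Qed.

Lemma poly_id : poly id.
Proof. by exists 1, 1 => n; rewrite mul1n expn1. Qed.

Lemma poly_mul p q : poly p -> poly q -> poly (fun n => p n * q n).
Proof.
case=> c [k pP] [d [l qP]]; exists (c * d), (k + l) => n.
by rewrite expnD mulnACA leq_mul.
Qed.

Lemma poly_add p q : poly p -> poly q -> poly (fun n => p n + q n).
Proof.
case=> c [k pP] [d [l qP]]; exists (c + d), (k + l) => n.
rewrite mulnDl expnD leq_add //.
  by apply: leq_trans (pP n) _; rewrite leq_mul2l leq_pmulr ?orbT ?expn_gt0.
by apply: leq_trans (qP n) _; rewrite leq_mul2l leq_pmull ?orbT ?expn_gt0.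
Qed.

Lemma poly_exp p k : poly p -> poly (fun n => p n ^ k).
Proof.
move=> pP; elim: k => [|k IH]; first exact: poly_const.
by apply: poly_le (poly_mul pP IH) => n; rewrite expnS.
Qed.

Lemma poly_comp p q : poly p -> poly q -> poly (fun n => p (q n)).
Proof.
case=> c [k pP] qP.
apply: poly_le (poly_mul (poly_const c) (poly_exp k (poly_add qP (poly_const 1)))) => n.
by rewrite addn1.
Qed.

Lemma poly_bound_poly c k : poly (poly_bound c k).
Proof.
apply: poly_add (poly_const c); apply: poly_mul (poly_const c) _.
by apply: poly_exp; apply: poly_id.
Qed.

Section Classes.
Variables (B C : finType).

Lemma inv_size R L Z N (s : store B C) T : inv (R := R) L Z N s T -> sout s = [::] ->
  forall i, tape_size (T i) <= Z + N + L + 5.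
Proof.
case=> [[l [j [T0 j0 lj]]] [k [T1 k0 kN]] IR] s0 i.
have -> : i = tp R i by apply/val_inj; rewrite /= inordK.
case: (nat_of_ord i) (ltn_ord i) => [|[|r]] iR.
- rewrite T0 s0 /tape_size /= size_behead size_nseq; apply: (@leq_ltn_trans Z); last by lia.
  by apply: leq_trans lj; rewrite leq_add2l leq_pred.
- rewrite T1 /tape_size /= size_behead !size_cat !size_map ?size_nseq /=; lia.
- by have /rep_size := IR r iR; lia.
Qed.

Lemma start_tapesE R (p : prog (alphabet B C) R.+1) out yes w n :
  iter n (@tm_step _ (prog_tm p out yes)) (inl (Some (pentry p)), start_tapes C R w) =
  tm_run (prog_tm p out yes) n (map (@inG B C) w).
Proof. by []. Qed.

(** Registers bounded by [2 ^ p] take about [p] cells, whatever the running time [t] is. The answer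
    is left in register 0 and read off by a final probe. *)
Theorem exec_in_PSPACE R (c : cmd B C) (p : nat -> nat) (K : set (seq B)) :
  poly p -> wf_cmd R.+1 c ->
  (forall w, exists t s', [/\ exec (2 ^ p (size w)) c (start_store C w) t s',
     sout s' = [::] & (0 < sreg s' 0 <-> K w)]) ->
  in_PSPACE K.
Proof.
move=> pp wf cK.
pose pr := PSeq (PSeq (prelude B C R.+1) (tr R.+1 c)) (probe (@bitG B C) (tp R.+1 2)).
pose M := prog_tm pr (tp R.+1 2) (Some (bitG B C true)).
pose X n := R.+3 * (n.+1 + n + (p n).+1 + 5).
have /poly_poly_bound[d [k Xk]] : poly X.
  apply: poly_mul; first exact: poly_const.
  apply: poly_add; last exact: poly_const.
  apply: poly_add; last by apply: poly_le (poly_add pp (poly_const 1)) => n; rewrite addn1.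
  by apply: poly_add poly_id; apply: poly_le (poly_add poly_id (poly_const 1)) => n; rewrite addn1.
exists (alphabet B C), (@inG B C), M, d, k; split; first by move=> x y [].
move=> w; have [t [s' [E s0 sK]]] := cK w.
have bL : 2 ^ p (size w) < 2 ^ (p (size w)).+1 by rewrite ltn_exp2l.
have [T' P I] := cmd_exec bL E wf (ltnSn _) (leqnn _).
have [_ _ /(_ 0 isT) rp] := I.
have [t1 P1 [h1 z1 _]] := rep_probe (@bitG_inj B C) (tp R.+1 2) T' rp.
rewrite upd_id in P1; have P2 := pexec_seq P P1.
have := prog_tm_exec (tp R.+1 2) (Some (bitG B C true)) P2.
set n := (X in iter X); rewrite start_tapesE updii h1 -/M => runE.
have H : halted (tm_run M n (map (@inG B C) w)) by rewrite /halted runE inE.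
split.
  exists n; split=> //; rewrite runE inE -sK.
  by case: (sreg s' 0).
move=> m; apply: leq_trans (Xk _); apply: leq_trans (tm_space_halted m H) _.
rewrite runE /tm_space /X.
have -> z : R.+3 * z = \sum_(i < R.+3) z by rewrite sum_nat_const card_ord.
apply: leq_sum => i _; rewrite ffunE; case: eqP => _.
  by apply: leq_trans z1 _; lia.
exact: inv_size I s0 i.
Qed.

(** Here register values themselves are polynomial. Their bound [p] is also used, crudely, as a
    bound on their length, as [p < 2 ^ p]. *)
Theorem exec_poly_time R (c : cmd B C) (p q : nat -> nat) (f : seq B -> seq C) :
  poly p -> poly q -> wf_cmd R c ->
  (forall w, exists t s', [/\ exec (p (size w)) c (start_store C w) t s',
     t <= q (size w) & sout s' = f w]) ->
  poly_time_computable f.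
Proof.
move=> pp pq wf cf.
pose pr := PSeq (prelude B C R) (tr R c).
pose X n := (2 * n + 2 + 2 * q n * (8 * p n + (2 * #|B| + 30))).+1.
have /poly_poly_bound[d [k Xk]] : poly X.

  apply: (@poly_le _ (fun n => 2 * n + 2 + 2 * q n * (8 * p n + (2 * #|B| + 30)) + 1)).
    by move=> n; rewrite /X addn1.
  apply: poly_add (poly_const 1); apply: poly_add.
    by apply: poly_add (poly_const 2); apply: poly_mul (poly_const 2) poly_id.
  apply: poly_mul; first exact: poly_mul (poly_const 2) pq.
  by apply: poly_add (poly_const _); apply: poly_mul (poly_const 8) pp.
exists (alphabet B C), (@inG B C), (@outG B C), (prog_tm pr (tp R 0) None), d, k.
split; [by move=> x y []|by move=> x y []|move=> w].
have [t [s' [E tq sf]]] := cf w.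
have [T' P I] := cmd_exec (ltn_expl _ (ltnSn 1)) E wf (ltnSn _) (leqnn _).
have := prog_tm_exec (tp R 0) None P; set n := (X in iter X); rewrite start_tapesE -/pr => runE.
exists n; split.
- apply: leq_trans (Xk _); rewrite /n /X /unit_time !ltnS leq_add2l -!addnA leq_mul //.
  by rewrite leq_mul2l.
- by rewrite /halted runE inE.
- rewrite runE /has_output /=; have [[l [j [T0 j0 _]]] _ _] := I.
  exists j; rewrite -tp0 T0 sf -[LHS]/(_ :: behead _).
  by rewrite -map_comp; case: (f w) => //; case: (j) j0.
Qed.

End Classes.

End Resources.
Import Resources.

Module Expressions.
From mathcomp Require Import zify.

(** * Recursive functions on natural numbers *)

(** Primitive recursion with de Bruijn indices: in the body of [XRec], variable 0 is the accumulator
    and variable 1 the counter. The syntax does not restrict complexity; the bound on intermediate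
    values in [within] does. *)
Inductive expr :=
| XVar of nat
| XZero
| XSuc of expr
| XLet of expr & expr
| XRec of expr & expr & expr
| XWk of expr.

Fixpoint ev (e : expr) (env : seq nat) : nat :=
  match e with
  | XVar i => nth 0 env i
  | XZero => 0
  | XSuc e => (ev e env).+1
  | XLet e1 e2 => ev e2 (ev e1 env :: env)
  | XRec n e0 e1 => iteri (ev n env) (fun i a => ev e1 (a :: i :: env)) (ev e0 env)
  | XWk e => ev e (behead env)
  end.

(* Every value computed during the evaluation is at most [b]. *)
Fixpoint within (b : nat) (e : expr) (env : seq nat) : Prop :=
  ev e env <= b /\
  match e with
  | XVar _ | XZero => True
  | XSuc e => within b e env
  | XLet e1 e2 => within b e1 env /\ within b e2 (ev e1 env :: env)
  | XRec n e0 e1 => [/\ within b n env, within b e0 env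
      & forall i, i < ev n env -> within b e1
          (iteri i (fun i a => ev e1 (a :: i :: env)) (ev e0 env) :: i :: env)]
  | XWk e => within b e (behead env)
  end.

Lemma within_ev b e env : within b e env -> ev e env <= b.
Proof. by case: e => > []. Qed.

Lemma within_le b b' e env : b <= b' -> within b e env -> within b' e env.
Proof.
move=> bb'; elim: e env => [i||e IH|e1 IH1 e2 IH2|n IHn e0 IH0 e1 IH1|e IH] env /=
  [vb H]; split; try exact: leq_trans vb bb'.
- by [].
- by [].
- exact: IH.
- by case: H => /IH1 ? /IH2.
- by case: H => /IHn ? /IH0 ? H; split=> // i /H /IH1.
- exact: IH.
Qed.

Section Compile.
Variables (B C : finType) (b : nat).
Notation cmd := (cmd B C).
Implicit Types (c : cmd) (g : nat -> nat).

Definition runs c (t : nat) g (P : (nat -> nat) -> Prop) :=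
  forall l r o, exists t' g', [/\ t' <= t,
    exec b c (Store g l r o) t' (Store g' l r o) & P g'].

Lemma runs_le c t t' g P : t <= t' -> runs c t g P -> runs c t' g P.
Proof.
move=> tt' H l r o; have [t1 [g1 [? ? ?]]] := H l r o.
by exists t1, g1; split=> //; apply: leq_trans tt'.
Qed.

Lemma runs_imp c t g (P Q : _ -> Prop) :
  (forall g', P g' -> Q g') -> runs c t g P -> runs c t g Q.
Proof.
by move=> PQ H l r o; have [t1 [g1 [? ? /PQ ?]]] := H l r o; exists t1, g1.
Qed.

Lemma runs_skip g (P : _ -> Prop) : P g -> runs CSkip 1 g P.
Proof. by move=> Pg l r o; exists 1, g; split=> //; constructor. Qed.

Lemma runs_seq c1 c2 t1 t2 g P Q : runs c1 t1 g P ->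
  (forall g1, P g1 -> runs c2 t2 g1 Q) -> runs (CSeq c1 c2) (t1 + t2).+1 g Q.
Proof.
move=> H1 H2 l r o; have [u1 [g1 [ut1 E1 P1]]] := H1 l r o.
have [u2 [g2 [ut2 E2 P2]]] := H2 g1 P1 l r o.
by exists (u1 + u2).+1, g2; split=> //; [rewrite ltnS leq_add|apply: ESeq E1 E2].
Qed.

Definition setr g r v := fun r' => if r' == r then v else g r'.

Lemma runs_inc r g (P : _ -> Prop) : g r < b -> P (setr g r (g r).+1) ->
  runs (CInc r) 1 g P.
Proof. by move=> gr Pg l r' o; exists 1, (setr g r (g r).+1); split=> //; apply: EInc. Qed.

Lemma runs_dec r g (P : _ -> Prop) : 0 < g r <= b -> P (setr g r (g r).-1) ->
  runs (CDec r) 1 g P.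
Proof.
by case/andP=> g0 gr Pg l r' o; exists 1, (setr g r (g r).-1); split=> //; apply: EDec.
Qed.

Lemma runs_while r c t (I : nat -> (nat -> nat) -> Prop) :
  (forall k g, I k g -> g r = k) ->
  (forall k g, I k.+1 g -> runs c t g (I k)) ->
  forall k g, I k g -> runs (CWhile r c) (k * t.+1).+1 g (I 0).
Proof.
move=> Ir step; elim=> [|k IH] g Ig l r' o.
  by exists 1, g; split=> //; apply: EWhile0; apply: Ir Ig.
have [t1 [g1 [tt1 E1 I1]]] := step k g Ig l r' o.
have [t2 [g2 [tt2 E2 I2]]] := IH g1 I1 l r' o.
exists (t1 + t2).+1, g2; split=> //; first by rewrite mulSn; lia.
by apply: EWhileS E1 E2; rewrite /= (Ir _ _ Ig).
Qed.

Definition clear r : cmd := CWhile r (CDec r).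
Definition transfer r r' : cmd := CWhile r (CSeq (CDec r) (CInc r')).
(** Reading a register empties it, so its value also goes to a scratch register [u], from which [r]
    is restored. *)
Definition copy r r' u : cmd :=
  CSeq (CWhile r (CSeq (CDec r) (CSeq (CInc r') (CInc u)))) (transfer u r).

Lemma runs_clear r g : g r <= b ->
  runs (clear r) (2 * b + 1) g (fun g' => g' =1 setr g r 0).
Proof.
move=> grb.
have := @runs_while r (CDec r) 1 (fun k g' => g' =1 setr g r k /\ k <= b) _ _ (g r) g _.
move=> H; apply: (@runs_le _ (g r * 2).+1); first by lia.
apply: runs_imp (H _ _ _); first by move=> g' [].
- by move=> k g' [-> _]; rewrite /setr eqxx.
- move=> k g1 [E kb]; apply: runs_dec; rewrite E /setr eqxx //=.
  by split; [move=> x; rewrite E /setr; case: eqP|apply: ltnW].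
- by split=> // x; rewrite /setr; case: eqP => [->|].
Qed.

Lemma runs_transfer r r' g : r != r' -> g r + g r' <= b ->
  runs (transfer r r') (4 * b + 1) g
    (fun g' => g' =1 setr (setr g r' (g r + g r')) r 0).
Proof.
move=> rr' gb; set v := _ + _ in gb *.
pose I k g' := g' =1 setr (setr g r' (v - k)) r k /\ k <= v.
apply: (@runs_le _ (g r * 4).+1); first by lia.
apply: (@runs_imp _ _ _ (I 0)); first by move=> g' [E _] x; rewrite E subn0.
apply: (@runs_while _ _ 3 I).
- by move=> k g' [-> _]; rewrite /setr eqxx.
- move=> k g1 [E kv]; apply: (@runs_seq _ _ 1 1 _ (fun g' => g' =1 setr (setr g r' (v - k.+1)) r k)).
    apply: runs_dec; rewrite E /setr eqxx /=; first by lia.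
    by move=> x; rewrite E /setr; case: eqP.
  move=> g2 E2; apply: runs_inc; rewrite E2 /setr eqxx eq_sym (negPf rr'); first by lia.
  split; last by lia.
  move=> x; rewrite E2 /setr; case: (eqVneq x r') => [->|//].
  by rewrite eq_sym (negPf rr'); lia.
- split; last by rewrite leq_addr.
  by move=> x; rewrite /setr /v; case: eqP => [->//|_]; case: eqP => [->|//]; lia.
Qed.

Lemma runs_copy r r' u g : uniq [:: r; r'; u] -> g r <= b -> g r' = 0 -> g u = 0 ->
  runs (copy r r' u) (10 * b + 3) g (fun g' => g' =1 setr g r' (g r)).
Proof.
rewrite /= !inE negb_or andbT => /andP[/andP[rr' ru] r'u] gb g0 u0.
pose I k g' := g' =1 setr (setr (setr g r' (g r - k)) u (g r - k)) r k /\ k <= g r.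
apply: (@runs_le _ ((g r * 6).+1 + (4 * b + 1)).+1); first by lia.
apply: (@runs_seq _ _ _ _ _ (I 0)).
  apply: (@runs_while _ _ 5 I).
  - by move=> k g' [-> _]; rewrite /setr eqxx.
  - move=> k g1 [E kv].
    apply: (@runs_seq _ _ 1 3 _ (fun g' => g' =1 setr (setr (setr g r' (g r - k.+1)) u (g r - k.+1)) r k)).
      apply: runs_dec; rewrite E /setr eqxx /=; first by lia.
      by move=> x; rewrite E /setr; case: eqP.
    move=> g2 E2.
    apply: (@runs_seq _ _ 1 1 _ (fun g' => g' =1 setr (setr (setr g r' (g r - k)) u (g r - k.+1)) r k)).
      apply: runs_inc; rewrite E2 /setr eqxx eq_sym (negPf rr') (negPf r'u); first by lia.
      move=> x; rewrite E2 /setr; case: (eqVneq x r') => [->|//].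
      by rewrite eq_sym (negPf rr') (negPf r'u); lia.
    move=> g3 E3; apply: runs_inc; rewrite E3 /setr eqxx eq_sym (negPf ru); first by lia.
    split; last by lia.
    move=> x; rewrite E3 /setr; case: (eqVneq x u) => [->|//].
    by rewrite eq_sym (negPf ru); lia.
  - split=> // x; rewrite /setr subnn; case: eqP => [->//|_].
    by case: eqP => [->//|_]; case: eqP => [->//|].
move=> g1 [E _]; apply: (runs_imp _ (runs_transfer _ _)); last 1 first.
- by rewrite !E /setr eqxx (negPf ru) eqxx eq_sym (negPf ru) ?eqxx; lia.
- move=> g2 E2 x; rewrite E2 /setr !E /setr !eqxx !(eq_sym _ r) (negPf ru) subn0 addn0.
  case: (eqVneq x u) => [->|xu]; first by rewrite eq_sym (negPf r'u).
  by rewrite eq_sym; case: (eqVneq x r) => [->|_] //; rewrite (negPf rr').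
- by rewrite eq_sym.
Qed.

(** Registers are allocated as on a stack: [rho] locates the variables below [d], and all registers
    from [d] on hold 0, before as well as after, except that the result is left in [d]. *)
Fixpoint comp (rho : seq nat) (d : nat) (e : expr) : cmd :=
  match e with
  | XVar i => if i < size rho then copy (nth 0 rho i) d d.+1 else CSkip
  | XZero => CSkip
  | XSuc e => CSeq (comp rho d e) (CInc d)
  | XLet e1 e2 => CSeq (comp rho d e1) (CSeq (comp (d :: rho) d.+1 e2)
      (CSeq (clear d) (transfer d.+1 d)))
  | XRec n e0 e1 => CSeq (comp rho d n) (CSeq (comp rho d.+2 e0)
      (CSeq (CWhile d (CSeq (CDec d) (CSeq (comp (d.+2 :: d.+1 :: rho) d.+3 e1)
               (CSeq (clear d.+2) (CSeq (transfer d.+3 d.+2) (CInc d.+1))))))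
        (CSeq (clear d.+1) (transfer d.+2 d))))
  | XWk e => comp (behead rho) d e
  end.

Fixpoint cost (e : expr) : nat :=
  match e with
  | XVar _ => 10 * b + 3
  | XZero => 1
  | XSuc e => cost e + 2
  | XLet e1 e2 => cost e1 + cost e2 + 10 * b + 10
  | XRec n e0 e1 => cost n + cost e0 + b * (cost e1 + 10 * b + 20) + 10 * b + 20
  | XWk e => cost e
  end.

Definition frame (rho : seq nat) d env g :=
  [/\ map g rho = env, all (fun r => r < d) rho & forall r, d <= r -> g r = 0].

Lemma map_frame rho d g g' : all (fun r => r < d) rho ->
  (forall r, r < d -> g' r = g r) -> map g' rho = map g rho.
Proof. by move=> /allP rd gg'; apply/eq_in_map => r /rd /gg'. Qed.

Local Ltac store_cases :=
  rewrite /setr; repeat (case: eqP => ?); try (by exfalso; lia); subst; try done.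

Lemma comp_runs e rho d env g : frame rho d env g -> all (fun v => v <= b) env ->
  within b e env ->
  runs (comp rho d e) (cost e) g (fun g' => g' =1 setr g d (ev e env)).
Proof.
elim: e rho d env g => [i||e IH|e1 IH1 e2 IH2|n IHn e0 IH0 e1 IH1|e IH]
  rho d env g /= F vb W; have [E rd g0] := F.
- rewrite -E; case: ifP => [ir|/negbT]; last first.
    rewrite -leqNgt => ir; rewrite nth_default ?size_map //.
    apply: (@runs_le _ 1); first by lia.
    by apply: runs_skip => x; rewrite /setr; case: eqP => // ->; apply: g0.
  rewrite (nth_map 0) //.
  have xd : nth 0 rho i < d by apply: (allP rd); apply: mem_nth.
  apply: runs_copy; [|by case: W => + _; rewrite -E (nth_map 0)|exact: g0|exact: g0 (leqnSn d)].
  have xd' := ltn_trans xd (ltnSn d).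
  by rewrite /= !inE negb_or (ltn_eqF xd) (ltn_eqF xd') (ltn_eqF (ltnSn d)).
- by apply: runs_skip => x; rewrite /setr; case: eqP => // ->; apply: g0.
- case: W => vb1 W; rewrite addn2 -addn1.
  apply: (@runs_le _ (cost e + 1).+1); first by lia.
  apply: runs_seq; first exact: IH F vb W.
  move=> g1 E1; apply: runs_inc; rewrite E1 /setr eqxx // => x.
  by rewrite E1 /setr; case: eqP.
- case: W => vb2 [W1 W2].
  apply: (@runs_le _ (cost e1 + (cost e2 + ((2 * b + 1) + (4 * b + 1)).+1).+1).+1).
    by lia.
  apply: runs_seq; first exact: IH1 F vb W1.
  move=> g1 E1; apply: runs_seq.
    apply: IH2 (_ : frame _ _ (ev e1 env :: env) _) _ W2; last first.
      by rewrite /= vb (within_ev W1).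
    split=> /=.
    + rewrite E1 /setr eqxx -E (@map_frame _ d g) // => r rlt.
      by rewrite E1 /setr ltn_eqF.
    + by rewrite ltnSn; apply: sub_all rd => r /ltnW.
    + by move=> r dr; rewrite E1 /setr gtn_eqF // g0 // ltnW.
  move=> g2 E2; apply: runs_seq.
    by apply: runs_clear; rewrite E2 /setr ltn_eqF // E1 /setr eqxx (within_ev W1).
  move=> g3 E3; apply: (runs_imp _ (runs_transfer _ _)); last 2 first.
  + by rewrite gtn_eqF.
  + by rewrite !E3 /setr eqxx gtn_eqF // E2 /setr eqxx addn0.
  move=> g4 E4 x; rewrite E4 /setr; case: (eqVneq x d.+1) => [->|xd].
    by rewrite gtn_eqF // g0 // ltnW.
  case: (eqVneq x d) => [_|xd']; first by rewrite !E3 /setr eqxx gtn_eqF // E2 /setr eqxx addn0.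
  by rewrite E3 /setr (negPf xd') E2 /setr (negPf xd) E1 /setr (negPf xd').
- case: W => _ [Wn W0 W1]; set N := ev n env in W1 *.
  set acc := fun i => iteri i (fun i a => ev e1 (a :: i :: env)) (ev e0 env).
  have accb i : i <= N -> acc i <= b.
    by case: i => [_|i iN]; [apply: within_ev W0|apply: within_ev (W1 i iN)].
  have Nb : N <= b := within_ev Wn.
  have gd r : d <= r -> g r = 0 by apply: g0.
  (* [k] rounds remain: [d] counts down, [d.+1] holds the index and [d.+2] the accumulator. *)
  pose I k g' := k <= N /\
    g' =1 setr (setr (setr g d k) d.+1 (N - k)) d.+2 (acc (N - k)).
  apply: (@runs_le _ (cost n + (cost e0 + ((N * (cost e1 + 6 * b + 8).+1).+1 +
     ((2 * b + 1) + (4 * b + 1)).+1).+1).+1).+1).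
    have : N * (cost e1 + 6 * b + 8).+1 <= b * (cost e1 + 10 * b + 20).
      by apply: leq_mul => //; lia.
    by lia.
  apply: runs_seq; first exact: IHn F vb Wn.
  move=> g1 E1; apply: runs_seq.
    apply: IH0 (_ : frame _ _ env _) vb W0; split.
    + by rewrite -E (@map_frame _ d g) // => r rlt; rewrite E1 /setr ltn_eqF.
    + by apply: sub_all rd => r rlt; apply: ltnW; apply: ltnW.
    + move=> r dr; rewrite E1; store_cases; apply: gd; lia.
  move=> g2 E2; apply: (@runs_seq _ _ _ _ _ (I 0)).
    apply: (@runs_while _ _ _ I) => [k g3 [_ ->]|k g3 [kN E3]|].
    + by store_cases.
    + have kN1 : N - k.+1 < N by lia.
      have kS : N - k = (N - k.+1).+1 by lia.
      apply: (@runs_le _ (1 + (cost e1 + ((2 * b + 1) + ((4 * b + 1) + 1).+1).+1).+1).+1).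
        by lia.
      apply: (@runs_seq _ _ _ _ _ (fun g' => g' =1 setr g3 d k)).
        apply: runs_dec; last by move=> x; store_cases; rewrite E3; store_cases.
        by rewrite E3; store_cases; lia.
      move=> g4 E4; apply: runs_seq.
        apply: (IH1 _ _ (acc (N - k.+1) :: N - k.+1 :: env)); last exact: W1 kN1.
          split=> /=.
          * have -> : map g4 rho = env.
              rewrite -E; apply: (@map_frame _ d) => // r rlt.
              by rewrite E4; store_cases; rewrite E3; store_cases.
            by congr [:: _, _ & _]; rewrite E4; store_cases; rewrite E3; store_cases.
          * by rewrite !ltnS leqnn leqnSn /=; apply: sub_all rd => r rlt; lia.
          * by move=> r dr; rewrite E4 /setr gtn_eqF ?E3; [store_cases; apply: g0|]; lia.
        by rewrite /= vb accb ?(ltnW kN1) ?(leq_trans (ltnW kN1) Nb).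
      rewrite -[ev e1 _]/(acc (N - k.+1).+1) -kS => g5 E5.
      have ab : acc (N - k) <= b by apply: accb; lia.
      have ab' : acc (N - k.+1) <= b by apply: accb; lia.
      apply: runs_seq.
        by apply: runs_clear; rewrite E5 /setr; store_cases; rewrite E4; store_cases; rewrite E3; store_cases.
      move=> g6 E6; apply: runs_seq.
        apply: runs_transfer; first by rewrite gtn_eqF.
        by rewrite !E6; store_cases; rewrite !E5; store_cases; lia.
      move=> g7 E7.
      have E8 : g7 =1 setr (setr (setr g d k) d.+1 (N - k.+1)) d.+2 (acc (N - k)).
        move=> x; rewrite E7 /setr !E6 /setr !E5 /setr !E4 /setr !E3.
        by store_cases; rewrite ?addn0 // gd //; lia.
      apply: runs_inc; first by rewrite E8; store_cases; lia.
      split; first by lia.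
      by move=> x; rewrite /setr !E8; store_cases; lia.
    + split=> // x; rewrite E2 /setr E1 subnn.
      by store_cases; apply: gd; lia.
  move=> g3 [_ E3]; rewrite subn0 in E3; have accN := accb N (leqnn N).
  apply: runs_seq.
    by apply: runs_clear; rewrite E3; store_cases.
  move=> g4 E4; apply: (runs_imp _ (runs_transfer _ _)); last 2 first.
  + by rewrite gtn_eqF.
  + by rewrite !E4 /setr !E3; store_cases; lia.
  move=> g5 E5 x; rewrite E5 /setr !E4 /setr !E3.
  by store_cases; rewrite ?addn0 // gd //; lia.
- case: W => _ W; apply: IH W; last by case: (env) vb => //= v l /andP[].
  split=> //; first by rewrite -E; case: (rho).
  by case: (rho) rd => //= r l /andP[].
Qed.

End Compile.

(** Polynomial in the values, hence exponential in their lengths: of use for the reduction, whose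
    values are polynomial, whereas the membership proof has no time bound to respect. *)
Lemma poly_cost e : poly (cost ^~ e).
Proof.
have pD m n : poly (fun b => m * b + n).
  exact: poly_add (poly_mul (poly_const m) poly_id) (poly_const n).
elim: e => [i||e IH|e1 IH1 e2 IH2|n IHn e0 IH0 e1 IH1|e IH] //=.
- exact: poly_const.
- exact: poly_add IH (poly_const 2).
- apply: poly_le (poly_add (poly_add IH1 IH2) (pD 10 10)) => b; lia.
- apply: poly_le (poly_add (poly_add IHn IH0) (poly_add (poly_mul poly_id
    (poly_add IH1 (pD 10 20))) (pD 10 20))) => b; lia.
Qed.

End Expressions.
Import Expressions.

Module PolySpace.
From mathcomp Require Import zify.

(** * Functions computable in polynomial space *)

Notation vr i env := (nth 0 env i).
Notation below N := (all (fun v => v < 2 ^ N)).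

(** On arguments of [N] bits all intermediate values have about [p N] bits, and the number of
    registers depends on [e] alone: together this is polynomial space. *)
Definition ps (f : seq nat -> nat) := exists e p, poly p /\
  forall N env, below N env -> ev e env = f env /\ within (2 ^ p N) e env.

Definition psb (f : seq nat -> bool) := ps (fun env => f env).

(** The value, and not only its length, is polynomial in the number of bits; this is what an
    exponent must satisfy. *)
Definition small (f : seq nat -> nat) := exists2 p, poly p &
  forall N env, below N env -> f env <= p N.

Lemma below_le N M env : N <= M -> below N env -> below M env.
Proof. by move=> NM; apply: sub_all => v vN; apply: leq_trans vN _; rewrite leq_exp2l. Qed.

Lemma below_behead N env : below N env -> below N (behead env).
Proof. by case: env => //= v l /andP[]. Qed.

Lemma below_nth N env i : below N env -> (vr i env) < 2 ^ N.
Proof.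
move=> bN; case: (ltnP i (size env)) => [/(mem_nth 0)/(allP bN) //|ie].
by rewrite nth_default // expn_gt0.
Qed.

Lemma below_cons N env v : below N (v :: env) = (v < 2 ^ N) && below N env.
Proof. by []. Qed.

Lemma ps_ext f g : f =1 g -> ps f -> ps g.
Proof. by move=> fg [e [p [pp E]]]; exists e, p; split=> // N env /E; rewrite fg. Qed.

Lemma ps_bound f : ps f -> exists2 p, poly p & forall N env, below N env -> f env < 2 ^ p N.
Proof.
case=> e [p [pp E]]; exists (fun N => p N + 1); first exact: poly_add pp (poly_const 1).
move=> N env /E[<- /within_ev]; rewrite addn1 expnS => H.
by apply: leq_ltn_trans H _; rewrite -{1}[2 ^ _]mul1n ltn_pmul2r ?expn_gt0.
Qed.

Lemma ps_var i : ps (fun env => (vr i env)).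
Proof.
exists (XVar i), id; split; first exact: poly_id.
by move=> N env bN; split=> //=; split=> //; apply/ltnW/below_nth.
Qed.

Lemma ps_zero : ps (fun=> 0).
Proof. by exists XZero, (fun=> 0); split; [apply: poly_const|]. Qed.

Lemma ps_succ f : ps f -> ps (fun env => (f env).+1).
Proof.
move=> pf; have [q qp qB] := ps_bound pf; case: pf => e [p [pp E]].
exists (XSuc e), (fun N => p N + q N); split; first exact: poly_add.
move=> N env bN; have [Ee W] := E _ _ bN; split; first by rewrite /= Ee.
split=> /=; last by apply: within_le W; rewrite leq_exp2l // leq_addr.
by rewrite Ee (leq_trans (qB _ _ bN)) // leq_exp2l // leq_addl.
Qed.

Lemma ps_const c : ps (fun=> c).
Proof. by elim: c => [|c IH]; [apply: ps_zero|apply: ps_succ]. Qed.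

Lemma ps_wk f : ps f -> ps (fun env => f (behead env)).
Proof.
case=> e [p [pp E]]; exists (XWk e), p; split=> // N env /below_behead/E[Ee W].
by split=> //; split=> //; apply: within_ev W.
Qed.

Lemma ps_let f g : ps f -> ps g -> ps (fun env => g (f env :: env)).
Proof.
move=> pf; have [q qp qB] := ps_bound pf; case: pf => e [p [pp E]] [e' [p' [pp' E']]].
exists (XLet e e'), (fun N => p N + p' (N + q N)); split.
  by apply: poly_add => //; apply: poly_comp pp' (poly_add poly_id qp).
move=> N env bN; have [Ee W] := E _ _ bN.
have [|Ee' W'] := E' (N + q N) (f env :: env).
  rewrite below_cons (below_le (leq_addr _ _) bN) andbT.
  by apply: leq_trans (qB _ _ bN) _; rewrite leq_exp2l ?leq_addl.
split=> /=; rewrite Ee ?Ee' //; split.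
  by rewrite -Ee'; apply: leq_trans (within_ev W') _; rewrite leq_exp2l ?leq_addl.
by split; [apply: within_le W|apply: within_le W']; rewrite leq_exp2l ?leq_addl ?leq_addr.
Qed.

(** Exponentially many rounds are harmless; what has to be bounded is the length of every
    intermediate accumulator. *)
Lemma ps_iteri n f0 h : ps n -> ps f0 ->
  ps (fun env => h (behead (behead env)) (vr 1 env) (vr 0 env)) ->
  (exists2 q, poly q & forall N env, below N env ->
     forall i, i <= n env -> iteri i (h env) (f0 env) < 2 ^ q N) ->
  ps (fun env => iteri (n env) (h env) (f0 env)).
Proof.
move=> pn pf [e1 [p1 [pp1 E1]]] [q qp qB].
have [m mp mB] := ps_bound pn.
case: pn pf => en [pn [ppn En]] [e0 [p0 [pp0 E0]]].
exists (XRec en e0 e1), (fun N => pn N + p0 N + p1 (N + m N + q N) + q N); split.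
  by do !apply: poly_add => //; apply: (poly_comp pp1 (poly_add (poly_add poly_id mp) qp)).
move=> N env bN; have [Een Wn] := En _ _ bN; have [Ee0 W0] := E0 _ _ bN.
have nB := mB _ _ bN; have fB := qB _ _ bN.
have step i : i < n env -> let a := iteri i (h env) (f0 env) in
    ev e1 [:: a, i & env] = h env i a /\
    within (2 ^ p1 (N + m N + q N)) e1 [:: a, i & env].
  move=> i_n a; apply: (E1 _ [:: a, i & env]).
  rewrite !below_cons (below_le _ bN) ?andbT; last by rewrite -addnA leq_addr.
  apply/andP; split.
    by apply: leq_trans (fB i (ltnW i_n)) _; rewrite leq_exp2l ?leq_addl.
  apply: leq_trans (ltn_trans i_n nB) _; rewrite leq_exp2l //; lia.
have it i : i <= n env ->
    iteri i (fun i a => ev e1 [:: a, i & env]) (ev e0 env) = iteri i (h env) (f0 env).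
  by elim: i => [|i IH] i_n //=; rewrite IH ?(step _ i_n).1 // ltnW.
split=> /=; rewrite Een it //; split.
  by apply: leq_trans (ltnW (fB _ (leqnn _))) _; rewrite leq_exp2l ?leq_addl.
split.
- by apply: within_le Wn; rewrite leq_exp2l //; lia.
- by apply: within_le W0; rewrite leq_exp2l //; lia.
- move=> i i_n; rewrite it ?(ltnW i_n) //.
  by apply: within_le (step _ i_n).2; rewrite leq_exp2l //; lia.
Qed.

(** Computing the arguments first by [XLet] reduces an operation on arbitrary arguments to the
    operation on variables. *)
Lemma ps_app1 F a : ps (fun env => F (vr 0 env)) -> ps a -> ps (fun env => F (a env)).
Proof. by move=> pF pa; exact (ps_let pa pF). Qed.

Lemma ps_app2 F a b : ps (fun env => F (vr 0 env) (vr 1 env)) -> ps a -> ps b ->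
  ps (fun env => F (a env) (b env)).
Proof. by move=> pF pa pb; exact (ps_let pb (ps_let (ps_wk pa) pF)). Qed.

Lemma ps_app3 F a b c : ps (fun env => F (vr 0 env) (vr 1 env) (vr 2 env)) ->
  ps a -> ps b -> ps c -> ps (fun env => F (a env) (b env) (c env)).
Proof.
move=> pF pa pb pc.
exact (ps_let pc (ps_let (ps_wk pb) (ps_let (ps_wk (ps_wk pa)) pF))).
Qed.

Lemma ps_app4 F a b c d :
  ps (fun env => F (vr 0 env) (vr 1 env) (vr 2 env) (vr 3 env)) ->
  ps a -> ps b -> ps c -> ps d ->
  ps (fun env => F (a env) (b env) (c env) (d env)).
Proof.
move=> pF pa pb pc pd.
exact (ps_let pd (ps_let (ps_wk pc) (ps_let (ps_wk (ps_wk pb))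
  (ps_let (ps_wk (ps_wk (ps_wk pa))) pF)))).
Qed.

Lemma ps_add a b : ps a -> ps b -> ps (fun env => a env + b env).
Proof.
apply: ps_app2.
apply: (@ps_ext (fun env => iteri (vr 1 env) (fun _ x => x.+1) (vr 0 env))).
  by move=> env; elim: (vr 1 env) => [|k /= ->]; rewrite ?addn0 ?addnS.
apply: ps_iteri; [exact: ps_var|exact: ps_var|exact: ps_succ (ps_var 0)|].
exists (fun N => N + 1) => [|N env bN i ib]; first exact: poly_add poly_id (poly_const 1).
have := below_nth 0 bN; have := leq_ltn_trans ib (below_nth 1 bN).
have -> : iteri i (fun _ x => x.+1) (vr 0 env) = (vr 0 env) + i.
  by elim: i {ib} => [|k /= ->]; rewrite ?addn0 ?addnS.
by rewrite addn1 expnS; lia.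
Qed.

Lemma ps_rec_le n f0 h (c : seq nat -> nat) : ps n -> ps f0 ->
  ps (fun env => h (behead (behead env)) (vr 1 env) (vr 0 env)) ->
  ps c -> (forall env i, i <= n env -> iteri i (h env) (f0 env) <= c env) ->
  ps (fun env => iteri (n env) (h env) (f0 env)).
Proof.
move=> pn pf ph /ps_bound[q qp qB] H; apply: ps_iteri => //; exists q => // N env bN i ib.
exact: leq_ltn_trans (H _ _ ib) (qB _ _ bN).
Qed.

Lemma ps_mul a b : ps a -> ps b -> ps (fun env => a env * b env).
Proof.
apply: ps_app2.
have E i x : iteri i (fun _ y => y + x) 0 = x * i.
  by elim: i => [|k /= ->]; rewrite ?muln0 // mulnS addnC.
apply: (@ps_ext (fun env => iteri (vr 1 env) (fun _ x => x + (vr 0 env)) 0)).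
  by move=> env; rewrite E.
apply: ps_iteri; [exact: ps_var|exact: ps_zero|apply: ps_add (ps_var 0) (ps_wk (ps_wk (ps_var 0)))|].
exists (fun N => N + N) => [|N env bN i ib]; first exact: poly_add poly_id poly_id.
have := below_nth 0 bN; have := leq_ltn_trans ib (below_nth 1 bN).
by rewrite E expnD => ? ?; apply: ltn_mul.
Qed.

Lemma ps_pred a : ps a -> ps (fun env => (a env).-1).
Proof.
apply: ps_app1.
have E x : iteri x (fun i _ => i) 0 = x.-1 by case: x.
apply: (@ps_ext (fun env => iteri (vr 0 env) (fun i _ => i) 0)); first by move=> env; rewrite E.
apply: ps_rec_le (ps_var 0) ps_zero (ps_var 1) (ps_var 0) _ => env i; rewrite E; lia.
Qed.

Lemma ps_sub a b : ps a -> ps b -> ps (fun env => a env - b env).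
Proof.
apply: ps_app2.
have E i x : iteri i (fun _ y => y.-1) x = x - i.
  by elim: i => [|k /= ->]; rewrite ?subn0 // subnS.
apply: (@ps_ext (fun env => iteri (vr 1 env) (fun _ x => x.-1) (vr 0 env))).
  by move=> env; rewrite E.
apply: ps_rec_le (ps_var 1) (ps_var 0) (ps_pred (ps_var 0)) (ps_var 0) _ => env i _.
by rewrite E leq_subr.
Qed.

Lemma ps_if (c : seq nat -> bool) a b : psb c -> ps a -> ps b ->
  ps (fun env => if c env then a env else b env).
Proof.
move=> pc pa pb.
apply: (@ps_ext (fun env => iteri (c env) (fun _ _ => a env) (b env))).
  by move=> env; case: (c env).
apply: ps_rec_le pc pb (ps_wk (ps_wk pa)) (ps_add pa pb) _ => env [|i] _ /=; lia.
Qed.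

Lemma psb_eq0 a : ps a -> psb (fun env => a env == 0).
Proof.
apply: (@ps_app1 (fun x => x == 0)).
apply: (@ps_ext (fun env => iteri (vr 0 env) (fun _ _ => 0) 1)).
  by move=> env; case: (vr 0 env).
by apply: ps_rec_le (ps_var 0) (ps_const 1) ps_zero (ps_const 1) _ => env [|i].
Qed.

Lemma psb_leq a b : ps a -> ps b -> psb (fun env => a env <= b env).
Proof. by move=> pa pb; apply: psb_eq0; apply: ps_sub. Qed.

Lemma psb_ltn a b : ps a -> ps b -> psb (fun env => a env < b env).
Proof. by move=> pa pb; apply: psb_leq => //; apply: ps_succ. Qed.

Lemma psb_ext f g : f =1 g -> psb f -> psb g.
Proof. by move=> fg; apply: ps_ext => env; rewrite fg. Qed.

Lemma psb_const c : psb (fun=> c).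
Proof. exact: ps_const. Qed.

Lemma psb_and c d : psb c -> psb d -> psb (fun env => c env && d env).
Proof.
move=> pc pd; apply: ps_ext (ps_if pc pd ps_zero) => env.
by case: (c env).
Qed.

Lemma psb_or c d : psb c -> psb d -> psb (fun env => c env || d env).
Proof.
move=> pc pd; apply: ps_ext (ps_if pc (ps_const 1) pd) => env.
by case: (c env).
Qed.

Lemma psb_not c : psb c -> psb (fun env => ~~ c env).
Proof.
move=> pc; apply: ps_ext (ps_if pc (ps_const 0) (ps_const 1)) => env.
by case: (c env).
Qed.

Lemma psb_imp c d : psb c -> psb d -> psb (fun env => c env ==> d env).
Proof.
move=> pc pd; apply: ps_ext (ps_if pc pd (ps_const 1)) => env.
by case: (c env).
Qed.

Lemma psb_eq a b : ps a -> ps b -> psb (fun env => a env == b env).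
Proof.
by move=> pa pb; apply: psb_ext (psb_and (psb_leq pa pb) (psb_leq pb pa)) => env; rewrite -eqn_leq.
Qed.

Lemma psb_eqb c d : psb c -> psb d -> psb (fun env => c env == d env).
Proof.
by move=> pc pd; apply: psb_ext (psb_eq pc pd) => env; case: (c env); case: (d env).
Qed.

Lemma ps_wkb c : psb c -> psb (fun env => c (behead env)).
Proof. exact: (@ps_wk (fun env => c env)). Qed.

Lemma psb_if (c a b : seq nat -> bool) : psb c -> psb a -> psb b ->
  psb (fun env => if c env then a env else b env).
Proof.
by move=> pc pa pb; apply: ps_ext (ps_if pc pa pb) => env; case: (c env).
Qed.

Lemma psb_has n (P : seq nat -> nat -> bool) : ps n ->
  psb (fun env => P (behead env) (vr 0 env)) ->
  psb (fun env => has (P env) (iota 0 (n env))).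
Proof.
move=> pn pP.
have E env i : iteri i (fun i a => (0 < a) || P env i : nat) 0 = has (P env) (iota 0 i).
  elim: i => // i IH; rewrite -[in RHS]addn1 iotaD has_cat /= IH orbF.
  by case: (has _ _).
apply: (@ps_ext (fun env => iteri (n env) (fun i a => (0 < a) || P env i : nat) 0)).
  by move=> env; rewrite E.
apply: (@ps_rec_le n _ (fun env i a => (0 < a) || P env i : nat)) pn ps_zero _ (ps_const 1) _.
  apply: psb_or; first exact: psb_ltn ps_zero (ps_var 0).
  by apply: psb_ext (ps_wkb pP) => env; rewrite nth_behead.
by move=> env i _; rewrite E; case: has.
Qed.

Lemma psb_all n (P : seq nat -> nat -> bool) : ps n ->
  psb (fun env => P (behead env) (vr 0 env)) ->
  psb (fun env => all (P env) (iota 0 (n env))).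
Proof.
move=> pn pP; apply: psb_ext (psb_not (psb_has (P := fun env i => ~~ P env i) pn (psb_not pP))) => env.
by rewrite -[has _ _]/(has (predC (P env)) _) has_predC negbK.
Qed.

Lemma ps_min a b : ps a -> ps b -> ps (fun env => minn (a env) (b env)).
Proof.
by move=> pa pb; apply: ps_ext (ps_if (psb_ltn pa pb) pa pb) => env.
Qed.

Lemma ps_div a b : ps a -> ps b -> ps (fun env => a env %/ b env).
Proof.
apply: ps_app2.
have E x d i : 0 < d ->
    iteri i (fun _ q => if q.+1 * d <= x then q.+1 else q) 0 = minn i (x %/ d).
  move=> d0; elim: i => [|i IH] /=; first by rewrite min0n.
  by rewrite IH -leq_divRL //; case: ifP; lia.
apply: (@ps_ext (fun env => if vr 1 env == 0 then 0 else
    iteri (vr 0 env) (fun _ q => if q.+1 * vr 1 env <= vr 0 env then q.+1 else q) 0)).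
  move=> env; case: eqP => [->|/eqP]; first by rewrite divn0.
  by rewrite -lt0n => d0; rewrite E //; apply/minn_idPr/leq_div.
apply: (ps_if (psb_eq0 (ps_var 1)) ps_zero).
apply: (ps_rec_le (ps_var 0) ps_zero _ (ps_var 0)).
  apply: ps_if (ps_succ (ps_var 0)) (ps_var 0).
  apply: psb_leq; last exact: (ps_wk (ps_wk (ps_var 0))).
  by apply: ps_mul (ps_succ (ps_var 0)) _; exact: (ps_wk (ps_wk (ps_var 1))).
move=> env i iv; apply: leq_trans iv.
by elim: i => //= i; case: ifP; lia.
Qed.

Lemma ps_mod a b : ps a -> ps b -> ps (fun env => a env %% b env).
Proof.
move=> pa pb; apply: ps_ext (ps_sub pa (ps_mul (ps_div pa pb) pb)) => env.
by rewrite {1}(divn_eq (a env) (b env)) addKn.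
Qed.

(* The [i]-th digit of [x] in base [b]. *)
Definition digit b x i := iter i (divn^~ b) x %% b.

Lemma digitE b x i : 0 < b -> digit b x i = x %/ b ^ i %% b.
Proof.
move=> b0; rewrite /digit; congr (_ %% _); elim: i => [|i IH] /=; first by rewrite divn1.
by rewrite IH -divnMA expnSr.
Qed.

Lemma ps_digit a b c : ps a -> ps b -> ps c ->
  ps (fun env => digit (a env) (b env) (c env)).
Proof.
apply: ps_app3; rewrite /digit; apply: ps_mod (ps_var 0).
apply: (@ps_ext (fun env => iteri (vr 2 env) (fun _ x => x %/ vr 0 env) (vr 1 env))).
  by move=> env; elim: (vr 2 env) => //= k ->.
apply: (ps_rec_le (ps_var 2) (ps_var 1) _ (ps_var 1)).
  by apply: ps_div (ps_var 0) _; exact: (ps_wk (ps_wk (ps_var 0))).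
by move=> env i _; elim: i => //= i; apply: leq_trans (leq_div _ _).
Qed.

Lemma ltn_exp_pred x i : (x < 2 ^ i) = ~~ (minn (2 ^ i) x.+1 <= x).
Proof. by rewrite -ltnNge leq_min ltnSn andbT. Qed.

(** A computable bit length: it turns a bound on the length of an argument into a number available
    to the computation. *)
Lemma ps_bits : exists L : nat -> nat,
  [/\ ps (fun env => L (vr 0 env)), forall x, x < 2 ^ L x
    & forall x N, x < 2 ^ N -> L x <= N].
Proof.
(* The search over [i] runs up to [x], where [2 ^ i] would have exponentially many bits; capping the
   powers at [x.+1] keeps them short and still decides whether they exceed [x]. *)
pose cap x i := iteri i (fun _ a => minn (a + a) x.+1) 1.
have capE x i : cap x i = minn (2 ^ i) x.+1.
  elim: i => [|i /= ->]; first by rewrite /cap /=; lia.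
  by rewrite expnS; lia.
pose g x i a := if cap x i <= x then a.+1 else a.
exists (fun x => iteri x (g x) 0); split.
- apply: (@ps_rec_le (fun env => vr 0 env) (fun=> 0) (fun env => g (vr 0 env)) (fun env => vr 0 env)).
  + exact: ps_var.
  + exact: ps_zero.
  + apply: ps_if; [|exact: ps_succ (ps_var 0)|exact: ps_var].
    apply: psb_leq; last exact: (ps_wk (ps_wk (ps_var 0))).
    apply: (@ps_app2 cap); last exact: ps_var; last exact: (ps_wk (ps_wk (ps_var 0))).
    apply: (@ps_rec_le (fun env => vr 1 env) (fun=> 1) (fun env _ a => minn (a + a) (vr 0 env).+1) (fun env => (vr 0 env).+1)).
    * exact: ps_var.
    * exact: ps_const.
    * apply: ps_min; first exact: ps_add (ps_var 0) (ps_var 0).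
      exact: (ps_wk (ps_wk (ps_succ (ps_var 0)))).
    * exact: ps_succ (ps_var 0).
    * by move=> env i _; rewrite -/(cap _ _) capE geq_minr.
  + exact: ps_var.
  + move=> env i iv; apply: leq_trans iv.
    by elim: i => //= i; set a := iteri _ _ _; rewrite /g; case: ifP; lia.
- move=> x; suff : forall k, iteri k (g x) 0 = k \/ x < 2 ^ iteri k (g x) 0.
    by case/(_ x) => // ->; apply: ltn_expl.
  elim=> [|k] /=; first by left.
  set a := iteri _ _ _; rewrite /g capE => IH; case: ifP => [_|/negbT]; last first.
    by rewrite -ltn_exp_pred => xk; case: IH => [->|]; right.
  by case: IH => [->|xI]; [left|right; apply: ltn_trans xI _; rewrite ltn_exp2l].
- move=> x N xN; suff : forall k, iteri k (g x) 0 <= minn k N.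
    by move/(_ x)/leq_trans; apply; apply: geq_minr.
  elim=> [|k] /=; first by rewrite min0n.
  set a := iteri _ _ _; rewrite /g capE => IH; case: ifP => [|_]; last first.
    by apply: leq_trans IH _; lia.
  rewrite -[_ <= x]negbK -ltn_exp_pred -leqNgt => kx; have : k < N by rewrite -(ltn_exp2l _ _ (ltnSn 1)); apply: leq_ltn_trans kx xN.
  by lia.
Qed.

Lemma small_ps_pow2 f : ps f -> small f -> ps (fun env => 2 ^ f env).
Proof.
move=> pf [q qp qB].
have E i : iteri i (fun _ a => a + a) 1 = 2 ^ i by elim: i => //= i ->; rewrite expnS; lia.
apply: (@ps_ext (fun env => iteri (f env) (fun _ a => a + a) 1)); first by move=> env; rewrite E.
apply: ps_iteri pf (ps_const 1) (ps_add (ps_var 0) (ps_var 0)) _.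
exists (fun N => q N + 1); first exact: poly_add qp (poly_const 1).
by move=> N env bN i ib; rewrite E ltn_exp2l // addn1 ltnS (leq_trans ib) ?qB.
Qed.

Lemma small_const c : small (fun=> c).
Proof. by exists (fun=> c) => //; apply: poly_const. Qed.

Lemma small_add f g : small f -> small g -> small (fun env => f env + g env).
Proof.
move=> [p pp pB] [q qp qB]; exists (fun N => p N + q N); first exact: poly_add.
by move=> N env bN; rewrite leq_add ?pB ?qB.
Qed.

Lemma small_mul f g : small f -> small g -> small (fun env => f env * g env).
Proof.
move=> [p pp pB] [q qp qB]; exists (fun N => p N * q N); first exact: poly_mul.
by move=> N env bN; rewrite leq_mul ?pB ?qB.
Qed.

Lemma small_le f g : (forall env, f env <= g env) -> small g -> small f.
Proof.
by move=> fg [p pp pB]; exists p => // N env bN; apply: leq_trans (fg env) (pB _ _ bN).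
Qed.

End PolySpace.
Import PolySpace.

Module Savitch.
From mathcomp Require Import zify.

Ltac ps_user := fail.

(** The closure rules of [ps] and [psb], selected by the shape of the function; [ps_user] is
    extended whenever a new function has been treated. *)
Ltac ps_step := lazymatch goal with
  | H : ps ?f |- ps ?f => exact H
  | H : psb ?f |- psb ?f => exact H
  | H : ps ?f |- ps (fun env => ?f env) => exact H
  | H : psb ?f |- psb (fun env => ?f env) => exact H
  | |- ps (fun _ => ?c) => exact (ps_const c)
  | |- psb (fun _ => ?c) => exact (psb_const c)
  | |- ps (fun env => nat_of_bool (@?b env)) => change (psb b)
  | |- psb (fun env => @?a env && @?b env) => apply (@psb_and a b)
  | |- psb (fun env => @?a env || @?b env) => apply (@psb_or a b)
  | |- psb (fun env => ~~ @?a env) => apply (@psb_not a)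
  | |- psb (fun env => @?a env ==> @?b env) => apply (@psb_imp a b)
  | |- psb (fun env => @eq_op _ (@?a env) (@?b env)) =>
      first [apply (@psb_eq a b) | apply (@psb_eqb a b)]
  | |- psb (fun env => S (@?a env) <= @?b env) => apply (@psb_ltn a b)
  | |- psb (fun env => @?a env <= @?b env) => apply (@psb_leq a b)
  | |- psb (fun env => has (@?P env) (iota 0 (@?n env))) => apply (@psb_has n P)
  | |- psb (fun env => all (@?P env) (iota 0 (@?n env))) => apply (@psb_all n P)
  | |- ps (fun env => @?a env + @?b env) => apply (@ps_add a b)
  | |- ps (fun env => @?a env - @?b env) => apply (@ps_sub a b)
  | |- ps (fun env => @?a env * @?b env) => apply (@ps_mul a b)
  | |- ps (fun env => @?a env %/ @?b env) => apply (@ps_div a b)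
  | |- ps (fun env => @?a env %% @?b env) => apply (@ps_mod a b)
  | |- ps (fun env => minn (@?a env) (@?b env)) => apply (@ps_min a b)
  | |- ps (fun env => digit (@?a env) (@?b env) (@?c env)) => apply (@ps_digit a b c)
  | |- ps (fun env => S (@?a env)) => apply (@ps_succ a)
  | |- ps (fun env => predn (@?a env)) => apply (@ps_pred a)
  | |- ps (fun env => nth 0 env ?i) => exact (ps_var i)
  | |- ps (fun env => nth 0 (behead (@?e env)) ?i) =>
      apply (@ps_ext (fun env => nth 0 (e env) i.+1));
      [intro; exact (esym (nth_behead _ _ _))|]
  | |- ps (fun env => ?f (behead (@?e env))) => apply (@ps_wk (fun env => f (e env)))
  | |- psb (fun env => ?f (behead (@?e env))) => apply (@ps_wkb (fun env => f (e env)))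
  | |- psb _ => first [ps_user | apply psb_if]
  | |- ps _ => first [ps_user | apply ps_if]
  | _ => ps_user
  end.
Ltac ps_auto := repeat (cbv beta; ps_step).

(** * Reachability in exponentially large graphs *)

Section Savitch.
Variables (V : nat) (R : rel nat).

Definition reach x y := exists s, [/\ path R x s, last x s = y & all (fun z => z < V) s].

Fixpoint sv k x y : bool :=
  if k is k'.+1 then has (fun z => sv k' x z && sv k' z y) (iota 0 V)
  else (x == y) || R x y.

Lemma sv_reach k x y : y < V -> sv k x y -> reach x y.
Proof.
elim: k x y => [|k IH] x y yV /=.
  by case/orP=> [/eqP->|Rxy]; [exists [::]|exists [:: y]; rewrite /= Rxy yV].
case/hasP=> z; rewrite mem_iota /= => zV /andP[/(IH _ _ zV)[s [ps ls sV]]].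
case/(IH _ _ yV) => s' [ps' ls' sV']; exists (s ++ s').
by rewrite cat_path last_cat all_cat ps ls ps' ls' sV sV'.
Qed.

Lemma path_sv k x s : size s <= 2 ^ k -> x < V -> all (fun z => z < V) s ->
  path R x s -> sv k x (last x s).
Proof.
elim: k x s => [|k IH] x s.
  by case: s => [|y [|]] //=; rewrite ?eqxx // => _ _ _ /andP[-> _]; rewrite orbT.
rewrite -{2 3 4}(cat_take_drop (2 ^ k) s) all_cat cat_path last_cat => sk xV.
move=> /andP[aV bV] /andP[pa pb]; apply/hasP; exists (last x (take (2 ^ k) s)).
  have := mem_last x (take (2 ^ k) s); rewrite mem_iota /= inE.
  by case/orP=> [/eqP->|/(allP aV)].
apply/andP; split; apply: IH => //.
- by rewrite size_take; case: ltnP.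
- by rewrite size_drop; move: sk; rewrite expnS; lia.
- by have := mem_last x (take (2 ^ k) s); rewrite inE; case/orP=> [/eqP->|/(allP aV)].
Qed.

(** A path without repeated vertices has at most [V] edges, which level [k] covers. *)
Lemma reach_sv k x y : V < 2 ^ k -> x < V -> reach x y -> sv k x y.
Proof.
move=> Vk xV [s [ps <- sV]]; move: sV.
case: (shortenP ps) => s' ps' us' s's sV.
have sV' : all (fun z => z < V) s' by apply/allP=> z /s's; apply: (allP sV).
apply: path_sv => //; apply: leq_trans (ltnW Vk).
rewrite -[V in _ <= V](size_iota 0); apply: uniq_leq_size; first by case/andP: us'.
by move=> z /(allP sV'); rewrite mem_iota.
Qed.

End Savitch.

(** Level [V] is far more than enough, but it spares the definition any bit length. The computation
    runs at a logarithmic level, and both levels decide [reach]. *)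
Definition reachb V R x y := [&& x < V, y < V & sv V R V x y].

Lemma reachP V R x y : reflect [/\ x < V, y < V & reach V R x y] (reachb V R x y).
Proof.
apply: (iffP and3P) => -[xV yV H]; split=> //; first exact: sv_reach H.
exact: reach_sv (ltn_expl _ _) xV H.
Qed.

(* Savitch's algorithm: the recursion of [sv] run on an explicit stack. A state is
   a tuple (mode, level, x, y, stack): mode 0 evaluates [sv level x y], modes 1
   and 2 return false and true. A stack frame (x, y, z, b) is suspended on the
   first ([b = 0]) or second ([b = 1]) conjunct for the midpoint [z]. *)
Section StackMachine.
Variables (V K : nat) (R : rel nat).

Definition state_code m k x y st := (((st * V + x) * V + y) * K.+1 + k) * 3 + m.
Definition s_mode s := s %% 3.
Definition s_lev s := s %/ 3 %% K.+1.
Definition s_y s := s %/ 3 %/ K.+1 %% V.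
Definition s_x s := s %/ 3 %/ K.+1 %/ V %% V.
Definition s_st s := s %/ 3 %/ K.+1 %/ V %/ V.

Definition frames := V * V * V * 2.
Definition push x y z b st := st * frames + (((x * V + y) * V + z) * 2 + b).
Definition f_b f := f %% 2.
Definition f_z f := f %/ 2 %% V.
Definition f_y f := f %/ 2 %/ V %% V.
Definition f_x f := f %/ 2 %/ V %/ V %% V.

Definition sav_step s :=
  let k := s_lev s in let st := s_st s in
  let f := st %% frames in let st' := st %/ frames in
  if s_mode s == 0 then
    if k == 0 then state_code (1 + ((s_x s == s_y s) || R (s_x s) (s_y s))) 0 0 0 st
    else state_code 0 k.-1 (s_x s) 0 (push (s_x s) (s_y s) 0 0 st)
  else if k == K then s
  else if s_mode s == 2 then
    if f_b f == 0 then state_code 0 k (f_z f) (f_y f) (push (f_x f) (f_y f) (f_z f) 1 st')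
    else state_code 2 k.+1 0 0 st'
  else if (f_z f).+1 < V then
    state_code 0 k (f_x f) (f_z f).+1 (push (f_x f) (f_y f) (f_z f).+1 0 st')
  else state_code 1 k.+1 0 0 st'.

Lemma state_codeK m k x y st : m < 3 -> k <= K -> x < V -> y < V ->
  let s := state_code m k x y st in
  [/\ s_mode s = m, s_lev s = k, s_x s = x, s_y s = y & s_st s = st].
Proof.
move=> m3 kK xV yV; have V0 : 0 < V by apply: leq_ltn_trans xV.
rewrite /s_mode /s_lev /s_x /s_y /s_st /state_code.
rewrite modnMDl divnMDl // (divn_small m3) addn0 (modn_small m3).
rewrite modnMDl divnMDl // (divn_small (_ : k < K.+1)) // addn0 modn_small //.
by rewrite !modnMDl !divnMDl // (divn_small yV) addn0 modnMDl divnMDl // (divn_small xV) addn0 !modn_small.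
Qed.

Lemma pushK x y z b st : x < V -> y < V -> z < V -> b < 2 ->
  let f := push x y z b st %% frames in
  [/\ push x y z b st %/ frames = st, f_x f = x, f_y f = y, f_z f = z & f_b f = b].
Proof.
move=> xV yV zV b2; have V0 : 0 < V by apply: leq_ltn_trans xV.
have fB : ((x * V + y) * V + z) * 2 + b < frames.
  have h1 : x * V + y < V * V by nia.
  have h2 : (x * V + y) * V + z < V * V * V by nia.
  by rewrite /frames; lia.
rewrite /push modnMDl (modn_small fB) divnMDl ?muln_gt0 ?V0 // (divn_small fB) addn0.
rewrite /f_x /f_y /f_z /f_b modnMDl divnMDl // (divn_small b2) addn0 (modn_small b2).
rewrite modnMDl divnMDl // (divn_small zV) addn0 modnMDl divnMDl // (divn_small yV) addn0.
by rewrite !modn_small.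
Qed.

Definition sav_reaches t s s' := exists2 t', t' <= t & iter t' sav_step s = s'.

Lemma sav_trans t1 t2 s1 s2 s3 : sav_reaches t1 s1 s2 -> sav_reaches t2 s2 s3 ->
  sav_reaches (t1 + t2) s1 s3.
Proof.
move=> [u1 h1 <-] [u2 h2 <-]; exists (u1 + u2); first exact: leq_add.
by rewrite addnC iterD.
Qed.

Lemma sav_one s s' : sav_step s = s' -> sav_reaches 1 s s'.
Proof. by exists 1. Qed.

Lemma sav_le t t' s s' : t <= t' -> sav_reaches t s s' -> sav_reaches t' s s'.
Proof. by move=> tt' [u h E]; exists u => //; apply: leq_trans tt'. Qed.

(** One level costs a factor of at most [6 * V]: there are [V] midpoints, each with two calls and at
    most two steps for passing between them. *)
Lemma sav_eval k x y st : k <= K -> x < V -> y < V ->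
  sav_reaches ((6 * V) ^ k) (state_code 0 k x y st)
    (state_code (1 + sv V R k x y) k 0 0 st).
Proof.
elim: k x y st => [|k IH] x y st kK xV yV; have V0 := leq_ltn_trans (leq0n _) xV.
  apply: sav_one; rewrite /sav_step.
  by have [-> -> -> -> ->] := state_codeK st (isT : 0 < 3) kK xV yV.
have kK' := ltnW kK.
set T := (6 * V) ^ k in IH *.
have T0 : 0 < T by rewrite expn_gt0 muln_gt0 V0.
(* The search over the midpoints from [z] on, by induction on their number; [next] below treats the
   failure of one, on either conjunct. *)
have mid z : z < V -> sav_reaches ((V - z) * (2 * T + 2))
    (state_code 0 k x z (push x y z 0 st))
    (state_code (1 + has (fun z => sv V R k x z && sv V R k z y) (iota z (V - z))) k.+1 0 0 st).
  move Ed: (V - z) => d; elim: d z Ed => [|d IHd] z Ed zV; first by lia.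
  have [ds dx dy dz db] := pushK st xV yV zV (isT : 0 < 2).
  have [ds' dx' dy' dz' db'] := pushK st xV yV zV (isT : 1 < 2).
  have next st0 : st0 %/ frames = st -> f_x (st0 %% frames) = x -> f_y (st0 %% frames) = y ->
      f_z (st0 %% frames) = z ->
      sav_reaches (1 + d * (2 * T + 2)) (state_code 1 k 0 0 st0)
       (state_code (1 + has (fun z => sv V R k x z && sv V R k z y) (iota z.+1 d)) k.+1 0 0 st).
    move=> e1 e2 e3 e4.
    have step : sav_step (state_code 1 k 0 0 st0) = if z.+1 < V
        then state_code 0 k x z.+1 (push x y z.+1 0 st) else state_code 1 k.+1 0 0 st.
      rewrite /sav_step; have [-> -> _ _ ->] := state_codeK st0 (isT : 1 < 3) kK' V0 V0.
      by rewrite (ltn_eqF kK) e1 e2 e3 e4.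
    case: ltnP step => zV' step.
      by apply: sav_trans (sav_one step) (IHd _ _ zV'); lia.
    have d0 : d = 0 by lia.
    by rewrite d0 mul0n addn0; apply: sav_one.
  have -> : d.+1 * (2 * T + 2) = T + (T + (2 + d * (2 * T + 2))) by lia.
  apply: sav_trans (IH _ _ _ kK' xV zV) _ => /=.
  case: (sv V R k x z) => /=; last first.
    by apply: sav_le (next _ ds dx dy dz); lia.
  have step : sav_step (state_code 2 k 0 0 (push x y z 0 st)) =
      state_code 0 k z y (push x y z 1 st).
    rewrite /sav_step; have [-> -> _ _ ->] := state_codeK (push x y z 0 st) (isT : 2 < 3) kK' V0 V0.
    by rewrite (ltn_eqF kK) ds dx dy dz db.
  apply: (@sav_le (1 + (T + (1 + d * (2 * T + 2))))); first by lia.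
  apply: sav_trans (sav_one step) _; apply: sav_trans (IH _ _ _ kK' zV yV) _.
  case: (sv V R k z y) => /=; last exact: next.
  apply: (@sav_le 1); first by lia.
  apply: sav_one; rewrite /sav_step.
  have [-> -> _ _ ->] := state_codeK (push x y z 1 st) (isT : 2 < 3) kK' V0 V0.
  by rewrite (ltn_eqF kK) ds' db'.
have := mid 0 V0; rewrite subn0 => M.
apply: (@sav_le (1 + V * (2 * T + 2))).
  by rewrite expnS -/T; nia.
apply: sav_trans M; apply: sav_one; rewrite /sav_step.
by have [-> -> -> -> ->] := state_codeK st (isT : 0 < 3) kK xV yV.
Qed.

Lemma sav_halt b : 0 < V -> b < 3 -> 0 < b -> forall n,
  iter n sav_step (state_code b K 0 0 0) = state_code b K 0 0 0.
Proof.
move=> V0 b3 b0; elim=> //= n ->; rewrite /sav_step.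
have [-> -> _ _ _] := state_codeK 0 b3 (leqnn K) V0 V0.
by rewrite eqxx (negPf (lt0n_neq0 b0)).
Qed.

Lemma sav_result n x y : x < V -> y < V -> (6 * V) ^ K <= n ->
  iter n sav_step (state_code 0 K x y 0) = state_code (1 + sv V R K x y) K 0 0 0.
Proof.
move=> xV yV Kn; have [t tK E] := sav_eval 0 (leqnn K) xV yV.
rewrite -(subnK (leq_trans tK Kn)) iterD E.
by case: (sv _ _ _ _ _); apply: sav_halt; rewrite ?(leq_ltn_trans _ xV).
Qed.

End StackMachine.

Lemma ps_state_code V K m k x y st : ps V -> ps K -> ps m -> ps k -> ps x -> ps y -> ps st ->
  ps (fun env => state_code (V env) (K env) (m env) (k env) (x env) (y env) (st env)).
Proof. by move=> *; rewrite /state_code; ps_auto. Qed.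

Lemma ps_push V x y z b st : ps V -> ps x -> ps y -> ps z -> ps b -> ps st ->
  ps (fun env => push (V env) (x env) (y env) (z env) (b env) (st env)).
Proof. by move=> *; rewrite /push /frames; ps_auto. Qed.

Lemma ps_sav_step V K R : ps V -> ps K -> (forall x y, ps x -> ps y ->
    psb (fun env => R (behead (behead env)) (x env) (y env))) ->
  ps (fun env => sav_step (V (behead (behead env))) (K (behead (behead env)))
    (R (behead (behead env))) (vr 0 env)).
Proof.
move=> pV pK pR; rewrite /sav_step /s_mode /s_lev /s_x /s_y /s_st /f_x /f_y /f_z /f_b /frames.
repeat (cbv beta; first [apply pR | apply ps_state_code | apply ps_push | ps_step]).
Qed.

Lemma state_code_lt V K m k x y st N : m < 3 -> k <= K -> x < V -> y < V -> st < N ->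
  state_code V K m k x y st < N * V * V * K.+1 * 3.
Proof.
move=> m3 kK xV yV sN; rewrite /state_code.
have h1 : st * V + x < N * V by nia.
have h2 : (st * V + x) * V + y < N * V * V by nia.
have h3 : ((st * V + x) * V + y) * K.+1 + k < N * V * V * K.+1 by nia.
lia.
Qed.

(** At level [k] at most [K - k] frames are suspended. This is the heart of the space bound: the
    stack has at most [K] frames of logarithmic length in [V]. *)
Definition sav_valid V K s := exists m k x y st,
  [/\ s = state_code V K m k x y st, m < 3, k <= K, x < V & y < V] /\
  st < frames V ^ (K - k).

Lemma sav_step_valid V K R s : sav_valid V K s -> sav_valid V K (sav_step V K R s).
Proof.
move=> [m [k [x [y [st [[-> m3 kK xV yV] stB]]]]]].
have V0 : 0 < V by apply: leq_ltn_trans xV.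
have F0 : 0 < frames V by rewrite /frames !muln_gt0 V0.
have mz z : z %% V < V by rewrite ltn_mod.
have fB : forall x y z b, x < V -> y < V -> z < V -> b < 2 ->
    ((x * V + y) * V + z) * 2 + b < frames V.
  move=> x0 y0 z b xV0 yV0 zV b2.
  have h1 : x0 * V + y0 < V * V by nia.
  have h2 : (x0 * V + y0) * V + z < V * V * V by nia.
  by rewrite /frames; lia.
have pushB x0 y0 z b st0 j : x0 < V -> y0 < V -> z < V -> b < 2 -> st0 < frames V ^ j ->
    push V x0 y0 z b st0 < frames V ^ j.+1.
  move=> h1 h2 h3 h4 h5; rewrite /push expnSr.
  by have := fB _ _ _ _ h1 h2 h3 h4; nia.
have popB : k < K -> st %/ frames V < frames V ^ (K - k.+1).
  by move=> kK'; rewrite ltn_divLR // -expnSr subnSK.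
rewrite /sav_step; have [-> -> -> -> ->] := state_codeK st m3 kK xV yV.
case: eqP => [m0|_].
  case: eqP => [k0|/eqP k0].
    exists (1 + ((x == y) || R x y)), 0, 0, 0, st; split; last by rewrite -k0.
    by split=> //; case: (_ || _).
  exists 0, k.-1, x, 0, (push V x y 0 0 st); split; first by split=> //; lia.
  by rewrite (_ : K - k.-1 = (K - k).+1); [apply: pushB|lia].
case: (eqVneq k K) => [kK'|kK'].
  by exists m, k, x, y, st.
have {}kK' : k < K by rewrite ltn_neqAle kK'.
have KS : K - k = (K - k.+1).+1 by lia.
case: eqP => [m2|_].
  case: eqP => [_|_].
    exists 0, k; do 3 eexists; split; first by split=> //; rewrite ?mz.
    by rewrite KS; apply: pushB; rewrite ?mz ?popB.
  by exists 2, k.+1, 0, 0; eexists; split; [split|apply: popB].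
case: ifP => zV.
  exists 0, k; do 3 eexists; split; first by split=> //; rewrite ?mz.
  by rewrite KS; apply: pushB; rewrite ?mz ?popB.
by exists 1, k.+1, 0, 0; eexists; split; [split|apply: popB].
Qed.

Lemma psb_reachb V x y (R : seq nat -> nat -> nat -> bool) : ps V -> ps x -> ps y ->
  (forall x y, ps x -> ps y -> psb (fun env => R (behead (behead env)) (x env) (y env))) ->
  psb (fun env => reachb (V env) (R env) (x env) (y env)).
Proof.
move=> pV px py pR; have [L [pL LV LN]] := ps_bits.
have pK : ps (fun env => L (V env)) := ps_app1 pL pV.
have sK : small (fun env => L (V env)).
  have [q qp qB] := ps_bound pV; exists q => // N env bN.
  exact: LN (qB _ _ bN).
(* The number of steps granted: [6 * V <= 2 ^ (L + 3)], raised to the level [L]. *)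
pose T env := 2 ^ ((L (V env) + 3) * L (V env)).
have pT : ps T.
  apply: small_ps_pow2; first by ps_auto.
  by apply: small_mul => //; apply: small_add => //; apply: small_const.
(* The bound on the stack: a frame is below [2 * V ^ 3 <= 2 ^ (3 * L + 1)], and there are at most
   [L] of them. *)
pose W env := 2 ^ ((3 * L (V env) + 1) * L (V env)).
have pW : ps W.
  apply: small_ps_pow2; first by ps_auto.
  by apply: small_mul => //; apply: small_add; [apply: small_mul => //|]; apply: small_const.
pose ok env := (x env < V env) && (y env < V env).
have pok : psb ok by rewrite /ok; ps_auto.
(* Arguments out of range would spoil the decoding of states, so no step is made on them. *)
pose T' env := if ok env then T env else 0.
pose s0 env := if ok env then
     state_code (V env) (L (V env)) 0 (L (V env)) (x env) (y env) 0 else 0.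
pose it env := iteri (T' env) (fun _ s => sav_step (V env) (L (V env)) (R env) s) (s0 env).
have iterE (f : nat -> nat) n s : iteri n (fun=> f) s = iter n f s by elim: n => //= n ->.
have LVe env : V env <= 2 ^ L (V env) by apply/ltnW/LV.
have pit : ps it.
  apply: (@ps_rec_le T' s0 (fun env _ s => sav_step (V env) (L (V env)) (R env) s)
    (fun env => W env * V env * V env * (L (V env)).+1 * 3)).
  - by apply: ps_if => //; ps_auto.
  - by apply: ps_if => //; [apply: ps_state_code; ps_auto|ps_auto].
  - exact: (@ps_sav_step V (fun env => L (V env))).
  - by have := pW; rewrite /W => ?; ps_auto.
  - move=> env i; rewrite /T' /s0 iterE; case: ifP => [/andP[xV yV] _|_]; last by case: i.
    set s1 := state_code _ _ _ _ _ _ _.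
    have : sav_valid (V env) (L (V env)) s1.
      by exists 0, (L (V env)), (x env), (y env), 0; rewrite subnn.
    have V0 := leq_ltn_trans (leq0n _) xV.
    elim: i s1 => [|i IH] s1 H; last by rewrite iterSr; apply: IH; apply: sav_step_valid.
    case: H => m [k [x0 [y0 [st [[-> m3 kK xV0 yV0] stB]]]]].
    apply/ltnW/state_code_lt => //; apply: leq_trans stB _.
    apply: leq_trans (leq_pexp2l _ (leq_subr _ _)) _; first by rewrite /frames; lia.
    rewrite /W expnM; apply: leq_exp2r_weak; rewrite /frames addn1 expnSr leq_mul2r /=.
    by rewrite !mulSn mul0n addn0 !expnD mulnA !leq_mul.
(* The remainder modulo 3 is the mode, and mode 2 is the answer true. *)
apply: psb_ext (psb_and pok (psb_eq (ps_mod pit (ps_const 3)) (ps_const 2))) => env.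
rewrite /it /T' /s0 /ok iterE; case: (boolP ((x env < V env) && (y env < V env))) => [/andP[xV yV]|ni]; last first.
  by case E: (reachb _ _ _ _) => //; case/reachP: E ni => -> ->.
rewrite sav_result //; last first.
  rewrite /T expnM; apply: leq_exp2r_weak; rewrite expnD mulnC.
  by apply: leq_mul.
have V0 := leq_ltn_trans (leq0n _) xV.
have : state_code (V env) (L (V env)) (1 + sv (V env) (R env) (L (V env)) (x env) (y env))
    (L (V env)) 0 0 0 %% 3 = 1 + sv (V env) (R env) (L (V env)) (x env) (y env).
  by rewrite /state_code modnMDl modn_small //; case: sv.
move=> -> /=; apply/idP/idP.
  case E: sv => // _; apply/reachP; split=> //; exact: sv_reach E.
by case/reachP => _ _ /(reach_sv (LV _) xV) ->.
Qed.

End Savitch.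
Import Savitch.

(** * Words as numbers, and languages decided through their codes *)

Module WordCodes.
From mathcomp Require Import zify.

Lemma exec_input (B C : finType) bd (f : B -> cmd B C) T
    (I : seq B -> (nat -> nat) -> Prop) :
  (forall b l g, I (b :: l) g -> runs bd (f b) T g (I l)) ->
  forall l g r o, I l g -> exists t g',
    [/\ t <= (size l * T.+1).+1,
        exec bd (CInput f) (Store g l r o) t (Store g' [::] (catrev l r) o) & I [::] g'].
Proof.
move=> step; elim=> [|b l IH] g r o Ig.
  by exists 1, g; split=> //; apply: EInput0.
have [t1 [g1 [tT E1 I1]]] := step b l g Ig l (b :: r) o.
have [t2 [g2 [t2T E2 I2]]] := IH g1 (b :: r) o I1.
exists (t1 + t2).+1, g2; split=> //; first by rewrite /= mulSn; lia.
exact: (@EInputS _ _ _ f b l (Store g (b :: l) r o) _ _ _ _ (erefl _) E1 E2).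
Qed.

Section WordCode.
Variable B : finType.

(** Letters are the nonzero digits, so that the digit 0 marks the end of a word. The first letter is
    the least significant digit. *)
Definition word_base := #|B|.+1.
Definition letter_code (b : B) := (enum_rank b).+1.
Definition word_code (w : seq B) := foldr (fun b c => c * word_base + letter_code b) 0 w.

Lemma letter_code_lt b : letter_code b < word_base.
Proof. by rewrite ltnS ltn_ord. Qed.

Lemma word_code_lt w : word_code w < word_base ^ size w.
Proof.
elim: w => //= b w IH; rewrite expnS; have := letter_code_lt b.
by rewrite mulnC; nia.
Qed.

Lemma word_code_bits w : word_code w < 2 ^ (word_base * size w).
Proof.
apply: leq_trans (word_code_lt w) _.
by rewrite expnM; apply: leq_exp2r_weak; apply/ltnW/ltn_expl.
Qed.

Fixpoint const_expr k := if k is k'.+1 then XSuc (const_expr k') else XZero.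

Lemma const_exprP k b env : k <= b -> ev (const_expr k) env = k /\ within b (const_expr k) env.
Proof.
elim: k => //= k IH kb; have [-> W] := IH (ltnW kb).
by split.
Qed.

Definition assign e : cmd B unit := CSeq (comp _ _ [:: 0] 1 e) (CSeq (clear _ _ 0) (transfer _ _ 1 0)).

Lemma assign_runs b e g : (forall r, 0 < r -> g r = 0) -> within b e [:: g 0] -> g 0 <= b ->
  runs b (assign e) (cost b e + (2 * b + 1 + (4 * b + 1)).+1).+1 g
    (fun g' => g' 0 = ev e [:: g 0] /\ forall r, 0 < r -> g' r = 0).
Proof.
move=> g0 W gb; have evb := within_ev W; apply: runs_seq.
  by apply: (comp_runs (env := [:: g 0])) W; rewrite /= ?gb.
move=> g1 E1; apply: runs_seq.
  by apply: runs_clear; rewrite E1 /setr.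
move=> g2 E2; apply: runs_imp (runs_transfer _ _) => //.
  move=> g3 E3; split; first by rewrite E3 /setr /= !E2 /setr /= E1 /setr /= addn0.
  by move=> [|[|r]] // _; rewrite E3 /setr /= E2 /setr /= E1 /setr /= g0.
by rewrite !E2 /setr /= E1 /setr /= addn0.
Qed.

(** Reading the input backwards is Horner's scheme for [word_code]. The code has linearly many bits
    in the length of the word, so a polynomial in the former is one in the latter. *)
Theorem psb_in_PSPACE (P : nat -> bool) (K : set (seq B)) :
  psb (fun env => P (vr 0 env)) -> (forall w, P (word_code w) <-> K w) ->
  in_PSPACE K.
Proof.
move=> [e [p [pp E]]] PK.
have [e1 [p1 [pp1 E1]]] : ps (fun env => vr 1 env * word_base + vr 0 env) by ps_auto.
pose rd b := assign (XLet (const_expr (letter_code b)) e1).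
pose c := CSeq (CInput rd) (assign e).
pose q n := p (word_base * n) + p1 (word_base * n + word_base).
have pq : poly q.
  apply: poly_add; first by apply: (poly_comp pp); apply: poly_mul (poly_const _) poly_id.
  apply: (poly_comp pp1); apply: poly_add (poly_const _).
  exact: poly_mul (poly_const _) poly_id.
pose q' n := q n + word_base * n + word_base.
have pq' : poly q'.
  apply: poly_add (poly_const _); apply: poly_add => //.
  exact: poly_mul (poly_const _) poly_id.
apply: (@exec_in_PSPACE B unit (regs c) c q' K pq' (wf_regs (leqnSn _))) => w.
set bd := 2 ^ q' (size w).
pose step := fun c b => c * word_base + letter_code b.
have bdle m : m <= q' (size w) -> 2 ^ m <= bd by move=> ?; rewrite leq_exp2l.
pose I l (g : nat -> nat) := (forall r, 0 < r -> g r = 0) /\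
  exists u, rev w = u ++ l /\ g 0 = foldl step 0 u.
have pre u l : rev w = u ++ l -> foldl step 0 u < 2 ^ (word_base * size w).
  move=> E2; have -> : foldl step 0 u = word_code (rev u) by rewrite -{1}(revK u) foldl_rev.
  apply: leq_trans (word_code_bits _) _; rewrite leq_exp2l // leq_mul2l size_rev.
  by rewrite -(size_rev w) E2 size_cat leq_addr orbT.
have rdT b l g : I (b :: l) g -> runs bd (rd b)
    (\max_(b : B) (cost bd (XLet (const_expr (letter_code b)) e1) + (2 * bd + 1 + (4 * bd + 1)).+1).+1) g (I l).
  move=> [g0 [u [wu gE]]]; pose v := letter_code b.
  have vq : v < word_base := letter_code_lt b.
  have vb : letter_code b = v by []; rewrite /rd vb; clearbody v.
  have vB : v <= bd.
    apply: leq_trans (ltnW vq) _; apply: leq_trans (ltnW (ltn_expl _ (ltnSn 1))) _.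
    by apply: bdle; rewrite /q'; lia.
  have [cE cW] := const_exprP [:: g 0] vB.
  have gB := pre _ _ wu; rewrite -gE in gB.
  have [|vE vW] := E1 (word_base * size w + word_base) [:: v; g 0].
    rewrite /= andbT; apply/andP; split.
      apply: leq_trans vq _; apply: leq_trans (ltnW (ltn_expl _ (ltnSn 1))) _.
      by rewrite leq_exp2l // leq_addl.
    by apply: leq_trans gB _; rewrite leq_exp2l // leq_addr.
  have gb : g 0 <= bd.
    by apply: leq_trans (ltnW gB) _; apply: bdle; rewrite /q'; lia.
  have W : within bd (XLet (const_expr v) e1) [:: g 0].
    have vW' : within bd e1 [:: v; g 0].
      by apply: within_le vW; apply: bdle; rewrite /q' /q; lia.
    by split; rewrite /= cE ?(within_ev vW').
  apply: runs_le (runs_imp _ (assign_runs g0 W gb)).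
    by rewrite -vb; exact: (leq_bigmax (F := fun b => (cost bd (XLet (const_expr (letter_code b)) e1) + _).+1)).
  move=> g' [g'E g'0]; split=> //; exists (rcons u b).
  by rewrite cat_rcons wu g'E -cats1 foldl_cat /= -gE cE vE /step vb.
have I0 : I (rev w) (fun=> 0) by split=> //; exists [::].
have [t1 [g1 [_ X1 [g10 [u [wu g1E]]]]]] := exec_input rdT [::] [::] I0.
rewrite cats0 in wu; rewrite -wu foldl_rev -/(word_code w) in g1E.
have bw : below (word_base * size w) [:: g1 0] by rewrite /= g1E word_code_bits.
have [Ee We] := E _ _ bw.
have We' : within bd e [:: g1 0].
  by apply: within_le We; apply: bdle; rewrite /q' /q; lia.
have g1b : g1 0 <= bd.
  by rewrite g1E; apply: leq_trans (ltnW (word_code_bits w)) _; apply: bdle; rewrite /q'; lia.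
have [t2 [g2 [_ X2 [g2E _]]]] := assign_runs g10 We' g1b [::] (catrev (rev w) [::]) [::].
exists (t1 + t2).+1; eexists; split; first exact: ESeq X1 X2.
  by [].
by rewrite /= g2E Ee /= g1E -PK; case: (P _).
Qed.

End WordCode.

End WordCodes.
Import WordCodes.

Module Regions.
From mathcomp Require Import zify lra.
From mathcomp Require Import boolp classical_sets reals.

Import Order.TTheory GRing.Theory Num.Theory.
Local Open Scope ring_scope.

(** * Clock regions *)

Inductive star (S : Type) (r : S -> S -> Prop) : S -> S -> Prop :=
| star0 x : star r x x
| starS x y z : r x y -> star r y z -> star r x z.

Lemma star_trans S (r : S -> S -> Prop) x y z : star r x y -> star r y z -> star r x z.
Proof. by elim=> // {}x x' y' H _ IH /IH; apply: starS H. Qed.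

(* Time is measured in units of which an integer constant contains [D]: the
   dense semantics is the case [D = 1], the discretized one has integer time. *)
Section World.
Variables (T : realDomainType) (D : T) (Sigma L X : finType) (A : TA Sigma L X).
Implicit Types (mu : {ffun X -> T}) (s d : T).

Definition gcmp (c : cmp) : rel T :=
  match c with
  | CLt => fun u v => u < v
  | CLe => fun u v => u <= v
  | CEq => fun u v => u == v
  | CGe => fun u v => u >= v
  | CGt => fun u v => u > v
  end.

Definition gsat mu (g : guard X) : bool :=
  all (fun c : constraint X =>
    let: (x, op, d) := c in gcmp op (mu x) (d%:~R * D)) g.

Definition gdelay mu d : {ffun X -> T} := [ffun x => mu x + d].
Definition greset mu (r : {set X}) : {ffun X -> T} :=
  [ffun x => if x \in r then 0 else mu x].

Definition inv_on mu l s d :=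
  forall u, s <= u -> u <= d -> gsat (gdelay mu u) (ta_inv A l).

(* From location [p.1.1], reached [p.2] time units after the valuation was [mu],
   an edge with action [oa] is taken when [d] time units have elapsed; the flags
   record whether a private location has been visited. *)
Definition astep (oa : option Sigma) mu (p : L * bool * T) d (q : L * bool) mu' :=
  [/\ p.1.1 \notin ta_final A, p.2 <= d, inv_on mu p.1.1 p.2 d
   & exists e, [/\ e \in ta_edges A, esrc e = p.1.1 /\ eact e = oa,
       gsat (gdelay mu d) (eguard e) /\ mu' = greset (gdelay mu d) (ereset e),
       gsat mu' (ta_inv A (etgt e))
     & q = (etgt e, p.1.2 || (etgt e \in ta_priv A))]].

(** The valuation reached is forgotten: a silent edge of an oERA resets nothing, so [mu] and the
    elapsed time still determine it. *)
Definition sstep mu (p q : L * bool * T) :=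
  exists mu', astep None mu p q.2 q.1 mu'.

Definition fstep (p q : L * bool * {ffun X -> T}) :=
  exists oa d, astep oa p.2 (p.1, 0) d q.1 q.2.

Definition post mu (S : {set L * bool}) d (a : Sigma) : {set L * bool} :=
  [set q | `[< exists p q' mu', [/\ p \in S, star (sstep mu) (p, 0) q'
                & astep (Some a) mu q' d q mu'] >]].

Definition ends_silently mu (S : {set L * bool}) (f : bool) :=
  exists p q, [/\ p \in S, star (sstep mu) (p, 0) q, q.1.1 \in ta_final A & q.1.2 = f].

Definition ends_somehow mu (S : {set L * bool}) (f : bool) :=
  exists p q, [/\ p \in S, star fstep (p, mu) q, q.1.1 \in ta_final A & q.1.2 = f].

Definition ends (n : nat) mu S f :=
  if n is 0%N then ends_somehow mu S f else ends_silently mu S f.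

Variable C : nat.

(** A critical instant: the moment, counted from [mu], at which clock [x] takes the value [c].
    [None] is the present moment. *)
Definition pt mu (i : option (X * 'I_C.+1)) : T :=
  if i is Some (x, c) then (c : nat)%:R * D - mu x else 0.

Definition active mu (i : option (X * 'I_C.+1)) : bool :=
  if i is Some (x, _) then mu x <= C%:R * D else true.

Definition nneg mu := forall x, 0 <= mu x.

(* Between any point and the next ones there is an instant, which satisfies [Bd]. *)
Definition spaced (Bd : T -> Prop) mu := forall i, active mu i -> 0 <= pt mu i ->
  Bd (pt mu i) /\
  exists t, [/\ Bd t, pt mu i < t
    & forall j, active mu j -> pt mu i < pt mu j -> t < pt mu j].

End World.

Section TwoWorlds.
Variables (T1 T2 : realDomainType) (D1 : T1) (D2 : T2) (Sigma L X : finType).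
Variables (A : TA Sigma L X) (C : nat).
Hypotheses (D1_gt0 : 0 < D1) (D2_gt0 : 0 < D2).
Implicit Types (mu : {ffun X -> T1}) (nu : {ffun X -> T2}).

(** Region equivalence in the sense of Alur and Dill, phrased through critical instants. Comparing
    one of them with the present gives the integer part of a clock, comparing those of two clocks
    gives the order of the fractional parts. *)
Definition eqv mu nu :=
  (forall x, (mu x <= C%:R * D1) = (nu x <= C%:R * D2)) /\
  forall i j : option (X * 'I_C.+1), active D1 mu i -> active D1 mu j ->
    (pt D1 mu i <= pt D1 mu j) = (pt D2 nu i <= pt D2 nu j).

(** The instants [s] and [t] occupy the same place among the critical ones, so constraints cannot
    tell them apart. *)
Definition sim mu nu s t := forall i : option (X * 'I_C.+1), active D1 mu i ->
  (pt D1 mu i <= s) = (pt D2 nu i <= t) /\ (s <= pt D1 mu i) = (t <= pt D2 nu i).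

Lemma eqv_active mu nu i : eqv mu nu -> active D1 mu i = active (C := C) D2 nu i.
Proof. by case=> E _; case: i => // -[x c] /=. Qed.

Lemma sim0 mu nu : eqv mu nu -> sim mu nu 0 0.
Proof. by case=> _ E i ai; split; [apply: (E i None)|apply: (E None i)]. Qed.

Definition const_le (g : guard X) := all (fun c : constraint X => (`|c.2| <= C)%N) g.

(** A negative constant is below every clock value, a clock beyond [C] is above every constant, and
    in the remaining case comparing a clock with a constant is comparing the instant with a critical
    one. *)
Lemma sat_sim mu nu s t g : eqv mu nu -> sim mu nu s t -> nneg mu -> nneg nu ->
  0 <= s -> 0 <= t -> const_le g ->
  gsat D1 (gdelay mu s) g = gsat D2 (gdelay nu t) g.
Proof.
move=> E S mu0 nu0 s0 t0 gC; apply: eq_in_all => -[[x op] d] cg.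
have dC : (`|d| <= C)%N := allP gC _ cg.
have [Ele Ege] : (mu x + s <= d%:~R * D1) = (nu x + t <= d%:~R * D2) /\
    (d%:~R * D1 <= mu x + s) = (d%:~R * D2 <= nu x + t).
  case: d dC {cg} => d dC; last first.
    have n1 : (Negz d)%:~R * D1 < 0 by rewrite pmulr_llt0 // ltrz0.
    have n2 : (Negz d)%:~R * D2 < 0 by rewrite pmulr_llt0 // ltrz0.
    have p1 : 0 <= mu x + s by rewrite addr_ge0.
    have p2 : 0 <= nu x + t by rewrite addr_ge0.
    rewrite (lt_geF (lt_le_trans n1 p1)) (lt_geF (lt_le_trans n2 p2)).
    by rewrite (le_trans (ltW n1) p1) (le_trans (ltW n2) p2).
  rewrite -!pmulrn; case: (boolP (mu x <= C%:R * D1)) => [xC|].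
    have := S (Some (x, Ordinal (dC : (d < C.+1)%N))) xC.
    by rewrite /= !lerBlDr !lerBrDr ![_ + mu x]addrC ![_ + nu x]addrC => -[-> ->].
  move=> xC; have xC2 : ~~ (nu x <= C%:R * D2) by rewrite -E.1.
  rewrite -!ltNge in xC xC2.
  have g1 : d%:R * D1 < mu x + s.
    apply: (@le_lt_trans _ _ (C%:R * D1)); first by rewrite ler_pM2r // ler_nat.
    by apply: lt_le_trans xC _; rewrite lerDl.
  have g2 : d%:R * D2 < nu x + t.
    apply: (@le_lt_trans _ _ (C%:R * D2)); first by rewrite ler_pM2r // ler_nat.
    by apply: lt_le_trans xC2 _; rewrite lerDl.
  by rewrite !(lt_geF g1) !(lt_geF g2) !ltW.
by rewrite !ffunE; case: op {cg} => /=; rewrite ?eq_le ?ltNge ?Ele ?Ege.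
Qed.

Lemma eqv_delay mu nu s t : eqv mu nu -> sim mu nu s t -> 0 <= s -> 0 <= t ->
  eqv (gdelay mu s) (gdelay nu t).
Proof.
move=> E S s0 t0.
have aD i : active D1 (gdelay mu s) i -> active (C := C) D1 mu i.
  by case: i => // -[x c] /=; rewrite ffunE; apply: le_trans; rewrite lerDl.
split=> [x|i j /[dup] ai /aD ai' /[dup] aj /aD aj'].
  rewrite !ffunE; case: (boolP (mu x <= C%:R * D1)) => xC.
    have := (S (Some (x, ord_max)) xC).2.
    by rewrite /= !lerBrDr ![_ + mu x]addrC ![_ + nu x]addrC.
  have xC2 : ~~ (nu x <= C%:R * D2) by rewrite -E.1.
  rewrite -!ltNge in xC xC2.
  by rewrite !lt_geF // ?(lt_le_trans xC) ?(lt_le_trans xC2) // lerDl.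
case: i j ai aj ai' aj' => [[x c]|] [[y c']|] ai aj ai' aj' /=; rewrite ?lexx //.
- by rewrite !ffunE !opprD !addrA !lerD2r; apply: E.2 ai' aj'.
- have := (S _ ai').1.
  by rewrite /= !ffunE !opprD !addrA !subr_le0.
- have := (S _ aj').2.
  by rewrite /= !ffunE !opprD !addrA !subr_ge0.
Qed.

Lemma eqv_reset mu nu r : eqv mu nu -> nneg mu -> nneg nu ->
  eqv (greset mu r) (greset nu r).
Proof.
move=> E mu0 nu0; split=> [x|].
  by rewrite !ffunE; case: ifP => _; [rewrite !mulr_ge0 ?ler0n ?ltW|apply: E.1].
(* Mixed case, a reset clock against another one. If [c <= c'], the comparison is that of the
   critical instant for the value [c' - c] of [y] with the present; otherwise it is decided by [y]
   being nonnegative. *)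
have K (y : X) (c c' : 'I_C.+1) : mu y <= C%:R * D1 ->
    (c%:R * D1 <= c'%:R * D1 - mu y) = (c%:R * D2 <= c'%:R * D2 - nu y) /\
    (c'%:R * D1 - mu y <= c%:R * D1) = (c'%:R * D2 - nu y <= c%:R * D2).
  move=> yC; case: (leqP c c') => cc'.
    have c'c : (c' - c < C.+1)%N by rewrite (leq_ltn_trans (leq_subr _ _)).
    have := E.2 (Some (y, Ordinal c'c)) None yC isT.
    have := E.2 None (Some (y, Ordinal c'c)) isT yC.
    rewrite /= !natrB // !mulrBl ![_ - c%:R * _ - _]addrAC !subr_ge0 !subr_le0.
    by move=> -> ->.
  have h1 : c'%:R * D1 - mu y < c%:R * D1.
    by apply: (@le_lt_trans _ _ (c'%:R * D1)); rewrite ?gerBl // ltr_pM2r // ltr_nat.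
  have h2 : c'%:R * D2 - nu y < c%:R * D2.
    by apply: (@le_lt_trans _ _ (c'%:R * D2)); rewrite ?gerBl // ltr_pM2r // ltr_nat.
  by rewrite (lt_geF h1) (lt_geF h2) !ltW.
case=> [[x c]|] [[y c']|] /=; rewrite ?ffunE ?lexx //.
- case: ifP => xr; case: ifP => yr; rewrite ?subr0 => ax ay.
  + by rewrite !ler_pM2r // !ler_nat.
  + by have [-> _] := K y c c' ay.
  + by have [_ ->] := K x c' c ax.
  + exact: (E.2 (Some (x, c)) (Some (y, c'))).
- case: ifP => xr; rewrite ?subr0 => ax _.
  + by rewrite !pmulr_lle0 // !lern0.
  + exact: (E.2 (Some (x, c)) None).
- case: ifP => xr; rewrite ?subr0 => _ ay.
  + by rewrite !mulr_ge0 ?ler0n ?ltW.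
  + exact: (E.2 None (Some (y, c'))).
Qed.

Section Transfer.
Variables (mu : {ffun X -> T1}) (nu : {ffun X -> T2}).
Hypotheses (E : eqv mu nu) (mu0 : nneg mu) (nu0 : nneg nu).
Hypothesis ext12 : forall s, 0 <= s -> exists2 t, 0 <= t & sim mu nu s t.
Hypothesis ext21 : forall t, 0 <= t -> exists2 s, 0 <= s & sim mu nu s t.
Hypothesis invC : forall l, const_le (ta_inv A l).
Hypothesis guardC : forall e, e \in ta_edges A -> const_le (eguard e).

Lemma sim_lt mu1 nu1 s t i : sim mu1 nu1 s t -> active D1 mu1 i ->
  (pt D1 mu1 i < s) = (pt (C := C) D2 nu1 i < t) /\ (s < pt D1 mu1 i) = (t < pt D2 nu1 i).
Proof. by move=> S /S[a b]; rewrite !ltNge a b. Qed.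

(** Should the counterpart of [v] fall outside the interval, then the endpoint it missed is a
    counterpart as well, because the instants similar to a given one form an interval. *)
Lemma clip21 s s' t t' v : sim mu nu s t -> sim mu nu s' t' -> 0 <= s -> s <= s' ->
  0 <= t -> t <= v -> v <= t' -> exists u, [/\ s <= u, u <= s' & sim mu nu u v].
Proof.
move=> S S' s0 ss' t0 tv vt'.
have [u u0 U] := ext21 (le_trans t0 tv).
case: (leP s u) => [su|/ltW us]; last first.
  exists s; split=> // i ai; have [a b] := S i ai; have [a' b'] := U i ai.
  split; apply/idP/idP.
  - by rewrite a => /le_trans; apply.
  - by rewrite -a' => /le_trans; apply.
  - by move=> /(le_trans us); rewrite b'.
  - by move=> /(le_trans tv); rewrite -b.
case: (leP u s') => [us'|/ltW s'u]; first by exists u.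
exists s'; split=> // i ai; have [a b] := S' i ai; have [a' b'] := U i ai.
split; apply/idP/idP.
- by move=> /le_trans/(_ s'u); rewrite a'.
- by move=> /le_trans/(_ vt'); rewrite -a.
- by rewrite b => /(le_trans vt').
- by rewrite -b' => /(le_trans s'u).
Qed.

Lemma clip12 s s' t t' u : sim mu nu s t -> sim mu nu s' t' -> 0 <= s -> s <= u ->
  u <= s' -> 0 <= t -> t <= t' -> exists v, [/\ t <= v, v <= t' & sim mu nu u v].
Proof.
move=> S S' s0 su us' t0 tt'.
have [v v0 V] := ext12 (le_trans s0 su).
case: (leP t v) => [tv|/ltW vt]; last first.
  exists t; split=> // i ai; have [a b] := S i ai; have [a' b'] := V i ai.
  split; apply/idP/idP.
  - by rewrite a' => /le_trans; apply.
  - by rewrite -a => /le_trans; apply.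
  - by move=> /(le_trans su); rewrite b.
  - by move=> /(le_trans vt); rewrite -b'.
case: (leP v t') => [vt'|/ltW t'v]; first by exists v.
exists t'; split=> // i ai; have [a b] := S' i ai; have [a' b'] := V i ai.
split; apply/idP/idP.
- by move=> /le_trans/(_ us'); rewrite a.
- by move=> /le_trans/(_ t'v); rewrite -a'.
- by rewrite b' => /(le_trans t'v).
- by rewrite -b => /(le_trans us').
Qed.

(** The invariant must hold during the whole delay: each instant of the delay in the second world is
    pulled back by [clip21] to one of the delay in the first. *)
Lemma astep_transfer oa p t d d' q mu' : sim mu nu p.2 t -> sim mu nu d d' ->
  0 <= p.2 -> 0 <= t -> t <= d' -> astep D1 A oa mu p d q mu' ->
  exists nu', astep D2 A oa nu (p.1, t) d' q nu' /\ eqv mu' nu'.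
Proof.
move=> S S' s0 t0 td' [lF sd I [e [eA [el ea] [g ->] ie qe]]].
have d0 := le_trans s0 sd; have d'0 := le_trans t0 td'.
have E1 := eqv_delay E S' d0 d'0.
have ge1 : nneg (gdelay mu d) by move=> x; rewrite ffunE addr_ge0.
have ge2 : nneg (gdelay nu d') by move=> x; rewrite ffunE addr_ge0.
have E2 := eqv_reset (ereset e) E1 ge1 ge2.
exists (greset (gdelay nu d') (ereset e)); split=> //.
split=> // [v tv vd'|].
  have [u [su ud U]] := clip21 S S' s0 sd t0 tv vd'.
  rewrite -(sat_sim E U) ?invC ?(le_trans s0) ?(le_trans t0) //.
  exact: I.
exists e; split=> //.
  by split=> //; rewrite -(sat_sim E S') ?guardC.
have z1 (T : realDomainType) (m : {ffun X -> T}) : gdelay m 0 = m.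
  by apply/ffunP=> x; rewrite ffunE addr0.
have r1 : nneg (greset (gdelay mu d) (ereset e)) by move=> x; rewrite ffunE; case: ifP.
have r2 : nneg (greset (gdelay nu d') (ereset e)) by move=> x; rewrite ffunE; case: ifP.
by have := sat_sim E2 (sim0 E2) r1 r2 (lexx 0) (lexx 0) (invC (etgt e)); rewrite !z1 => <-.
Qed.

Lemma sstep_star_le (T : realDomainType) (D : T) (m : {ffun X -> T}) p q :
  star (sstep D A m) p q -> p.2 <= q.2.
Proof. by elim=> // p1 p2 q1 [m' [_ H _ _]] _; apply: le_trans. Qed.

Lemma sstep_star_transfer p q t t' : star (sstep D1 A mu) p q ->
  sim mu nu p.2 t -> sim mu nu q.2 t' -> 0 <= p.2 -> 0 <= t -> t <= t' ->
  exists t1, [/\ star (sstep D2 A nu) (p.1, t) (q.1, t1), t1 <= t' & sim mu nu q.2 t1].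
Proof.
move=> H; elim: H t t' => {p q} [p|p p1 q [m H1] H2 IH] t t' S S' s0 t0 tt'.
  by exists t; split=> //; apply: star0.
have ss1 : p.2 <= p1.2 by case: H1.
have [t1 [tt1 t1t' S1]] := clip12 S S' s0 ss1 (sstep_star_le H2) t0 tt'.
have [nu' [H1' _]] := astep_transfer S S1 s0 t0 tt1 H1.
have [t2 [H2' t2t' S2]] := IH t1 t' S1 S' (le_trans s0 ss1) (le_trans t0 tt1) t1t'.
exists t2; split=> //; apply: starS H2'.
by exists nu'.
Qed.

Lemma post_transfer S d d' a : sim mu nu d d' -> 0 <= d -> 0 <= d' ->
  post D1 A mu S d a \subset post D2 A nu S d' a.
Proof.
move=> dd d0 d'0; apply/fintype.subsetP=> q; rewrite /post !inE.
move=> [p [q1 [mu1 [pS H1 H2]]]].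
have q1d : q1.2 <= d by case: H2.
have q10 : 0 <= q1.2 := sstep_star_le H1.
have [t1 [t10 t1d Q1]] := clip12 (sim0 E) dd (lexx 0) q10 q1d (lexx 0) d'0.
have [t2 [H1' t2t1 Q2]] := sstep_star_transfer H1 (sim0 E) Q1 (lexx 0) (lexx 0) t10.
have t20 : 0 <= t2 := sstep_star_le H1'.
have [nu' [H2' _]] := astep_transfer Q2 dd q10 t20 (le_trans t2t1 t1d) H2.
by exists p, (q1.1, t2), nu'.
Qed.

Lemma silent_transfer p q t : star (sstep D1 A mu) (p, 0) q -> 0 <= t ->
  sim mu nu q.2 t -> exists2 t1, t1 <= t & star (sstep D2 A nu) (p, 0) (q.1, t1).
Proof.
move=> H t0 Q.
have [t1 [H' t1t _]] := sstep_star_transfer H (sim0 E) Q (lexx 0) (lexx 0) t0.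
by exists t1.
Qed.

Lemma astep_nneg (T : realDomainType) (D : T) oa (m : {ffun X -> T}) p d q m' :
  astep D A oa m p d q m' -> nneg m -> 0 <= p.2 -> nneg m'.
Proof.
move=> [_ pd _ [e [_ _ [_ ->] _ _]]] m0 p0 x; rewrite !ffunE; case: ifP => // _.
by rewrite addr_ge0 // (le_trans p0).
Qed.

End Transfer.
End TwoWorlds.

End Regions.
Import Regions.

(** * Counterparts of instants, and normal representatives of regions *)

Module Normalization.
From mathcomp Require Import zify lra.
From mathcomp Require Import boolp classical_sets reals.

Import Order.TTheory GRing.Theory Num.Theory.
Local Open Scope ring_scope.

Lemma eqv_sym (T1 T2 : realDomainType) D1 D2 (X : finType) C (mu : {ffun X -> T1}) (nu : {ffun X -> T2}) :
  eqv D1 D2 C mu nu -> eqv D2 D1 C nu mu.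
Proof.
move=> E; split=> [x|i j]; first by rewrite E.1.
by rewrite -!(eqv_active _ E) => ai aj; rewrite (E.2 _ _ ai aj).
Qed.

Lemma sim_sym (T1 T2 : realDomainType) D1 D2 (X : finType) C (mu : {ffun X -> T1}) (nu : {ffun X -> T2}) s t :
  eqv D1 D2 C mu nu -> sim D1 D2 C mu nu s t -> sim D2 D1 C nu mu t s.
Proof. by move=> E S i; rewrite -(eqv_active _ E) => /S[-> ->]. Qed.

Lemma eqv_trans (T1 T2 T3 : realDomainType) D1 D2 D3 (X : finType) C
    (mu : {ffun X -> T1}) (nu : {ffun X -> T2}) (xi : {ffun X -> T3}) :
  eqv D1 D2 C mu nu -> eqv D2 D3 C nu xi -> eqv D1 D3 C mu xi.
Proof.
move=> E F; split=> [x|i j ai aj]; first by rewrite E.1 F.1.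
by rewrite (E.2 _ _ ai aj) F.2 -?(eqv_active _ E).
Qed.

(** A critical instant corresponds to the critical instant of the same index. Any other one follows
    a last critical instant, and [spaced] supplies an instant shortly after the corresponding
    one. *)
Lemma ext_spaced (T1 T2 : realDomainType) (D1 : T1) (D2 : T2) (X : finType) C Bd
    (mu : {ffun X -> T1}) (nu : {ffun X -> T2}) :
  eqv D1 D2 C mu nu -> spaced D2 C Bd nu ->
  forall s, 0 <= s -> exists t, [/\ 0 <= t, sim D1 D2 C mu nu s t & Bd t].
Proof.
move=> E sp s s0; have [i /andP[ai /eqP is_]|no] := pickP (fun i => active (C := C) D1 mu i && (pt D1 mu i == s)).
  have ti : 0 <= pt D2 nu i by rewrite -(E.2 None i isT ai) /= is_.
  exists (pt D2 nu i); split=> //; last by case: (sp i _ ti); rewrite -?(eqv_active _ E).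
  by move=> j aj; rewrite -is_ !E.2.
have ne j : active (C := C) D1 mu j -> pt D1 mu j != s.
  by move=> aj; have := no j; rewrite aj /= => ->.
have s1 : (None : option (X * 'I_C.+1)) \in (fun i => active (C := C) D1 mu i && (pt D1 mu i < s)).
  by rewrite /in_mem /= lt_neqAle s0 andbT; exact: (ne None isT).
case: (arg_maxP (pt D1 mu) s1) => p /andP[ap ps] pmax.
have p0 : 0 <= pt D2 nu p by rewrite -(E.2 None p) //; apply: (pmax None).
have [||_ [t [Bt pt_t tn]]] := sp p => //; first by rewrite -(eqv_active _ E).
exists t; split=> //; first exact: le_trans p0 (ltW pt_t).
move=> j aj.
have aj2 : active D2 nu j by rewrite -(eqv_active _ E).
have H : (pt D1 mu j <= s) = (pt D2 nu j <= pt D2 nu p).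
  rewrite -E.2 //; apply/idP/idP => [js|/le_trans]; last by apply; apply: ltW.
  by apply: pmax; rewrite /in_mem /= aj lt_neqAle ne.
have H2 : (pt D2 nu j <= pt D2 nu p) = (pt D2 nu j <= t).
  apply/idP/idP => [/le_trans|jt]; first by apply; apply: ltW.
  by rewrite leNgt; apply/negP=> /(tn _ aj2); rewrite ltNge jt.
split; first by rewrite H.
apply/idP/idP => sj.
  apply/ltW/tn => //; rewrite ltNge -H -ltNge lt_neqAle sj andbT eq_sym; exact: ne.
rewrite leNgt; apply/negP=> /ltW; rewrite H => jp.
by have := lt_le_trans pt_t sj; rewrite ltNge jp.
Qed.

Lemma real_spaced (R : realFieldType) (D : R) (X : finType) C (mu : {ffun X -> R}) :
  spaced D C (fun=> True) mu.
Proof.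
move=> i ai i0; split=> //.
have [j0 j0P|no] := pickP (fun j => active (C := C) D mu j && (pt D mu i < pt D mu j)).
  have s1 : j0 \in (fun j => active (C := C) D mu j && (pt D mu i < pt D mu j)) by [].
  case: (arg_minP (pt D mu) s1) => p /andP[ap ip] pmin.
  exists ((pt D mu i + pt D mu p) / 2); split=> //; first by rewrite midf_lt.
  move=> j aj ij; apply: lt_le_trans (pmin j _); last by rewrite /in_mem /= aj.
  by rewrite midf_lt.
exists (pt D mu i + 1); split=> //; first by rewrite ltrDl.
by move=> j aj ij; have := no j; rewrite aj ij.
Qed.

Section Discrete.
Variables (X : finType) (C : nat).

(* Half of [unit] is more than the number of clocks, so that distinct fractional
   parts can be realized by distinct even numbers below [unit]. *)
Definition unit : nat := (2 * #|X|.+1)%N.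
Definition D2 : int := unit%:Z.

Definition normal (nu : {ffun X -> int}) :=
  forall x, [/\ 0 <= nu x, nu x <= C.+1%:Z * D2 & exists k, nu x = 2 * k].

Lemma normal_nneg nu : normal nu -> nneg nu.
Proof. by move=> H x; case: (H x). Qed.

(** Critical instants are even, so one more than such an instant is still before the next. The last
    one is at most [C * D2], which explains the bound. *)
Lemma int_spaced nu : normal nu -> spaced D2 C (fun t => t <= C%:Z * D2 + 1) nu.
Proof.
move=> nn.
have even j : active (C := C) D2 nu j -> exists k, pt D2 nu j = 2 * k.
  case: j => [[x c] _|_] /=; last by exists 0.
  have [_ _ [k ->]] := nn x; exists ((c : nat)%:Z * #|X|.+1%:Z - k).
  by rewrite natz /D2 /unit PoszM; lia.
have bd j : active (C := C) D2 nu j -> pt D2 nu j <= C%:Z * D2.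
  case: j => [[x c] _|_] /=; last by rewrite mulr_ge0.
  have [nx _ _] := nn x; rewrite natz.
  have : (c : nat)%:Z * D2 <= C%:Z * D2 by rewrite ler_wpM2r // lez_nat -ltnS.
  lia.
move=> i ai i0; split; first by have := bd i ai; lia.
exists (pt D2 nu i + 1); split; first by have := bd i ai; lia.
  by lia.
by move=> j /even[k ->]; have [k' ->] := even i ai; lia.
Qed.

(** Quotients decide first; among equal quotients the order of remainders is reversed, since a
    larger fractional part reaches the next integer earlier. *)
Lemma lex_le (a b r r' : int) : 0 <= r < D2 -> 0 <= r' < D2 ->
  (a * D2 - r <= b * D2 - r') = (a < b) || (a == b) && (r' <= r).
Proof.
move=> /andP[r0 rD] /andP[r'0 r'D]; have D0 : 0 < D2 by [].
case: (ltgtP a b) => [ab|ba|->] /=; last by apply/idP/idP; lia.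
  have : (a + 1) * D2 <= b * D2 by rewrite ler_pM2r; lia.
  by rewrite mulrDl mul1r => ?; apply/idP; lia.
have : (b + 1) * D2 <= a * D2 by rewrite ler_pM2r; lia.
by rewrite mulrDl mul1r => ?; apply/negbTE; lia.
Qed.

(** Integer parts are kept, fractional parts are replaced by twice their rank, and every clock
    beyond [C] is set to [C + 1]. By [lex_le] only the order of the fractional parts matters. *)
Lemma normalize nu : nneg nu -> exists nu', normal nu' /\ eqv D2 D2 C nu nu'.
Proof.
move=> nn; have D0 : 0 < D2 by [].
(* [None] contributes the fractional part 0, which gets rank 0, so that integer values stay
   integers. *)
pose rf (y : option X) : int := if y is Some x then (nu x %% D2)%Z else 0.
have rf0 y : 0 <= rf y < D2.
  by case: y => [x|] /=; rewrite ?modz_ge0 ?ltz_pmod ?lt0r_neq0 ?lexx.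
pose rk (y : option X) : nat := #|[set z | rf z < rf y]|.
have rkE y z : (rk y <= rk z)%N = (rf y <= rf z).
  case: (leP (rf y) (rf z)) => [yz|zy].
    apply: subset_leq_card; apply/fintype.subsetP=> w; rewrite !inE => wy.
    exact: lt_le_trans wy yz.
  apply/negbTE; rewrite -ltnNge; apply: proper_card; apply/fintype.properP; split.
    by apply/fintype.subsetP=> w; rewrite !inE => /lt_trans; apply.
  by exists z; rewrite !inE ?ltxx.
have rkD y : (2 * rk y < unit)%N.
  rewrite ltn_pmul2l // ltnS; apply: leq_trans (_ : #|[set~ y]| <= _)%N.
    apply: subset_leq_card; apply/fintype.subsetP=> w; rewrite !inE.
    by apply: contraTneq => ->; rewrite ltxx.
  by rewrite cardsC1 card_option.
pose nu' := [ffun x => if nu x <= C%:Z * D2 then (nu x %/ D2)%Z * D2 + (2 * rk (Some x))%:Z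
                       else C.+1%:Z * D2].
have act_x x : nu x <= C%:Z * D2 -> nu' x <= C%:Z * D2.
  rewrite ffunE => /[dup] xC ->; have /andP[r0 rD] := rf0 (Some x); have kD : (2 * rk (Some x))%:Z < D2 by rewrite ltz_nat rkD.
  have E := divz_eq (nu x) D2; rewrite -/(rf (Some x)) in E.
  have qC : (nu x %/ D2)%Z <= C%:Z.
    by rewrite -(ler_pM2r D0); lia.
  case: (ltgtP (nu x %/ D2)%Z C%:Z) qC => // [qC _|qC _].
    have : ((nu x %/ D2)%Z + 1) * D2 <= C%:Z * D2 by rewrite ler_pM2r; lia.
    by rewrite mulrDl mul1r; apply: le_trans; rewrite lerD2l ltW.
  have r00 : rf (Some x) = 0 by rewrite qC in E; lia.
  have -> : rk (Some x) = 0%N.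
    apply/eqP; rewrite cards_eq0; apply/eqP/setP=> z; rewrite !inE r00.
    by apply/negbTE; rewrite -leNgt; case/andP: (rf0 z).
  by rewrite qC; lia.
exists nu'; split.
  move=> x; rewrite /= ffunE; case: ifP => xC; last first.
    split; first by rewrite mulr_ge0.
      by [].
    by exists (C.+1%:Z * #|X|.+1%:Z); rewrite /D2 /unit PoszM; lia.
  have q0 : 0 <= (nu x %/ D2)%Z by rewrite divz_ge0.
  split.
  - by rewrite addr_ge0 // mulr_ge0.
  - have := act_x _ xC; rewrite ffunE xC => /le_trans; apply.
    by rewrite ler_wpM2r // lez_nat.
  - by exists ((nu x %/ D2)%Z * #|X|.+1%:Z + (rk (Some x))%:Z); rewrite /D2 /unit !PoszM mulrDr mulrCA.
pose co (i : option (X * 'I_C.+1)) : int := if i is Some (x, c) then (c : nat)%:Z - (nu x %/ D2)%Z else 0.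
pose cl (i : option (X * 'I_C.+1)) : option X := omap fst i.
have ptE i : pt D2 nu i = co i * D2 - rf (cl i).
  case: i => [[x c]|] /=; last by lia.
  by rewrite {1}(divz_eq (nu x) D2) natz mulrBl; lia.
have ptE' i : active D2 nu i -> pt D2 nu' i = co i * D2 - (2 * rk (cl i))%:Z.
  case: i => [[x c]|] /=.
    by rewrite natz => xC; rewrite ffunE xC natz mulrBl; lia.
  have -> : rk None = 0%N.
    apply/eqP; rewrite cards_eq0; apply/eqP/setP=> z; rewrite !inE.
    by apply/negbTE; rewrite -leNgt; case/andP: (rf0 z).
  by move=> _; lia.
split=> [x|i j ai aj].
  rewrite natz; apply/idP/idP; first exact: act_x.
  rewrite ffunE; case: ifP => // _; rewrite ler_pM2r //; lia.
rewrite !ptE !ptE' // lex_le // lex_le ?rkE -?rkE; last 2 first.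
- by rewrite ltz_nat rkD.
- by rewrite ltz_nat rkD.
by rewrite lez_nat leq_pmul2l.
Qed.

End Discrete.

End Normalization.
Import Normalization.

Module TimedWords.
From mathcomp Require Import zify lra.
From mathcomp Require Import boolp classical_sets reals.

Import Order.TTheory GRing.Theory Num.Theory.
Local Open Scope ring_scope.

(** * Runs over a given timed word *)

Lemma postP (T : realDomainType) (D : T) (Sigma L X : finType) (A : TA Sigma L X)
    mu (S : {set L * bool}) d a q :
  reflect (exists p q' mu', [/\ p \in S, star (sstep D A mu) (p, 0) q'
                & astep D A (Some a) mu q' d q mu']) (q \in post D A mu S d a).
Proof. by rewrite /post finset.in_set; apply: asboolP. Qed.

Section Runs.
Variables (R : realType) (Sigma L X : finType) (A : TA Sigma L X).
Implicit Types (mu : {ffun X -> R}) (t s d : R).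

Lemma satE mu g : sat mu g = gsat 1 mu g.
Proof. by apply: eq_all => -[[x op] d]; rewrite mulr1; case: op. Qed.

Lemma gdelayD mu s d : gdelay (gdelay mu s) d = gdelay mu (s + d).
Proof. by apply/ffunP=> x; rewrite !ffunE addrA. Qed.

Lemma gdelay0 mu : gdelay mu 0 = mu.
Proof. by apply/ffunP=> x; rewrite ffunE addr0. Qed.

Lemma step_astep l f mu s d e c' : l \notin ta_final A ->
  delay_ok A (l, gdelay mu s) d -> edge_ok A (l, delay (gdelay mu s) d) e c' ->
  [/\ e \in ta_edges A, c'.2 = greset (gdelay mu (s + d)) (ereset e),
      c'.1 = etgt e, 0 <= d &
      astep 1 A (eact e) mu (l, f, s) (s + d) (c'.1, f || (c'.1 \in ta_priv A)) c'.2].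
Proof.
move=> lF [d0 I] [eA /= el g Ec i].
have E2 : c'.2 = greset (gdelay mu (s + d)) (ereset e) by rewrite Ec -gdelayD.
have E1 : c'.1 = etgt e by rewrite Ec.
split=> //; split=> //=; first by rewrite lerDl.
  move=> u su ud; rewrite -satE -[u](subrK s) addrC -gdelayD.
  by apply: I; [rewrite subr_ge0|rewrite lerBlDr addrC].
exists e; split=> //.
- by split=> //; rewrite -gdelayD -satE.
- by rewrite -satE -E1.
- by rewrite E1.
Qed.

Lemma astep_step oa p mu d q mu' : astep 1 A oa mu p d q mu' ->
  exists2 e, [/\ eact e = oa, p.1.1 \notin ta_final A & q.2 = p.1.2 || (q.1 \in ta_priv A)]
    & delay_ok A (p.1.1, gdelay mu p.2) (d - p.2) /\
      edge_ok A (p.1.1, delay (gdelay mu p.2) (d - p.2)) e (q.1, mu').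
Proof.
case=> lF pd I [e [eA [el ea] [g Em] i ->]]; exists e => //; split.
  split=> [|d' d'0 d'd]; first by rewrite subr_ge0.
  rewrite satE -[delay _ _]/(gdelay _ _) gdelayD; apply: I; first by rewrite lerDl.
  by rewrite addrC -lerBrDr.
split=> //=; rewrite ?satE -?[delay _ _]/(gdelay _ _) ?gdelayD ?subrKC //.
  by rewrite Em.
by rewrite /is_config /= satE.
Qed.

Definition visits (r : seq (step R Sigma L X)) :=
  has (fun z : step R Sigma L X => z.2.1 \in ta_priv A) r.

Lemma run_fstep l f0 f mu :
  (exists2 r, is_run_from A (l, mu) r & f = f0 || visits r) <->
  (exists q, [/\ star (fstep 1 A) ((l, f0), mu) q, q.1.1 \in ta_final A & q.1.2 = f]).
Proof.
split=> [[r]|[q []]].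
  elim: r l f0 f mu => [|[[d e] [l' mu']] r IH] l f0 f mu /=.
    by move=> lF ->; exists ((l, f0), mu); split; rewrite ?orbF //; apply: star0.
  case=> lF dok eok run ->.
  rewrite -[mu]gdelay0 in dok eok.
  have [_ _ _ _ H] := step_astep f0 lF dok eok.
  have [q [S qF qf]] := IH l' (f0 || (l' \in ta_priv A)) _ mu' run (erefl _).
  exists q; split=> //; last by rewrite qf orbA.
  by apply: starS S; exists (eact e), (0 + d).
move E: (l, f0, mu) => p H; elim: H l f0 mu E => {p q} [p|p p1 q [oa [d H]] _ IH] l f0 mu E qF qf.
  by exists [::]; [rewrite -E in qF|rewrite -qf -E orbF].
rewrite -E in H; case: p1 H IH => [[l1 f1] mu1] H IH.
have [e [_ lF /= f1E] [dok eok]] := astep_step H.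
have [r run fE] := IH l1 f1 mu1 (erefl _) qF qf.
exists ((d - 0, e, (l1, mu1)) :: r); last by rewrite fE f1E /= orbA.
by rewrite gdelay0 in dok eok; split.
Qed.

Variable ra : Sigma -> {set X}.
Hypothesis oera : forall e, e \in ta_edges A ->
  ereset e = if eact e is Some a then ra a else finset.set0.

Definition letter_reset mu d a := greset (gdelay mu d) (ra a).

Lemma greset0 mu : greset mu finset.set0 = mu.
Proof. by apply/ffunP=> x; rewrite ffunE inE. Qed.

(** The oERA condition at work: the valuation after a step depends on the action and the delay
    alone, so all runs over a word share it. *)
Lemma astep_act oa mu p d q mu' : astep 1 A oa mu p d q mu' ->
  mu' = if oa is Some a then letter_reset mu d a else gdelay mu d.
Proof.
case=> _ _ _ [e [/oera eA [_ ea] [_ ->] _ _]]; rewrite eA ea.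
by case: (oa) => // ; rewrite greset0.
Qed.

(** [mu] is the valuation at the date [t] of the last letter, [p.2] the time elapsed since, and [n]
    the number of letters still observed. The empty word with [n] positive forces a silent run, with
    [n = 0] it allows any run. *)
Fixpoint pends n f t mu (p : L * bool * R) (u : tword R Sigma) {struct u} : Prop :=
  match u with
  | [::] => if n is 0%N then
        exists q, [/\ star (fstep 1 A) (p.1, gdelay mu p.2) q, q.1.1 \in ta_final A & q.1.2 = f]
      else exists q, [/\ star (sstep 1 A mu) p q, q.1.1 \in ta_final A & q.1.2 = f]
  | (a, t') :: u' => t + p.2 <= t' /\ if n is n'.+1 then
        exists q q', [/\ star (sstep 1 A mu) p q,
          astep 1 A (Some a) mu q (t' - t) q' (letter_reset mu (t' - t) a)
          & pends n' f t' (letter_reset mu (t' - t) a) (q', 0) u']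
      else False
  end.

(** In one direction, the induction on the run absorbs silent steps into the elapsed time; in the
    other, the silent steps before a letter are put back one at a time. *)
Lemma run_pends n f t mu p u :
  (exists r, [/\ is_run_from A (p.1.1, gdelay mu p.2) r, take n (trace_from (t + p.2) r) = u
     & f = p.1.2 || visits r]) <-> pends n f t mu p u.
Proof.
have case0 f2 (t1 : R) (mu1 : {ffun X -> R}) p1 u1 : (exists r, [/\ is_run_from A (p1.1.1, gdelay mu1 p1.2) r, take 0 (trace_from (t1 + p1.2) r) = u1
     & f2 = p1.1.2 || visits r]) <-> pends 0 f2 t1 mu1 p1 u1.
  case: p1 => [[l1 f1] s1]; split=> [[r []]|].
    rewrite take0 => run <- fE /=.
    by apply/run_fstep; exists r.
  case: u1 => [|[a t'] u1] /=; last by case.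
  move=> /run_fstep[r run fE]; exists r; split=> //.
  by rewrite take0.
split.
  case=> r []; elim: r n f t mu p u => [|[[d e] [l' mu']] r IH] n f t mu [[l f0] s] u.
    case: n => [|n] lF Eu fE; first by apply/case0; exists [::].
    by rewrite -Eu; exists (l, f0, s); split; rewrite ?fE ?orbF //; apply: star0.
  case: n => [|n] run Eu fE; first by apply/case0; exists ((d, e, (l', mu')) :: r).
  move: run Eu fE => /= [lF dok eok run] Eu ->.
  have [eA /= mE lE d0 H] := step_astep f0 lF dok eok.
  case ea: (eact e) Eu => [a|] Eu; rewrite ea in H; have mE' := astep_act H.
    rewrite -Eu; split; first by rewrite lerDl.
    have ts : t + s + d - t = s + d by rewrite -(addrA t s d) [t + _]addrC addrK.
    exists (l, f0, s), (l', f0 || (l' \in ta_priv A)); split; first exact: star0.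
      by rewrite ts -mE'.
    rewrite ts -mE'; apply: IH; rewrite ?gdelay0 ?addr0 //.
    by rewrite /visits orbA.
  have := IH n.+1 _ t mu ((l', f0 || (l' \in ta_priv A)), s + d) u.
  rewrite /= -mE' addrA orbA => /(_ _ run Eu (erefl _)) K.
  have S1 : sstep 1 A mu (l, f0, s) (l', f0 || (l' \in ta_priv A), s + d) by exists mu'.
  case: u {Eu} K => [|[a t'] u] /=.
    by case=> q [S qF qf]; exists q; split=> //; apply: starS S.
  case=> tt' [q [q' [S H' P]]]; split; first by apply: le_trans tt'; rewrite ?addrA lerDl.
  by exists q, q'; split=> //; apply: starS S.
have silent n1 t1 mu1 p1 q1 u1 : star (sstep 1 A mu1) p1 q1 ->
    (exists r, [/\ is_run_from A (q1.1.1, gdelay mu1 q1.2) r, take n1 (trace_from (t1 + q1.2) r) = u1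
       & f = q1.1.2 || visits r]) ->
    exists r, [/\ is_run_from A (p1.1.1, gdelay mu1 p1.2) r, take n1 (trace_from (t1 + p1.2) r) = u1
       & f = p1.1.2 || visits r].
  elim=> // {p1 q1} p p1 q1 [mu2 H] _ IH /IH[r [run <- fE]].
  have [e [ea lF f1] [dok eok]] := astep_step H; have mE := astep_act H.
  exists ((p1.2 - p.2, e, (p1.1.1, mu2)) :: r); split=> /=.
  - by split=> //; rewrite mE.
  - by rewrite ea -addrA subrKC.
  - by rewrite fE f1 orbA.
elim: u n t mu p => [|[a t'] u IH] n t mu p.
  case: n => [|n]; first by move/case0.
  case=> q [S qF qf]; apply: silent S _; exists [::]; split=> //.
  by rewrite orbF.
case: n => [|n] /= [tt' //] [q [q' [S H P]]]; apply: silent S _.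
have [e [ea lF f1] [dok eok]] := astep_step H.
have [r [run Eu fE]] := IH n t' _ _ P.
rewrite gdelay0 addr0 in run Eu.
exists ((t' - t - q.2, e, (q'.1, letter_reset mu (t' - t) a)) :: r); split=> /=.
- by split.
- by rewrite ea /= -[t' - t - _]addrA -opprD subrKC Eu.
- by rewrite fE f1 orbA.
Qed.

Fixpoint wends n f t mu (S : {set L * bool}) (u : tword R Sigma) {struct u} : Prop :=
  match u with
  | [::] => ends 1 A n mu S f
  | (a, t') :: u' => t <= t' /\ if n is n'.+1 then
        wends n' f t' (letter_reset mu (t' - t) a) (post 1 A mu S (t' - t) a) u'
      else False
  end.

Lemma wends_pends n f t mu S u :
  wends n f t mu S u <-> exists2 p, p \in S & pends n f t mu (p, 0) u.
Proof.
elim: u n t mu S => [|[a t'] u IH] n t mu S /=.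
  case: n => [|n] /=.
    split=> [[p [q [pS H qF qf]]]|[p pS [q [H qF qf]]]].
      by exists p => //; exists q; rewrite gdelay0.
    by exists p, q; rewrite gdelay0 in H.
  split=> [[p [q [pS H qF qf]]]|[p pS [q [H qF qf]]]]; first by exists p => //; exists q.
  by exists p, q.
case: n => [|n]; first by split=> [[]|[? _ []]].
split=> [[tt' /IH[q']]|[p pS [tt' [q [q' [H1 H2 P]]]]]].
  case/postP=> p [q [mu' [pS H1 H2]]] P; exists p => //; split; first by rewrite addr0.
  by exists q, q'; split=> //; rewrite -{1}(astep_act H2).
split; first by rewrite addr0 in tt'.
apply/IH; exists q' => //; apply/postP.
by exists p, q, (letter_reset mu (t' - t) a).
Qed.

(** Empty when the initial valuation violates the invariant, in which case there is no run at
    all. *)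
Definition start_set : {set L * bool} :=
  if sat (R := R) [ffun => 0] (ta_inv A (ta_init A))
  then finset.set1 (ta_init A, ta_init A \in ta_priv A) else finset.set0.

Lemma wends_run N f u : wends N f 0 [ffun => 0] start_set u <->
  (exists r, [/\ is_run A r, private A r = f & take N (trace r) = u]).
Proof.
rewrite wends_pends /start_set /is_run /is_config /=.
case: ifP => S; last by split=> [[p]|[r [[]]]]; rewrite ?inE.
split=> [[p]|[r [[_ run] pf Eu]]].
  rewrite inE => /eqP-> /run_pends[r []]; rewrite gdelay0 addr0 => run Eu fE.
  exists r; split=> //; rewrite fE /private /run_locs /= has_map.
  by congr (_ || _); apply: eq_has => x.
exists (ta_init A, ta_init A \in ta_priv A); first by rewrite inE.
apply/run_pends; exists r; rewrite gdelay0 addr0; split=> //.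
by rewrite -pf /private /run_locs /= has_map; congr (_ || _); apply: eq_has.
Qed.

End Runs.

End TimedWords.
Import TimedWords.

Module OpacityGame.
From mathcomp Require Import zify lra.
From mathcomp Require Import boolp classical_sets reals.

Import Order.TTheory GRing.Theory Num.Theory.
Local Open Scope ring_scope.

(** * The subset construction on discretized regions *)

Section Game.
Variables (R : realType) (Sigma L X : finType) (A : TA Sigma L X) (C : nat).
Variable ra : Sigma -> {set X}.
Hypothesis oera : forall e, e \in ta_edges A ->
  ereset e = if eact e is Some a then ra a else finset.set0.
Hypothesis invC : forall l, const_le C (ta_inv A l).
Hypothesis guardC : forall e, e \in ta_edges A -> const_le C (eguard e).

Notation D := (D2 X).
Definition horizon : int := C%:Z * D + 1.

Definition zsilent nu p q := star (sstep D A nu) (p, 0) q /\ q.2 <= horizon.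

(** After each step the valuation is exchanged for an equivalent normal one, which keeps the
    valuations in a finite set. *)
Definition zfstep (p q : L * bool * {ffun X -> int}) := exists oa k m,
  [/\ 0 <= k, k <= horizon, astep D A oa p.2 (p.1, 0) k q.1 m, eqv D D C m q.2 & normal C q.2].

Definition zends (n : nat) (nu : {ffun X -> int}) (S : {set L * bool}) f :=
  if n is 0%N then exists p q, [/\ p \in S, star zfstep (p, nu) q, q.1.1 \in ta_final A & q.1.2 = f]
  else exists p q, [/\ p \in S, zsilent nu p q, q.1.1 \in ta_final A & q.1.2 = f].

Definition zstep (x y : nat * {ffun X -> int} * {set L * bool}) := exists a k,
  [/\ x.1.1 = y.1.1.+1, 0 <= k <= horizon, y.2 = post D A x.1.2 x.2 k a,
      eqv D D C (greset (gdelay x.1.2 k) (ra a)) y.1.2 & normal C y.1.2].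

(** [F1] and [F0] say that a private, resp. public, run exists. The weak question, [w = true], only
    objects to a private run without a public one. *)
Definition conflict (w : bool) (F1 F0 : Prop) := (F1 /\ ~ F0) \/ (~~ w /\ F0 /\ ~ F1).

Lemma conflict_iff w F1 F0 G1 G0 : (F1 <-> G1) -> (F0 <-> G0) ->
  (conflict w F1 F0 <-> conflict w G1 G0).
Proof. by move=> E1 E0; rewrite /conflict E1 E0. Qed.

Definition rel_RZ (mu : {ffun X -> R}) nu := [/\ eqv 1 D C mu nu, nneg mu & normal C nu].

Section Related.
Variables (mu : {ffun X -> R}) (nu : {ffun X -> int}).
Hypothesis H : rel_RZ mu nu.

Let E : eqv 1 D C mu nu. Proof. by case: H. Qed.
Let mu0 : nneg mu. Proof. by case: H. Qed.
Let nuN : normal C nu. Proof. by case: H. Qed.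
Let nu0 : nneg nu. Proof. exact: normal_nneg nuN. Qed.
Let D0 : 0 < D. Proof. by []. Qed.

Let RZb s : 0 <= s -> exists t, [/\ 0 <= t, sim 1 D C mu nu s t & t <= horizon].
Proof. exact: ext_spaced E (int_spaced nuN) s. Qed.

Let RZ s : 0 <= s -> exists2 t, 0 <= t & sim 1 D C mu nu s t.
Proof. by case/RZb => t [? ? _]; exists t. Qed.

Let ZR t : 0 <= t -> exists2 s, 0 <= s & sim 1 D C mu nu s t.
Proof.
move=> /(ext_spaced (eqv_sym E) (@real_spaced R 1 X C mu))[s [s0 S _]].
by exists s => //; apply: sim_sym (eqv_sym E) S.
Qed.

Let RZ' s : 0 <= s -> exists2 t, 0 <= t & sim D 1 C nu mu t s.
Proof. by case/RZ => t t0 S; exists t => //; apply: sim_sym E S. Qed.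

Let ZR' t : 0 <= t -> exists2 s, 0 <= s & sim D 1 C nu mu t s.
Proof. by case/ZR => s s0 S; exists s => //; apply: sim_sym E S. Qed.

Lemma post_eq S d k a : 0 <= d -> 0 <= k -> sim 1 D C mu nu d k ->
  post 1 A mu S d a = post D A nu S k a.
Proof.
move=> d0 k0 S'; apply/eqP; rewrite finset.eqEsubset; apply/andP; split.
  exact: (post_transfer ltr01 D0 E mu0 nu0 RZ ZR invC guardC).
exact: (post_transfer D0 ltr01 (eqv_sym E) nu0 mu0 ZR' RZ' invC guardC _ _ (sim_sym E S')).
Qed.

Lemma letter_rel d k a nu' : 0 <= d -> 0 <= k -> sim 1 D C mu nu d k ->
  eqv D D C (greset (gdelay nu k) (ra a)) nu' -> normal C nu' ->
  rel_RZ (letter_reset ra mu d a) nu'.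
Proof.
move=> d0 k0 S E' N'; split=> //; last first.
  by move=> x; rewrite !ffunE; case: ifP => // _; rewrite addr_ge0.
apply: eqv_trans E'; apply: eqv_reset => //.
- exact: eqv_delay.
- by move=> x; rewrite ffunE addr_ge0.
- by move=> x; rewrite ffunE addr_ge0.
Qed.

Lemma fstep_RZ p q mu' : fstep 1 A (p, mu) (q, mu') ->
  exists nu', zfstep (p, nu) (q, nu') /\ rel_RZ mu' nu'.
Proof.
case=> oa [d K]; have d0 : 0 <= d by case: K.
have [k [k0 S kH]] := RZb d0.
have [m [K' E']] := @astep_transfer _ _ _ _ _ _ _ A C ltr01 D0 mu nu E mu0 nu0 ZR invC guardC
  _ (p, 0) 0 d k q mu' (sim0 E) S (lexx 0) (lexx 0) k0 K.
have [nu' [N' E2]] := normalize C (astep_nneg K' nu0 (lexx 0)).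
exists nu'; split; first by exists oa, k, m.
by split=> //; [apply: eqv_trans E' E2|apply: astep_nneg K mu0 (lexx 0)].
Qed.

Lemma fstep_ZR p q nu' : zfstep (p, nu) (q, nu') ->
  exists mu', fstep 1 A (p, mu) (q, mu') /\ rel_RZ mu' nu'.
Proof.
case=> oa [k [m [k0 kH K E2 N']]].
have [d d0 S] := ZR' k0.
have [mu' [K' E']] := @astep_transfer _ _ _ _ _ _ _ A C D0 ltr01 nu mu (eqv_sym E) nu0 mu0 RZ' invC guardC
  _ (p, 0) 0 k d q m (sim0 (eqv_sym E)) S (lexx 0) (lexx 0) d0 K.
exists mu'; split; first by exists oa, d.
by split=> //; [apply: eqv_trans (eqv_sym E') E2|apply: astep_nneg K' mu0 (lexx 0)].
Qed.

Lemma silent_RZ p q : star (sstep 1 A mu) (p, 0) q -> exists k, zsilent nu p (q.1, k).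
Proof.
move=> K; have [k [k0 S kH]] := RZb (sstep_star_le K).
have [k1 k1k K'] := silent_transfer ltr01 D0 E mu0 nu0 RZ ZR invC guardC K k0 S.
by exists k1; split=> //; apply: le_trans k1k kH.
Qed.

Lemma silent_ZR p q : zsilent nu p q -> exists d, star (sstep 1 A mu) (p, 0) (q.1, d).
Proof.
case=> K _; have [d d0 S] := ZR' (sstep_star_le K).
have [d1 _ K'] := silent_transfer D0 ltr01 (eqv_sym E) nu0 mu0 ZR' RZ' invC guardC K d0 S.
by exists d1.
Qed.

End Related.

Lemma star_RZ p q mu nu : rel_RZ mu nu -> star (fstep 1 A) (p, mu) q ->
  exists nu', star zfstep (p, nu) (q.1, nu').
Proof.
move=> r; move Ex: (p, mu) => x K; elim: K p mu nu r Ex => {x q} [x|[p mu] [p1 mu1] q K _ IH] p0 mu0 nu r Ex.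
  by exists nu; rewrite -Ex; apply: star0.
case: Ex r => -> -> r; have [nu1 [K' r1]] := fstep_RZ r K.
have [nu2 K2] := IH p1 mu1 nu1 r1 (erefl _).
by exists nu2; apply: starS K' K2.
Qed.

Lemma star_ZR p q mu nu : rel_RZ mu nu -> star zfstep (p, nu) q ->
  exists mu', star (fstep 1 A) (p, mu) (q.1, mu').
Proof.
move=> r; move Ex: (p, nu) => x K; elim: K p mu nu r Ex => {x q} [x|[p nu] [p1 nu1] q K _ IH] p0 mu nu0 r Ex.
  by exists mu; rewrite -Ex; apply: star0.
case: Ex r => -> -> r; have [mu1 [K' r1]] := fstep_ZR r K.
have [mu2 K2] := IH p1 mu1 nu1 r1 (erefl _).
by exists mu2; apply: starS K' K2.
Qed.

Lemma ends_RZ n mu nu S f : rel_RZ mu nu -> ends 1 A n mu S f <-> zends n nu S f.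
Proof.
move=> r; case: n => [|n]; split=> -[p [q [pS K qF qf]]].
- by have [nu' K'] := star_RZ r K; exists p, (q.1, nu').
- by have [mu' K'] := star_ZR r K; exists p, (q.1, mu').
- by have [k K'] := silent_RZ r K; exists p, (q.1, k).
- by have [d K'] := silent_ZR r K; exists p, (q.1, d).
Qed.

Definition zconflict w (x : nat * {ffun X -> int} * {set L * bool}) :=
  conflict w (zends x.1.1 x.1.2 x.2 true) (zends x.1.1 x.1.2 x.2 false).

(** Letter by letter, a real delay is exchanged for a similar integer one within the horizon; by
    [post_eq] the set of reachable locations is the same. *)
Lemma word_path w n t mu nu S u : rel_RZ mu nu ->
  conflict w (wends A ra n true t mu S u) (wends A ra n false t mu S u) ->
  exists2 y, star zstep (n, nu, S) y & zconflict w y.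
Proof.
elim: u n t mu nu S => [|[a t'] u IH] n t mu nu S r c.
  exists (n, nu, S); first exact: star0.
  exact ((conflict_iff w (ends_RZ n S true r) (ends_RZ n S false r)).1 c).
have [tt' [n' [en c']]] : t <= t' /\ exists n', n = n'.+1 /\
    conflict w (wends A ra n' true t' (letter_reset ra mu (t' - t) a) (post 1 A mu S (t' - t) a) u)
     (wends A ra n' false t' (letter_reset ra mu (t' - t) a) (post 1 A mu S (t' - t) a) u).
  case: n c => [|n]; rewrite /conflict /=.
    by case=> [[[]]|[_ [[]]]].
  case=> [[[tt' W1] W0]|[w0 [[tt' W1] W0]]]; split=> //; exists n; split=> //; [left|right; do 2 split=> //].
    by split=> // W; apply: W0.
  by move=> W; apply: W0.
have d0 : 0 <= t' - t by rewrite subr_ge0.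
have [E mu0 nuN] := r.
have [k [k0 Sk kH]] := ext_spaced E (int_spaced nuN) d0.
have m0 : nneg (greset (gdelay nu k) (ra a)).
  by move=> x; rewrite !ffunE; case: ifP => // _; rewrite addr_ge0 // (normal_nneg nuN).
have [nu' [N' E']] := normalize C m0.
have r' := letter_rel r d0 k0 Sk E' N'.
have [y Y c2] := IH n' t' _ nu' _ r' c'.
exists y => //; apply: starS Y; exists a, k; rewrite /= en k0 kH; split=> //.
exact: post_eq.
Qed.

(** Density of the reals gives a similar real delay for each integer one; summing them up from [t]
    yields the timestamps. *)
Lemma path_word w n mu nu S y t : rel_RZ mu nu -> star zstep (n, nu, S) y -> zconflict w y ->
  exists u, conflict w (wends A ra n true t mu S u) (wends A ra n false t mu S u).
Proof.
move=> r; move Ex: (n, nu, S) => x K c; elim: K n mu nu S t r Ex c => {x y} [x|x x1 y K _ IH] n mu nu S t r Ex c.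
  exists [::]; rewrite -Ex in c.
  exact ((conflict_iff w (ends_RZ n S true r) (ends_RZ n S false r)).2 c).
case: K => a [k []]; rewrite -{x}Ex /= => en /andP[k0 kH] S' E' N'.
have [E mu0 nuN] := r.
have [d [d0 Sk _]] := ext_spaced (eqv_sym E) (@real_spaced R 1 X C mu) k0.
have Sk' := sim_sym (eqv_sym E) Sk.
have r' := letter_rel r d0 k0 Sk' E' N'.
case: x1 en S' E' N' r' IH => [[n1 nu1] S1] /= -> -> E' N' r' IH.
have [u c'] := IH n1 _ nu1 _ (t + d) r' (erefl _) c.
exists ((a, t + d) :: u); rewrite /= lerDl d0.
have -> : t + d - t = d by rewrite [t + d]addrC addrK.
rewrite (post_eq r S a d0 k0 Sk').
have K F : F <-> (true /\ F) by split=> [|[]].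
exact ((conflict_iff w (K _) (K _)).1 c').
Qed.

Definition zstart : {set L * bool} :=
  if gsat D [ffun => 0] (ta_inv A (ta_init A))
  then finset.set1 (ta_init A, ta_init A \in ta_priv A) else finset.set0.

Lemma rel_RZ0 : rel_RZ [ffun => 0] [ffun => 0].
Proof.
split; last first.
- by move=> x; rewrite ffunE; split=> //; exists 0.
- by move=> x; rewrite ffunE.
split=> [x|]; first by rewrite !ffunE !mulr_ge0.
have K c : ((c : nat)%:R * D <= 0) = (c == 0%N).
  by rewrite pmulr_lle0 // natz lez_nat leqn0.
have K' c : ((c : nat)%:R * 1 <= 0 :> R) = (c == 0%N).
  by rewrite pmulr_lle0 // lern0.
case=> [[x c]|] [[y c']|] _ _ /=; rewrite ?ffunE ?subr0 ?lexx //.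
- by rewrite !ler_pM2r // !ler_nat.
- by rewrite K K'.
- by rewrite !mulr_ge0.
Qed.

Lemma zstartE : start_set R A = zstart.
Proof.
rewrite /start_set /zstart satE; have [E m0 n0] := rel_RZ0.
have := sat_sim ltr01 (erefl _ : 0 < D) E (sim0 E) m0 (normal_nneg n0) (lexx 0) (lexx 0) (invC (ta_init A)).
have z (T : realDomainType) (m : {ffun X -> T}) : gdelay m 0 = m.
  by apply/ffunP=> x; rewrite ffunE addr0.
by rewrite !z => ->.
Qed.

Theorem opacity_game w N :
  (if w then weakly_opaque R A N else fully_opaque R A N) <->
  ~ exists2 y, star zstep (N, [ffun => 0], zstart) y & zconflict w y.
Proof.
have pr f (u : tword R Sigma) : wends A ra N f 0 [ffun => 0] zstart u <->
    (if f then (take N @` PrivTr A)%classic u else (take N @` PubTr A)%classic u).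
  rewrite -zstartE; apply: iff_trans (wends_run oera N f u) _.
  case: f; split.
  - by case=> r [run pr <-]; exists (trace r) => //; exists r.
  - by case=> _ [r [run pr] <-] <-; exists r.
  - by case=> r [run pr <-]; exists (trace r) => //; exists r => //; split=> //; rewrite pr.
  - by case=> _ [r [run /negbTE pr] <-] <-; exists r.
apply: (@iff_trans _ (~ exists u, conflict w (wends A ra N true 0 [ffun => 0] zstart u)
    (wends A ra N false 0 [ffun => 0] zstart u))); last first.
  split=> H K; apply: H.
    by case: K => y; apply: path_word rel_RZ0.
  by case: K => u; apply: word_path rel_RZ0.
case: w; rewrite /conflict; split=> [H [u]|H].
- by case=> [[P1 nP]|[]//]; apply: nP; apply/(pr false u)/H/(pr true u).
- move=> u Pu; apply: contrapT => nu; apply: H; exists u; left.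
  by split; [apply/(pr true u)|move=> /(pr false u)].
- case=> [[P1 nP]|[_ [P1 nP]]]; apply: nP.
    by apply/(pr false u); rewrite -H; apply/(pr true u).
  by apply/(pr true u); rewrite H; apply/(pr false u).
- apply/seteqP; split=> u Pu; apply: contrapT => nu; apply: H; exists u.
    by left; split; [apply/(pr true u)|move=> /(pr false u)].
  by right; do 2 split=> //; [apply/(pr false u)|move=> /(pr true u)].
Qed.

End Game.

End OpacityGame.
Import OpacityGame.

Module NumericalGame.
From mathcomp Require Import zify.

(** * Deciding opacity on numerical codes *)

(* An instance is guessed as a number [g], whose digits in base [b], with indices
   built from three coordinates of which the last two are below [W], are its data. *)
Definition fld b W g t i j := digit b g ((t * W + i) * W + j).

(** A nonzero [sg] means a negative constant, which is below [u]: exactly the codes 3 and 4, those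
    of [CGe] and [CGt], are then satisfied. *)
Definition compare_code o u sg m :=
  if sg == 0 then
    if o == 0 then u < m else if o == 1 then u <= m else if o == 2 then u == m
    else if o == 3 then m <= u else m < u
  else 2 < o.

Section Raw.
Variables b W g : nat.
Notation fld := (fld b W g).

(** Row 0 has the cardinalities, the initial location, N and the number of edges; row 1 the private
    and final flags. Rows 2 to 6 are the invariants: number of constraints, then clock, comparison,
    sign and magnitude of each. Rows 7 to 11 are the guards in the same layout, row 12 has source,
    target and action of edges, row 13 the clock of each action. In an oERA there are as many clocks
    as actions, so [nA] counts both. *)
Definition nA := fld 0 0 0.
Definition nL := fld 0 0 1.
Definition rini := fld 0 0 2.
Definition rN := fld 0 0 3.
Definition nE := fld 0 0 4.
Definition rpriv l := 0 < fld 1 l 0.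
Definition rfin l := 0 < fld 1 l 1.
Definition rcnt t i := fld t i 0.
Definition rx t i j := fld t.+1 i j.
Definition rop t i j := fld t.+2 i j.
Definition rsg t i j := fld t.+3 i j.
Definition rmag t i j := fld t.+4 i j.
Definition rsrc e := fld 12 e 0.
Definition rtgt e := fld 12 e 1.
Definition ract e := fld 12 e 2.
Definition rclk a := fld 13 a 0.
Definition invs := 2.
Definition guards := 7.

(** All constants are digits, so the base [b] serves as the maximal constant: [rD] is the unit of
    time, [rH] the horizon, and [rV] exceeds every value of a normal valuation, which thus becomes a
    number in base [rV]. *)
Definition rD := 2 * nA.+1.
Definition rH := b * rD + 1.
Definition rV := b.+1 * rD + 1.
Definition nQ := 2 * nL.

(* The value of clock [x], [d] time units after [v], once the action [a.-1]
   has occurred if [0 < a]. *)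
Definition rval v d a x :=
  if (0 < a) && (x == rclk a.-1) then 0 else digit rV v x + d.

Definition satn t i v d a :=
  all (fun j => compare_code (rop t i j) (rval v d a (rx t i j)) (rsg t i j) (rmag t i j * rD))
    (iota 0 (rcnt t i)).

Definition edgen a v d f l q' :=
  has (fun e => [&& rsrc e == l, ract e == a, satn guards e v d 0, satn invs (rtgt e) v d a
      & q' == (f || rpriv (rtgt e)) * nL + rtgt e]) (iota 0 nE).

Definition stepn a v q s d q' :=
  [&& ~~ rfin (q %% nL), s <= d,
      all (fun u => (s <= u) ==> (u <= d) ==> satn invs (q %% nL) v u 0) (iota 0 rH.+1)
    & edgen a v d (0 < q %/ nL) (q %% nL) q'].

(** The remainder modulo [nQ] is a location with its flag; the quotient is the time here and the
    valuation in [zfR]. *)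
Definition silR v x y := stepn 0 v (x %% nQ) (x %/ nQ) (y %/ nQ) (y %% nQ).
Definition nS := rH.+1 * nQ.
Definition silent v q x := reachb nS (silR v) q x.

(** This is [eqv] with critical instants compared after moving clock values across the inequalities,
    since subtraction on naturals truncates. *)
Definition eqvn v d a v' :=
  all (fun x => ((rval v d a x <= b * rD) == (digit rV v' x <= b * rD)) &&
   ((rval v d a x <= b * rD) ==> all (fun c =>
     [&& (c * rD <= rval v d a x) == (c * rD <= digit rV v' x),
         (rval v d a x <= c * rD) == (digit rV v' x <= c * rD)
       & all (fun y => (rval v d a y <= b * rD) ==> all (fun c' =>
            (c * rD + rval v d a y <= c' * rD + rval v d a x) ==
            (c * rD + digit rV v' y <= c' * rD + digit rV v' x)) (iota 0 b.+1))
          (iota 0 nA)]) (iota 0 b.+1))) (iota 0 nA).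

(** Digits in base [rV] satisfy the bounds of [normal] by themselves; parity is what remains. *)
Definition evenn v := all (fun x => digit rV v x %% 2 == 0) (iota 0 nA).

Definition zfR x y := has (fun a => has (fun k =>
    [&& stepn a (x %/ nQ) (x %% nQ) 0 k (y %% nQ), eqvn (x %/ nQ) k a (y %/ nQ)
      & evenn (y %/ nQ)]) (iota 0 rH.+1)) (iota 0 nA.+1).

Definition bit S q := digit 2 S q == 1.

Definition postn v S k a q' := has (fun q => bit S q && has (fun x =>
    silent v q x && stepn a v (x %% nQ) (x %/ nQ) k q') (iota 0 nS)) (iota 0 nQ).

Variable B : nat.

Definition nF := B * nQ.

Definition goal f q := rfin (q %% nL) && ((0 < q %/ nL) == f).

Definition endsn n v S f :=
  has (fun q => bit S q &&
    (if n == 0 then has (fun y => reachb nF zfR (v * nQ + q) y && goal f (y %% nQ)) (iota 0 nF)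
     else has (fun x => silent v q x && goal f (x %% nQ)) (iota 0 nS))) (iota 0 nQ).

Definition z_n x := x %/ B %/ B.
Definition z_v x := x %/ B %% B.
Definition z_S x := x %% B.

Definition zR x y := (z_n x == (z_n y).+1) && has (fun a => has (fun k =>
    [&& all (fun q => bit (z_S y) q == postn (z_v x) (z_S x) k a.+1 q) (iota 0 nQ),
        eqvn (z_v x) k a.+1 (z_v y) & evenn (z_v y)]) (iota 0 rH.+1)) (iota 0 nA).

Definition nZ := rN.+1 * B * B.

Definition zconfn (w : bool) x :=
  (endsn (z_n x) (z_v x) (z_S x) true && ~~ endsn (z_n x) (z_v x) (z_S x) false) ||
  (~~ w && (endsn (z_n x) (z_v x) (z_S x) false && ~~ endsn (z_n x) (z_v x) (z_S x) true)).

Definition lostn w := has (fun S =>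
   all (fun q => bit S q == (satn invs rini 0 0 0 && (q == rpriv rini * nL + rini))) (iota 0 nQ)
   && has (fun y => reachb nZ zR (rN * B * B + S) y && zconfn w y) (iota 0 nZ)) (iota 0 B).

(** A negative sign needs a positive magnitude: there is no second zero. *)
Definition validg t i := (rcnt t i <= W) && all (fun j =>
  [&& rx t i j < nA, rop t i j < 5, rsg t i j < 2 & (rsg t i j == 1) ==> (0 < rmag t i j)])
  (iota 0 (rcnt t i)).

Definition valid := [&& nL <= W, nA <= W, nE <= W, rini < nL,
  all (validg invs) (iota 0 nL),
  all (fun e => [&& validg guards e, rsrc e < nL, rtgt e < nL & ract e <= nA]) (iota 0 nE)
 & all (fun a => (rclk a < nA) && all (fun a' => (rclk a == rclk a') ==> (a == a')) (iota 0 nA))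
     (iota 0 nA)].

Variable w : nat.

(* Matching the word [w] against an encoding, symbol by symbol: the position [W]
   stands for failure. *)
Definition eat s p := if (p < W) && (digit (word_base sym) w p == s) then p.+1 else W.
Definition c0 := letter_code S0.
Definition c1 := letter_code S1.
Definition csep := letter_code Sep.
Definition copen := letter_code Open.
Definition cclose := letter_code Close.

Definition mU k p := eat csep (iteri k (fun _ => eat c1) p).
Definition halves k i := iteri i (fun _ k => k %/ 2) k.
Definition mbin k p := eat csep (iteri W (fun i p =>
  if halves k i == 0 then p else eat (if halves k i %% 2 == 0 then c0 else c1) p) p).
Definition mint sg m p := mbin m (eat (if sg == 0 then c0 else c1) p).
Definition mguard t i p := eat cclose (iteri (rcnt t i) (fun j p =>
  mint (rsg t i j) (rmag t i j) (mU (rop t i j) (mU (rx t i j) p))) (eat copen p)).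
Definition mpriv p := eat cclose (iteri nL (fun l p => if rpriv l then mU l p else p) (eat copen p)).
Definition mfin p := eat cclose (iteri nL (fun l p => if rfin l then mU l p else p) (eat copen p)).
Definition mact a p := if a == 0 then eat c0 p else mU a.-1 (eat c1 p).
(** Resets are not stored. Matching demands the set that the action dictates, so automata whose
    resets violate the oERA condition match no code. *)
Definition mreset a p := eat cclose (if a == 0 then eat copen p else mU (rclk a.-1) (eat copen p)).
Definition medge e p :=
  mU (rtgt e) (mreset (ract e) (mact (ract e) (mguard guards e (mU (rsrc e) p)))).
Definition minvs p := eat cclose (iteri nL (fun l p => mguard invs l p) (eat copen p)).
Definition medges p := eat cclose (iteri nE (fun e p => medge e p) (eat copen p)).
Definition mall := mbin rN (medges (minvs (mfin (mpriv (mU rini (mU nA (mU nL (mU nA 0)))))))).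
Definition matches := (mall < W) && (digit (word_base sym) w mall == 0).

End Raw.

(** * Polynomial space for the numerical game *)

Section PsBasic.
Variables b W g : seq nat -> nat.
Hypotheses (pb : ps b) (pW : ps W) (pg : ps g).

Lemma ps_fld t i j : ps t -> ps i -> ps j ->
  ps (fun env => fld (b env) (W env) (g env) (t env) (i env) (j env)).
Proof. by move=> *; rewrite /fld; ps_auto. Qed.

Lemma psb_compare o u sg m : ps o -> ps u -> ps sg -> ps m ->
  psb (fun env => compare_code (o env) (u env) (sg env) (m env)).
Proof.
move=> *; rewrite /compare_code /psb.
apply: (@ps_ext (fun env => if sg env == 0 then
    if o env == 0 then nat_of_bool (u env < m env) else if o env == 1 then nat_of_bool (u env <= m env)
    else if o env == 2 then nat_of_bool (u env == m env)
    else if o env == 3 then nat_of_bool (m env <= u env) else nat_of_bool (m env < u env)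
  else nat_of_bool (2 < o env))).
  by move=> env; do 5?case: ifP.
by ps_auto.
Qed.

Lemma psb_bit S q : ps S -> ps q -> psb (fun env => bit (S env) (q env)).
Proof. by move=> *; rewrite /bit; ps_auto. Qed.

Lemma ps_halves k i : ps k -> ps i -> ps (fun env => halves (k env) (i env)).
Proof.
move=> pk pi; apply: (ps_rec_le pi pk _ pk); first by ps_auto.
by move=> env j _; elim: j => //= j; apply: leq_trans (leq_div _ _).
Qed.

Lemma ps_eat w s p : ps w -> ps s -> ps p ->
  ps (fun env => eat (W env) (w env) (s env) (p env)).
Proof. by move=> *; rewrite /eat; ps_auto. Qed.

Lemma eat_le W0 w s p : eat W0 w s p <= W0.
Proof. by rewrite /eat; case: ifP => // /andP[]. Qed.

(** A position either stays where it is or ends up at most [W], which bounds all iterates. *)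
Lemma ps_iter_eat n p h : ps n -> ps p ->
  ps (fun env => h (behead (behead env)) (vr 1 env) (vr 0 env)) ->
  (forall env i a, h env i a = a \/ h env i a <= W env) ->
  ps (fun env => iteri (n env) (h env) (p env)).
Proof.
move=> pn pp ph H; apply: (ps_rec_le pn pp ph (ps_add pp pW)) => env i _.
elim: i => [|i IH] /=; first exact: leq_addr.
by case: (H env i (iteri i (h env) (p env))) => [->|/leq_trans] //; apply; apply: leq_addl.
Qed.

End PsBasic.

Ltac ps_user0 := lazymatch goal with
  | |- ps (fun env => fld _ _ _ _ _ _) => apply ps_fld
  | |- psb (fun env => compare_code _ _ _ _) => apply psb_compare
  | |- psb (fun env => bit _ _) => apply psb_bit
  | |- ps (fun env => halves _ _) => apply ps_halves
  | |- ps (fun env => eat _ _ _ _) => apply ps_eat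
  | |- psb (fun env => reachb _ _ _ _) => apply psb_reachb
  | |- forall _ : seq nat -> nat, _ => intros ? ? ? ?
  end.
Ltac ps_user ::= ps_user0.

Lemma ps_nA b W g : ps b -> ps W -> ps g ->
  ps (fun env => nA (b env) (W env) (g env)).
Proof. by intros; rewrite /nA; ps_auto. Qed.

Lemma ps_nL b W g : ps b -> ps W -> ps g ->
  ps (fun env => nL (b env) (W env) (g env)).
Proof. by intros; rewrite /nL; ps_auto. Qed.

Lemma ps_rini b W g : ps b -> ps W -> ps g ->
  ps (fun env => rini (b env) (W env) (g env)).
Proof. by intros; rewrite /rini; ps_auto. Qed.

Lemma ps_rN b W g : ps b -> ps W -> ps g ->
  ps (fun env => rN (b env) (W env) (g env)).
Proof. by intros; rewrite /rN; ps_auto. Qed.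

Lemma ps_nE b W g : ps b -> ps W -> ps g ->
  ps (fun env => nE (b env) (W env) (g env)).
Proof. by intros; rewrite /nE; ps_auto. Qed.

Lemma psb_rpriv b W g l : ps b -> ps W -> ps g -> ps l ->
  psb (fun env => rpriv (b env) (W env) (g env) (l env)).
Proof. by intros; rewrite /rpriv; ps_auto. Qed.

Lemma psb_rfin b W g l : ps b -> ps W -> ps g -> ps l ->
  psb (fun env => rfin (b env) (W env) (g env) (l env)).
Proof. by intros; rewrite /rfin; ps_auto. Qed.

Lemma ps_rcnt b W g t i : ps b -> ps W -> ps g -> ps t -> ps i ->
  ps (fun env => rcnt (b env) (W env) (g env) (t env) (i env)).
Proof. by intros; rewrite /rcnt; ps_auto. Qed.

Lemma ps_rx b W g t i j : ps b -> ps W -> ps g -> ps t -> ps i -> ps j ->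
  ps (fun env => rx (b env) (W env) (g env) (t env) (i env) (j env)).
Proof. by intros; rewrite /rx; ps_auto. Qed.

Lemma ps_rop b W g t i j : ps b -> ps W -> ps g -> ps t -> ps i -> ps j ->
  ps (fun env => rop (b env) (W env) (g env) (t env) (i env) (j env)).
Proof. by intros; rewrite /rop; ps_auto. Qed.

Lemma ps_rsg b W g t i j : ps b -> ps W -> ps g -> ps t -> ps i -> ps j ->
  ps (fun env => rsg (b env) (W env) (g env) (t env) (i env) (j env)).
Proof. by intros; rewrite /rsg; ps_auto. Qed.

Lemma ps_rmag b W g t i j : ps b -> ps W -> ps g -> ps t -> ps i -> ps j ->
  ps (fun env => rmag (b env) (W env) (g env) (t env) (i env) (j env)).
Proof. by intros; rewrite /rmag; ps_auto. Qed.

Lemma ps_rsrc b W g e : ps b -> ps W -> ps g -> ps e ->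
  ps (fun env => rsrc (b env) (W env) (g env) (e env)).
Proof. by intros; rewrite /rsrc; ps_auto. Qed.

Lemma ps_rtgt b W g e : ps b -> ps W -> ps g -> ps e ->
  ps (fun env => rtgt (b env) (W env) (g env) (e env)).
Proof. by intros; rewrite /rtgt; ps_auto. Qed.

Lemma ps_ract b W g e : ps b -> ps W -> ps g -> ps e ->
  ps (fun env => ract (b env) (W env) (g env) (e env)).
Proof. by intros; rewrite /ract; ps_auto. Qed.

Lemma ps_rclk b W g a : ps b -> ps W -> ps g -> ps a ->
  ps (fun env => rclk (b env) (W env) (g env) (a env)).
Proof. by intros; rewrite /rclk; ps_auto. Qed.

Ltac ps_user1 := lazymatch goal with
  | |- ps (fun env => nA _ _ _) => apply ps_nA
  | |- ps (fun env => nL _ _ _) => apply ps_nL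
  | |- ps (fun env => rini _ _ _) => apply ps_rini
  | |- ps (fun env => rN _ _ _) => apply ps_rN
  | |- ps (fun env => nE _ _ _) => apply ps_nE
  | |- psb (fun env => rpriv _ _ _ _) => apply psb_rpriv
  | |- psb (fun env => rfin _ _ _ _) => apply psb_rfin
  | |- ps (fun env => rcnt _ _ _ _ _) => apply ps_rcnt
  | |- ps (fun env => rx _ _ _ _ _ _) => apply ps_rx
  | |- ps (fun env => rop _ _ _ _ _ _) => apply ps_rop
  | |- ps (fun env => rsg _ _ _ _ _ _) => apply ps_rsg
  | |- ps (fun env => rmag _ _ _ _ _ _) => apply ps_rmag
  | |- ps (fun env => rsrc _ _ _ _) => apply ps_rsrc
  | |- ps (fun env => rtgt _ _ _ _) => apply ps_rtgt
  | |- ps (fun env => ract _ _ _ _) => apply ps_ract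
  | |- ps (fun env => rclk _ _ _ _) => apply ps_rclk
  | _ => ps_user0
  end.
Ltac ps_user ::= ps_user1.

Lemma ps_rD b W g : ps b -> ps W -> ps g ->
  ps (fun env => rD (b env) (W env) (g env)).
Proof. by intros; rewrite /rD; ps_auto. Qed.

Lemma ps_nQ b W g : ps b -> ps W -> ps g ->
  ps (fun env => nQ (b env) (W env) (g env)).
Proof. by intros; rewrite /nQ; ps_auto. Qed.

Lemma psb_validg b W g t i : ps b -> ps W -> ps g -> ps t -> ps i ->
  psb (fun env => validg (b env) (W env) (g env) (t env) (i env)).
Proof. by intros; rewrite /validg; ps_auto. Qed.

Ltac ps_user2 := lazymatch goal with
  | |- ps (fun env => rD _ _ _) => apply ps_rD
  | |- ps (fun env => nQ _ _ _) => apply ps_nQ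
  | |- psb (fun env => validg _ _ _ _ _) => apply psb_validg
  | _ => ps_user1
  end.
Ltac ps_user ::= ps_user2.

Lemma ps_rH b W g : ps b -> ps W -> ps g ->
  ps (fun env => rH (b env) (W env) (g env)).
Proof. by intros; rewrite /rH; ps_auto. Qed.

Lemma ps_rV b W g : ps b -> ps W -> ps g ->
  ps (fun env => rV (b env) (W env) (g env)).
Proof. by intros; rewrite /rV; ps_auto. Qed.

Lemma psb_valid b W g : ps b -> ps W -> ps g ->
  psb (fun env => valid (b env) (W env) (g env)).
Proof. by intros; rewrite /valid; ps_auto. Qed.

Ltac ps_user3 := lazymatch goal with
  | |- ps (fun env => rH _ _ _) => apply ps_rH
  | |- ps (fun env => rV _ _ _) => apply ps_rV
  | |- psb (fun env => valid _ _ _) => apply psb_valid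
  | _ => ps_user2
  end.
Ltac ps_user ::= ps_user3.

Lemma ps_rval b W g v d a x : ps b -> ps W -> ps g -> ps v -> ps d -> ps a -> ps x ->
  ps (fun env => rval (b env) (W env) (g env) (v env) (d env) (a env) (x env)).
Proof. by intros; rewrite /rval; ps_auto. Qed.

Lemma ps_nS b W g : ps b -> ps W -> ps g ->
  ps (fun env => nS (b env) (W env) (g env)).
Proof. by intros; rewrite /nS; ps_auto. Qed.

Ltac ps_user4 := lazymatch goal with
  | |- ps (fun env => rval _ _ _ _ _ _ _) => apply ps_rval
  | |- ps (fun env => nS _ _ _) => apply ps_nS
  | _ => ps_user3
  end.
Ltac ps_user ::= ps_user4.

Lemma psb_satn b W g t i v d a : ps b -> ps W -> ps g -> ps t -> ps i -> ps v -> ps d -> ps a ->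
  psb (fun env => satn (b env) (W env) (g env) (t env) (i env) (v env) (d env) (a env)).
Proof. by intros; rewrite /satn; ps_auto. Qed.

Lemma psb_evenn b W g v : ps b -> ps W -> ps g -> ps v ->
  psb (fun env => evenn (b env) (W env) (g env) (v env)).
Proof. by intros; rewrite /evenn; ps_auto. Qed.

Ltac ps_user5 := lazymatch goal with
  | |- psb (fun env => satn _ _ _ _ _ _ _ _) => apply psb_satn
  | |- psb (fun env => evenn _ _ _ _) => apply psb_evenn
  | _ => ps_user4
  end.
Ltac ps_user ::= ps_user5.

Lemma psb_eqvn b W g v d a v' : ps b -> ps W -> ps g -> ps v -> ps d -> ps a -> ps v' ->
  psb (fun env => eqvn (b env) (W env) (g env) (v env) (d env) (a env) (v' env)).
Proof. by intros; rewrite /eqvn; ps_auto. Qed.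

Ltac ps_user6 := lazymatch goal with
  | |- psb (fun env => eqvn _ _ _ _ _ _ _) => apply psb_eqvn
  | _ => ps_user5
  end.
Ltac ps_user ::= ps_user6.

Lemma psb_edgen b W g a v d f l q' : ps b -> ps W -> ps g -> ps a -> ps v -> ps d -> psb f -> ps l -> ps q' ->
  psb (fun env => edgen (b env) (W env) (g env) (a env) (v env) (d env) (f env) (l env) (q' env)).
Proof. by intros; rewrite /edgen; ps_auto. Qed.

Ltac ps_user7 := lazymatch goal with
  | |- psb (fun env => edgen _ _ _ _ _ _ _ _ _) => apply psb_edgen
  | _ => ps_user6
  end.
Ltac ps_user ::= ps_user7.

Lemma psb_stepn b W g a v q s d q' : ps b -> ps W -> ps g -> ps a -> ps v -> ps q -> ps s -> ps d -> ps q' ->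
  psb (fun env => stepn (b env) (W env) (g env) (a env) (v env) (q env) (s env) (d env) (q' env)).
Proof. by intros; rewrite /stepn; ps_auto. Qed.

Ltac ps_user8 := lazymatch goal with
  | |- psb (fun env => stepn _ _ _ _ _ _ _ _ _) => apply psb_stepn
  | _ => ps_user7
  end.
Ltac ps_user ::= ps_user8.

Lemma psb_silR b W g v x y : ps b -> ps W -> ps g -> ps v -> ps x -> ps y ->
  psb (fun env => silR (b env) (W env) (g env) (v env) (x env) (y env)).
Proof. by intros; rewrite /silR; ps_auto. Qed.

Lemma psb_zfR b W g x y : ps b -> ps W -> ps g -> ps x -> ps y ->
  psb (fun env => zfR (b env) (W env) (g env) (x env) (y env)).
Proof. by intros; rewrite /zfR; ps_auto. Qed.

Ltac ps_user9 := lazymatch goal with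
  | |- psb (fun env => silR _ _ _ _ _ _) => apply psb_silR
  | |- psb (fun env => zfR _ _ _ _ _) => apply psb_zfR
  | _ => ps_user8
  end.
Ltac ps_user ::= ps_user9.

Lemma psb_silent b W g v q x : ps b -> ps W -> ps g -> ps v -> ps q -> ps x ->
  psb (fun env => silent (b env) (W env) (g env) (v env) (q env) (x env)).
Proof. by intros; rewrite /silent; ps_auto. Qed.

Lemma psb_goal b W g f q : ps b -> ps W -> ps g -> psb f -> ps q ->
  psb (fun env => goal (b env) (W env) (g env) (f env) (q env)).
Proof. by intros; rewrite /goal; ps_auto. Qed.

Ltac ps_user10 := lazymatch goal with
  | |- psb (fun env => silent _ _ _ _ _ _) => apply psb_silent
  | |- psb (fun env => goal _ _ _ _ _) => apply psb_goal
  | _ => ps_user9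
  end.
Ltac ps_user ::= ps_user10.

Lemma psb_postn b W g v S k a q' : ps b -> ps W -> ps g -> ps v -> ps S -> ps k -> ps a -> ps q' ->
  psb (fun env => postn (b env) (W env) (g env) (v env) (S env) (k env) (a env) (q' env)).
Proof. by intros; rewrite /postn; ps_auto. Qed.

Ltac ps_user11 := lazymatch goal with
  | |- psb (fun env => postn _ _ _ _ _ _ _ _) => apply psb_postn
  | _ => ps_user10
  end.
Ltac ps_user ::= ps_user11.

Lemma ps_nF b W g B : ps b -> ps W -> ps g -> ps B ->
  ps (fun env => nF (b env) (W env) (g env) (B env)).
Proof. by intros; rewrite /nF; ps_auto. Qed.

Lemma ps_nZ b W g B : ps b -> ps W -> ps g -> ps B ->
  ps (fun env => nZ (b env) (W env) (g env) (B env)).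
Proof. by intros; rewrite /nZ; ps_auto. Qed.

Lemma psb_zR b W g B x y : ps b -> ps W -> ps g -> ps B -> ps x -> ps y ->
  psb (fun env => zR (b env) (W env) (g env) (B env) (x env) (y env)).
Proof. by intros; rewrite /zR /z_n /z_v /z_S; ps_auto. Qed.

Ltac ps_user12 := lazymatch goal with
  | |- ps (fun env => nF _ _ _ _) => apply ps_nF
  | |- ps (fun env => nZ _ _ _ _) => apply ps_nZ
  | |- psb (fun env => zR _ _ _ _ _ _) => apply psb_zR
  | _ => ps_user11
  end.
Ltac ps_user ::= ps_user12.

Lemma psb_endsn b W g B n v S f : ps b -> ps W -> ps g -> ps B -> ps n -> ps v -> ps S -> psb f ->
  psb (fun env => endsn (b env) (W env) (g env) (B env) (n env) (v env) (S env) (f env)).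
Proof. by intros; rewrite /endsn; ps_auto. Qed.

Ltac ps_user13 := lazymatch goal with
  | |- psb (fun env => endsn _ _ _ _ _ _ _ _) => apply psb_endsn
  | _ => ps_user12
  end.
Ltac ps_user ::= ps_user13.

Lemma psb_zconfn b W g B w x : ps b -> ps W -> ps g -> ps B -> psb w -> ps x ->
  psb (fun env => zconfn (b env) (W env) (g env) (B env) (w env) (x env)).
Proof. by intros; rewrite /zconfn /z_n /z_v /z_S; ps_auto. Qed.

Ltac ps_user14 := lazymatch goal with
  | |- psb (fun env => zconfn _ _ _ _ _ _) => apply psb_zconfn
  | _ => ps_user13
  end.
Ltac ps_user ::= ps_user14.

Lemma psb_lostn b W g B w : ps b -> ps W -> ps g -> ps B -> psb w ->
  psb (fun env => lostn (b env) (W env) (g env) (B env) (w env)).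
Proof. by intros; rewrite /lostn; ps_auto. Qed.

Ltac ps_user15 := lazymatch goal with
  | |- psb (fun env => lostn _ _ _ _ _) => apply psb_lostn
  | _ => ps_user14
  end.
Ltac ps_user ::= ps_user15.

Lemma ps_mU W w k p : ps W -> ps w -> ps k -> ps p ->
  ps (fun env => mU (W env) (w env) (k env) (p env)).
Proof. by intros; rewrite /mU; repeat (cbv beta; first [ps_step | apply (@ps_iter_eat W)]); try (by move=> *; right; apply: eat_le); try (move=> *; case: ifP => _; first [by left|by right; apply: eat_le]). Qed.

Lemma ps_mbin W w k p : ps W -> ps w -> ps k -> ps p ->
  ps (fun env => mbin (W env) (w env) (k env) (p env)).
Proof. by intros; rewrite /mbin; repeat (cbv beta; first [ps_step | apply (@ps_iter_eat W)]); try (by move=> *; right; apply: eat_le); try (move=> *; case: ifP => _; first [by left|by right; apply: eat_le]). Qed.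

Ltac ps_user16 := lazymatch goal with
  | |- ps (fun env => mU _ _ _ _) => apply ps_mU
  | |- ps (fun env => mbin _ _ _ _) => apply ps_mbin
  | _ => ps_user15
  end.
Ltac ps_user ::= ps_user16.

Lemma ps_mint W w sg m p : ps W -> ps w -> ps sg -> ps m -> ps p ->
  ps (fun env => mint (W env) (w env) (sg env) (m env) (p env)).
Proof. by intros; rewrite /mint; ps_auto. Qed.

Ltac ps_user17 := lazymatch goal with
  | |- ps (fun env => mint _ _ _ _ _) => apply ps_mint
  | _ => ps_user16
  end.
Ltac ps_user ::= ps_user17.

Lemma ps_mguard b W g w t i p : ps b -> ps W -> ps g -> ps w -> ps t -> ps i -> ps p ->
  ps (fun env => mguard (b env) (W env) (g env) (w env) (t env) (i env) (p env)).
Proof. by intros; rewrite /mguard; repeat (cbv beta; first [ps_step | apply (@ps_iter_eat W)]); try (by move=> *; right; apply: eat_le); try (move=> *; case: ifP => _; first [by left|by right; apply: eat_le]). Qed.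

Lemma ps_mpriv b W g w p : ps b -> ps W -> ps g -> ps w -> ps p ->
  ps (fun env => mpriv (b env) (W env) (g env) (w env) (p env)).
Proof. by intros; rewrite /mpriv; repeat (cbv beta; first [ps_step | apply (@ps_iter_eat W)]); try (by move=> *; right; apply: eat_le); try (move=> *; case: ifP => _; first [by left|by right; apply: eat_le]). Qed.

Lemma ps_mfin b W g w p : ps b -> ps W -> ps g -> ps w -> ps p ->
  ps (fun env => mfin (b env) (W env) (g env) (w env) (p env)).
Proof. by intros; rewrite /mfin; repeat (cbv beta; first [ps_step | apply (@ps_iter_eat W)]); try (by move=> *; right; apply: eat_le); try (move=> *; case: ifP => _; first [by left|by right; apply: eat_le]). Qed.

Lemma ps_mreset b W g w a p : ps b -> ps W -> ps g -> ps w -> ps a -> ps p ->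
  ps (fun env => mreset (b env) (W env) (g env) (w env) (a env) (p env)).
Proof. by intros; rewrite /mreset; ps_auto. Qed.

Ltac ps_user18 := lazymatch goal with
  | |- ps (fun env => mguard _ _ _ _ _ _ _) => apply ps_mguard
  | |- ps (fun env => mpriv _ _ _ _ _) => apply ps_mpriv
  | |- ps (fun env => mfin _ _ _ _ _) => apply ps_mfin
  | |- ps (fun env => mreset _ _ _ _ _ _) => apply ps_mreset
  | _ => ps_user17
  end.
Ltac ps_user ::= ps_user18.

Lemma ps_mact W w a p : ps W -> ps w -> ps a -> ps p ->
  ps (fun env => mact (W env) (w env) (a env) (p env)).
Proof. by intros; rewrite /mact; ps_auto. Qed.

Ltac ps_user19 := lazymatch goal with
  | |- ps (fun env => mact _ _ _ _) => apply ps_mact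
  | _ => ps_user18
  end.
Ltac ps_user ::= ps_user19.

Lemma ps_medge b W g w e p : ps b -> ps W -> ps g -> ps w -> ps e -> ps p ->
  ps (fun env => medge (b env) (W env) (g env) (w env) (e env) (p env)).
Proof. by intros; rewrite /medge; ps_auto. Qed.

Lemma ps_minvs b W g w p : ps b -> ps W -> ps g -> ps w -> ps p ->
  ps (fun env => minvs (b env) (W env) (g env) (w env) (p env)).
Proof. by intros; rewrite /minvs; repeat (cbv beta; first [ps_step | apply (@ps_iter_eat W)]); try (by move=> *; right; apply: eat_le); try (move=> *; case: ifP => _; first [by left|by right; apply: eat_le]). Qed.

Ltac ps_user20 := lazymatch goal with
  | |- ps (fun env => medge _ _ _ _ _ _) => apply ps_medge
  | |- ps (fun env => minvs _ _ _ _ _) => apply ps_minvs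
  | _ => ps_user19
  end.
Ltac ps_user ::= ps_user20.

Lemma ps_medges b W g w p : ps b -> ps W -> ps g -> ps w -> ps p ->
  ps (fun env => medges (b env) (W env) (g env) (w env) (p env)).
Proof. by intros; rewrite /medges; repeat (cbv beta; first [ps_step | apply (@ps_iter_eat W)]); try (by move=> *; right; apply: eat_le); try (move=> *; case: ifP => _; first [by left|by right; apply: eat_le]). Qed.

Ltac ps_user21 := lazymatch goal with
  | |- ps (fun env => medges _ _ _ _ _) => apply ps_medges
  | _ => ps_user20
  end.
Ltac ps_user ::= ps_user21.

Lemma ps_mall b W g w : ps b -> ps W -> ps g -> ps w ->
  ps (fun env => mall (b env) (W env) (g env) (w env)).
Proof. by intros; rewrite /mall; ps_auto. Qed.

Ltac ps_user22 := lazymatch goal with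
  | |- ps (fun env => mall _ _ _ _) => apply ps_mall
  | _ => ps_user21
  end.
Ltac ps_user ::= ps_user22.

Lemma psb_matches b W g w : ps b -> ps W -> ps g -> ps w ->
  psb (fun env => matches (b env) (W env) (g env) (w env)).
Proof. by intros; rewrite /matches; ps_auto. Qed.

Ltac ps_user23 := lazymatch goal with
  | |- psb (fun env => matches _ _ _ _) => apply psb_matches
  | _ => ps_user22
  end.
Ltac ps_user ::= ps_user23.

End NumericalGame.
Import NumericalGame.

(** * The numerical game as the game on the automaton that a code describes *)

Module DecodedGame.
From mathcomp Require Import zify.
From mathcomp Require Import boolp classical_sets reals.

Import Order.TTheory GRing.Theory Num.Theory.

Local Notation "n %:Z" := (Posz n) : nat_scope.

Lemma digit_surj (beta M : nat) (f : nat -> nat) : 0 < beta ->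
  (forall k, k < M -> f k < beta) ->
  exists2 v, v < beta ^ M & forall k, k < M -> digit beta v k = f k.
Proof.
move=> b0; elim: M f => [|M IH] f fb; first by exists 0.
have [k kM|v vM vE] := IH (fun k => f k.+1); first exact: fb.
have f0 := fb 0 isT.
exists (v * beta + f 0); first by rewrite expnS; nia.
case=> [|k] kM; rewrite digitE //.
  by rewrite divn1 modnMDl modn_small.
by rewrite expnS divnMA divnMDl // (divn_small f0) addn0 -digitE // vE.
Qed.

(** [dec] need not be injective nor onto: it suffices that each successor of a decoded vertex is
    again decoded from some vertex below [V]. *)
Lemma star_reachb (T : Type) (dec : nat -> T) V (Rn : rel nat) (Rt : T -> T -> Prop) :
  (forall x y, x < V -> y < V -> Rn x y <-> Rt (dec x) (dec y)) ->
  (forall x t, x < V -> Rt (dec x) t -> exists2 y, y < V & dec y = t) ->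
  forall x t, x < V -> star Rt (dec x) t <-> exists y, [/\ reachb V Rn x y & dec y = t].
Proof.
move=> RE Rs x t xV; split.
  move Ex: (dec x) => z H; elim: H x xV Ex => {z t} [z|z z1 t H _ IH] x xV Ex.
    by exists x; split=> //; apply/reachP; split=> //; exists [::].
  rewrite -Ex in H; have [y yV Ey] := Rs _ _ xV H.
  have [y' [/reachP[_ y'V [s [ps ls sV]]] Ey']] := IH y yV Ey.
  exists y'; split=> //; apply/reachP; split=> //; exists (y :: s); split=> //=; last by rewrite yV.
  by rewrite ps andbT; apply/RE => //; rewrite Ey.
case=> y [/reachP[_ yV [s [ps ls sV]]] <-].
elim: s x xV ps ls sV => [|z s IH] x xV /=; first by move=> _ -> _; apply: star0.
case/andP=> Rxz ps ls /andP[zV sV]; apply: starS (IH z zV ps ls sV).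
exact/RE.
Qed.

Lemma all_pmap (S T : Type) (f : S -> option T) P (s : seq S) :
  all P (pmap f s) = all (fun x => if f x is Some y then P y else true) s.
Proof. by elim: s => //= x s <-; case: (f x). Qed.

Lemma all_iotaP (P : pred nat) n : reflect (forall k, k < n -> P k) (all P (iota 0 n)).
Proof.
apply: (iffP allP) => H k; first by move=> kn; apply: H; rewrite mem_iota.
by rewrite mem_iota; apply: H.
Qed.

Lemma has_iotaP (P : pred nat) n : reflect (exists2 k, k < n & P k) (has P (iota 0 n)).
Proof.
apply: (iffP hasP) => -[k kn Pk]; exists k => //; first by rewrite mem_iota in kn.
by rewrite mem_iota.
Qed.

Section Typed.
Variables b W g : nat.
Hypothesis b0 : 0 < b.
Hypothesis ok : valid b W g.
Local Notation nA := (nA b W g).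
Local Notation nL := (nL b W g).
Local Notation nQ := (nQ b W g).
Local Notation rV := (rV b W g).
Local Notation rD := (rD b W g).
Local Notation rH := (rH b W g).
Local Notation guards := guards.

Lemma rini_lt : rini b W g < nL. Proof. by case/and5P: ok => _ _ _ ? _. Qed.
Lemma nL_gt0 : 0 < nL. Proof. exact: leq_ltn_trans rini_lt. Qed.

Lemma valid_inv l : l < nL -> validg b W g invs l.
Proof. by case/and5P: ok => _ _ _ _ /and3P[/all_iotaP H _ _]; apply: H. Qed.

Lemma valid_edge e : e < nE b W g ->
  [/\ validg b W g guards e, rsrc b W g e < nL, rtgt b W g e < nL & ract b W g e <= nA].
Proof. by case/and5P: ok => _ _ _ _ /and3P[_ /all_iotaP H _] /H /and4P. Qed.

Lemma valid_clk a : a < nA -> rclk b W g a < nA.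
Proof. by case/and5P: ok => _ _ _ _ /and3P[_ _ /all_iotaP H] /H /andP[]. Qed.

Lemma clk_inj a a' : a < nA -> a' < nA -> rclk b W g a = rclk b W g a' -> a = a'.
Proof.
case/and5P: ok => _ _ _ _ /and3P[_ _ /all_iotaP H] /H /andP[_ /all_iotaP {}H] /H.
by move=> /implyP {}H /eqP /H /eqP.
Qed.

Definition ini0 : 'I_nL := Ordinal rini_lt.
Definition ordL (v : nat) : 'I_nL := insubd ini0 v.

Lemma ordLE v : v < nL -> ordL v = v :> nat.
Proof. by move=> vL; rewrite val_insubd vL. Qed.

Definition int_of sg m : int := if sg == 0 then m%:Z else Negz m.-1.
Definition mkcon t i j : option (constraint 'I_nA) :=
  omap (fun x => (x, odflt CLt (cmp_of_nat (rop b W g t i j)),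
                  int_of (rsg b W g t i j) (rmag b W g t i j)))
    (insub (rx b W g t i j)).
Definition mkguard t i : guard 'I_nA := pmap (mkcon t i) (iota 0 (rcnt b W g t i)).
Definition mkact a : option 'I_nA := if a is a'.+1 then insub a' else None.
Definition rs a : {set 'I_nA} := [set y : 'I_nA | (0 < a) && (y == rclk b W g a.-1 :> nat)].
Definition mkedge e := Edge (ordL (rsrc b W g e)) (mkguard guards e) (mkact (ract b W g e))
  (rs (ract b W g e)) (ordL (rtgt b W g e)).
Definition mkTA : TA 'I_nA 'I_nL 'I_nA :=
  MkTA ini0 [set l : 'I_nL | rpriv b W g l] [set l : 'I_nL | rfin b W g l]
    [ffun l : 'I_nL => mkguard invs l] (map mkedge (iota 0 (nE b W g))).

Definition ra (a : 'I_nA) : {set 'I_nA} := rs a.+1.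

Lemma mkactS a : a < nA -> exists2 o : 'I_nA, mkact a.+1 = Some o & val o = a.
Proof. by move=> aA; exists (Ordinal aA); rewrite //= insubT. Qed.

Lemma oera_mk e : e \in ta_edges mkTA ->
  ereset e = if eact e is Some a then ra a else finset.set0.
Proof.
move=> /mapP[k]; rewrite mem_iota /= => /valid_edge[_ _ _ aA] -> /=.
case: (ract b W g k) aA => [|a] aA /=.
  by apply/setP=> y; rewrite !inE.
by rewrite insubT.
Qed.

Lemma is_oERA_mk : is_oERA mkTA.
Proof.
pose x (a : 'I_nA) : 'I_nA := Ordinal (valid_clk (ltn_ord a)).
exists x.
  apply: injF_bij => a a' /(congr1 val) /= /clk_inj H.
  by apply/val_inj/H.
move=> e eA; rewrite (oera_mk eA); case: (eact e) => // a.
by apply/setP=> y; rewrite !inE.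
Qed.

Lemma fld_lt t i j : fld b W g t i j < b.
Proof. by rewrite /fld /digit ltn_mod. Qed.

Lemma mkguard_const t i : const_le b (mkguard t i).
Proof.
rewrite /const_le all_pmap; apply/allP=> j _; rewrite /mkcon; case: insubP => //= x _ _.
have := fld_lt t.+4 i j; rewrite /int_of /rmag; case: ifP => _ /=; lia.
Qed.

Lemma mk_invC l : const_le b (ta_inv mkTA l).
Proof. by rewrite ffunE; apply: mkguard_const. Qed.

Lemma mk_guardC e : e \in ta_edges mkTA -> const_le b (eguard e).
Proof. by move=> /mapP[k _ ->]; apply: mkguard_const. Qed.

Local Notation DD := (D2 'I_nA).

Lemma DDE : DD = rD%:Z.
Proof. by rewrite /D2 /unit card_ord. Qed.

Definition mv v d a : {ffun 'I_nA -> int} := [ffun x : 'I_nA => (rval b W g v d a x)%:Z].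
Definition dv v : {ffun 'I_nA -> int} := [ffun x : 'I_nA => (digit rV v x)%:Z].

Lemma mv_delay v d : gdelay (dv v) d%:Z = mv v d 0.
Proof. by apply/ffunP=> x; rewrite !ffunE. Qed.

Lemma mv_reset v d a : greset (gdelay (dv v) d%:Z) (rs a) = mv v d a.
Proof. by apply/ffunP=> x; rewrite !ffunE inE /rval; case: ifP. Qed.

Lemma mv00 v : mv v 0 0 = dv v.
Proof. by apply/ffunP=> x; rewrite !ffunE /rval addn0. Qed.

Lemma satnE t i v d a : validg b W g t i ->
  gsat DD (mv v d a) (mkguard t i) = satn b W g t i v d a.
Proof.
case/andP=> _ /all_iotaP gv; rewrite /gsat /satn all_pmap.
apply/eq_in_all => j; rewrite mem_iota /= => /gv /and4P[xA o5 s2 m0].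
rewrite /mkcon insubT /= ffunE /= DDE /int_of /compare_code.
move: (rval _ _ _ _ _ _ _) => u.
have [_|s0] := eqVneq (rsg b W g t i j) 0.
  rewrite /= intz -PoszM.
  by case: (rop b W g t i j) o5 => [|[|[|[|[|o]]]]] //= _; rewrite ?ltz_nat ?lez_nat.
have s1 : rsg b W g t i j = 1 by lia.
rewrite s1 /= in m0; rewrite /=.
have neg : ((Negz (rmag b W g t i j).-1)%:~R * rD%:Z < u%:Z :> int)%R by rewrite intz /NumericalGame.rD; nia.
case: (rop b W g t i j) o5 => [|[|[|[|[|o]]]]] //= _.
- by rewrite lt_gtF.
- by rewrite lt_geF.
- by rewrite gt_eqF.
- by rewrite ltW.
Qed.

Definition dq q : 'I_nL * bool := (ordL (q %% nL), 0 < q %/ nL).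
Definition eq (p : 'I_nL * bool) : nat := p.2 * nL + p.1.

Lemma eq_lt p : eq p < nQ.
Proof. by rewrite /eq /NumericalGame.nQ; case: p => l [] /=; have := ltn_ord l; lia. Qed.

Lemma dqK q : q < nQ -> eq (dq q) = q.
Proof.
move=> qQ; rewrite /eq /= ordLE ?ltn_mod ?nL_gt0 // {3}(divn_eq q nL).
congr (_ * _ + _); have : q %/ nL < 2 by rewrite ltn_divLR ?nL_gt0.
by case: (q %/ nL) => [|[|]].
Qed.

Lemma eqK p : dq (eq p) = p.
Proof.
case: p => l f; rewrite /dq /eq modnMDl divnMDl ?nL_gt0 // divn_small // addn0 modn_small //.
congr (_, _); first by apply/val_inj; rewrite /= ordLE.
by case: f.
Qed.

Lemma dq_inj q q' : q < nQ -> q' < nQ -> dq q = dq q' -> q = q'.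
Proof. by move=> qQ q'Q E; rewrite -(dqK qQ) E dqK. Qed.

Lemma mkact_inj a a' : a <= nA -> a' <= nA -> mkact a = mkact a' -> a = a'.
Proof.
case: a => [|a]; case: a' => [|a'] //= aA a'A; rewrite ?insubT //.
by case=> ->.
Qed.

Lemma stepnP a v q s d q' : a <= nA -> q < nQ -> q' < nQ -> d <= rH ->
  stepn b W g a v q s d q' <->
  astep DD mkTA (mkact a) (dv v) (dq q, s%:Z) d%:Z (dq q') (mv v d a).
Proof.
move=> aA qQ q'Q dH; have lq : q %% nL < nL by rewrite ltn_mod nL_gt0.
have fin : ((dq q).1 \notin ta_final mkTA) = ~~ rfin b W g (q %% nL).
  by rewrite inE ordLE.
have I u : gsat DD (gdelay (dv v) u%:Z) (ta_inv mkTA (dq q).1) = satn b W g invs (q %% nL) v u 0.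
  by rewrite mv_delay ffunE /= ordLE // satnE // valid_inv.
have tgt e : e < nE b W g ->
    dq ((((0 < q %/ nL) || rpriv b W g (rtgt b W g e)) * nL + rtgt b W g e)) =
    (ordL (rtgt b W g e), (dq q).2 || (ordL (rtgt b W g e) \in ta_priv mkTA)).
  case/valid_edge=> _ _ tL _.
  by rewrite inE ordLE // -[X in dq (_ + X)](ordLE tL) -[LHS]/(dq (eq (_, _))) eqK.
have tgtlt e : e < nE b W g ->
    ((0 < q %/ nL) || rpriv b W g (rtgt b W g e)) * nL + rtgt b W g e < nQ.
  by case/valid_edge=> _ _ tL _; rewrite /NumericalGame.nQ; case: (_ || _); lia.
split.
  case/and4P=> qF sd /all_iotaP Iu /has_iotaP[e eE /and5P[/eqP es /eqP ea eg ei /eqP q'E]].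
  have [vg _ tL _] := valid_edge eE.
  split; rewrite /= ?fin //.
    case=> u; last by lia.
    rewrite !lez_nat => su ud; rewrite I.
    have := Iu u; rewrite ltnS su ud (leq_trans ud dH); exact.
  exists (mkedge e); split=> /=.
  - by apply: map_f; rewrite mem_iota.
  - by rewrite es ea.
  - by split; [rewrite mv_delay satnE|rewrite ea mv_reset].
  - by rewrite ffunE ordLE // satnE // valid_inv.
  - by rewrite q'E tgt.
case=> qF sd Iu [e [/mapP[k]]]; rewrite mem_iota /= => kE ->.
have [vg sL tL kA] := valid_edge kE.
move=> [es ea] [eg _] ei q'E; apply/and4P; split.
- by rewrite -fin.
- by rewrite -lez_nat.
- apply/all_iotaP=> u _; apply/implyP=> su; apply/implyP=> ud.
  by rewrite -I; apply: Iu; rewrite lez_nat.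
- apply/has_iotaP; exists k => //; apply/and5P; split.
  + by have := congr1 val es; rewrite /= !ordLE // => ->.
  + by apply/eqP/mkact_inj.
  + by rewrite -satnE // -mv_delay.
  + by move: ei; rewrite /= ffunE ordLE // satnE // valid_inv.
  + by apply/eqP/dq_inj; rewrite ?tgtlt // tgt.
Qed.

(* The next valuation is determined by the action. *)
Lemma astep_mv oa v p d q mu : astep DD mkTA oa (dv v) p d%:Z q mu ->
  exists2 a, a <= nA & oa = mkact a /\ mu = mv v d a.
Proof.
case=> _ _ _ [e [/mapP[k]]]; rewrite mem_iota /= => /valid_edge[_ _ _ kA] -> [_ ea] [_ ->] _ _.
by exists (ract b W g k) => //; rewrite -ea /= mv_reset.
Qed.

Definition dx x : 'I_nL * bool * int := (dq (x %% nQ), (x %/ nQ)%:Z).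

Lemma nQ_gt0 : 0 < nQ. Proof. by rewrite muln_gt0 nL_gt0. Qed.

Lemma horizonE : horizon 'I_nA b = rH%:Z.
Proof. by rewrite /horizon DDE /rH PoszD PoszM. Qed.

Lemma nS_div x : x < nS b W g -> x %/ nQ <= rH.
Proof. by move=> xS; rewrite -ltnS ltn_divLR ?nQ_gt0. Qed.

Definition bsstep v (x y : 'I_nL * bool * int) := sstep DD mkTA (dv v) x y /\ (y.2 <= rH%:Z)%R.

Lemma mod_nQ x : x %% nQ < nQ. Proof. by rewrite ltn_mod nQ_gt0. Qed.

Lemma dx_surj p s : s <= rH -> exists2 x, x < nS b W g & dx x = (p, s%:Z).
Proof.
move=> sH; exists (s * nQ + eq p).
  have := eq_lt p; rewrite /nS; nia.
by rewrite /dx modnMDl divnMDl ?nQ_gt0 // divn_small ?eq_lt // addn0 modn_small ?eq_lt // eqK.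
Qed.

Lemma silentP v q x : q < nQ -> x < nS b W g ->
  silent b W g v q x <-> zsilent mkTA b (dv v) (dq q) (dx x).
Proof.
move=> qQ xS.
have qS : q < nS b W g by rewrite /nS mulSn; apply: leq_trans qQ (leq_addr _ _).
have dxq : dx q = (dq q, 0%:Z) by rewrite /dx modn_small // divn_small.
have SR : forall x y, x < nS b W g -> y < nS b W g -> silR b W g v x y <-> bsstep v (dx x) (dx y).
  move=> x0 y xS0 yS; rewrite /silR stepnP ?mod_nQ ?nS_div //.
  split=> [H|[[mu H] _]]; first by split; [exists (mv v (y %/ nQ) 0)|rewrite lez_nat nS_div].
  have [a aA [oa mE]] := astep_mv H.
  by case: a aA oa mE => [|a] aA /= oa mE; [rewrite -mE|rewrite insubT in oa].
have sur : forall x t, x < nS b W g -> bsstep v (dx x) t -> exists2 y, y < nS b W g & dx y = t.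
  move=> x0 [p [s|s]] xS0 [[mu [_ /= ps _ _]] sH]; last by have : (Posz (x0 %/ nQ) <= Negz s)%R := ps.
  exact: dx_surj.
rewrite /silent /zsilent horizonE -dxq; split.
  move=> H; have /(star_reachb SR sur (dx x) qS) : exists y, reachb (nS b W g) (silR b W g v) q y /\ dx y = dx x.
    by exists x.
  move=> K; split; last by rewrite lez_nat nS_div.
  by elim: K => [z|z z1 t [? _] _]; [apply: star0|apply: starS].
(* Time never decreases along silent steps, so the bound at the end holds all the way. *)
case=> K xH; have : star (bsstep v) (dx q) (dx x).
  elim: K xH => [z _|z z1 t H K IH tH]; first exact: star0.
  by apply: starS (IH tH); split=> //; apply: le_trans (sstep_star_le K) tH.
case/(star_reachb SR sur (dx x) qS) => y [H E]; suff -> : x = y by [].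
have /reachP[_ yS _] := H.
have E3 := dq_inj (mod_nQ y) (mod_nQ x) (congr1 fst E).
have [E2] : Posz (y %/ nQ) = Posz (x %/ nQ) := congr1 snd E.
by rewrite (divn_eq x nQ) (divn_eq y nQ) E3 -E2.
Qed.

Lemma bD_E c : (c%:R * DD)%R = (c * rD)%:Z.
Proof. by rewrite natz DDE PoszM. Qed.

Lemma eqvnP v d a v' : eqvn b W g v d a v' <-> eqv DD DD b (mv v d a) (dv v').
Proof.
have sub0 c u : ((c * rD)%:Z - u%:Z <= 0 :> int)%R = (c * rD <= u) by apply/idP/idP; lia.
have sub1 c u : (0 <= (c * rD)%:Z - u%:Z :> int)%R = (u <= c * rD) by apply/idP/idP; lia.
have sub2 c u c' u' : ((c * rD)%:Z - u%:Z <= (c' * rD)%:Z - u'%:Z :> int)%R =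
    (c * rD + u' <= c' * rD + u) by apply/idP/idP; lia.
rewrite /eqvn; split.
  move=> /all_iotaP H; split=> [x|].
    by rewrite bD_E !ffunE !lez_nat; case/andP: (H x (ltn_ord x)) => /eqP.
  case=> [[x c]|] [[y c']|] /=; rewrite ?bD_E ?ffunE ?lez_nat ?sub2 ?sub1 ?sub0 // => ax ay.
  - case/andP: (H x (ltn_ord x)) => _; rewrite ax => /all_iotaP/(_ c (ltn_ord c)).
    by case/and3P=> _ _ /all_iotaP/(_ y (ltn_ord y)); rewrite ay => /all_iotaP/(_ c' (ltn_ord c'))/eqP.
  - case/andP: (H x (ltn_ord x)) => _; rewrite ax => /all_iotaP/(_ c (ltn_ord c)).
    by case/and3P=> /eqP.
  - case/andP: (H y (ltn_ord y)) => _; rewrite ay => /all_iotaP/(_ c' (ltn_ord c')).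
    by case/and3P=> _ /eqP.
case=> H1 H2; apply/all_iotaP=> x xA; pose x' := Ordinal xA.
have := H1 x'; rewrite bD_E !ffunE !lez_nat => ->; rewrite eqxx andTb.
apply/implyP=> xb; apply/all_iotaP=> c cb; pose c' := Ordinal cb.
have ax : active (C := b) DD (mv v d a) (Some (x', c')).
  by have /= := H1 x'; rewrite bD_E !ffunE !lez_nat /= => ->.
apply/and3P; split.
- by have := H2 (Some (x', c')) None ax isT; rewrite /= bD_E !ffunE !sub0 => ->.
- by have := H2 None (Some (x', c')) isT ax; rewrite /= bD_E !ffunE !sub1 => ->.
apply/all_iotaP=> y yA; apply/implyP=> yb; apply/all_iotaP=> c1 cb1.
have ay : active (C := b) DD (mv v d a) (Some (Ordinal yA, Ordinal cb1)).
  by rewrite /= bD_E !ffunE lez_nat.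
by have := H2 _ _ ax ay; rewrite /= !bD_E !ffunE !sub2 => ->.
Qed.

Lemma digit_lt be x i : 0 < be -> digit be x i < be.
Proof. by move=> be0; rewrite /digit ltn_mod. Qed.

Lemma rV_gt0 : 0 < rV. Proof. by rewrite /NumericalGame.rV addn1. Qed.

Lemma evennP v : evenn b W g v <-> normal b (dv v).
Proof.
rewrite /evenn; split=> [/all_iotaP H x|H].
  rewrite ffunE DDE -PoszM !lez_nat; split=> //.
    by have := digit_lt v x rV_gt0; rewrite {2}/NumericalGame.rV addn1 ltnS.
  exists (digit rV v x %/ 2)%:Z; rewrite -PoszM mulnC.
  by rewrite {1}(divn_eq (digit rV v x) 2) (eqP (H x (ltn_ord x))) addn0.
apply/all_iotaP=> x xA; have [_ _ [k]] := H (Ordinal xA); rewrite ffunE /= => E.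
by apply/eqP; lia.
Qed.

Variable B : nat.
(** [B] is a common base: a normal valuation and, by [BQ], a set of locations with flags each fit
    into one digit. *)
Hypothesis BV : rV ^ nA <= B.
Hypothesis BQ : 2 ^ nQ <= B.

Lemma B_gt0 : 0 < B.
Proof. by apply: leq_trans BQ; rewrite expn_gt0. Qed.

Lemma dv_surj nu : normal b nu -> exists2 v, v < B & dv v = nu.
Proof.
move=> N.
have [|v vB vE] := @digit_surj rV nA (fun k => if insub k is Some x then `|nu x|%N else 0) rV_gt0.
  move=> k kA; rewrite insubT; have [h0 h1 _] := N (Ordinal kA).
  by rewrite /NumericalGame.rV addn1 ltnS -lez_nat gez0_abs // PoszM -DDE.
exists v; first exact: leq_trans vB BV.
apply/ffunP=> x; rewrite ffunE vE // valK; have [h0 _ _] := N x.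
exact: gez0_abs.
Qed.

Definition dS S : {set 'I_nL * bool} := [set p | bit S (eq p)].

Lemma dS_surj S : exists2 s, s < B & dS s = S.
Proof.
have [|s sB sE] := @digit_surj 2 nQ (fun k => nat_of_bool (dq k \in S)) isT.
  by move=> k _; case: (_ \in _).
exists s; first exact: leq_trans sB BQ.
apply/setP=> p; rewrite inE /bit sE ?eq_lt // eqK.
by case: (_ \in _).
Qed.

Definition dF x : 'I_nL * bool * {ffun 'I_nA -> int} := (dq (x %% nQ), dv (x %/ nQ)).

Lemma dq_div_lt x n : x < n * nQ -> x %/ nQ < n.
Proof. by rewrite ltn_divLR ?nQ_gt0. Qed.

Lemma dF_mk v p : dF (v * nQ + eq p) = (p, dv v).
Proof.
by rewrite /dF modnMDl divnMDl ?nQ_gt0 // divn_small ?eq_lt // addn0 modn_small ?eq_lt // eqK.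
Qed.

Lemma mk_lt v p n : v < n -> v * nQ + eq p < n * nQ.
Proof. by move=> vn; have := eq_lt p; nia. Qed.

Lemma int_nat (k : int) : (0 <= k)%R -> (k <= rH%:Z)%R -> exists2 n, n <= rH & k = n%:Z.
Proof. by case: k => // n _; rewrite lez_nat => nH; exists n. Qed.

Lemma zfRP x y : zfR b W g x y <-> zfstep mkTA b (dF x) (dF y).
Proof.
rewrite /zfR; split.
  move=> /has_iotaP[a aA /has_iotaP[k kH /and3P[st e n]]].
  exists (mkact a), k%:Z, (mv (x %/ nQ) k a); rewrite horizonE lez_nat; split=> //.
  - by apply/(stepnP _ 0 aA (mod_nQ x) (mod_nQ y) kH).
  - exact/eqvnP.
  - exact/evennP.
case=> oa [k [m []]]; rewrite horizonE => k0 kH st e n.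
have [k' kH' kE] := int_nat k0 kH; rewrite {k k0 kH}kE in st e.
have [a aA [oE mE]] := astep_mv st.
apply/has_iotaP; exists a => //; apply/has_iotaP; exists k' => //; apply/and3P; split.
- by apply/(stepnP _ 0 aA (mod_nQ x) (mod_nQ y) kH'); rewrite -oE -mE.
- by apply/eqvnP; rewrite -mE.
- exact/evennP.
Qed.

Lemma dF_surj x t : zfstep mkTA b (dF x) t -> exists2 y, y < nF b W g B & dF y = t.
Proof.
case=> oa [k [m [_ _ _ _ N]]]; have [v vB vE] := dv_surj N.
by exists (v * nQ + eq t.1); [exact: mk_lt|rewrite dF_mk vE; case: (t)].
Qed.

Lemma goalP f q : q < nQ -> goal b W g f q <->
  ((dq q).1 \in ta_final mkTA) /\ (dq q).2 = f.
Proof.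
move=> qQ; rewrite inE ordLE ?ltn_mod ?nL_gt0 //.
rewrite /goal; case: (rfin _ _ _ _); last by split=> // -[].
by split=> [/eqP|[_ <-]] //=.
Qed.

Lemma mod_small_nQ x : x < nQ -> dx x = (dq x, 0%:Z).
Proof. by move=> xQ; rewrite /dx modn_small // divn_small. Qed.

Lemma endsnP n v S f : v < B -> endsn b W g B n v S f <-> zends mkTA b n (dv v) (dS S) f.
Proof.
move=> vB; rewrite /endsn; case: n => [|n] /=.
  have K q : q < nQ -> forall t, star (zfstep mkTA b) (dq q, dv v) t <->
      exists y, [/\ reachb (nF b W g B) (zfR b W g) (v * nQ + q) y & dF y = t].
    move=> qQ t; rewrite -dF_mk dqK //; apply: star_reachb.
    - by move=> x y _ _; apply: zfRP.
    - by move=> x t' _; apply: dF_surj.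
    - by rewrite -(dqK qQ); apply: mk_lt.
  split.
    move=> /has_iotaP[q qQ /andP[qS /has_iotaP[y yF /andP[R /(goalP _ (mod_nQ y))[yf fE]]]]].
    exists (dq q), (dF y); split=> //; first by rewrite inE dqK.
    by apply/K => //; exists y.
  case=> p [t [pS]]; rewrite -(eqK p); case/(K _ (eq_lt p)) => y [R <-] tF tf.
  apply/has_iotaP; exists (eq p); rewrite ?eq_lt //; rewrite inE in pS; rewrite pS /=.
  have /reachP[_ yF _] := R; apply/has_iotaP; exists y => //; rewrite R /=.
  by apply/goalP; rewrite ?mod_nQ.
split.
  move=> /has_iotaP[q qQ /andP[qS /has_iotaP[x xS /andP[R /(goalP _ (mod_nQ x))[xf fE]]]]].
  exists (dq q), (dx x); split=> //; first by rewrite inE dqK.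
  by apply/silentP.
case=> p [t [pS [st tH] tF tf]]; rewrite horizonE in tH.
have t0 := sstep_star_le st; have [s sH sE] := int_nat t0 tH.
have [x xS xE] := dx_surj t.1 sH; have {xE} xE : dx x = t by rewrite xE -sE; case: (t).
apply/has_iotaP; exists (eq p); rewrite ?eq_lt //; rewrite inE in pS; rewrite pS /=.
apply/has_iotaP; exists x => //; apply/andP; split.
  by apply/silentP; rewrite ?eq_lt // eqK xE; split=> //; rewrite horizonE.
by apply/goalP; rewrite ?mod_nQ // -[dq _]/(dx x).1 xE.
Qed.

Lemma postnP v S k (a : 'I_nA) q' : k <= rH -> q' < nQ ->
  postn b W g v S k a.+1 q' = (dq q' \in post DD mkTA (dv v) (dS S) k%:Z a).
Proof.
rewrite /postn; move=> kH q'Q; have aE : mkact a.+1 = Some a by exact: valK.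
apply/idP/postP.
  move=> /has_iotaP[q qQ /andP[qS /has_iotaP[x xS /andP[/(silentP _ qQ xS)[st _] ]]]].
  move/(stepnP _ _ (ltn_ord a) (mod_nQ x) q'Q kH); rewrite aE => H.
  by exists (dq q), (dx x), (mv v k a.+1); split=> //; rewrite inE dqK.
case=> p [t [mu [pS st H]]].
have tk : (t.2 <= k%:Z)%R by case: H.
have tH : (t.2 <= rH%:Z)%R by apply: le_trans tk _; rewrite lez_nat.
have t0 := sstep_star_le st; have [s sH sE] := int_nat t0 tH.
have [x xS xE] := dx_surj t.1 sH; have {xE} xE : dx x = t by rewrite xE -sE; case: (t).
apply/has_iotaP; exists (eq p); rewrite ?eq_lt //; rewrite inE in pS; rewrite pS /=.
apply/has_iotaP; exists x => //; apply/andP; split.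
  by apply/silentP; rewrite ?eq_lt // eqK xE; split=> //; rewrite horizonE.
apply/(stepnP _ _ (ltn_ord a) (mod_nQ x) q'Q kH); rewrite -[(dq _, _)]/(dx x) xE aE.
by have [a' aA' [oE mE]] := astep_mv H; rewrite -aE in oE; rewrite (mkact_inj (ltn_ord a) aA' oE) -mE.
Qed.

Definition dZ x := (z_n B x, dv (z_v B x), dS (z_S B x)).

Lemma dZ_mk n v s : v < B -> s < B -> dZ ((n * B + v) * B + s) = (n, dv v, dS s).
Proof.
move=> vB sB; rewrite /dZ /z_n /z_v /z_S.
rewrite divnMDl ?B_gt0 // (divn_small sB) addn0 divnMDl ?B_gt0 // (divn_small vB) addn0.
by rewrite !modnMDl !modn_small.
Qed.

Lemma mod_B x : x %% B < B. Proof. by rewrite ltn_mod B_gt0. Qed.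

Lemma zRP x y : zR b W g B x y <-> zstep mkTA b ra (dZ x) (dZ y).
Proof.
rewrite /zR; split.
  case/andP=> /eqP nE /has_iotaP[a aA /has_iotaP[k kH /and3P[/all_iotaP H e n]]].
  exists (Ordinal aA), k%:Z; split=> //=.
  - by rewrite horizonE lez_nat.
  - apply/setP=> p; rewrite inE -{2}(eqK p) -postnP ?eq_lt //.
    by have /eqP -> := H _ (eq_lt p).
  - by rewrite mv_reset; apply/eqvnP.
  - exact/evennP.
case=> a [k []]; rewrite horizonE => nE /andP[k0 kH] SE e n.
have [k' kH' kE] := int_nat k0 kH; rewrite {k k0 kH}kE in SE e.
apply/andP; split; first exact/eqP.
apply/has_iotaP; exists a => //; apply/has_iotaP; exists k' => //; apply/and3P; split.
- apply/all_iotaP=> q qQ; rewrite postnP //; apply/eqP.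
  by move/setP/(_ (dq q)): SE; rewrite inE dqK.
- by apply/eqvnP; rewrite mv_reset in e.
- exact/evennP.
Qed.

Lemma dZ_surj x t : x < nZ b W g B -> zstep mkTA b ra (dZ x) t ->
  exists2 y, y < nZ b W g B & dZ y = t.
Proof.
case: t => [[n nu] S] xZ [a [k [/= nE _ _ _ N]]].
have [v vB vE] := dv_surj N; have [s sB sE] := dS_surj S.
exists ((n * B + v) * B + s); last by rewrite dZ_mk // vE sE.
have : n.+1 < (rN b W g).+1.
  by rewrite -nE /z_n !ltn_divLR ?B_gt0.
move=> /ltnW h; have h1 : n * B + v < n.+1 * B by rewrite mulSn; lia.
apply: leq_trans (leq_mul (leq_mul h (leqnn B)) (leqnn B)).
by apply: leq_trans (leq_mul h1 (leqnn B)); rewrite mulSn; lia.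
Qed.

Lemma zconfnP w x : zconfn b W g B w x <-> zconflict mkTA b w (dZ x).
Proof.
have E f := endsnP (z_n B x) (z_S B x) f (mod_B (x %/ B)).
rewrite /zconflict /conflict /zconfn -!E -/(z_v B x).
move: (endsn _ _ _ _ _ _ _ true) (endsn _ _ _ _ _ _ _ false) => F1 F0.
by split=> [/orP[/andP[-> /negP]|/and3P[-> -> /negP]]|[[-> /negP->]|[-> [-> /negP ->]]]];
  rewrite ?orbT; auto.
Qed.

Lemma digit_0 be i : digit be 0 i = 0.
Proof.
rewrite /digit (_ : iter i _ 0 = 0) ?mod0n //.
by elim: i => //= i ->; rewrite div0n.
Qed.

Lemma dv0 : dv 0 = [ffun => 0%R].
Proof. by apply/ffunP=> x; rewrite !ffunE digit_0. Qed.

Lemma dS_start S : all (fun q => bit S q == (satn b W g invs (rini b W g) 0 0 0 &&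
    (q == rpriv b W g (rini b W g) * nL + rini b W g))) (iota 0 nQ) <-> dS S = zstart mkTA.
Proof.
have I : gsat DD [ffun => 0%R] (ta_inv mkTA (ta_init mkTA)) = satn b W g invs (rini b W g) 0 0 0.
  by rewrite -dv0 -mv00 ffunE satnE // valid_inv // rini_lt.
have e : rpriv b W g (rini b W g) * nL + rini b W g =
    eq (ta_init mkTA, ta_init mkTA \in ta_priv mkTA) by rewrite /eq /= inE.
have Z p : (p \in zstart mkTA) = satn b W g invs (rini b W g) 0 0 0 &&
    (p == (ta_init mkTA, ta_init mkTA \in ta_priv mkTA)).
  by rewrite /zstart I; case: satn; rewrite inE.
split=> [/all_iotaP H|H].
  apply/setP=> p; rewrite Z inE (eqP (H _ (eq_lt p))) e.
  by congr (_ && _); apply/eqP/eqP => [/(congr1 dq)|->]; rewrite ?eqK.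
apply/all_iotaP=> q qQ; move/setP/(_ (dq q)): H; rewrite Z inE dqK // e => ->.
apply/eqP; congr (_ && _); apply/eqP/eqP => [<-|->]; rewrite ?dqK ?eqK //.
Qed.

Theorem lostnP w : lostn b W g B w <->
  exists2 y, star (zstep mkTA b ra) (rN b W g, [ffun => 0%R], zstart mkTA) y & zconflict mkTA b w y.
Proof.
have st s : s < B -> dS s = zstart mkTA -> forall t,
   star (zstep mkTA b ra) (rN b W g, [ffun => 0%R], zstart mkTA) t <->
   exists y, [/\ reachb (nZ b W g B) (zR b W g B) (rN b W g * B * B + s) y & dZ y = t].
  move=> sB sE t; rewrite -sE -dv0 -dZ_mk ?B_gt0 // addn0; apply: star_reachb.
  - by move=> x y _ _; apply: zRP.
  - exact: dZ_surj.
  - by rewrite /nZ !mulSn; nia.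
rewrite /lostn; split.
  move=> /has_iotaP[s sB /andP[/dS_start sE /has_iotaP[y yZ /andP[R /zconfnP c]]]].
  by exists (dZ y) => //; apply/(st s) => //; exists y.
case=> t S c; have [s sB sE] := dS_surj (zstart mkTA).
move: S; case/(st s sB sE) => y [R Ey]; have /reachP[_ yZ _] := R.
apply/has_iotaP; exists s => //; apply/andP; split; first exact/dS_start.
apply/has_iotaP; exists y => //; rewrite R /=; apply/zconfnP.
by rewrite Ey.
Qed.

Theorem lostn_opaque (R : realType) w : ~~ lostn b W g B w <->
  (if w then weakly_opaque R mkTA (rN b W g) else fully_opaque R mkTA (rN b W g)).
Proof.
apply: iff_sym; apply: iff_trans (opacity_game R oera_mk mk_invC mk_guardC w (rN b W g)) _.
by split=> [H|/negP H K]; [apply/negP=> /lostnP|apply: H; apply/lostnP].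
Qed.

End Typed.

End DecodedGame.
Import DecodedGame.

(** * Comparing a word with the encoding of a numerical code *)

Module Matching.
From mathcomp Require Import zify.
From mathcomp Require Import boolp classical_sets reals.

Import Order.TTheory GRing.Theory Num.Theory.

Definition bits_of m := if bin_of_nat m is Npos p then pos_bits p else [::].

Lemma bits_ofE m : bits_of m =
  if m == 0 then [::] else (if m %% 2 == 0 then S0 else S1) :: bits_of (m %/ 2).
Proof.
rewrite /bits_of -{2 3 4}[m]bin_of_natK; case: (bin_of_nat m) => //= p.
have p0 q : 0 < nat_of_pos q by elim: q => //= q; lia.
case: p => [q|q|] //=; rewrite ?NatTrec.doubleE.
- rewrite modn2 /= odd_double /= divn2 /= uphalf_double.
  by rewrite -[nat_of_pos q]/(nat_of_bin (Npos q)) nat_of_binK.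
- have := p0 q; rewrite modn2 odd_double divn2 doubleK.
  rewrite -[nat_of_pos q]/(nat_of_bin (Npos q)) nat_of_binK /=.
  by rewrite double_eq0; case: (nat_of_pos q).
Qed.

Lemma halvesE m i : halves m i = m %/ 2 ^ i.
Proof.
by elim: i => [|i IH]; rewrite ?divn1 //= -/(halves m i) IH expnSr divnMA.
Qed.

(** Places beyond the last digit contribute nothing, so a fixed number of rounds serves all numbers
    below [2 ^ n]. *)
Lemma bits_halves n m : m < 2 ^ n ->
  bits_of m = flatten [seq (if m %/ 2 ^ i == 0 then [::] else
     [:: if m %/ 2 ^ i %% 2 == 0 then S0 else S1]) | i <- iota 0 n].
Proof.
elim: n m => [|n IH] m mn; first by rewrite bits_ofE; case: m mn.
rewrite bits_ofE /= divn1; case: eqP => [->|_] /=.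
  rewrite (eq_map (g := fun=> [::])) => [|i]; last by rewrite div0n.
  by elim: (n) 1 => //= k H i; rewrite -H.
congr (_ :: _); rewrite IH ?ltn_divLR -?expnSr //; congr flatten.
rewrite [iota 1 n](iotaDl 1 0) -map_comp; apply/eq_map => i.
by rewrite [RHS]/= add1n expnS divnMA.
Qed.

Lemma bits_of_lt m : m < 2 ^ (size (bits_of m)).
Proof.
elim/ltn_ind: m => m IH; rewrite bits_ofE; case: posnP => [->|m0] //=.
have := IH (m %/ 2); rewrite ltn_Pdiv // => /(_ isT).
by rewrite ltn_divLR // -expnSr.
Qed.

Lemma digit_word (T : finType) (u : seq T) i :
  digit (word_base T) (word_code u) i = nth 0 (map (@letter_code T) u) i.
Proof.
elim: u i => [|s u IH] [|i] /=; rewrite ?digitE ?div0n ?mod0n //.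
  by rewrite divn1 modnMDl modn_small ?letter_code_lt.
by rewrite -IH digitE // expnS divnMA divnMDl  // (divn_small (letter_code_lt s)) addn0.
Qed.

Lemma letter_code_inj (T : finType) : injective (@letter_code T).
Proof. by move=> x y [] /ord_inj /enum_rank_inj. Qed.

Section Matching.
Variables (W : nat) (u : seq sym).
Hypothesis uW : size u < W.
Local Notation c := (word_code u).

(** The meaning of a position: having matched [v] so far, or failure. Each matcher then sends
    [pos v] to [pos (v ++ x)] for the piece [x] it looks for, and failure propagates. *)
Definition pos v := if prefix v u then size v else W.

Lemma prefix_rconsE (v : seq sym) s : prefix (rcons v s) u =
  prefix v u && (nth 0 (map (@letter_code sym) u) (size v) == letter_code s).
Proof.
elim: v u => [|t v IH] [|t' u'] //=; last by rewrite IH andbA.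
  by rewrite prefix0s andbT (inj_eq (@letter_code_inj _)) eq_sym.
Qed.

Lemma eat_pos s v : eat W c (letter_code s) (pos v) = pos (rcons v s).
Proof.
rewrite /eat /pos prefix_rconsE; case: (prefix v u) (@size_prefix _ v u) => [/(_ isT) pv|_]; last by rewrite ltnn.
have vW : size v < W by apply: leq_ltn_trans uW.
by rewrite vW digit_word /= size_rcons; case: ifP.
Qed.

Lemma eat_seq s v : eat W c (letter_code s) (pos v) = pos (v ++ [:: s]).
Proof. by rewrite eat_pos cats1. Qed.

Lemma iter_pos n (F : nat -> nat -> nat) f v :
  (forall j v, j < n -> F j (pos v) = pos (v ++ f j)) ->
  iteri n F (pos v) = pos (v ++ flatten (map f (iota 0 n))).
Proof.
elim: n => [|n IH] H; first by rewrite cats0.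
rewrite iteriS IH => [|j v' jn]; last by apply: H; apply: ltnW.
by rewrite H // -addn1 iotaD map_cat flatten_cat /= cats0 catA.
Qed.

Lemma mU_pos k v : mU W c k (pos v) = pos (v ++ enc_unary k).
Proof.
rewrite /mU (@iter_pos _ _ (fun=> [:: S1])) => [|j v' _]; last exact: eat_seq.
rewrite /csep eat_seq -catA; congr (pos (_ ++ (_ ++ _))).
by elim: k 0 => //= k IH j; rewrite IH.
Qed.

Lemma mbin_pos m v : m < 2 ^ W -> mbin W c m (pos v) = pos (v ++ enc_bin m).
Proof.
move=> mW; rewrite /mbin; set f := fun i => if m %/ 2 ^ i == 0 then [::] else
     [:: if m %/ 2 ^ i %% 2 == 0 then S0 else S1].
rewrite (@iter_pos _ _ f) => [|j v' _].
  by rewrite /csep eat_seq -catA -bits_halves.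
rewrite halvesE /f; case: ifP => _; first by rewrite cats0.
by case: ifP => _; exact: eat_seq.
Qed.

Definition xint sg m := (if sg == 0 then S0 else S1) :: enc_bin m.

Lemma mint_pos sg m v : m < 2 ^ W -> mint W c sg m (pos v) = pos (v ++ xint sg m).
Proof.
move=> mW; rewrite /mint /xint -cat1s catA -mbin_pos //.
by case: ifP => _; rewrite -eat_seq.
Qed.

Definition xseq (s : seq (seq sym)) := Open :: flatten s ++ [:: Close].

Lemma seq_pos n F f v : (forall j v, j < n -> F j (pos v) = pos (v ++ f j)) ->
  eat W c cclose (iteri n F (eat W c copen (pos v))) = pos (v ++ xseq (map f (iota 0 n))).
Proof.
by move=> H; rewrite /copen eat_seq (iter_pos _ H) /cclose eat_seq -!catA.
Qed.

Definition xcon (y : nat * nat * nat * nat) :=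
  let: (x, o, sg, m) := y in enc_unary x ++ enc_unary o ++ xint sg m.

Variable g : nat.
Notation b := (2 ^ W).

Lemma b_gt0 : 0 < b. Proof. by rewrite expn_gt0. Qed.

Definition con t i j := (rx b W g t i j, rop b W g t i j, rsg b W g t i j, rmag b W g t i j).
Definition xguard t i := xseq [seq xcon (con t i j) | j <- iota 0 (rcnt b W g t i)].

Lemma mguard_pos t i v : mguard b W g c t i (pos v) = pos (v ++ xguard t i).
Proof.
rewrite /mguard /xguard; apply: seq_pos => j v' _.
by rewrite !mU_pos mint_pos ?fld_lt ?b_gt0 // /xcon /= -!catA.
Qed.

Definition xset n (p : pred nat) := xseq [seq (if p l then enc_unary l else [::]) | l <- iota 0 n].

Lemma mset_pos n (p : pred nat) v :
  eat W c cclose (iteri n (fun l q => if p l then mU W c l q else q) (eat W c copen (pos v)))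
  = pos (v ++ xset n p).
Proof.
by apply: seq_pos => j v' _; case: ifP => _; rewrite ?mU_pos ?cats0.
Qed.

Definition xact a := if a == 0 then [:: S0] else S1 :: enc_unary a.-1.
Definition xreset a := xseq (if a == 0 then [::] else [:: enc_unary (rclk b W g a.-1)]).
Definition xedge e := enc_unary (rsrc b W g e) ++ xguard guards e ++ xact (ract b W g e) ++
  xreset (ract b W g e) ++ enc_unary (rtgt b W g e).

Lemma medge_pos e v : medge b W g c e (pos v) = pos (v ++ xedge e).
Proof.
rewrite /medge mU_pos mguard_pos /xedge /xact /xreset /mact /mreset.
case: (ract _ _ _ _) => [|a]; rewrite /c0 /c1 /copen /cclose !(eat_seq, mU_pos);
  move: (xguard _ _) enc_unary => G E; by rewrite /xseq /= -?catA /= ?cats0 -?catA.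
Qed.

Definition xall := enc_unary (nA b W g) ++ enc_unary (nL b W g) ++ enc_unary (nA b W g) ++
  enc_unary (rini b W g) ++ xset (nL b W g) (rpriv b W g) ++ xset (nL b W g) (rfin b W g) ++
  xseq [seq xguard invs l | l <- iota 0 (nL b W g)] ++ xseq [seq xedge e | e <- iota 0 (nE b W g)] ++
  enc_bin (rN b W g).

Lemma matchesP : reflect (u = xall) (matches b W g c).
Proof.
have -> : matches b W g c = (pos xall < W) && (digit (word_base sym) c (pos xall) == 0).
  rewrite /matches; suff -> : mall b W g c = pos xall by [].
  have e0 : pos [::] = 0 by rewrite /pos prefix0s.
  rewrite /mall -[X in mU _ _ (nL _ _ _) (mU _ _ _ X)]e0.
  rewrite !mU_pos /mpriv mset_pos /mfin mset_pos /minvs /medges.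
  rewrite (seq_pos _ (fun l v _ => mguard_pos invs l v)) (seq_pos _ (fun l v _ => medge_pos l v)).
  by rewrite mbin_pos ?fld_lt ?b_gt0 // /xall -!catA.
rewrite /pos digit_word; apply: (iffP andP) => [|<-]; last first.
  by rewrite prefix_refl nth_default ?size_map.
case: ifP => [/prefixP[s E]|_] []; last by rewrite ltnn.
(* Codes of letters are positive, so the digit 0 here says that nothing follows the prefix. *)
move=> _; rewrite {1}E map_cat nth_cat size_map ltnn subnn.
by case: s E => [|s s'] //= ->; rewrite cats0.
Qed.

End Matching.

(** * The numerical codes of instances *)

Definition quad (n : nat) (y : constraint 'I_n) : nat * nat * nat * nat :=
  (nat_of_ord y.1.1, nat_of_cmp y.1.2, if y.2 is Posz _ then 0 else 1, `|y.2|%N).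

Definition act_code (n : nat) (o : option 'I_n) := if o is Some a then a.+1 else 0.

Section Describes.
Variables (W g k n : nat) (A : TA 'I_k 'I_n 'I_k) (N : nat) (x : 'I_k -> 'I_k).
Local Notation b := (2 ^ W).

Definition describes_guard t i (G : guard 'I_k) :=
  map (@quad k) G = [seq con W g t i j | j <- iota 0 (rcnt b W g t i)].

Definition describes_edge e (E : edge 'I_k 'I_n 'I_k) :=
  [/\ rsrc b W g e = esrc E, rtgt b W g e = etgt E, describes_guard guards e (eguard E),
      ract b W g e = act_code (eact E)
    & ereset E = if eact E is Some a then finset.set1 (x a) else finset.set0].

Definition describes :=
  [/\ [/\ nA b W g = k, nL b W g = n, rini b W g = ta_init A & rN b W g = N],
      forall a : 'I_k, rclk b W g a = x a,
      forall l : 'I_n, rpriv b W g l = (l \in ta_priv A) /\ rfin b W g l = (l \in ta_final A),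
      forall l : 'I_n, describes_guard invs l (ta_inv A l)
    & exists2 f, ta_edges A = map f (iota 0 (nE b W g))
        & forall e, e < nE b W g -> describes_edge e (f e)].

Lemma xguard_enc t i G : describes_guard t i G -> xguard W g t i = enc_guard G.
Proof.
move=> H; rewrite /xguard /enc_guard /enc_seq /xseq; congr (_ :: flatten _ ++ _).
rewrite map_comp -H -map_comp; apply/eq_map => -[[y o] d] /=.
by rewrite /xint; case: d.
Qed.

Lemma xset_enc (P : {set 'I_n}) (p : pred nat) : (forall l : 'I_n, p l = (l \in P)) ->
  xset n p = enc_set P.
Proof.
move=> pP; rewrite /xset /enc_set /enc_seq /xseq; congr (_ :: _ ++ _).
rewrite -val_enum_ord -map_comp /enum_mem -enumT.
elim: (enum 'I_n) => //= l s ->.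
by rewrite pP; case: ifP => // ->.
Qed.

Lemma xall_encode : describes -> xall W g = encode (Instance A N).
Proof.
case=> [[kE nE iE NE] xE pfE invE [f fE edE]].
rewrite encodeE /xall kE nE iE NE (@xset_enc (ta_priv A)) => [|l]; last by case: (pfE l).
rewrite (@xset_enc (ta_final A)) => [|l]; last by case: (pfE l).
do 6![congr (_ ++ _)]; congr (_ ++ (_ ++ _)).
  rewrite /xseq /enc_seq -map_comp -val_enum_ord -map_comp; congr (_ :: flatten _ ++ _).
  by apply/eq_map => l /=; apply: xguard_enc.
rewrite /xseq /enc_seq fE -map_comp; congr (_ :: flatten _ ++ _).
apply/eq_in_map => e; rewrite mem_iota /= => /edE[sE tE gE aE rE].
rewrite /xedge /enc_edge sE tE (xguard_enc gE) aE rE; do 2![congr (_ ++ _)].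
case: (eact (f e)) => [a|] /=.
  by rewrite /xreset /= xE /enc_set enum_set1 /enc_seq /= cats0 -!catA.
by rewrite /xreset /= /enc_set enum_set0.
Qed.

End Describes.

End Matching.
Import Matching.

(** * Every valid code describes an automaton, and every oERA has a code *)

Module Decoding.
From mathcomp Require Import zify.
From mathcomp Require Import boolp classical_sets reals.

Import Order.TTheory GRing.Theory Num.Theory.

Section Decode.
Variables W g : nat.
Local Notation b := (2 ^ W).
Hypothesis ok : valid b W g.

Lemma mkguard_describes t i : validg b W g t i -> describes_guard W g t i (mkguard b W g t i).
Proof.
case/andP=> _ /all_iotaP H; rewrite /describes_guard /mkguard.
have {H} : all (fun j => [&& rx b W g t i j < nA b W g, rop b W g t i j < 5, rsg b W g t i j < 2
   & (rsg b W g t i j == 1) ==> (0 < rmag b W g t i j)]) (iota 0 (rcnt b W g t i)).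
  exact/all_iotaP.
elim: (iota _ _) => //= j s IH /andP[/and4P[xA o5 s2 m0] /IH {}IH].
rewrite [mkcon _ _ _ _ _ j]/mkcon insubT /= IH; congr (_ :: _); rewrite /con /quad /=.
congr (_, _, _, _).
- by case: (rop b W g t i j) o5 => [|[|[|[|[|o]]]]].
- by rewrite /int_of; case: (rsg b W g t i j) s2 => [|[|sg]].
- by rewrite /int_of; case: (rsg b W g t i j) s2 m0 => [|[|sg]] //= _; case: (rmag _ _ _ _ _ _).
Qed.

Lemma mkTA_describes : describes W g (mkTA ok) (rN b W g)
  (fun a => Ordinal (valid_clk ok (ltn_ord a))).
Proof.
split=> //.
- by move=> l; rewrite !inE.
- by move=> l; rewrite ffunE; apply: mkguard_describes; apply: valid_inv.
exists (mkedge ok) => // e eE; have [vg sL tL aA] := valid_edge ok eE.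
split; rewrite /= ?ordLE //.
- exact: mkguard_describes.
- by case: (ract b W g e) aA => //= a aA; rewrite insubT.
case: (ract b W g e) aA => [_|a aA] /=; first by apply/setP=> y; rewrite !inE.
by rewrite insubT; apply/setP=> y; rewrite !inE.
Qed.

End Decode.

Lemma mem_size_flatten (T : eqType) (S : Type) (f : T -> seq S) x s :
  x \in s -> size (f x) <= size (flatten (map f s)).
Proof.
elim: s => //= y s IH; rewrite inE size_cat => /orP[/eqP<-|/IH]; first exact: leq_addr.
by move=> h; apply: leq_trans h (leq_addl _ _).
Qed.

Lemma size_enc_seq_mem (T : eqType) (f : T -> seq sym) x s : x \in s ->
  size (f x) < size (enc_seq f s).
Proof.
move=> /(mem_size_flatten f) h; rewrite /enc_seq /= size_cat addn1; lia.
Qed.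

Lemma size_enc_seq (T : Type) (f : T -> seq sym) s : (forall x, 0 < size (f x)) ->
  size s < size (enc_seq f s).
Proof.
move=> f0; rewrite /enc_seq /= size_cat addn1; suff : size s <= size (flatten (map f s)) by lia.
by elim: s => //= x s IH; rewrite size_cat; have := f0 x; lia.
Qed.

Lemma size_enc_unary n : size (enc_unary n) = n.+1.
Proof. by rewrite size_cat size_nseq addn1. Qed.

Lemma enc_bin_lt m : m < 2 ^ size (enc_bin m).
Proof.
apply: leq_trans (bits_of_lt m) _; rewrite leq_exp2l // /enc_bin size_cat; exact: leq_addr.
Qed.

Lemma enc_constraint_lt n (y : constraint 'I_n) : `|y.2|%N < 2 ^ size (enc_constraint y).
Proof.
case: y => [[y o] d] /=; apply: leq_trans (enc_bin_lt _) _; rewrite leq_exp2l //.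
by rewrite /enc_int; move: (enc_bin _) => B; rewrite !size_cat /=; lia.
Qed.

Section Encode.
Variables (W k n : nat) (A : TA 'I_k 'I_n 'I_k) (N : nat) (x : 'I_k -> 'I_k).
Local Notation b := (2 ^ W).
Hypothesis sizeW : size (encode (Instance A N)) < W.
Hypothesis xinj : injective x.
Hypothesis resetx : forall e, e \in ta_edges A ->
  ereset e = if eact e is Some a then finset.set1 (x a) else finset.set0.

(** Listed items take at least one symbol and unary numbers as many symbols as their value, so
    counts are below the length of the encoding; binary numbers are below 2 to that length. *)
Let szs : [/\ k < W, n < W, size (ta_edges A) < W, N < b & 5 < W] /\
  ((forall l, size (enc_guard (ta_inv A l)) < W) /\ (forall e, e \in ta_edges A -> size (enc_edge e) < W)).
Proof.
move: sizeW (size_enc_unary k) (size_enc_unary n) (enc_bin_lt N); rewrite encodeE.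
move: (enc_unary k) (enc_unary n) (enc_bin N) => Ek En EN; rewrite !size_cat => H sk sn NB.
have ed : size (ta_edges A) < size (enc_seq (@enc_edge k n k) (ta_edges A)).
  apply: size_enc_seq => e; by rewrite /enc_edge size_cat size_enc_unary.
have s2 (S : {set 'I_n}) : 1 < size (enc_set S) by rewrite /= size_cat addn1.
have := s2 (ta_priv A); have := s2 (ta_final A) => h1 h2.
have gW : size (enc_seq (@enc_guard k) [seq ta_inv A l | l <- enum 'I_n]) < W by lia.
have eW : size (enc_seq (@enc_edge k n k) (ta_edges A)) < W by lia.
split.
  split; try lia.
  by apply: leq_trans NB _; rewrite leq_exp2l //; lia.
split=> [l|e eA].
  have : ta_inv A l \in [seq ta_inv A l0 | l0 <- enum 'I_n] by rewrite map_f // mem_enum.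
  by move/(size_enc_seq_mem (@enc_guard k)) => h; apply: ltn_trans h gW.
exact: ltn_trans (size_enc_seq_mem (@enc_edge k n k) eA) eW.
Qed.

Let guard_of (G : guard 'I_k) t j := let y := nth (0, 0, 0, 0) (map (@quad k) G) j in
  nth 0 [:: y.1.1.1; y.1.1.2; y.1.2; y.2] t.

Let e0 : edge 'I_k 'I_n 'I_k := Edge (ta_init A) [::] None finset.set0 (ta_init A).
Let ed i := nth e0 (ta_edges A) i.
Let inv i : guard 'I_k := if insub i is Some l then ta_inv A l else [::].

Let data t i j := match t with
  | 0 => nth 0 [:: k; n; nat_of_ord (ta_init A); N; size (ta_edges A)] j
  | 1 => if insub i is Some l then nth 0 [:: nat_of_bool (l \in ta_priv A); nat_of_bool (l \in ta_final A)] j else 0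
  | 2 => size (inv i)
  | 7 => size (eguard (ed i))
  | 12 => nth 0 [:: nat_of_ord (esrc (ed i)); nat_of_ord (etgt (ed i)); act_code (eact (ed i))] j
  | 13 => if insub i is Some a then x a : nat else 0
  | _ => if t < 7 then guard_of (inv i) (t - 3) j else guard_of (eguard (ed i)) (t - 8) j
  end.

(** With [W] above the length of the encoding, indices are below [W] and all data below [b = 2 ^ W],
    so they can be prescribed as the digits of one number. *)
Lemma encode_valid : exists2 g, g < b ^ (14 * W * W) & valid b W g /\ describes W g A N x.
Proof.
have [[kW nW eW NB W5] [invW edW]] := szs.
have Wb m : m < W -> m < b by move=> mW; apply: ltn_trans mW (ltn_expl _ _).
have b0 : 0 < b by apply: Wb; lia.
(* There are 14 rows of [W * W] entries. Reduction modulo [b] makes every prescribed entry a digit;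
   the entries that get read are already below [b]. *)
have [g gB gE] := @digit_surj b (14 * W * W)
  (fun i => data (i %/ W %/ W) (i %/ W %% W) (i %% W) %% b) b0 (fun i _ => ltn_pmod _ b0).
exists g => //.
have fE t i j : t < 14 -> i < W -> j < W -> fld b W g t i j = data t i j %% b.
  move=> t14 iW jW; rewrite /fld gE.
    rewrite !modnMDl !divnMDl ?(modn_small jW) ?(divn_small jW) ?addn0; try lia.
    by rewrite modnMDl divnMDl ?(modn_small iW) ?(divn_small iW) ?addn0; try lia.
  have : t * W + i < 14 * W by nia.
  by move=> h; nia.
have kb : k < b by exact: Wb.
have small m : m < W -> m %% b = m by move=> mW; apply/modn_small/Wb.
have fS t i : t < 14 -> i < W -> fld b W g t i 0 = data t i 0 %% b.
  by move=> ? ?; apply: fE => //; lia.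
have NE : nE b W g = size (ta_edges A) by rewrite /nE fE ?small //; lia.
have NL : nL b W g = n by rewrite /nL fE ?small //; lia.
have NA : nA b W g = k by rewrite /nA fE ?small //; lia.
have gd t i (G : guard 'I_k) : size (enc_guard G) < W ->
   (forall j, j < W -> con W g t i j = let y := nth (0, 0, 0, 0) (map (@quad k) G) j in
      (y.1.1.1 %% b, y.1.1.2 %% b, y.1.2 %% b, y.2 %% b)) ->
   rcnt b W g t i = size G %% b ->
   describes_guard W g t i G /\ validg b W g t i.
  move=> GW cE rE.
  have sG : size G < W.
    apply: ltn_trans GW; apply: size_enc_seq => -[[y o] d].
    by rewrite size_cat size_enc_unary.
  rewrite modn_small in rE; last exact: Wb.
  have qE j : j < size G -> exists2 z : constraint 'I_k,
      nth (0, 0, 0, 0) (map (@quad k) G) j = quad z & con W g t i j = quad z.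
    move=> jG; have /mapP[z zG zE] : nth (0, 0, 0, 0) (map (@quad k) G) j \in map (@quad k) G.
      by rewrite mem_nth ?size_map.
    exists z => //; rewrite cE ?(ltn_trans jG) //= zE.
    have zb : `|z.2|%N < b.
      apply: leq_trans (enc_constraint_lt z) _; rewrite leq_exp2l //.
      by apply/ltnW/(ltn_trans (size_enc_seq_mem (@enc_constraint k) zG)).
    have [ob sb] : nat_of_cmp z.1.2 < b /\ (if z.2 is Posz _ then 0 else 1) < b.
      by have := Wb 5 W5; split; [case: (z.1.2) => /=; lia|case: (z.2) => _; lia].
    by rewrite /quad !modn_small // (ltn_trans (ltn_ord _)).
  split.
    rewrite /describes_guard rE; apply: (@eq_from_nth _ (0, 0, 0, 0)); rewrite !size_map ?size_iota //.
    move=> j jG; rewrite [RHS](nth_map 0) ?size_iota // nth_iota // add0n.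
    by case: (qE j jG) => z -> ->.
  rewrite /validg rE ltnW //; apply/all_iotaP => j /qE[[[y o] d] _ [-> -> -> ->]].
  by rewrite NA /= ltn_ord; case: o; case: d.
have NI : rini b W g = ta_init A.
  by rewrite /rini fE ?small /= //; try lia; apply: ltn_trans (ltn_ord _) nW.
have invG (l : 'I_n) : describes_guard W g invs l (ta_inv A l) /\ validg b W g invs l.
  have lW : l < W by apply: ltn_trans (ltn_ord l) nW.
  have il : inv l = ta_inv A l by rewrite /inv valK.
  apply: gd => [|j jW|]; first exact: invW.
    by rewrite /con /rx /rop /rsg /rmag !fE //= /guard_of il.
  by rewrite /rcnt fS //= il.
have edG e : e < size (ta_edges A) ->
    describes_edge W g x e (ed e) /\ [/\ validg b W g guards e, rsrc b W g e < n,
       rtgt b W g e < n & ract b W g e <= k].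
  move=> eE; have eW' : e < W by apply: ltn_trans eE eW.
  have edA : ed e \in ta_edges A by rewrite mem_nth.
  have [G1 G2] : describes_guard W g guards e (eguard (ed e)) /\ validg b W g guards e.
    apply: gd => [|j jW|].
    - apply: leq_ltn_trans (edW _ edA); rewrite /enc_edge !size_cat; lia.
    - by rewrite /con /rx /rop /rsg /rmag !fE //= /guard_of.
    by rewrite /rcnt fS.
  have srcE : rsrc b W g e = esrc (ed e).
    by rewrite /rsrc fS //= small // (ltn_trans (ltn_ord _)).
  have tgtE : rtgt b W g e = etgt (ed e).
    by rewrite /rtgt fE //= ?small // ?(ltn_trans (ltn_ord _)) //; lia.
  have ak : act_code (eact (ed e)) <= k by case: (eact _) => //= a; apply: ltn_ord.
  have actE : ract b W g e = act_code (eact (ed e)).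
    by rewrite /ract fE //= ?small //; [apply: leq_ltn_trans kW|lia].
  split; first by split=> //; apply: resetx.
  by split=> //; rewrite ?srcE ?tgtE ?actE ?ltn_ord.
have clkE (a : 'I_k) : rclk b W g a = x a.
  by rewrite /rclk fS //= ?valK ?small // (ltn_trans (ltn_ord _)).
split.
  rewrite /valid NL NA NE (ltnW nW) (ltnW kW) (ltnW eW) NI ltn_ord /=; apply/and3P; split; apply/all_iotaP.
  - by move=> l ln; have [] := invG (Ordinal ln).
  - by move=> e /edG[_ [-> -> -> ->]].
  - move=> a ak; rewrite (clkE (Ordinal ak)) ltn_ord; apply/all_iotaP => a' ak'.
    rewrite (clkE (Ordinal ak')); apply/implyP => /eqP /val_inj /xinj /(congr1 val) /= ->.
    exact: eqxx.
split=> //.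
- by split=> //; rewrite /rN fE /= ?modn_small //; lia.
- move=> l; have lW : l < W by apply: ltn_trans (ltn_ord l) nW.
  rewrite /rpriv /rfin !fE //=; try lia.
  by rewrite valK /= !small ?lt0b //; apply: leq_ltn_trans (leq_b1 _) _; lia.
- by move=> l; case: (invG l).
exists ed => [|e]; last by rewrite NE => /edG[].
by rewrite NE -[LHS](mkseq_nth e0).
Qed.

End Encode.

End Decoding.
Import Decoding.

(** * Membership in PSPACE *)

Module Membership.
From mathcomp Require Import zify.
From mathcomp Require Import boolp classical_sets reals.

Import Order.TTheory GRing.Theory Num.Theory.

Definition opacity (R : realType) (w : bool) (i : instance) :=
  if w then weakly_opaque R (inst_ta i) (inst_N i) else fully_opaque R (inst_ta i) (inst_N i).

Definition opacity_lang (R : realType) w : set (seq sym) :=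
  (encode @` [set i | is_oERA (inst_ta i) /\ opacity R w i])%classic.

Lemma oERA_square k n m (A : TA 'I_k 'I_n 'I_m) : is_oERA A -> m = k.
Proof. by case=> x /bij_eq_card; rewrite !card_ord. Qed.

Lemma size_bits_word (u : seq sym) L : word_code u < 2 ^ L -> size u <= L.
Proof.
have h : 2 ^ size u <= (word_code u).+1.
  elim: u => //= s u IH; rewrite expnS /letter_code.
  have b2 : 1 < word_base sym by rewrite ltnS; apply/card_gt0P; exists S0.
  have := leq_mul2l (word_code u) 2 (word_base sym); rewrite b2 orbT => h2.
  apply: (@leq_trans (word_code u * 2 + 1).+1); first by rewrite mul2n; lia.
  by rewrite ltnS leq_add.
by move=> uL; rewrite -(leq_exp2l (m := 2)) //; apply: leq_trans uL.
Qed.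

Section Decide.
Variable L : nat -> nat.
Hypothesis LP : forall x, x < 2 ^ L x.

Definition decide (w : bool) c := let W := L c + 6 in
  has (fun g => [&& valid (2 ^ W) W g, matches (2 ^ W) W g c
       & ~~ lostn (2 ^ W) W g (2 ^ ((2 * W + 3) * W)) w]) (iota 0 (2 ^ (W * (14 * W * W)))).

Lemma bounds W g : 5 < W -> valid (2 ^ W) W g ->
  rV (2 ^ W) W g ^ nA (2 ^ W) W g <= 2 ^ ((2 * W + 3) * W) /\
  2 ^ nQ (2 ^ W) W g <= 2 ^ ((2 * W + 3) * W).
Proof.
move=> W6 /andP[nLW /andP[nAW _]]; split; last by rewrite leq_exp2l // /nQ; nia.
have h1 : W < 2 ^ W by apply: ltn_expl.
have h : rV (2 ^ W) W g <= 2 ^ (2 * W + 3).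
  rewrite /rV /rD (_ : 2 * W + 3 = W + W + 3) ?expnD; last by lia.
  move: h1 nAW; move: (2 ^ W) (nA _ _ _) => B a WB aW.
  have : B.+1 * (2 * a.+1) <= B.+1 * (2 * B) by rewrite leq_mul2l leq_mul2l /=; lia.
  nia.
apply: (@leq_trans ((2 ^ (2 * W + 3)) ^ nA (2 ^ W) W g)); first exact: leq_exp2r_weak.
by rewrite -expnM leq_exp2l // leq_mul2l nAW orbT.
Qed.

Lemma decideP (R : realType) w u : decide w (word_code u) <-> opacity_lang R w u.
Proof.
rewrite /decide; set W := _ + 6.
have uW : size u < W by rewrite /W addnS ltnS; apply: leq_trans (size_bits_word (LP _)) _; apply: leq_addr.
have b0 : 0 < 2 ^ W by rewrite expn_gt0.
have W6 : 5 < W by rewrite /W; lia.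
clearbody W.
have key g (ok : valid (2 ^ W) W g) : ~~ lostn (2 ^ W) W g (2 ^ ((2 * W + 3) * W)) w <->
   opacity R w (Instance (mkTA ok) (rN (2 ^ W) W g)).
  by have [BV BQ] := bounds W6 ok; exact: (lostn_opaque b0 ok BV BQ R w).
split.
  case/has_iotaP=> g _ /and3P[ok /(matchesP uW) uE lo].
  exists (Instance (mkTA ok) (rN (2 ^ W) W g)).
    by split; [exact: is_oERA_mk|apply/key].
  by rewrite uE; apply/esym/xall_encode/mkTA_describes.
case=> -[k n m A N] [/= oA opq] uE; have E := oERA_square oA; subst m.
case: (oA) => x /bij_inj xinj resetx.
rewrite -uE in uW *.
have [|g gB [ok dg]] := @encode_valid W k n A N x uW xinj.
  by move=> e /resetx; case: (eact e).
apply/has_iotaP; exists g; first by rewrite expnM.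
have xE := xall_encode dg; have xE' := xall_encode (mkTA_describes ok).
apply/and3P; split=> //; first exact/(matchesP uW)/esym.
(* The automaton decoded from [g] has the same encoding as the given instance and hence is that
   instance. *)
by apply/(key g ok); move: xE'; rewrite xE => /encode_inj <-.
Qed.

End Decide.

Lemma psb_search b W B G c w : ps b -> ps W -> ps B -> ps G -> ps c ->
  psb (fun env => has (fun g => [&& valid (b env) (W env) g, matches (b env) (W env) g (c env)
       & ~~ lostn (b env) (W env) g (B env) w]) (iota 0 (G env))).
Proof. by intros; ps_auto. Qed.

(** The search ranges and bases are powers of two with exponents polynomial in the bit length of the
    code; establishing that these exponents are [small] is what remains. *)
Theorem opacity_in_PSPACE (R : realType) w : in_PSPACE (opacity_lang R w).
Proof.
have [L [pL LP Lle]] := ps_bits.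
have sL : small (fun env => L (vr 0 env)).
  by exists id; [exact: poly_id|move=> N env bN; apply: Lle; apply: below_nth].
have sW : small (fun env => L (vr 0 env) + 6) by apply: small_add sL (small_const 6).
have sB : small (fun env => (2 * (L (vr 0 env) + 6) + 3) * (L (vr 0 env) + 6)).
  exact (small_mul (small_add (small_mul (small_const 2) sW) (small_const 3)) sW).
have sG : small (fun env => (L (vr 0 env) + 6) * (14 * (L (vr 0 env) + 6) * (L (vr 0 env) + 6))).
  exact (small_mul sW (small_mul (small_mul (small_const 14) sW) sW)).
apply: (@psb_in_PSPACE _ (decide L w)); last by move=> u; apply: decideP.
have pW : ps (fun env => L (vr 0 env) + 6) by ps_auto.
have pB : ps (fun env => (2 * (L (vr 0 env) + 6) + 3) * (L (vr 0 env) + 6)).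
  exact (ps_mul (ps_add (ps_mul (ps_const 2) pW) (ps_const 3)) pW).
have pG : ps (fun env => (L (vr 0 env) + 6) * (14 * (L (vr 0 env) + 6) * (L (vr 0 env) + 6))).
  exact (ps_mul pW (ps_mul (ps_mul (ps_const 14) pW) pW)).
exact (psb_search w (small_ps_pow2 pW sW) pW (small_ps_pow2 pB sB) (small_ps_pow2 pG sG) (ps_var 0)).
Qed.

End Membership.
Import Membership.

(** * An oERA simulating a machine in bounded space *)

Module Reduction.
From mathcomp Require Import zify lra.
From mathcomp Require Import boolp classical_sets reals.

Import Order.TTheory GRing.Theory Num.Theory.

Definition bool_of_move m := match m with MoveL => Some false | Stay => None | MoveR => Some true end.
Definition move_of_bool o := match o with Some false => MoveL | None => Stay | Some true => MoveR end.
Lemma bool_of_moveK : cancel bool_of_move move_of_bool. Proof. by case. Qed.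
HB.instance Definition _ := Finite.copy move (can_type bool_of_moveK).

(** * The cells of a tape *)

Section Tape.
Variable G : Type.
Implicit Types (tp : tape G) (h p : nat).

(** Contents in absolute coordinates, with the head at position [h]: unlike the stored halves of the
    tape, they stay put when the head moves. *)
Definition cell tp h p :=
  if p < h then nth None (tape_left tp) (h - p.+1)
  else if p == h then tape_head tp else nth None (tape_right tp) (p - h.+1).

Definition moved mv h := match mv with MoveL => h.-1 | Stay => h | MoveR => h.+1 end.

Lemma cell_act tp (a : option G * move) h p : 0 < h ->
  cell (tape_act tp a) (moved a.2 h) p = if p == h then a.1 else cell tp h p.
Proof.
case: h a tp => // h [b mv] [l x r] _; rewrite /cell; case: mv => /=.
- case: ltngtP => ph.
  + have -> : (p < h.+1) = true by lia.
    have -> : (p == h.+1) = false by lia.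
    by rewrite nth_behead; congr nth; lia.
  + have -> : (p < h.+1) = false by lia.
    case: eqP => [->|ne]; first by rewrite subnn.
    by rewrite (_ : p - h.+1 = (p - h.+2).+1) //; lia.
  + have -> : (p < h.+1) = true by lia.
    have -> : (p == h.+1) = false by lia.
    by rewrite ph subnn nth0.
- by case: ltngtP.
- case: ltngtP => ph.
  + rewrite ltnS in ph; case: eqP => [->|ne]; first by rewrite subnn.
    have -> : (p < h.+1) = true by lia.
    by have -> : h.+2 - p.+1 = (h.+1 - p.+1).+1 by lia.
  + have -> : (p < h.+1) = false by lia.
    have -> : (p == h.+1) = false by lia.
    by rewrite nth_behead; congr nth; lia.
  + have -> : (p < h.+1) = false by lia.
    have -> : (p == h.+1) = false by lia.
    by rewrite ph subnn nth0.
Qed.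

End Tape.

Section Reduction.
Variables (G : finType) (M : TM G) (u : seq G) (s : nat).
Hypothesis space : forall t, tm_space (tm_run M t u) <= s.
Local Notation K := (tm_aux M).
Local Notation heads := {ffun 'I_K.+1 -> option G}.
Local Notation acts := {ffun 'I_K.+1 -> option G * move}.

(* A step of the machine takes two rotations through the cells: the first one
   gathers the scanned symbols, the second one performs the actions. *)
Definition ctl := (tm_state M * (heads + acts))%type.
Implicit Types (f : ctl) (h : nat -> nat) (x : option G).

(** Heads start at position [s]; as at most [s] cells are in use, they remain among the positions 1
    to [2 * s] of a tape with [P] cells. *)
Definition P := 2 * s + 1.
Definition Q := P.+1.
Definition m := K.+1 * P.
Definition gC := #|{: option G}|.

Definition hcode h := foldr (fun i a => a * Q + h i) 0 (iota 0 K.+1).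
(** Numbers up to [m] are kept for the initial phase, which writes the input. Otherwise [c] is the
    next cell to visit, and [c = m] the end of a rotation. *)
Definition locnum f h c := m.+1 + ((enum_rank f * Q ^ K.+1 + hcode h) * m.+1 + c).
Definition nloc := m.+1 + #|{: ctl}| * Q ^ K.+1 * m.+1.
Definition nclk := m * gC.

Lemma P_gt0 : 0 < P. Proof. by rewrite /P addn1. Qed.
Lemma gC_gt0 : 0 < gC. Proof. by apply/card_gt0P; exists None. Qed.
Lemma m_gt0 : 0 < m. Proof. by rewrite muln_gt0 P_gt0. Qed.
Lemma nclk_gt0 : 0 < nclk. Proof. by rewrite muln_gt0 m_gt0 gC_gt0. Qed.

Definition loc v : 'I_nloc := insubd (Ordinal (ltn_addr _ (ltn0Sn m) : 0 < nloc)) v.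
Definition clk j x : 'I_nclk := insubd (Ordinal nclk_gt0) (j * gC + enum_rank x).

Lemma locE v : v < nloc -> loc v = v :> nat.
Proof. by move=> vL; rewrite val_insubd vL. Qed.

Lemma rank_lt x : enum_rank x < gC. Proof. exact: ltn_ord. Qed.

Lemma clkE j x : j < m -> clk j x = j * gC + enum_rank x :> nat.
Proof.
move=> jm; rewrite val_insubd; have := rank_lt x; rewrite /nclk => xC.
by rewrite ifT //; nia.
Qed.

Lemma clk_inj j x j' x' : j < m -> j' < m -> clk j x = clk j' x' -> j = j' /\ x = x'.
Proof.
move=> jm j'm /(congr1 val) /=; rewrite !clkE // => E.
have := congr1 (divn ^~ gC) E; have := congr1 (modn ^~ gC) E.
rewrite /= !modnMDl !divnMDl ?gC_gt0 // !modn_small ?rank_lt // !divn_small ?rank_lt // !addn0.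
by move=> /val_inj /enum_rank_inj.
Qed.

Lemma hcode_lt h : (forall i, i < K.+1 -> h i < Q) -> hcode h < Q ^ K.+1.
Proof.
move=> hQ; rewrite /hcode -{2}(size_iota 0 K.+1).
have : all (fun i => h i < Q) (iota 0 K.+1) by apply/allP=> i; rewrite mem_iota; apply: hQ.
elim: (iota _ _) => //= i l IH /andP[hi /IH]; rewrite expnS; nia.
Qed.

Lemma hcode_inj h h' : (forall i, i < K.+1 -> h i < Q) -> (forall i, i < K.+1 -> h' i < Q) ->
  hcode h = hcode h' -> forall i, i < K.+1 -> h i = h' i.
Proof.
move=> hQ h'Q; rewrite /hcode => E i iK.
have : i \in iota 0 K.+1 by rewrite mem_iota.
have : all (fun i => h i < Q) (iota 0 K.+1) by apply/allP=> j; rewrite mem_iota; apply: hQ.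
have : all (fun i => h' i < Q) (iota 0 K.+1) by apply/allP=> j; rewrite mem_iota; apply: h'Q.
elim: (iota _ _) E => //= j l IH E /andP[h'j h'l] /andP[hj hl].
have := congr1 (divn ^~ Q) E; have := congr1 (modn ^~ Q) E.
rewrite /= !modnMDl !divnMDl // !modn_small // !divn_small // !addn0 inE => E1 E2.
by case: eqP => [-> //|_] /=; apply: IH.
Qed.

Lemma locnum_lt f h c : (forall i, i < K.+1 -> h i < Q) -> c <= m -> locnum f h c < nloc.
Proof.
move=> /hcode_lt hQ cm; rewrite /locnum /nloc ltn_add2l.
have := ltn_ord (enum_rank f); move: (enum_rank f : nat) (hcode h) hQ => a b bQ aF.
have h1 : (a * Q ^ K.+1 + b).+1 <= #|{: ctl}| * Q ^ K.+1.
  by apply: leq_trans (leq_mul aF (leqnn _)); rewrite mulSn; lia.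
by apply: leq_trans (leq_mul h1 (leqnn _)); rewrite mulSn; lia.
Qed.

Lemma locnum_inj f h c f' h' c' :
  (forall i, i < K.+1 -> h i < Q) -> (forall i, i < K.+1 -> h' i < Q) -> c <= m -> c' <= m ->
  locnum f h c = locnum f' h' c' -> [/\ f = f', forall i, i < K.+1 -> h i = h' i & c = c'].
Proof.
move=> hQ h'Q cm c'm /addnI E; rewrite -ltnS in cm; rewrite -ltnS in c'm.
have := congr1 (divn ^~ m.+1) E; have := congr1 (modn ^~ m.+1) E.
rewrite /= !modnMDl !divnMDl // !modn_small // !divn_small // !addn0 => -> {E} E.
have q0 : 0 < Q ^ K.+1 by rewrite expn_gt0.
have := congr1 (divn ^~ (Q ^ K.+1)) E; have := congr1 (modn ^~ (Q ^ K.+1)) E.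
rewrite /= !modnMDl !divnMDl // !modn_small ?hcode_lt // !divn_small ?hcode_lt // !addn0.
by move=> /hcode_inj H /val_inj /enum_rank_inj ->; split=> //; apply: H.
Qed.

Definition guard_of j x : guard 'I_nclk :=
  [seq (clk j y, if y == x then CEq else CGe, if y == x then Posz 1 else Posz 2) | y <- enum {: option G}].
(** Waiting until all clocks of the cell are at least 1 makes its first reset separate the written
    symbol from the others by 1. *)
Definition guard0 j : guard 'I_nclk := [seq (clk j y, CGe, Posz 1) | y <- enum {: option G}].

(** A visit resets the clock of the symbol it leaves behind even if the symbol is unchanged, so that
    this clock is 1 again one rotation later. *)
Definition cell_edge src tgt j g x : edge 'I_nclk 'I_nloc 'I_nclk :=
  Edge (loc src) g (Some (clk j x)) (finset.set1 (clk j x)) (loc tgt).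
Definition eps_edge src tgt : edge 'I_nclk 'I_nloc 'I_nclk :=
  Edge (loc src) [::] None finset.set0 (loc tgt).

Definition init_edge j x := cell_edge j j.+1 j (guard0 j) x.

Definition start_ctl : ctl := (tm_start M, inl [ffun => None]).

Definition eff f (i : 'I_K.+1) x : ctl * option G :=
  match f.2 with
  | inl v => ((f.1, inl [ffun j => if j == i then x else v j]), x)
  | inr a => (f, (a i).1)
  end.

Definition wrap_ctl f : ctl :=
  match f.2 with
  | inl v => let qa := tm_delta f.1 v in (qa.1, inr qa.2)
  | inr a => (f.1, inl [ffun => None])
  end.

Definition wrap_heads f h j :=
  if f.2 is inr a then (if insub j is Some i then moved (a i).2 (h j) else h j) else h j.

Definition step_edge f f' h (i : 'I_K.+1) p x x' :=
  cell_edge (locnum f h (i * P + p)) (locnum f' h (i * P + p).+1) (i * P + p) (guard_of (i * P + p) x) x'.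

(** Cells before, after and under the head are listed apart, because the generator of the encoding
    has loops but no conditionals. *)
Definition sym_edges f h (i : 'I_K.+1) x :=
  [seq step_edge f f h i p x x | p <- iota 0 (h i)] ++
  [seq step_edge f f h i (h i + 1 + p) x x | p <- iota 0 (P - (h i + 1))] ++
  [:: step_edge f (eff f i x).1 h i (h i) x (eff f i x).2].

Definition ctl_edges f h :=
  eps_edge (locnum f h m) (locnum (wrap_ctl f) (wrap_heads f h) 0) ::
  flatten [seq flatten [seq sym_edges f h i x | x <- enum {: option G}] | i <- enum 'I_K.+1].

(** Head positions are enumerated as the environments of [d] nested loops; at the bottom remains the
    entry [acc], later the length of the input. *)
Fixpoint tuples d acc : seq (seq nat) :=
  if d is d'.+1 then flatten [seq tuples d' (a :: acc) | a <- iota 0 P] else [:: acc].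

(** The input starts at position [s] of tape 0: blanks before it, its letters, blanks after it, then
    the other tapes. *)
Definition init_edges :=
  [seq init_edge p None | p <- iota 0 s] ++
  [seq init_edge (s + y.2) (Some y.1) | y <- zip u (iota 0 (size u))] ++
  [seq init_edge (s + size u + p) None | p <- iota 0 (P - (s + size u))] ++
  flatten [seq [seq init_edge (i.+1 * P + p) None | p <- iota 0 P] | i <- iota 0 K].

Definition edges :=
  init_edges ++ eps_edge m (locnum start_ctl (fun=> s) 0) ::
  flatten [seq flatten [seq ctl_edges f (nth 0 e) | e <- tuples K.+1 [:: size u]]
     | f <- enum {: ctl} & f.1 \notin tm_halt M].

(** Opacity will mean that no final location is reachable, so final locations stand for
    rejection. *)
Definition rejecting f := (f.1 \in tm_halt M) && (f.1 \notin tm_accept M).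

Definition block := Q ^ K.+1 * m.+1.
Definition final_loc v := (m < v) &&
  [exists f : ctl, rejecting f && ((v - m.+1) %/ block == enum_rank f)].

Definition red_ta : TA 'I_nclk 'I_nloc 'I_nclk :=
  MkTA (loc 0) [set: 'I_nloc] [set l : 'I_nloc | final_loc l] [ffun => [::]] edges.

Lemma red_oERA : is_oERA red_ta.
Proof.
exists id; first by exists id.
move=> e; rewrite /= mem_cat in_cons => /orP[|/orP[/eqP->//|]].
  rewrite !mem_cat => /or4P[/mapP[? _ ->]|/mapP[? _ ->]|/mapP[? _ ->]|/flattenP[? /mapP[? _ ->] /mapP[? _ ->]]] //.
move=> /flattenP[? /mapP[f _ ->] /flattenP[? /mapP[h _ ->]]].
rewrite in_cons => /orP[/eqP->//|/flattenP[? /mapP[i _ ->] /flattenP[? /mapP[x _ ->]]]].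
by rewrite !mem_cat inE => /or3P[/mapP[? _ ->]|/mapP[? _ ->]|/eqP->].
Qed.

Lemma tuplesP d acc e : reflect (exists2 l, size l = d /\ all (fun a => a < P) l & e = l ++ acc)
  (e \in tuples d acc).
Proof.
apply: (iffP idP).
  elim: d acc => [|d IH] acc /=; first by rewrite inE => /eqP->; exists [::].
  case/flattenP=> ? /mapP[a]; rewrite mem_iota => aP -> /IH[l [<- lP] ->].
  by exists (rcons l a); rewrite ?size_rcons ?all_rcons ?lP ?andbT // cat_rcons.
elim: d acc e => [|d IH] acc e [l [sl lP] ->] /=; first by case: l sl {lP}; rewrite ?inE.
case/lastP: l sl lP => // l a; rewrite size_rcons all_rcons => -[sl] /andP[aP lP].
apply/flattenP; exists (tuples d (a :: acc)); first by apply/mapP; exists a; rewrite ?mem_iota.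
by apply: IH; exists l; rewrite ?cat_rcons.
Qed.

(** * The computation as a walk through the locations *)

Definition run t := tm_run M t u.
Definition heads_at t : heads := [ffun i => tape_head ((run t).2 i)].
Definition act_at t : acts := (tm_delta (run t).1 (heads_at t)).2.

Fixpoint hd t j := if t is t'.+1 then
    (if insub j is Some i then moved (act_at t' i).2 (hd t' j) else hd t' j) else s.

Definition cellat t j := cell ((run t).2 (inord (j %/ P))) (hd t (j %/ P)) (j %% P).

(** Rotation 0 writes the input. Rotation [2 * t + 1] gathers the symbols of step [t], and rotation
    [2 * t + 2] performs its actions with the control state already that of time [t + 1]; hence the
    state is read at [r./2] and the heads at [rt r]. *)
Definition alive r := forall t, t < r./2 -> ~~ halted (run t).
Definition rt r := r.-1./2.

(** Before the visit to cell [c]: in an acting rotation, the cells already passed show the next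
    tape. *)
Definition cont r c j := cellat (rt r + [&& ~~ odd r, 0 < r & j < c]) j.
Definition gathered t c : heads := [ffun i : 'I_K.+1 => if i * P + hd t i < c then heads_at t i else None].
Definition ctl_at r c : ctl :=
  ((run r./2).1, if odd r then inl (gathered (rt r) c) else inr (act_at (rt r))).
Definition locR r c := if r == 0 then c else locnum (ctl_at r c) (hd (rt r)) c.

Lemma run_next t : ~~ halted (run t) -> run t.+1 =
  ((tm_delta (run t).1 (heads_at t)).1, [ffun i => tape_act ((run t).2 i) (act_at t i)]).
Proof.
by move=> nh; rewrite /run /tm_run iterS -/(tm_run M t u) /tm_step (negPf nh) /act_at; case: tm_delta.
Qed.

Lemma size_tape t (i : 'I_K.+1) : size (tape_left ((run t).2 i)) + size (tape_right ((run t).2 i)) < s.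
Proof.
apply: leq_trans (space t); rewrite /tm_space (bigD1 i) //=; exact: leq_addr.
Qed.

(** A head away from its starting position has left that many cells on the stored tape. *)
Lemma hd_window t : (forall t', t' < t -> ~~ halted (run t')) -> forall i : 'I_K.+1,
  hd t i <= s + size (tape_left ((run t).2 i)) /\ s <= hd t i + size (tape_right ((run t).2 i)).
Proof.
elim: t => [_ i|t IH al i]; first by rewrite /= !leq_addr.
have [] := IH (fun t' lt => al t' (ltnW lt)) i; have := size_tape t i.
rewrite run_next ?al //= ffunE valK; move: (act_at t i) => [b mv].
by case: ((run t).2 i) => l x r /=; case: mv => /=; case: l => [|? l]; case: r => [|? r] /=; lia.
Qed.

Lemma hd_range t : (forall t', t' < t -> ~~ halted (run t')) -> forall i : 'I_K.+1, 0 < hd t i /\ hd t i < P.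
Proof.
move=> /hd_window H i; have [] := H i; have := size_tape t i; rewrite /P; lia.
Qed.

Lemma cellat_next t (i : 'I_K.+1) p : ~~ halted (run t) -> 0 < hd t i -> p < P ->
  cellat t.+1 (i * P + p) = if p == hd t i then (act_at t i).1 else cellat t (i * P + p).
Proof.
move=> nh h0 pP; rewrite /cellat divnMDl ?P_gt0 // (divn_small pP) addn0 modnMDl (modn_small pP).
by rewrite inord_val run_next //= ffunE valK cell_act.
Qed.

Lemma cellat_head t (i : 'I_K.+1) : hd t i < P -> cellat t (i * P + hd t i) = heads_at t i.
Proof.
move=> hP; rewrite /cellat divnMDl ?P_gt0 // (divn_small hP) addn0 modnMDl (modn_small hP).
by rewrite inord_val /cell ltnn eqxx ffunE.
Qed.

Lemma cell_eq (i i' : 'I_K.+1) p p' : p < P -> p' < P -> (i * P + p == i' * P + p') = (i == i') && (p == p').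
Proof.
move=> pP p'P; apply/eqP/andP => [E|[/eqP-> /eqP->] //].
have := congr1 (divn ^~ P) E; have := congr1 (modn ^~ P) E.
by rewrite /= !modnMDl !divnMDl ?P_gt0 // !modn_small // !divn_small // !addn0 => -> /val_inj ->.
Qed.

Lemma alive_hd r : alive r -> forall i : 'I_K.+1, 0 < hd (rt r) i /\ hd (rt r) i < P.
Proof.
by move=> al; apply: hd_range => t' h; apply: al; move: h; rewrite /rt; lia.
Qed.

Lemma cont_other r c j : j != c -> cont r c.+1 j = cont r c j.
Proof. by move=> jc; rewrite /cont [j < c.+1]ltnS [j <= c]leq_eqVlt (negPf jc). Qed.

Lemma cell_step r (i : 'I_K.+1) p : 0 < r -> alive r -> p < P ->
  (if p == hd (rt r) i then eff (ctl_at r (i * P + p)) i (cont r (i * P + p) (i * P + p))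
   else (ctl_at r (i * P + p), cont r (i * P + p) (i * P + p))) =
  (ctl_at r (i * P + p).+1, cont r (i * P + p).+1 (i * P + p)).
Proof.
move=> r0 al pP; have [h0 hP] := alive_hd al i.
rewrite /eff /ctl_at /cont r0 ltnn ltnSn; case od: (odd r) => /=; rewrite ?addn0.
  have K0 (j : 'I_K.+1) : (j * P + hd (rt r) j < (i * P + p).+1) =
      (j * P + hd (rt r) j < i * P + p) || (j == i) && (p == hd (rt r) i).
    rewrite ltnS leq_eqVlt cell_eq //; last by have [] := alive_hd al j.
    by rewrite orbC; case: eqP => [->|] //=; rewrite eq_sym.
  case: eqP => ph; [congr ((_, inl _), _)|congr ((_, inl _), _)]; apply/ffunP=> j; rewrite !ffunE K0.
    have pe : p == hd (rt r) i by apply/eqP.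
    rewrite pe andbT; case: eqP => [->|]; rewrite ?orbF // orbT ph cellat_head // ffunE //.
  by rewrite (introF eqP ph) andbF orbF.
have nh : ~~ halted (run (rt r)) by apply: al; rewrite /rt; lia.
by rewrite addn1 (cellat_next nh h0 pP); case: ifP.
Qed.

Lemma gathered_all t : (forall i : 'I_K.+1, hd t i < P) -> gathered t m = heads_at t.
Proof.
move=> hP; apply/ffunP=> i; rewrite !ffunE ifT ?ffunE //.
by have := hP i; have := ltn_ord i; rewrite /m; nia.
Qed.

Lemma wrap_step r : 0 < r -> alive r -> ~~ halted (run r./2) ->
  [/\ alive r.+1, wrap_ctl (ctl_at r m) = ctl_at r.+1 0,
      forall j, wrap_heads (ctl_at r m) (hd (rt r)) j = hd (rt r.+1) j
    & forall j, j < m -> cont r.+1 0 j = cont r m j].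
Proof.
move=> r0 al nh.
have al' : alive r.+1.
  by move=> t tr; have [/al//|-> //] : t < r./2 \/ t = r./2 by lia.
have hP i := (alive_hd al i).2.
have od1 : odd r.+1 = ~~ odd r by [].
split=> //; rewrite /wrap_ctl /wrap_heads /ctl_at ?od1; case od: (odd r); rewrite //=.
- have -> : rt r = r./2 by rewrite /rt; lia.
  have -> : uphalf r = r./2.+1 by lia.
  rewrite gathered_all => [|i]; last by have := hP i; rewrite (_ : rt r = r./2) //; rewrite /rt; lia.
  by rewrite (run_next nh).
- have -> : uphalf r = r./2 by lia.
  by congr (_, inl _); apply/ffunP=> i; rewrite !ffunE.
- by move=> j; rewrite (_ : rt r.+1 = rt r) // /rt; lia.
- move=> j; rewrite (_ : rt r.+1 = (rt r).+1) // /rt; lia.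
- by move=> j jm; rewrite /cont od1 ltn0 !andbF od /= (_ : rt r.+1 = rt r) // /rt; lia.
- by move=> j jm; rewrite /cont od1 ltn0 !andbF od jm r0 /= addn1 addn0 (_ : rt r.+1 = (rt r).+1) // /rt; lia.
Qed.

Lemma size_u : size u <= s.+1 /\ 0 < s.
Proof.
have := size_tape 0 ord0; rewrite /run /tm_run /= ffunE eqxx /= size_map size_behead; lia.
Qed.

Lemma cellat0 i p : i < K.+1 -> p < P -> cellat 0 (i * P + p) =
  if (i == 0) && (s <= p) then nth None (map Some u) (p - s) else None.
Proof.
move=> iK pP; rewrite /cellat divnMDl ?P_gt0 // (divn_small pP) addn0 modnMDl (modn_small pP).
rewrite /run /tm_run /= ffunE -val_eqE /= inordK //.
case: (i == 0) => /=; rewrite /cell /=; last by case: ltngtP => _; rewrite ?nth_nil.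
case: ltngtP => ps; [by rewrite nth_nil| |by rewrite ps subnn; case: u].
by case: (u) => [|a l] /=; rewrite ?nth_nil // (_ : p - s = (p - s.+1).+1) //; lia.
Qed.

Lemma init_edgesP e : (e \in init_edges) <-> (exists2 j, j < m & e = init_edge j (cellat 0 j)).
Proof.
have [su s0] := size_u.
have sP : s + size u <= P by rewrite /P; lia.
have PM : P <= m by rewrite /m mulSn leq_addr.
have c0 p : p < P -> cellat 0 p = if s <= p then nth None (map Some u) (p - s) else None.
  by move=> pP; rewrite -[in LHS](add0n p) -(mul0n P) cellat0.
split.
  rewrite !mem_cat => /or4P[/mapP[p]|/mapP[y yz ->]|/mapP[p]|/flattenP[? /mapP[i iK ->] /mapP[p]]].
  - rewrite mem_iota /= => ps ->; exists p; first by rewrite /P in PM; lia.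
    have -> : cellat 0 p = None; last by [].
    rewrite add0n in ps; rewrite c0; last by rewrite /P; lia.
    by rewrite leqNgt ps.
  - have /(nthP (y.1, 0))[k] := yz; rewrite size_zip size_iota minnn => ku.
    rewrite nth_zip ?size_iota // nth_iota // add0n => yE.
    have y2 : y.2 = k by rewrite -yE.
    have y1 : nth y.1 u k = y.1 := congr1 fst yE.
    have skP : s + k < P by apply: leq_trans sP; rewrite ltn_add2l.
    rewrite y2; exists (s + k); first exact: leq_trans skP PM.
    rewrite (c0 _ skP).
    by rewrite leq_addr addKn (nth_map y.1) // y1.
  - rewrite mem_iota /= => pP ->; exists (s + size u + p); first by lia.
    rewrite c0; last by lia.
    by rewrite -addnA leq_addr addKn nth_default ?size_map ?leq_addr.
  - rewrite mem_iota /= => pP ->; rewrite mem_iota /= in iK.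
    exists (i.+1 * P + p); last by rewrite cellat0.
    have hh : i.+2 * P <= m by rewrite /m leq_mul2r ltnS iK orbT.
    by apply: leq_trans hh; rewrite [i.+2 * P]mulSn addnC ltn_add2r.
case=> j jm ->; have := divn_eq j P; have := ltn_pmod j P_gt0.
have : j %/ P < K.+1 by rewrite ltn_divLR ?P_gt0.
move: (j %/ P) (j %% P) => i p iK pP jE; rewrite jE cellat0 // !mem_cat.
case: i iK {jE} => [_|i iK]; last first.
  apply/or4P/Or44/flattenP; exists [seq init_edge (i.+1 * P + p) None | p <- iota 0 P].
    by apply/mapP; exists i; rewrite ?mem_iota.
  by apply/mapP; exists p; rewrite ?mem_iota.
rewrite mul0n add0n eqxx /=; case: leqP => ps; last first.
  by apply/or4P/Or41/mapP; exists p; rewrite ?mem_iota.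
case: (ltnP (p - s) (size u)) => pu.
  case Eu : u => [|a0 l] //; first by rewrite Eu in pu.
  rewrite -Eu; apply/or4P/Or42/mapP; exists (nth a0 u (p - s), p - s); last first.
    by rewrite /= (nth_map a0) // subnKC.
  have := @mem_nth _ (a0, 0) (zip u (iota 0 (size u))) (p - s).
  by rewrite nth_zip ?size_iota // nth_iota // add0n; apply; rewrite size_zip size_iota minnn.
apply/or4P/Or43/mapP; exists (p - (s + size u)); rewrite ?mem_iota /=; first by lia.
by rewrite nth_default ?size_map // subnKC //; lia.
Qed.

Lemma loc_inj v v' : v < nloc -> v' < nloc -> loc v = loc v' -> v = v'.
Proof. by move=> vL v'L /(congr1 val) /=; rewrite !locE. Qed.

Lemma hcode_ext h h' : (forall i, i < K.+1 -> h i = h' i) -> hcode h = hcode h'.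
Proof.
move=> hh; rewrite /hcode.
have : all (fun i => h i == h' i) (iota 0 K.+1).
  by apply/allP=> i; rewrite mem_iota => /hh ->.
by elim: (iota _ _) => //= i l IH /andP[/eqP-> /IH ->].
Qed.

Lemma locnum_ext f h h' c : (forall i, i < K.+1 -> h i = h' i) -> locnum f h c = locnum f h' c.
Proof. by move=> hh; rewrite /locnum (hcode_ext hh). Qed.

Lemma sym_edgesP f h (i : 'I_K.+1) x e : h i < P -> (e \in sym_edges f h i x) <->
  (exists2 p, p < P & e = step_edge f (if p == h i then (eff f i x).1 else f) h i p x
                                    (if p == h i then (eff f i x).2 else x)).
Proof.
move=> hP; rewrite !mem_cat inE; split.
  case/or3P=> [/mapP[p]|/mapP[p]|/eqP->]; last by exists (h i) => //; rewrite eqxx.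
  - rewrite mem_iota /= => ph ->; exists p; first exact: ltn_trans hP.
    by rewrite ltn_eqF.
  - rewrite mem_iota /= => ph ->; exists (h i + 1 + p); first by lia.
    by rewrite gtn_eqF //; lia.
case=> p pP ->; case: ltngtP => ph.
- by apply/or3P/Or31/mapP; exists p; rewrite ?mem_iota.
- apply/or3P/Or32/mapP; exists (p - (h i + 1)); rewrite ?mem_iota /=; first by lia.
  by rewrite subnKC // addn1.
- by apply/or3P/Or33; rewrite ph.
Qed.

Lemma alive_lt r : alive r -> forall i, i < K.+1 -> hd (rt r) i < Q.
Proof. by move=> al i iK; have [_ h] := alive_hd al (Ordinal iK); apply: ltnW. Qed.

Lemma locR_lt r c : alive r -> c <= m -> locR r c < nloc.
Proof.
move=> al cm; rewrite /locR; case: eqP => [_|_].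
  by rewrite /nloc; apply: ltn_addr.
by apply: locnum_lt => //; apply: alive_lt.
Qed.

Lemma tuple_lt e : e \in tuples K.+1 [:: size u] -> forall i, i < K.+1 -> nth 0 e i < P.
Proof.
case/tuplesP=> l [sl /allP lP] -> i iK; rewrite nth_cat sl iK; apply: lP.
by rewrite mem_nth ?sl.
Qed.

Lemma edgesP e : e \in edges ->
  [\/ exists2 j, j < m & e = init_edge j (cellat 0 j),
      e = eps_edge m (locnum start_ctl (fun=> s) 0)
    | exists f h, [/\ f.1 \notin tm_halt M, forall i, i < K.+1 -> h i < P & e \in ctl_edges f h]].
Proof.
rewrite mem_cat in_cons => /orP[/init_edgesP H|/orP[/eqP H|]]; [exact: Or31|exact: Or32|].
case/flattenP=> ? /mapP[f]; rewrite mem_filter => /andP[fh _] -> /flattenP[? /mapP[h hT ->] eh].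
by apply: Or33; exists f, (nth 0 h); split=> //; apply: tuple_lt.
Qed.

Lemma ctl_edges_src f h e : (forall i, i < K.+1 -> h i < P) -> e \in ctl_edges f h ->
  (e = eps_edge (locnum f h m) (locnum (wrap_ctl f) (wrap_heads f h) 0)) \/
  (exists (i : 'I_K.+1) p x, [/\ p < P, i * P + p < m & e = step_edge f (if p == h (nat_of_ord i) then (eff f i x).1 else f) h i p x
                                    (if p == h (nat_of_ord i) then (eff f i x).2 else x)]).
Proof.
move=> hP; rewrite in_cons => /orP[/eqP ->|]; first by left.
case/flattenP=> ? /mapP[i _ ->] /flattenP[? /mapP[x _ ->]].
move/sym_edgesP => /(_ (hP _ (ltn_ord i)))[p pP ->]; right; exists i, p, x; split=> //.
by have := ltn_ord i; rewrite /m; nia.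
Qed.

Lemma start_locE : locR 1 0 = locnum start_ctl (fun=> s) 0.
Proof.
suff <- : ctl_at 1 0 = start_ctl by [].
by apply: (congr2 pair) => //; apply: (congr1 inl); apply/ffunP=> i; rewrite !ffunE.
Qed.

Lemma init_edge_at e c : e \in edges -> c <= m -> esrc e = loc c ->
  (c < m /\ e = init_edge c (cellat 0 c)) \/ (c = m /\ e = eps_edge m (locR 1 0)).
Proof.
have mL c' : c' <= m -> c' < nloc by move=> h; apply: (@leq_trans m.+1); rewrite // leq_addr.
move=> /edgesP[[j jm ->] cm /= /loc_inj E|-> cm /= /loc_inj E|[f [h [_ hP eE]]] cm].
- by left; rewrite -E ?jm //; apply: mL => //; apply: ltnW.
- by right; rewrite start_locE; split=> //; rewrite E ?mL.
have hQ i : i < K.+1 -> h i < Q by move=> /hP; apply: ltnW.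
have big c' : c' <= m -> loc (locnum f h c') = loc c -> False.
  move=> c'm /loc_inj; rewrite locnum_lt // mL // => /(_ isT isT); rewrite /locnum; lia.
case: (ctl_edges_src hP eE) => [->|[i [p [x [pP im ->]]]]] /= /big //; first by case.
by case; apply: ltnW.
Qed.

(** Numbering of locations is injective, so only the symbol [x] of a cell edge is open; with the
    true symbol the edge follows the computation. *)
Lemma main_edge_at e r c : e \in edges -> 0 < r -> alive r -> c <= m -> esrc e = loc (locR r c) ->
  ~~ halted (run r./2) /\ ((c = m /\ e = eps_edge (locR r m) (locR r.+1 0)) \/
   (c < m /\ exists x tgt x', e = cell_edge (locR r c) tgt c (guard_of c x) x' /\
      (x = cont r c c -> tgt = locR r c.+1 /\ x' = cont r c.+1 c))).
Proof.
have mL c' : c' <= m -> c' < nloc by move=> h; apply: (@leq_trans m.+1); rewrite // leq_addr.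
move=> eE r0 al cm; have rN : (r == 0) = false by lia.
have big c' : c' <= m -> loc c' = loc (locR r c) -> False.
  move=> c'm /loc_inj; rewrite locR_lt // mL // => /(_ isT isT); rewrite /locR rN /locnum; lia.
have hdQ := alive_lt al.
case: (edgesP eE) => [[j jm ->] /= /big|-> /= /big|[f [h [nh hP {}eE]]]].
- by case; apply: ltnW.
- by case.
have hQ i : i < K.+1 -> h i < Q by move=> /hP; apply: ltnW.
have inj c' : c' <= m -> loc (locnum f h c') = loc (locR r c) ->
    [/\ f = ctl_at r c, forall i, i < K.+1 -> h i = hd (rt r) i & c' = c].
  move=> c'm /loc_inj; rewrite locR_lt // locnum_lt // => /(_ isT isT).
  by rewrite /locR rN; apply: locnum_inj.
case: (ctl_edges_src hP eE) => [->|[i [p [x [pP im ->]]]]] /= /inj.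
  case=> // fE hE cE; subst f c; have nh' : ~~ halted (run r./2) by [].
  split=> //; left; split=> //; have [al' wE whE _] := wrap_step r0 al nh'.
  rewrite wE /locR rN /=; congr (eps_edge _ _); apply: locnum_ext => //.
  move=> j jK; rewrite -whE /wrap_heads; case: (ctl_at r m).2 => [v|a]; first by rewrite hE.
  by case: (insub j) => [k|]; rewrite hE.
case=> [|fE hE cE]; first exact: ltnW.
subst f; split=> //; right; rewrite -cE; split=> //; exists x.
set f' := if _ then _ else _; set x' := if _ then _ else _; exists (locnum f' h c.+1), x'.
split; first by rewrite /step_edge cE /locR rN (locnum_ext _ _ hE).
move=> xE; have := cell_step i r0 al pP; rewrite cE -hE //.
rewrite /f' /x' xE cE /locR rN (locnum_ext _ _ hE); case: ifP => _ E.
  by rewrite (congr1 fst E) (congr1 snd E).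
have E1 : ctl_at r c = ctl_at r c.+1 := congr1 fst E.
by have E2 : cont r c c = cont r c.+1 c := congr1 snd E; rewrite E1 E2.
Qed.

Lemma main_edges_in r : 0 < r -> alive r -> ~~ halted (run r./2) ->
  eps_edge (locR r m) (locR r.+1 0) \in edges /\
  forall c, c < m -> cell_edge (locR r c) (locR r c.+1) c (guard_of c (cont r c c)) (cont r c.+1 c) \in edges.
Proof.
move=> r0 al nh; have rN : (r == 0) = false by lia.
pose e := mkseq (hd (rt r)) K.+1 ++ [:: size u].
have eT : e \in tuples K.+1 [:: size u].
  apply/tuplesP; exists (mkseq (hd (rt r)) K.+1) => //; split; first by rewrite size_mkseq.
  by apply/allP=> ? /mapP[i]; rewrite mem_iota /= => iK ->; have [] := alive_hd al (Ordinal iK).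
have eN i : i < K.+1 -> nth 0 e i = hd (rt r) i.
  by move=> iK; rewrite nth_cat size_mkseq iK nth_mkseq.
have inE c y : y \in ctl_edges (ctl_at r c) (nth 0 e) -> y \in edges.
  move=> yE; rewrite mem_cat in_cons; apply/orP; right; apply/orP; right.
  apply/flattenP; exists (flatten [seq ctl_edges (ctl_at r c) (nth 0 e) | e <- tuples K.+1 [:: size u]]).
    by apply: map_f; rewrite mem_filter mem_enum andbT.
  by apply/flattenP; exists (ctl_edges (ctl_at r c) (nth 0 e)) => //; apply: (map_f (fun e => ctl_edges _ (nth 0 e))).
split.
  apply: (inE m); rewrite in_cons; apply/orP; left; apply/eqP.
  have [al' wE whE _] := wrap_step r0 al nh.
  rewrite wE /locR rN /=; congr (eps_edge _ _); apply: locnum_ext; first by move=> i /eN.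
  move=> j jK; rewrite -whE /wrap_heads; case: (ctl_at r m).2 => [v|a]; first by rewrite eN.
  by case: (insub j) => [k|]; rewrite eN.
move=> c cm; have iK : c %/ P < K.+1 by rewrite ltn_divLR ?P_gt0.
pose i := Ordinal iK; pose p := c %% P.
have cE : c = i * P + p by apply: divn_eq.
have pP : p < P by rewrite ltn_pmod ?P_gt0.
apply: (inE c); rewrite in_cons; apply/orP; right; apply/flattenP.
exists (flatten [seq sym_edges (ctl_at r c) (nth 0 e) i x | x <- enum {: option G}]).
  by apply: map_f; rewrite mem_enum.
apply/flattenP; exists (sym_edges (ctl_at r c) (nth 0 e) i (cont r c c)).
  by apply: (map_f (sym_edges (ctl_at r c) (nth 0 e) i)); rewrite mem_enum.
apply/sym_edgesP; first by rewrite eN //; have [] := alive_hd al i.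
exists p => //; have := cell_step i r0 al pP; rewrite -cE /step_edge -cE eN //.
rewrite /locR rN (locnum_ext _ _ eN) (locnum_ext (if _ then _ else _) _ eN).
case: ifP => _ E; first by rewrite (congr1 fst E) (congr1 snd E).
have E1 : ctl_at r c = ctl_at r c.+1 := congr1 fst E.
by have E2 : cont r c c = cont r c.+1 c := congr1 snd E; rewrite E1 E2.
Qed.

(** * Runs of the reduced automaton *)

Section Runs.
Variable R : realType.
Implicit Types (mu : {ffun 'I_nclk -> R}) (y : option G).
Local Notation TAM := red_ta.
Local Open Scope ring_scope.

Definition sep mu j x := forall y, y != x -> mu (clk j x) + 1 <= mu (clk j y).
Definition sound_at r c mu := forall j, (j < m)%N -> (0 < r)%N || (j < c)%N -> sep mu j (cont r c j).
(** Soundness is kept by every run, whatever its delays; the exact values are those of the run to be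
    built. Its clock of the true symbol is 1 at cells still to be visited in the current rotation,
    and 0 at visited ones and before the rotation's delay. *)
Definition timed_at r c mu := [/\ sound_at r c mu,
  forall j, (j < m)%N -> (0 < r)%N || (j < c)%N ->
     mu (clk j (cont r c j)) = ((c <= j)%N && (0 < c)%N)%:R
  & r = 0%N -> forall j y, (c <= j < m)%N -> (0 < c)%N%:R <= mu (clk j y)].

Lemma sound_delay r c mu d : sound_at r c mu -> sound_at r c (delay mu d).
Proof. by move=> H j jm rj y yx; rewrite !ffunE addrAC lerD2r; apply: H. Qed.

Lemma sat_guard mu j x : sat mu (guard_of j x) <->
  mu (clk j x) = 1 /\ forall y, y != x -> 2 <= mu (clk j y).
Proof.
rewrite /sat all_map; split=> [/allP H|[H1 H2]].
  split=> [|y yx]; [have := H x|have := H y]; rewrite mem_enum /= => /(_ isT).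
    by rewrite eqxx => /eqP.
  by rewrite (negPf yx).
by apply/allP=> y _ /=; case: eqP => [->|/eqP /H2 //]; apply/eqP.
Qed.

Lemma sat_guard0 mu j : sat mu (guard0 j) <-> forall y, 1 <= mu (clk j y).
Proof.
rewrite /sat all_map; split=> [/allP H y|H]; first by have := H y; rewrite mem_enum; apply.
by apply/allP=> y _; apply: H.
Qed.

Lemma reset_other mu c x j y : (c < m)%N -> (j < m)%N -> j != c ->
  reset mu (finset.set1 (clk c x)) (clk j y) = mu (clk j y).
Proof.
move=> cm jm jc; rewrite ffunE finset.in_set1; case: eqP => // /(clk_inj jm cm)[E _].
by rewrite E eqxx in jc.
Qed.

Lemma reset_here mu c x y : (c < m)%N ->
  reset mu (finset.set1 (clk c x)) (clk c y) = if y == x then 0 else mu (clk c y).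
Proof.
move=> cm; rewrite ffunE finset.in_set1; case: (eqVneq y x) => [->|yx]; first by rewrite eqxx.
by case: eqP => // /(clk_inj cm cm)[_ E]; rewrite E eqxx in yx.
Qed.

Lemma sound_cell r c mu : (c < m)%N -> (forall y, 1 <= mu (clk c y)) -> sound_at r c mu ->
  sound_at r c.+1 (reset mu (finset.set1 (clk c (cont r c.+1 c)))).
Proof.
move=> cm ge1 H j jm rj; have [->|jc] := eqVneq j c.
  by move=> y yx; rewrite !reset_here // eqxx (negPf yx) add0r.
rewrite (cont_other _ jc) => y yx; rewrite !reset_other //; apply: H => //.
by move: rj; rewrite ltnS [(j <= c)%N]leq_eqVlt (negPf jc).
Qed.

Lemma sat_inv mu (l : 'I_nloc) : sat mu (ta_inv TAM l).
Proof. by rewrite ffunE. Qed.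

Lemma reset0 mu : reset mu finset.set0 = mu.
Proof. by apply/ffunP=> x; rewrite ffunE finset.in_set0. Qed.

Lemma cont_wrap0 j : cont 1 0 j = cont 0 m j.
Proof. by []. Qed.

(** Separation survives delays, as all clocks grow alike, and a reset recreates it because the
    clocks of the visited cell are at least 1. *)
Lemma sound_step r c mu e c' : sound_at r c mu -> alive r -> (c <= m)%N ->
  edge_ok TAM (loc (locR r c), mu) e c' ->
  exists r' c1, [/\ (c1 <= m)%N, alive r', c'.1 = loc (locR r' c1) & sound_at r' c1 c'.2].
Proof.
move=> H al cm [eE /= es sg -> _] /=.
have [r0|r0] := posnP r.
  subst r; case: (init_edge_at eE cm (esym es)) => -[cE eq_e]; rewrite {}eq_e in sg *.
    exists 0%N, c.+1; split=> //.
    have -> : cellat 0 c = cont 0 c.+1 c by rewrite /cont /= addn0.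
    by apply: sound_cell => //; apply/sat_guard0.
  have al1 : alive 1 by move=> t; rewrite -[1./2]/0%N ltn0.
  exists 1%N, 0%N; split=> //=.
  by subst c; rewrite reset0 => j jm _; rewrite cont_wrap0; apply: H; rewrite // jm.
have [nh [[cE ->]|[cE [x [tgt [x' [eq_e xE]]]]]]] := main_edge_at eE r0 al cm (esym es).
  have [al' _ _ cw] := wrap_step r0 al nh.
  exists r.+1, 0%N; split=> //=; subst c; rewrite reset0 => j jm _.
  by rewrite cw //; apply: H; rewrite // r0.
rewrite {}eq_e /= in sg *; case/sat_guard: sg => x1 x2.
(* The guard asks for 1 on the clock of [x] and at least 2 on that of the true symbol, if different;
   separation says the opposite. *)
have xc : x = cont r c c.
  apply/eqP; apply/negP=> /negP xc; have := H c cE; rewrite r0 => /(_ isT x xc).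
  have := x2 _ (contra_neq esym xc); rewrite x1; lra.
have [-> ->] := xE xc; exists r, c.+1; split=> //.
apply: sound_cell => // y; case: (eqVneq y x) => [->|/x2]; rewrite ?x1 //; lra.
Qed.

Lemma final_locE r c : alive r -> (c <= m)%N ->
  (loc (locR r c) \in ta_final TAM) = (0 < r)%N && rejecting (ctl_at r c).
Proof.
move=> al cm; rewrite finset.in_set /final_loc locE ?locR_lt // /locR.
have [->|r0] := posnP r; first by rewrite ltnNge cm.
rewrite /locnum -[(m < _)%N]/(m.+1 <= _)%N leq_addr addKn /=.
have -> : (((enum_rank (ctl_at r c) * Q ^ K.+1 + hcode (hd (rt r))) * m.+1 + c) %/ block =
    enum_rank (ctl_at r c))%N.
  have hl := hcode_lt (alive_lt al); rewrite /block mulnDl -mulnA -addnA divnMDl ?muln_gt0 ?expn_gt0 //.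
  by rewrite divn_small ?addn0 //; move: (hcode _) (Q ^ _)%N hl => a b ab; nia.
apply/existsP/idP => [[f /andP[rf /eqP/val_inj/enum_rank_inj ->]] //|rf].
by exists (ctl_at r c); rewrite rf eqxx.
Qed.

Definition rejects := exists t, halted (run t) && ((run t).1 \notin tm_accept M).

Lemma run_rejects rr r c mu : sound_at r c mu -> alive r -> (c <= m)%N ->
  is_run_from TAM (loc (locR r c), mu) rr -> rejects.
Proof.
elim: rr r c mu => [|[[d e] [l mu']] rr IH] r c mu H al cm /=.
  by rewrite final_locE // => /andP[_ rj]; exists r./2.
case=> _ _ eo; have [r' [c1 [c1m al' /= -> H']]] := sound_step (sound_delay d H) al cm eo.
exact: IH.
Qed.

Theorem runs_reject (rr : seq (step R 'I_nclk 'I_nloc 'I_nclk)) : is_run TAM rr -> rejects.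
Proof.
case=> _; rewrite /init_config /= -[0%N]/(locR 0 0).
by apply: run_rejects => // j jm; rewrite ltn0.
Qed.

(** [n] counts the edges left before rotation [2 * t0 + 1]. A rotation has [m] cell edges and a
    silent one, hence the factor [m.+1]. *)
Lemma timed_run t0 : (forall t, (t < t0)%N -> ~~ halted (run t)) -> halted (run t0) ->
  (run t0).1 \notin tm_accept M ->
  forall n r c mu, (c <= m)%N -> (r * m.+1 + c + n = (2 * t0 + 1) * m.+1)%N -> timed_at r c mu ->
  exists rr, is_run_from TAM (loc (locR r c), mu) rr.
Proof.
move=> nh h0 rj; elim=> [|n IH] r c mu cm rn T.
  have E1 := congr1 (divn ^~ m.+1) rn; have E2 := congr1 (modn ^~ m.+1) rn.
  rewrite /= addn0 divnMDl // mulnK // divn_small ?ltnS // addn0 in E1.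
  rewrite /= addn0 modnMDl modnMl modn_small ?ltnS // in E2; rewrite E1 E2.
  have al : alive (2 * t0 + 1) by move=> t tt; apply: nh; lia.
  exists [::] => /=; rewrite final_locE // /rejecting /ctl_at /= (_ : (2 * t0 + 1)./2 = t0); last by lia.
  by rewrite -[_ \in _]/(halted _) h0 rj addn1.
have rt0 : (r <= 2 * t0 + 1)%N.
  by rewrite leqNgt; apply/negP=> rl; have : ((2 * t0 + 2) * m.+1 <= r * m.+1)%N; [rewrite leq_mul2r; lia|nia].
have al : alive r by move=> t tt; apply: nh; lia.
(* A run ends at its first final location; if [t0] is positive this is already at the start of
   rotation [2 * t0], whose control state is that of time [t0]. *)
have [fin|nfin] := boolP (loc (locR r c) \in ta_final TAM); first by exists [::].
have nhr : (0 < r)%N -> ~~ halted (run r./2).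
  move=> r0; have [/nh //|rE] : (r./2 < t0)%N \/ r./2 = t0 by lia.
  by move: nfin; rewrite final_locE // r0 /rejecting /ctl_at /= rE -[_ \in tm_halt M]/(halted _) h0 rj.
(* One time unit passes before cell 0 of a rotation, and all its cells are visited at that
   instant. *)
have [S V I] := T; pose d : R := (c == 0%N)%:R.
have d0 : 0 <= d by rewrite ler0n.
have dok : delay_ok TAM (loc (locR r c), mu) d by split=> // *; apply: sat_inv.
have cd : (0 < c)%N%:R + d = 1 by rewrite /d; case: (c) => [|c'] /=; rewrite ?add0r ?addr0.
pose mu1 := delay mu d; have S1 : sound_at r c mu1 := sound_delay d S.
have go e mu' r' c1 : e \in edges -> esrc e = loc (locR r c) -> sat mu1 (eguard e) ->
    etgt e = loc (locR r' c1) -> mu' = reset mu1 (ereset e) ->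
    (c1 <= m)%N -> (r' * m.+1 + c1 = (r * m.+1 + c).+1)%N -> timed_at r' c1 mu' ->
    exists rr, is_run_from TAM (loc (locR r c), mu) rr.
  move=> eE es eg et mE c1m pos T'.
  have [|rr rrP] := IH r' c1 mu' c1m _ T'; first by rewrite pos -rn addnS addSn.
  exists ((d, e, (loc (locR r' c1), mu')) :: rr) => /=; split=> //; split=> //=.
    by rewrite et mE.
  exact: sat_inv.
have [cE|cltm] : c = m \/ (c < m)%N by move: cm; rewrite leq_eqVlt => /orP[/eqP|]; [left|right].
  have m0 := m_gt0; have dE : d = 0 by rewrite /d cE gtn_eqF.
  have mu1E : mu1 = mu by apply/ffunP=> x; rewrite ffunE dE addr0.
  have cw j : (j < m)%N -> cont r.+1 0 j = cont r m j.
    have [->|r0] := posnP r; first by [].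
    by have [_ _ _] := wrap_step r0 al (nhr r0); apply.
  apply: (go (eps_edge (locR r m) (locR r.+1 0)) mu r.+1 0%N) => //; rewrite ?cE ?reset0 //.
  - have [->|r0] := posnP r; last by have [] := main_edges_in r0 al (nhr r0).
    rewrite mem_cat in_cons; apply/orP; right; apply/orP; left; apply/eqP.
    by rewrite start_locE.
  - by rewrite mulSn; lia.
  - subst c; split=> // j jm; rewrite cw // => _; first by apply: S; rewrite // jm orbT.
    by rewrite V ?jm ?orbT // leqNgt jm.
have ge1 y : 1 <= mu1 (clk c y).
  rewrite ffunE; have [r0|r0] := posnP r.
    by have := I r0 c y; rewrite leqnn cltm => /(_ isT); move: cd; lra.
  have := V c cltm; rewrite r0 leqnn => /(_ isT) vc.
  case: (eqVneq y (cont r c c)) => [->|yx]; first by rewrite vc cd.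
  by have := S c cltm; rewrite r0 => /(_ isT y yx); rewrite vc; move: cd; lra.
have tnext x' : x' = cont r c.+1 c -> timed_at r c.+1 (reset mu1 (finset.set1 (clk c x'))).
  move=> ->; split; first exact: sound_cell.
    move=> j jm rjc; have [->|jc] := eqVneq j c; first by rewrite reset_here // eqxx ltnn.
    rewrite reset_other // (cont_other _ jc) ffunE.
    have rj' : (0 < r)%N || (j < c)%N by move: rjc; rewrite ltnS [(j <= c)%N]leq_eqVlt (negPf jc).
    rewrite V // andbT; have [cj|cj] := ltnP c j; first by rewrite (ltnW cj) /= cd.
    have jc2 : (j < c)%N by rewrite ltn_neqAle jc cj.
    by rewrite leqNgt jc2 /= add0r /d gtn_eqF // (leq_ltn_trans (leq0n j) jc2).
  move=> r0 j y /andP[cj jm]; rewrite reset_other //; last by rewrite gtn_eqF.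
  have -> : (0 < c.+1)%N%:R = 1 :> R by [].
  by have := I r0 j y; rewrite jm (ltnW cj) => /(_ isT); rewrite ffunE; move: cd; lra.
have [r0|r0] := posnP r.
  subst r; apply: (go (init_edge c (cellat 0 c)) _ 0%N c.+1) => //.
  - by rewrite mem_cat; apply/orP; left; apply/init_edgesP; exists c.
  - exact/sat_guard0.
  - by apply: tnext; rewrite /cont addn0.
have [_ /(_ c cltm) eE] := main_edges_in r0 al (nhr r0).
apply: (go _ _ r c.+1 eE) => //; last 2 first.
- by rewrite addnS.
- exact: tnext.
apply/sat_guard; have vc : mu1 (clk c (cont r c c)) = 1.
  by rewrite ffunE V ?r0 // leqnn cd.
split=> // y yx; have := S1 c cltm; rewrite r0 => /(_ isT y yx); rewrite vc; lra.
Qed.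

Theorem reject_runs : rejects -> exists rr : seq (step R 'I_nclk 'I_nloc 'I_nclk), is_run TAM rr.
Proof.
move=> ex; have exb : exists t, halted (run t) && ((run t).1 \notin tm_accept M) by exact: ex.
case: ex => t1 /andP[h1 r1].
have exh : exists t, halted (run t) by exists t1.
case: (ex_minnP exh) => t0 h0 min0.
have stay k : run (t0 + k) = run t0.
  elim: k => [|k IH]; first by rewrite addn0.
  by rewrite addnS /run /tm_run iterS -/(tm_run M (t0 + k) u) -/(run (t0 + k)) IH /tm_step h0.
have nh t : (t < t0)%N -> ~~ halted (run t).
  by move=> tt; apply/negP=> /min0; rewrite leqNgt tt.
have rj : (run t0).1 \notin tm_accept M by rewrite -(stay (t1 - t0)%N) subnKC // min0.
have [|||rr rrP] := timed_run nh h0 rj (n := (2 * t0 + 1) * m.+1) (r := 0) (c := 0) (mu := [ffun=> 0]) _ _ _ => //.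
  by split; [move=> j jm; rewrite ltn0|move=> j jm; rewrite ltn0|move=> _ j y _; rewrite ffunE].
by exists rr; split; [apply: sat_inv|].
Qed.

Theorem red_opaque w : (if w then weakly_opaque R TAM 0 else fully_opaque R TAM 0) <-> ~ rejects.
Proof.
have pr (rr : seq (step R 'I_nclk 'I_nloc 'I_nclk)) : private TAM rr.
  by rewrite /private /= finset.in_setT.
have pub0 : @PubTr R _ _ _ TAM = set0.
  by rewrite /PubTr -subset0 => x [rr [_]]; rewrite pr.
rewrite /weakly_opaque /fully_opaque pub0 image_set0.
have E : (take 0 @` @PrivTr R _ _ _ TAM = set0)%classic <-> ~ rejects.
  split=> [E /reject_runs[rr H]|nr].
    suff : (take 0 @` @PrivTr R _ _ _ TAM)%classic [::] by rewrite E.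
    have tP : @PrivTr R _ _ _ TAM (Defs.trace rr).
      by rewrite /PrivTr; exists rr; first by split=> //; apply: pr.
    by exists (Defs.trace rr); rewrite ?take0.
  by rewrite -subset0 => x [y [rr [/runs_reject /nr]]].
by case: w => //; rewrite subset0.
Qed.

End Runs.

End Reduction.

End Reduction.
Import Reduction.

Module Generators.
From mathcomp Require Import zify.

(** * Words generated in polynomial time *)

Inductive aexp := AVar of nat | ANum of nat
  | AAdd of aexp & aexp | AMul of aexp & aexp | ASub of aexp & aexp.

Fixpoint aval a env := match a with
  | AVar i => nth 0 env i
  | ANum n => n
  | AAdd a c => aval a env + aval c env
  | AMul a c => aval a env * aval c env
  | ASub a c => aval a env - aval c env
  end.

Fixpoint aexpr a := match a with
  | AVar i => XVar i
  | ANum n => const_expr n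
  | AAdd a c => XRec (aexpr c) (aexpr a) (XSuc (XVar 0))
  | AMul a c => XRec (aexpr c) XZero (XRec (XWk (XWk (aexpr a))) (XVar 0) (XSuc (XVar 0)))
  | ASub a c => XRec (aexpr c) (aexpr a) (XRec (XVar 0) XZero (XVar 1))
  end.

(** Bounds the value and all intermediate values of [aexpr a], such as the argument counters of a
    product. *)
Fixpoint abound a M := match a with
  | AVar _ => M
  | ANum n => n
  | AAdd a c => abound a M + abound c M
  | AMul a c => abound a M * abound c M + (abound a M + abound c M)
  | ASub a c => abound a M + abound c M
  end.

Lemma poly_abound a : poly (abound a).
Proof.
elim: a => [i|n|a pa c pc|a pa c pc|a pa c pc] /=; rewrite -?[fun M => _]/(abound _).
- exact: poly_id.
- exact: poly_const.
- exact: poly_add pa pc.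
- exact: poly_add (poly_mul pa pc) (poly_add pa pc).
- exact: poly_add pa pc.
Qed.

Lemma iter_succ x k : iteri k (fun _ y => y.+1) x = x + k.
Proof. by elim: k => [|k /= ->]; rewrite ?addn0 ?addnS. Qed.

Lemma iter_pred x : iteri x (fun i _ => i) 0 = x.-1.
Proof. by case: x. Qed.

Lemma aexprP a M b env : all (fun v => v <= M) env -> abound a M <= b ->
  [/\ ev (aexpr a) env = aval a env, aval a env <= abound a M & within b (aexpr a) env].
Proof.
move=> eM; elim: a => [i|n|a IHa c IHc|a IHa c IHc|a IHa c IHc] /= ab.
- have nM : nth 0 env i <= M.
    case: (ltnP i (size env)) => [h|h]; last by rewrite nth_default.
    by apply: (allP eM); apply: mem_nth.
  by split=> //; split=> //; apply: leq_trans ab.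
- by have [-> W] := const_exprP env ab; split.
- have [|-> va Wa] := IHa; first lia; have [|-> vc Wc] := IHc; first lia.
  rewrite iter_succ; split=> //; first by rewrite leq_add.
  split; first lia; split=> // i ic; rewrite iter_succ; lia.
- have [|Ea va Wa] := IHa; first lia; have [|Ec vc Wc] := IHc; first lia.
  have vv : aval a env * aval c env <= abound a M * abound c M by apply: leq_mul.
  have it i : iteri i (fun i0 a0 => iteri (ev (aexpr a) env) (fun _ a1 => a1.+1) a0) 0 = aval a env * i.
    by elim: i => [|i /= ->]; rewrite ?muln0 // iter_succ Ea mulnS addnC.
  rewrite Ec it; split=> //; first lia; split; first lia.
  split=> // i ic; rewrite it iter_succ Ea.
  have vi : aval a env * i + aval a env <= aval a env * aval c env by rewrite -mulnSr leq_mul2l ic orbT.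
  split; first lia; split.
  + by split; [lia|split; [lia|]].
  + by split; [lia|].
  + by move=> j ja; rewrite iter_succ; split; [lia|split; [lia|]].
- have [|Ea va Wa] := IHa; first lia; have [|Ec vc Wc] := IHc; first lia.
  have it i : iteri i (fun i0 a0 => iteri a0 (fun i1 _ => i1) 0) (ev (aexpr a) env) = aval a env - i.
    by elim: i => [|i /= ->]; rewrite ?subn0 // iter_pred subnS.
  rewrite Ec it; split=> //; first lia; split; first lia.
  split=> // i ic; rewrite it iter_pred.
  split; first lia; split.
  + by split; [lia|].
  + by split.
  + by move=> j ja; split; [lia|].
Qed.

Section Gen.
Variable C : Type.

Inductive gen := GNil | GSym of C | GCat of gen & gen | GFor of aexp & gen.

Fixpoint gout g env : seq C := match g with
  | GNil => [::]
  | GSym x => [:: x]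
  | GCat g1 g2 => gout g1 env ++ gout g2 env
  | GFor a g => flatten [seq gout g (i :: env) | i <- iota 0 (aval a env)]
  end.

Fixpoint gbound g M := match g with
  | GNil | GSym _ => 0
  | GCat g1 g2 => gbound g1 M + gbound g2 M
  | GFor a g => abound a M + gbound g (M + abound a M)
  end.

Lemma poly_gbound g : poly (gbound g).
Proof.
elim: g => [|x|g1 p1 g2 p2|a g pg] /=; try exact: poly_const.
  exact: poly_add p1 p2.
exact: poly_add (poly_abound a) (poly_comp pg (poly_add poly_id (poly_abound a))).
Qed.

Fixpoint gcost b g := match g with
  | GNil | GSym _ => 1
  | GCat g1 g2 => gcost b g1 + gcost b g2 + 1
  | GFor a g => cost b (aexpr a) + (b * (gcost b g + 5) + 5)
  end.

Lemma poly_gcost g : poly (gcost ^~ g).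
Proof.
elim: g => [|x|g1 p1 g2 p2|a g pg] /=; try exact: poly_const.
  exact: poly_add (poly_add p1 p2) (poly_const 1).
apply: poly_add (poly_cost _) (poly_add (poly_mul poly_id (poly_add pg (poly_const 5))) (poly_const 5)).
Qed.

End Gen.
Arguments GNil {C}.

Section Compile.
Variables (B C : finType).
Notation cmd := (cmd B C).

Fixpoint gcomp (rho : seq nat) d (g : gen C) : cmd := match g with
  | GNil => CSkip
  | GSym x => CEmit x
  | GCat g1 g2 => CSeq (gcomp rho d g2) (gcomp rho d g1)
  | GFor a g => CSeq (comp B C rho d (aexpr a))
      (CWhile d (CSeq (CDec d) (gcomp (d :: rho) d.+1 g)))
  end.

(* Words are emitted from right to left, so that a loop counts down. *)
Lemma gcompP g rho d env reg M b : frame rho d env reg -> all (fun v => v <= M) env ->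
  M + gbound g M <= b -> forall l r o, exists t reg', [/\ t <= gcost b g,
    exec b (gcomp rho d g) (Store reg l r o) t (Store reg' l r (gout g env ++ o)) & reg' =1 reg].
Proof.
elim: g rho d env reg M => [|x|g1 IH1 g2 IH2|a g IH] rho d env reg M F eM gb l r o /=.
- by exists 1, reg; split=> //; constructor.
- by exists 1, reg; split=> //; constructor.
- have [|t2 [reg2 [tt2 X2 E2]]] := IH2 rho d env reg M F eM _ l r o; first by rewrite /= in gb; lia.
  have F2 : frame rho d env reg2.
    by have [A1 A2 A3] := F; split=> //; [rewrite -A1; apply: eq_map|move=> k /A3; rewrite E2].
  have [|t1 [reg1 [tt1 X1 E1]]] := IH1 rho d env reg2 M F2 eM _ l r (gout g2 env ++ o); first by rewrite /= in gb; lia.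
  exists (t2 + t1).+1, reg1; split; [lia|rewrite -catA; exact: ESeq X2 X1|].
  by move=> k; rewrite E1 E2.
rewrite /= in gb; have [A1 A2 A3] := F.
have [|Ea va Wa] := aexprP (a := a) (b := b) eM; first lia.
have eb : all (fun v => v <= b) env by apply: sub_all eM => v /= h; lia.
have [t0 [reg0 [tt0 X0 E0]]] := comp_runs F eb Wa l r o; rewrite Ea in E0.
have loop k reg1 o1 : k <= aval a env -> reg1 =1 setr reg d k -> exists t reg', [/\ t <= (k * (gcost b g + 5)).+1,
    exec b (CWhile d (CSeq (CDec d) (gcomp (d :: rho) d.+1 g))) (Store reg1 l r o1) t
      (Store reg' l r (flatten [seq gout g (i :: env) | i <- iota 0 k] ++ o1)) & reg' =1 reg].
  elim: k reg1 o1 => [|k IHk] reg1 o1 ka E1.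
    exists 1, reg1; split=> //; first by apply: EWhile0; rewrite /= E1 /setr eqxx.
    by move=> j; rewrite E1 /setr; case: eqP => // ->; rewrite A3.
  have d1 : reg1 d = k.+1 by rewrite E1 /setr eqxx.
  pose reg2 := setr reg1 d k.
  have X1 : exec b (CDec d) (Store reg1 l r o1) 1 (Store reg2 l r o1).
    have X := @EDec B C b d (Store reg1 l r o1); rewrite /set_reg /= in X.
    by rewrite /reg2 -[k in setr _ _ k]/(k.+1.-1) -d1; apply: X; rewrite d1 //; lia.
  have E2 : reg2 =1 setr reg d k.
    by move=> j; rewrite /reg2 /setr E1 /setr; case: eqP.
  have F2 : frame (d :: rho) d.+1 (k :: env) reg2.
    split=> /=.
    - rewrite E2 /setr eqxx -A1 (@map_frame _ d reg) // => j jd.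
      by rewrite E2 /setr ltn_eqF.
    - by rewrite ltnSn; apply: sub_all A2 => j /ltnW.
    - by move=> j jd; rewrite E2 /setr gtn_eqF // A3 // ltnW.
  have [||t2 [reg3 [tt2 X2 E3]]] := IH _ _ _ _ (M + abound a M) F2 _ _ l r o1.
  - by rewrite /=; apply/andP; split; [lia|apply: sub_all eM => v /= h; lia].
  - lia.
  have [||t3 [reg4 [tt3 X3 E4]]] := IHk reg3 (gout g (k :: env) ++ o1).
  - exact: ltnW.
  - by move=> j; rewrite E3.
  exists ((1 + t2).+1 + t3).+1, reg4; split=> //; first by rewrite mulSn; lia.
  have -> : iota 0 k.+1 = iota 0 k ++ [:: k] by rewrite -[k.+1]addn1 iotaD.
  rewrite map_cat flatten_cat /= cats0 -catA.
  by apply: EWhileS X3; [rewrite /= d1|exact: ESeq X1 X2].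
have [t1 [reg1 [tt1 X1 E1]]] := loop _ reg0 o (leqnn _) E0.
exists (t0 + t1).+1, reg1; split=> //; last exact: ESeq X0 X1.
have : aval a env * (gcost b g + 5) <= b * (gcost b g + 5) by rewrite leq_mul2r; apply/orP; right; lia.
lia.
Qed.

Lemma poly_sum (T : Type) (s : seq T) (F : T -> nat -> nat) :
  (forall x, poly (F x)) -> poly (fun n => \sum_(x <- s) F x n).
Proof.
move=> pF; elim: s => [|x s IH].
  by apply: poly_le (poly_const 0) => n; rewrite big_nil.
by apply: poly_le (poly_add (pF x) IH) => n; rewrite big_cons.
Qed.

(** A first pass counts the input letters into register 0. Output goes from right to left, so after
    rewinding come [g2], then the letters, read backwards while register 1 counts their index down,
    and finally [g1]. *)
Theorem gen_poly_time (g1 g2 : gen C) (gb : B -> gen C) : poly_time_computable (fun w =>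
  gout g1 [:: size w] ++
  flatten [seq gout (gb y.1) [:: y.2; size w] | y <- zip w (iota 0 (size w))] ++
  gout g2 [:: size w]).
Proof.
pose c : cmd := CSeq (CInput (fun _ => CInc 0)) (CSeq CRewind (CSeq (gcomp [:: 0] 1 g2)
  (CSeq (comp B C [:: 0] 1 (XVar 0))
  (CSeq (CInput (fun x => CSeq (CDec 1) (gcomp [:: 1; 0] 2 (gb x)))) (gcomp [:: 0] 1 g1))))).
pose p n := n + (gbound g1 n + gbound g2 n + \sum_(x <- enum B) gbound (gb x) n).
have pp : poly p.
  apply: poly_add poly_id _; apply: poly_add; first exact: poly_add (poly_gbound _) (poly_gbound _).
  by apply: poly_sum => x; apply: poly_gbound.
pose T b := \sum_(x <- enum B) gcost b (gb x).
pose q0 b := gcost b g1 + gcost b g2 + (10 * b + 3) + 20.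
pose q n := (n * 4 + 20 + q0 (p n)) + n * (T (p n) + 10).
have pq : poly q.
  have pT : poly T by apply: poly_sum => x; apply: poly_gcost.
  have pq0 : poly q0.
    apply: poly_add (poly_const _); apply: poly_add; first exact: poly_add (poly_gcost _) (poly_gcost _).
    exact: poly_add (poly_mul (poly_const _) poly_id) (poly_const _).
  apply: poly_add.
    apply: poly_add (poly_comp pq0 pp).
    exact: poly_add (poly_mul poly_id (poly_const _)) (poly_const _).
  exact: poly_mul poly_id (poly_add (poly_comp pT pp) (poly_const _)).
apply: (@exec_poly_time B C (regs c) c p q _ pp pq (wf_regs (leqnn _))) => w.
set n := size w; set b := p n.
have nb : n <= b by apply: leq_addr.
pose st k : nat -> nat := fun j => if j == 0 then n else if j == 1 then k else 0.
have count l r o k reg : k + size l = n -> reg =1 (fun j => if j == 0 then k else 0) ->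
    exists t reg', [/\ t <= (size l * 2).+1,
      exec b (CInput (fun _ => CInc 0)) (Store reg l r o : store B C) t (Store reg' [::] (catrev l r) o)
      & reg' =1 st 0].
  elim: l k r reg => [|x l IH] k r reg kn Er.
    exists 1, reg; split=> //; first by apply: EInput0.
    by rewrite /= addn0 in kn; case=> [|[|j]]; rewrite Er //= /st /= kn.
  have [||t [reg' [tt X Er']]] := IH k.+1 (x :: r) (setr reg 0 k.+1).
  - by rewrite -kn /= addSnnS.
  - by case=> [|j]; rewrite /setr //= Er.
  exists (1 + t).+1, reg'; split=> //.
  apply: (@EInputS _ _ _ _ x l _ 1 (Store (setr reg 0 k.+1) l (x :: r) o)) => //.
  have r0 : reg 0 = k by rewrite Er.
  have X1 := @EInc B C b 0 (Store reg l (x :: r) o); rewrite /set_reg /= in X1.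
  rewrite -[k in setr _ _ k.+1]r0; apply: X1; rewrite r0.
  by apply: leq_trans nb; rewrite -kn /=; lia.
have [||t1 [reg1 [tt1 X1 E1]]] := count (rev w) [::] [::] 0 (fun=> 0).
- by rewrite size_rev.
- by case.
rewrite size_rev in tt1; have wE : catrev (rev w) [::] = w by rewrite -[catrev _ _]/(rev (rev w)) revK.
rewrite wE in X1.
have X2 := @ERewind B C b (Store reg1 [::] w [::]); rewrite /= -/(rev w) in X2.
have F1 reg : reg =1 st 0 -> frame [:: 0] 1 [:: n] reg.
  by move=> E; split=> //=; [rewrite E|case=> [|[|j]] // _; rewrite E].
have [||t3 [reg3 [tt3 X3 E3]]] := gcompP (g := g2) (M := n) (b := b) (F1 _ E1) _ _ (rev w) [::] [::].
- by rewrite /= leqnn.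
- by rewrite /b /p; lia.
have E3' : reg3 =1 st 0 by move=> j; rewrite E3.
have Wv : within b (XVar 0) [:: n] by [].
have [|t4 [reg4 [tt4 X4 E4]]] := comp_runs (b := b) (C := C) (F1 _ E3') _ Wv (rev w) [::] (gout g2 [:: n] ++ [::]).
  by rewrite /= nb.
have E4' : reg4 =1 st n by case=> [|[|j]]; rewrite E4 /setr //= E3'.
have letters w' reg r o : size w' <= n -> reg =1 st (size w') -> exists t reg', [/\ t <= (size w' * (T b + 5)).+1,
    exec b (CInput (fun x => CSeq (CDec 1) (gcomp [:: 1; 0] 2 (gb x)))) (Store reg (rev w') r o) t
      (Store reg' [::] (catrev (rev w') r)
       (flatten [seq gout (gb y.1) [:: y.2; n] | y <- zip w' (iota 0 (size w'))] ++ o)) & reg' =1 st 0].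
  elim/last_ind: w' reg r o => [|w' x IH] reg r o wn Er.
    by exists 1, reg; split=> //; apply: EInput0.
  rewrite size_rcons in wn Er; pose reg1' := setr reg 1 (size w').
  have Xd l r' : exec b (CDec 1) (Store reg l r' o : store B C) 1 (Store reg1' l r' o).
    have r1 : reg 1 = (size w').+1 by rewrite Er.
    have X := @EDec B C b 1 (Store reg l r' o); rewrite /set_reg /= in X.
    rewrite /reg1' -[size w']/((size w').+1.-1) -r1; apply: X; rewrite r1 //.
    exact: leq_trans nb.
  have Er1 : reg1' =1 st (size w') by case=> [|[|j]]; rewrite /reg1' /setr //= Er.
  have Fx : frame [:: 1; 0] 2 [:: size w'; n] reg1'.
    split=> //=; first by rewrite !Er1.
    by case=> [|[|j]] // _; rewrite Er1.
  have xs : gbound (gb x) n <= \sum_(x <- enum B) gbound (gb x) n /\ gcost b (gb x) <= T b.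
    by split; rewrite /T (big_rem x) ?mem_enum //= leq_addr.
  have [||t5 [reg5 [tt5 X5 E5]]] := gcompP (g := gb x) (M := n) (b := b) Fx _ _ (rev w') (x :: r) o.
  - by rewrite /= leqnn (ltnW wn).
  - by rewrite /b /p; lia.
  have [||t6 [reg6 [tt6 X6 E6]]] := IH reg5 (x :: r) (gout (gb x) [:: size w'; n] ++ o).
  - exact: ltnW.
  - by move=> j; rewrite E5.
  exists ((1 + t5).+1 + t6).+1, reg6; split=> //.
    by rewrite size_rcons mulSn; lia.
  have -> : iota 0 (size (rcons w' x)) = iota 0 (size w') ++ [:: size w'] by rewrite size_rcons -[(size w').+1]addn1 iotaD.
  rewrite rev_rcons -[in zip _ _]cats1 zip_cat ?size_iota // map_cat flatten_cat /= cats0 -catA.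
  by apply: (@EInputS _ _ _ _ x (rev w')) X6 => //; apply: ESeq (Xd _ _) X5.
have [|t5 [reg5 [tt5 X5 E5]]] := letters w reg4 [::] (gout g2 [:: n] ++ [::]) (leqnn _); first exact: E4'.
rewrite wE in X5.
have [||t6 [reg6 [tt6 X6 E6]]] := gcompP (g := g1) (M := n) (b := b) (F1 _ E5) _ _ [::] w
   (flatten [seq gout (gb y.1) [:: y.2; n] | y <- zip w (iota 0 (size w))] ++ gout g2 [:: n] ++ [::]).
- by rewrite /= leqnn.
- by rewrite /b /p; lia.
eexists; eexists; split.
- exact: ESeq X1 (ESeq X2 (ESeq X3 (ESeq X4 (ESeq X5 X6)))).
- have : cost b (XVar 0) = 10 * b + 3 by [].
  by rewrite /q /q0 -/n -/b; move: tt1 tt3 tt4 tt5 tt6; rewrite -/n /=; lia.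
- by rewrite /= cats0.
Qed.

End Compile.

End Generators.
Import Generators.

(** * Generating the encoding of the simulating automaton *)

Module Generation.
From mathcomp Require Import zify.
From mathcomp Require Import boolp classical_sets reals.

Import Order.TTheory GRing.Theory Num.Theory.

Lemma map_flat (S T : Type) (f : S -> seq T) ss :
  flatten (map f (flatten ss)) = flatten [seq flatten (map f x) | x <- ss].
Proof. by elim: ss => //= x ss IH; rewrite map_cat flatten_cat IH. Qed.

Definition gcat (l : seq (gen sym)) := foldr (@GCat sym) GNil l.
Definition gstr (w : seq sym) := locked (gcat (map (@GSym sym) w)).
Definition gunary a := locked (GCat (GFor a (GSym S1)) (GSym Sep)).

Lemma gcatE l env : gout (gcat l) env = flatten [seq gout g env | g <- l].
Proof. by elim: l => //= g l ->. Qed.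

Lemma gstrE w env : gout (gstr w) env = w.
Proof. by rewrite /gstr -lock gcatE -map_comp; elim: w => //= x w ->. Qed.

Lemma gunaryE a env : gout (gunary a) env = enc_unary (aval a env).
Proof.
rewrite /gunary -lock /= /enc_unary; congr (_ ++ _).
by elim: (aval a env) 0 => //= k IH i; rewrite IH.
Qed.

Lemma gcat_cons g l env : gout (gcat (g :: l)) env = gout g env ++ gout (gcat l) env.
Proof. by []. Qed.
Lemma gforE a (g : gen sym) env : gout (GFor a g) env = flatten [seq gout g (i :: env) | i <- iota 0 (aval a env)].
Proof. by []. Qed.
Lemma gcat2E (g1 g2 : gen sym) env : gout (GCat g1 g2) env = gout g1 env ++ gout g2 env.
Proof. by []. Qed.
Lemma avalD a c env : aval (AAdd a c) env = aval a env + aval c env. Proof. by []. Qed.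
Lemma avalM a c env : aval (AMul a c) env = aval a env * aval c env. Proof. by []. Qed.
Lemma avalB a c env : aval (ASub a c) env = aval a env - aval c env. Proof. by []. Qed.
Lemma avalN k env : aval (ANum k) env = k. Proof. by []. Qed.
Lemma avalV k env : aval (AVar k) env = nth 0 env k. Proof. by []. Qed.

Fixpoint apow0 a k := if k is k'.+1 then AMul a (apow0 a k') else ANum 1.
Definition apow a k := locked (apow0 a k).
Lemma apowE a k env : aval (apow a k) env = aval a env ^ k.
Proof. by rewrite /apow -lock; elim: k => //= k ->; rewrite expnS. Qed.

Lemma iota_blocks (T : Type) (phi : nat -> seq T) b N Z :
  flatten [seq phi l | l <- iota b (N * Z)] =
  flatten [seq flatten [seq phi (b + i * Z + l) | l <- iota 0 Z] | i <- iota 0 N].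
Proof.
elim: N => [|N IH]; first by rewrite mul0n.
have -> : iota 0 N.+1 = iota 0 N ++ [:: N] by rewrite -[N.+1]addn1 iotaD.
rewrite mulSnr iotaD map_cat flatten_cat IH map_cat flatten_cat /= cats0; congr (_ ++ flatten _).
by rewrite -[X in iota X Z]addn0 iotaDl -map_comp.
Qed.

Lemma enum_rank_iota (T : finType) : [seq nat_of_ord (enum_rank x) | x <- enum T] = iota 0 #|T|.
Proof.
apply: (@eq_from_nth _ 0); first by rewrite size_map size_iota -cardE.
move=> i; rewrite size_map -cardE => iT; rewrite nth_iota // add0n.
have x0 : T := enum_val (Ordinal iT).
rewrite (nth_map x0) -?cardE //.
by rewrite -[i]/(nat_of_ord (Ordinal iT)) -enum_val_nth enum_valK.
Qed.

Section Generate.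
Variables (G : finType) (M : TM G) (c0 k0 : nat) (u : seq G).
Local Notation K := (tm_aux M).
Local Notation n := (size u).
Local Notation s := (poly_bound c0 k0 n).
Hypothesis space : forall t, tm_space (tm_run M t u) <= s.

(** [d] is the index of the input length in the environment; it is the number of enclosing loops, up
    to the letter index. *)
Definition aS d := locked (AAdd (AMul (ANum c0) (apow (AVar d) k0)) (ANum c0)).
Definition aP d := locked (AAdd (AMul (ANum 2) (aS d)) (ANum 1)).
Definition aQ d := locked (AAdd (aP d) (ANum 1)).
Definition aM d := locked (AMul (ANum K.+1) (aP d)).
Definition aM1 d := locked (AAdd (aM d) (ANum 1)).
Definition ablock d := locked (AMul (apow (aQ d) K.+1) (aM1 d)).
Definition ahc (h : nat -> aexp) d := locked (foldr (fun i a => AAdd (AMul a (aQ d)) (h i)) (ANum 0) (iota 0 K.+1)).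
Definition aloc (f : ctl M) h c d := locked (AAdd (aM1 d) (AAdd
  (AMul (AAdd (AMul (ANum (enum_rank f)) (apow (aQ d) K.+1)) (ahc h d)) (aM1 d)) c)).
Definition anloc d := locked (AAdd (aM1 d) (AMul (AMul (ANum #|{: ctl M}|) (apow (aQ d) K.+1)) (aM1 d))).
Definition anclk d := locked (AMul (aM d) (ANum (gC G))).

Section Values.
Variables (d : nat) (env : seq nat).
Hypothesis dn : nth 0 env d = n.
Lemma aSE : aval (aS d) env = s. Proof. by rewrite /aS -lock avalD avalM apowE !avalN avalV dn. Qed.
Lemma aPE : aval (aP d) env = P s. Proof. by rewrite /aP -lock avalD avalM aSE !avalN. Qed.
Lemma aQE : aval (aQ d) env = Q s. Proof. by rewrite /aQ -lock avalD aPE avalN addn1. Qed.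
Lemma aME : aval (aM d) env = m M s. Proof. by rewrite /aM -lock avalM aPE avalN. Qed.
Lemma aM1E : aval (aM1 d) env = (m M s).+1. Proof. by rewrite /aM1 -lock avalD aME avalN addn1. Qed.
Lemma ablockE : aval (ablock d) env = block M s.
Proof. by rewrite /ablock -lock avalM apowE aQE aM1E. Qed.
Lemma ahcE h h' : (forall i, i < K.+1 -> aval (h i) env = h' i) -> aval (ahc h d) env = hcode M s h'.
Proof.
move=> hh; rewrite /ahc -lock /hcode; have : all (fun i => aval (h i) env == h' i) (iota 0 K.+1).
  by apply/allP=> i; rewrite mem_iota => /hh ->.
elim: (iota 0 K.+1) => [|i l IH]; first by [].
case/andP=> /eqP hi /IH E; rewrite [foldr _ _ (i :: l)]/(foldr _ _ _) -/foldr avalD avalM aQE hi.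
by rewrite -[foldr _ _ (i :: l) in RHS]/(foldr (fun i a => a * Q s + h' i) 0 l * Q s + h' i) -E.
Qed.
Lemma alocE f h h' c : (forall i, i < K.+1 -> aval (h i) env = h' i) ->
  aval (aloc f h c d) env = locnum s f h' (aval c env).
Proof. by move=> hh; rewrite /aloc -lock !(avalD, avalM, avalN) aM1E apowE aQE (ahcE hh). Qed.
Lemma anlocE : aval (anloc d) env = nloc M s.
Proof. by rewrite /anloc -lock !(avalD, avalM, avalN) aM1E apowE aQE. Qed.
Lemma anclkE : aval (anclk d) env = nclk M s.
Proof. by rewrite /anclk -lock avalM avalN aME. Qed.
End Values.

Definition gclk j (x : option G) := locked (gunary (AAdd (AMul j (ANum (gC G))) (ANum (enum_rank x)))).
Definition gcons (ops : option G -> cmp * int) j := locked (gcat (gstr [:: Open] ::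
  rcons [seq GCat (gclk j y) (gstr (enc_unary (nat_of_cmp (ops y).1) ++ enc_int (ops y).2)) | y <- enum {: option G}]
  (gstr [:: Close]))).
Definition gcell src tgt j ops x := locked (gcat [:: gunary src; gcons ops j; gstr [:: S1]; gclk j x;
  gstr [:: Open]; gclk j x; gstr [:: Close]; gunary tgt]).
Definition geps src tgt := locked (gcat [:: gunary src; gstr [:: Open; Close; S0; Open; Close]; gunary tgt]).

Definition ops_of (x y : option G) : cmp * int :=
  (if y == x then CEq else CGe, if y == x then Posz 1 else Posz 2).
Definition ops0 (y : option G) : cmp * int := (CGe, Posz 1).

Lemma gclkE j x env : aval j env < m M s -> gout (gclk j x) env = enc_ord (clk M s (aval j env) x).
Proof. by move=> jm; rewrite /gclk -lock gunaryE /enc_ord clkE // avalD avalM !avalN. Qed.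

Lemma gconsE j ops env : aval j env < m M s -> gout (gcons ops j) env =
  enc_guard [seq (clk M s (aval j env) y, (ops y).1, (ops y).2) | y <- enum {: option G}].
Proof.
move=> jm; rewrite /gcons -lock gcatE map_cons map_rcons /enc_guard /enc_seq.
rewrite -[flatten (_ :: _)]/(_ ++ flatten _) flatten_rcons !gstrE; congr (_ :: _ ++ _).
rewrite -!map_comp; congr flatten; apply/eq_map => y; rewrite /ssrfun.comp; cbv beta; rewrite gcat2E gclkE // gstrE.
by [].
Qed.

Lemma gcellE src tgt j ops x env vs vt vj : aval src env = vs -> aval tgt env = vt -> aval j env = vj ->
  vs < nloc M s -> vt < nloc M s -> vj < m M s ->
  gout (gcell src tgt j ops x) env = enc_edge (@cell_edge G M s vs vt vj
    [seq (clk M s vj y, (ops y).1, (ops y).2) | y <- enum {: option G}] x).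
Proof.
move=> <- <- <- sl tl jm; rewrite /gcell -lock !gcat_cons !gunaryE !gstrE gconsE // !gclkE //.
rewrite /cell_edge /enc_edge [eguard _]/= [eact _]/= [ereset _]/= [esrc _]/= [etgt _]/=.
rewrite /enc_set enum_set1 /enc_seq [flatten _]/= cats0 /enc_act.
move: (enc_guard _) (enc_ord (clk _ _ _ _)) => X Y; rewrite /enc_ord !locE //.
move: (enc_unary _) (enc_unary _) => U V.
by rewrite -[gout (gcat [::]) env]/[::] cats0 /= -!catA.
Qed.

Lemma gepsE src tgt env vs vt : aval src env = vs -> aval tgt env = vt ->
  vs < nloc M s -> vt < nloc M s -> gout (geps src tgt) env = enc_edge (eps_edge M s vs vt).
Proof.
move=> <- <- sl tl; rewrite /geps -lock !gcat_cons !gunaryE !gstrE /eps_edge /enc_edge.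
rewrite [eguard _]/= [eact _]/= [ereset _]/= [esrc _]/= [etgt _]/= /enc_set enum_set0 /enc_ord !locE //.
by move: (enc_unary _) (enc_unary _) => U V; rewrite -[gout (gcat [::]) env]/[::] cats0.
Qed.

Definition gloops (b : nat -> aexp) := fix loops k d (g : gen sym) :=
  if k is k'.+1 then GFor (b d) (loops k' d.+1 g) else g.

Lemma gloopsE k d g acc : nth 0 acc d = n ->
  gout (gloops aP k d g) acc = flatten [seq gout g e | e <- tuples s k acc].
Proof.
elim: k d acc => [|k IH] d acc dn; first by rewrite /= cats0.
rewrite -[gloops _ _ _ _]/(GFor (aP d) (gloops aP k d.+1 g)) gforE aPE //.
rewrite -[tuples _ _ _]/(flatten [seq tuples s k (a :: acc) | a <- iota 0 (P s)]).
by elim: (iota 0 (P s)) => // a l; rewrite !map_cons => H; rewrite /= map_cat flatten_cat -H IH.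
Qed.

Definition acell (i p : nat -> aexp) (j : nat) d := AAdd (AMul (ANum j) (aP d)) (p d).
(** The head positions are variables 0 to K; [sh] is 1 inside a loop over cells, which shifts them,
    and 0 outside. *)
Definition gstep (f f' : ctl M) sh (i : nat) p x x' := let d := K.+1 + sh in
  let c := AAdd (AMul (ANum i) (aP d)) p in let h k := AVar (k + sh) in
  gcell (aloc f h c d) (aloc f' h (AAdd c (ANum 1)) d) c (ops_of x) x'.

Definition gsym f (i : 'I_K.+1) x := locked (gcat [:: GFor (AVar i) (gstep f f 1 i (AVar 0) x x);
  GFor (ASub (aP K.+1) (AAdd (AVar i) (ANum 1)))
    (gstep f f 1 i (AAdd (AAdd (AVar i.+1) (ANum 1)) (AVar 0)) x x);
  gstep f (eff f i x).1 0 i (AVar i) x (eff f i x).2]).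

Definition awrap (f : ctl M) (k : nat) := if f.2 is inr a then
    match (a (inord k)).2 with MoveL => ASub (AVar k) (ANum 1) | Stay => AVar k | MoveR => AAdd (AVar k) (ANum 1) end
  else AVar k.

Definition gctl f := locked (gcat (geps (aloc f AVar (aM K.+1) K.+1) (aloc (wrap_ctl f) (awrap f) (ANum 0) K.+1) ::
  [seq gcat [seq gsym f i x | x <- enum {: option G}] | i <- enum 'I_K.+1])).

Lemma gstepE f f' sh (i : 'I_K.+1) p x x' e h vp : nth 0 e (K.+1 + sh) = n ->
  (forall k, k < K.+1 -> nth 0 e (k + sh) = h k) -> (forall k, k < K.+1 -> h k < P s) ->
  aval p e = vp -> vp < P s ->
  gout (gstep f f' sh i p x x') e = enc_edge (step_edge s f f' h i vp x x').
Proof.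
move=> en eh hP pE vP; rewrite /gstep /step_edge.
have jm : i * P s + vp < m M s by have := ltn_ord i; rewrite /m; nia.
have hQ k : k < K.+1 -> h k < Q s by move=> /hP; apply: ltnW.
have cE : aval (AAdd (AMul (ANum i) (aP (K.+1 + sh))) p) e = i * P s + vp.
  by rewrite avalD avalM avalN aPE // pE.
rewrite (@gcellE _ _ _ _ _ _ (locnum s f h (i * P s + vp)) (locnum s f' h (i * P s + vp).+1) (i * P s + vp)) //.
- by rewrite (@alocE _ _ en _ _ h) // cE.
- by rewrite (@alocE _ _ en _ _ h) // avalD cE avalN addn1.
- by apply: locnum_lt => //; apply: ltnW.
- by apply: locnum_lt.
Qed.

Lemma gctlE f e : e \in tuples s K.+1 [:: n] -> nth 0 e K.+1 = n ->
  gout (gctl f) e = flatten (map (@enc_edge _ _ _) (ctl_edges s f (nth 0 e))).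
Proof.
move=> eT en; have hP := tuple_lt eT; rewrite /gctl -lock gcat_cons.
have hQ k : k < K.+1 -> nth 0 e k < Q s by move=> /hP; apply: ltnW.
rewrite -[flatten (map _ (ctl_edges _ _ _))]/(_ ++ flatten (map _ (flatten _))); congr (_ ++ _).
  apply: gepsE; [by rewrite (@alocE _ _ en _ _ (nth 0 e)) // aME| |exact: locnum_lt|].
    apply: (alocE en) => k kK; rewrite /awrap /wrap_heads; case: f.2 => // a.
    rewrite insubT; have -> : inord k = Ordinal kK :> 'I_K.+1 by apply/val_inj; rewrite /= inordK.
    rewrite -[Sub k _]/(Ordinal kK); case: (a _) => b [] /=; by rewrite ?(avalB, avalD) ?avalN ?avalV ?subn1 ?addn1.
  apply: locnum_lt => // k kK; rewrite /wrap_heads; case: f.2 => [v|a]; first exact: hQ.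
  rewrite insubT; have := hP k kK; rewrite /Q; case: (a _).2 => /=; lia.
rewrite gcatE map_flat; congr flatten; rewrite -!map_comp.
apply/eq_map => i; rewrite /ssrfun.comp; cbv beta.
rewrite gcatE map_flat; congr flatten; rewrite -!map_comp; apply/eq_map => x; rewrite /ssrfun.comp; cbv beta.
have hPi := hP i (ltn_ord i).
rewrite /gsym -lock !gcat_cons !gforE /sym_edges !map_cat !flatten_cat -!map_comp.
rewrite -[gout (gcat [::]) e]/[::]; congr (_ ++ (_ ++ _)).
- congr flatten; apply/eq_in_map => p; rewrite mem_iota /= => pi.
  apply: (@gstepE _ _ _ _ _ _ _ _ (nth 0 e)) => //=; rewrite ?addn1 //; last exact: ltn_trans hPi.
  by move=> k _; rewrite addn1.
- rewrite avalB aPE // avalD avalN avalV; congr flatten; apply/eq_in_map => p; rewrite mem_iota /= => pi.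
  apply: (@gstepE _ _ _ _ _ _ _ _ (nth 0 e)) => //=; rewrite ?addn1 //; last by lia.
  by move=> k _; rewrite addn1.
- by rewrite /= !cats0; apply: (@gstepE _ _ _ _ _ _ _ _ (nth 0 e)); rewrite ?addn0 // => k _; rewrite addn0.
Qed.

Definition ginit c x := gcell c (AAdd c (ANum 1)) c ops0 x.

Lemma ginitE c x env vc : aval c env = vc -> vc < m M s ->
  gout (ginit c x) env = enc_edge (init_edge M s vc x).
Proof.
have mL v : v <= m M s -> v < nloc M s by move=> h; apply: (@leq_trans (m M s).+1); rewrite // leq_addr.
move=> cE cm; rewrite /ginit /init_edge (@gcellE _ _ _ _ _ _ vc vc.+1 vc) //.
- by rewrite avalD cE avalN addn1.
- exact/mL/ltnW.
- exact: mL.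
Qed.

(** Only the edges writing the input depend on its letters. The encoding is cut there: [gen1] stops
    inside the list of edges, [genb] gives one edge per letter, and [gen2] closes the list and
    appends N = 0. *)
Definition gen1 := gcat [:: gunary (anclk 0); gunary (anloc 0); gunary (anclk 0); gunary (ANum 0);
  gstr [:: Open]; GFor (anloc 0) (gunary (AVar 0)); gstr [:: Close];
  gstr [:: Open]; gcat [seq if rejecting f then GFor (ablock 0) (gunary
      (AAdd (AAdd (aM1 1) (AMul (ANum (enum_rank f)) (ablock 1))) (AVar 0))) else GNil
    | f <- enum {: ctl M}]; gstr [:: Close];
  gstr [:: Open]; GFor (anloc 0) (gstr [:: Open; Close]); gstr [:: Close];
  gstr [:: Open]; GFor (aS 0) (ginit (AVar 0) None)].

Definition gen2 := gcat [:: GFor (ASub (aP 0) (AAdd (aS 0) (AVar 0)))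
    (ginit (AAdd (AAdd (aS 1) (AVar 1)) (AVar 0)) None);
  gcat [seq GFor (aP 0) (ginit (AAdd (AMul (ANum i.+1) (aP 1)) (AVar 0)) None) | i <- iota 0 K];
  geps (aM 0) (aloc (start_ctl M) (fun=> aS 0) (ANum 0) 0);
  gcat [seq gloops aP K.+1 0 (gctl f) | f <- enum {: ctl M} & f.1 \notin tm_halt M];
  gstr [:: Close; Sep]].

Definition genb (x : G) := ginit (AAdd (aS 1) (AVar 0)) (Some x).

(** The locations of one control form an interval of numbers, wholly final or wholly not, so final
    locations can be listed by loops. *)
Lemma final_block (f : ctl M) l : l < block M s ->
  final_loc M s ((m M s).+1 + enum_rank f * block M s + l) = rejecting f.
Proof.
move=> lb; rewrite /final_loc -addnA addKn divnMDl ?(leq_ltn_trans _ lb) // (divn_small lb) addn0.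
rewrite ltn_addr ?ltnSn //; apply/existsP/idP => [[f' /andP[rf /eqP E]]|rf]; last by exists f; rewrite rf eqxx.
by have /enum_rank_inj -> : enum_rank f = enum_rank f' by apply/val_inj.
Qed.

Lemma final_part : gout (gcat [seq if rejecting f then GFor (ablock 0) (gunary
      (AAdd (AAdd (aM1 1) (AMul (ANum (enum_rank f)) (ablock 1))) (AVar 0))) else GNil
    | f <- enum {: ctl M}]) [:: n] =
  flatten [seq (if final_loc M s l then enc_unary l else [::]) | l <- iota 0 (nloc M s)].
Proof.
have -> : nloc M s = (m M s).+1 + #|{: ctl M}| * block M s by rewrite /nloc /block mulnA.
rewrite iotaD map_cat flatten_cat add0n.
have -> : flatten [seq (if final_loc M s l then enc_unary l else [::]) | l <- iota 0 (m M s).+1] = [::].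
  transitivity (flatten [seq ([::] : seq sym) | l <- iota 0 (m M s).+1]); last by elim: (iota _ _).
  congr flatten; apply/eq_in_map => l; rewrite mem_iota /final_loc ltnS => /andP[_ lm].
  by rewrite ltnNge lm.
rewrite iota_blocks -enum_rank_iota -map_comp gcatE -map_comp; congr flatten; apply/eq_map => f; rewrite /ssrfun.comp; cbv beta.
have H : forall l, l \in iota 0 (block M s) -> (if final_loc M s ((m M s).+1 + enum_rank f * block M s + l)
     then enc_unary ((m M s).+1 + enum_rank f * block M s + l) else [::]) =
   if rejecting f then enc_unary ((m M s).+1 + enum_rank f * block M s + l) else [::].
  by move=> l; rewrite mem_iota => /andP[_ lb]; rewrite final_block.
have /eq_in_map -> := H; case: ifP => rf; last by elim: (iota _ _) => //= l L <-.
rewrite gforE ablockE //; congr flatten; apply/eq_map => l.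
by rewrite gunaryE !(avalD, avalM) aM1E // ablockE // avalN avalV.
Qed.

Lemma gen_encode : gout gen1 [:: n] ++
    flatten [seq gout (genb y.1) [:: y.2; n] | y <- zip u (iota 0 n)] ++ gout gen2 [:: n] =
  encode (Instance (red_ta M u s) 0).
Proof.
have [su s0] := size_u space.
have PM : P s <= m M s by rewrite /m mulSn leq_addr.
have sP : s + n <= P s by rewrite /P; lia.
have sL : s < P s by rewrite /P; lia.
have mL v : v <= m M s -> v < nloc M s by move=> h; apply: (@leq_trans (m M s).+1); rewrite // leq_addr.
have sM c : c < P s -> c < m M s by move=> cP; apply: leq_trans PM.
have fin : xset (nloc M s) (final_loc M s) = enc_set (ta_final (red_ta M u s)).
  by apply: xset_enc => l; rewrite finset.in_set.
have prv : xset (nloc M s) predT = enc_set (ta_priv (red_ta M u s)).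
  by apply: xset_enc => l; rewrite finset.in_setT.
have n1 : gout (GFor (anloc 0) (gunary (AVar 0))) [:: n] = flatten [seq enc_unary l | l <- iota 0 (nloc M s)].
  by rewrite gforE anlocE //; congr flatten; apply/eq_map => l; rewrite gunaryE.
have n2 : gout (GFor (anloc 0) (gstr [:: Open; Close])) [:: n] =
   flatten (map (@enc_guard _) [seq ta_inv (red_ta M u s) l | l <- enum 'I_(nloc M s)]).
  rewrite gforE anlocE // -map_comp -val_enum_ord -map_comp; congr flatten; apply/eq_map => l.
  by rewrite /ssrfun.comp; cbv beta; rewrite gstrE ffunE.
pose ee := @enc_edge (nclk M s) (nloc M s) (nclk M s).
have e1 : gout (GFor (aS 0) (ginit (AVar 0) None)) [:: n] = flatten (map ee [seq init_edge M s p None | p <- iota 0 s]).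
  rewrite gforE aSE // -map_comp; congr flatten; apply/eq_in_map => p; rewrite mem_iota => /andP[_ ps].
  by apply: ginitE => //; apply: sM; apply: ltn_trans sL.
have e2 : flatten [seq gout (genb y.1) [:: y.2; n] | y <- zip u (iota 0 n)] =
   flatten (map ee [seq init_edge M s (s + y.2) (Some y.1) | y <- zip u (iota 0 n)]).
  rewrite -map_comp; congr flatten; apply/eq_in_map => y yz.
  have yn : y.2 < n.
    have : y.2 \in unzip2 (zip u (iota 0 n)) by apply: map_f.
    by rewrite unzip2_zip ?size_iota // mem_iota.
  apply: ginitE; first by rewrite avalD aSE.
  by apply: sM; apply: leq_trans sP; rewrite ltn_add2l.
have e3 : gout (GFor (ASub (aP 0) (AAdd (aS 0) (AVar 0)))
    (ginit (AAdd (AAdd (aS 1) (AVar 1)) (AVar 0)) None)) [:: n] =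
   flatten (map ee [seq init_edge M s (s + n + p) None | p <- iota 0 (P s - (s + n))]).
  rewrite gforE avalB avalD aPE // aSE // avalV -map_comp; congr flatten.
  apply/eq_in_map => p; rewrite mem_iota => /andP[_ pP].
  apply: ginitE; first by rewrite !avalD aSE.
  by apply: sM; move: pP; rewrite add0n ltn_subRL.
have e4 : gout (gcat [seq GFor (aP 0) (ginit (AAdd (AMul (ANum i.+1) (aP 1)) (AVar 0)) None) | i <- iota 0 K]) [:: n] =
   flatten (map ee (flatten [seq [seq init_edge M s (i.+1 * P s + p) None | p <- iota 0 (P s)] | i <- iota 0 K])).
  rewrite gcatE map_flat -!map_comp; congr flatten.
  apply/eq_in_map => i; rewrite mem_iota => /andP[_ iK]; rewrite /ssrfun.comp; cbv beta; rewrite gforE aPE // -map_comp; congr flatten.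
  apply/eq_in_map => p; rewrite mem_iota => /andP[_ pP].
  apply: ginitE; first by rewrite avalD avalM aPE.
  apply: (@leq_trans (i.+2 * P s)); first by rewrite [i.+2 * _]mulSn addnC ltn_add2r.
  by rewrite /m leq_mul2r ltnS iK orbT.
have e5 : gout (geps (aM 0) (aloc (start_ctl M) (fun=> aS 0) (ANum 0) 0)) [:: n] =
   ee (eps_edge M s (m M s) (locnum s (start_ctl M) (fun=> s) 0)).
  apply: gepsE; [exact: aME| |exact: mL|].
    by rewrite (@alocE _ _ _ _ _ (fun=> s)) // => i _; apply: aSE.
  by apply: locnum_lt => // i _; apply: ltnW.
have e6 : gout (gcat [seq gloops aP K.+1 0 (gctl f) | f <- enum {: ctl M} & f.1 \notin tm_halt M]) [:: n] =
   flatten (map ee (flatten [seq flatten [seq ctl_edges s f (nth 0 e) | e <- tuples s K.+1 [:: n]]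
     | f <- enum {: ctl M} & f.1 \notin tm_halt M])).
  rewrite gcatE map_flat -!map_comp; congr flatten; apply/eq_map => f; rewrite /ssrfun.comp; cbv beta.
  rewrite gloopsE // [RHS]map_flat -[in RHS]map_comp; congr flatten; apply/eq_in_map => e eT.
  rewrite /ssrfun.comp; cbv beta; rewrite gctlE //; case/tuplesP: eT => l [sl _] ->.
  by rewrite nth_cat sl ltnn subnn.
rewrite encodeE -fin -prv /xset /xseq /enc_seq /gen1 /gen2 !gcat_cons !gunaryE !gstrE.
rewrite n1 n2 final_part e1 e2 e3 e4 e5 e6 anclkE // anlocE // avalN.
rewrite -/ee [ta_edges _]/= /edges /init_edges !map_cat map_cons !flatten_cat.
have fc x (l : seq (seq sym)) : flatten (x :: l) = x ++ flatten l by [].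
rewrite (fc (ee (eps_edge M s (m M s) (locnum s (start_ctl M) (fun=> s) 0)))).
rewrite /enc_ord -[ta_init _]/(loc M s 0) locE; last by rewrite /nloc ltn_addr.
rewrite -[enc_bin 0]/[:: Sep] -[gout (gcat [::]) _]/(@nil sym).
move: (ee (eps_edge _ _ _ _)) => X; repeat match goal with |- context [flatten ?x] => move: (flatten x) => ? end.
by move: enc_unary => U; rewrite ?cats0 -!catA /= -!catA.
Qed.

End Generate.

End Generation.
Import Generation.

(** * PSPACE-hardness *)

Module Hardness.
From mathcomp Require Import zify.
From mathcomp Require Import boolp classical_sets reals.

Lemma tm_run_stay (G : finType) (M : TM G) v t1 t2 : halted (tm_run M t1 v) -> t1 <= t2 ->
  tm_run M t2 v = tm_run M t1 v.
Proof.
move=> h1 /subnKC <-; elim: (t2 - t1) => [|k IH]; first by rewrite addn0.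
by rewrite addnS /tm_run iterS -/(tm_run M (t1 + k) v) IH /tm_step h1.
Qed.

(** The space bound that comes with the machine is an explicit polynomial in the input length, so it
    serves as [s] and the generator can evaluate it. *)
Theorem opacity_hard (R : realType) w : PSPACE_hard (opacity_lang R w).
Proof.
move=> B L [G [inj [M [c [k [_ HM]]]]]].
exists (fun v => gout (gen1 M c k) [:: size v] ++
  flatten [seq gout (genb c k (inj y.1)) [:: y.2; size v] | y <- zip v (iota 0 (size v))] ++
  gout (gen2 M c k) [:: size v]); first exact: (gen_poly_time (gen1 M c k) (gen2 M c k) (fun x => genb c k (inj x))).
move=> v; have [[t [ht acc]] sp] := HM v.
have space t' : tm_space (tm_run M t' (map inj v)) <= poly_bound c k (size (map inj v)).
  by rewrite size_map.
set fv := _ ++ _.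
have fE : fv = encode (Instance (red_ta M (map inj v) (poly_bound c k (size (map inj v)))) 0).
  rewrite -(gen_encode space) /fv size_map; congr (_ ++ (flatten _ ++ _)).
  move: (iota 0 (size v)) => l; move: (size v) => N; elim: (v) l => [|x v1 IH] [|a l] //=; by rewrite IH.
have rej : ~ rejects M (map inj v) <-> L v.
  split=> [nr|/acc at_ [t' /andP[h' r']]].
    apply/acc; apply: contra_notT nr => na; by exists t; rewrite /Reduction.run ht.
  (* A halted configuration never changes, so the verdict is the same at both halting times. *)
  suff E : tm_run M t' (map inj v) = tm_run M t (map inj v).
    by move: r'; rewrite /Reduction.run E at_.
  by case: (leqP t t') => [/(tm_run_stay ht)|/ltnW /(tm_run_stay h')].
have op := @red_opaque _ _ _ _ space R w.
split=> [Lv|[i [oA opq] E]].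
  exists (Instance (red_ta M (map inj v) (poly_bound c k (size (map inj v)))) 0) => //.
  by split; [exact: red_oERA|apply/op/rej].
have Ei := encode_inj (etrans E fE); rewrite Ei in opq.
exact/rej/op.
Qed.

End Hardness.
Import Hardness.

Theorem theorem6p37 (R : realType) :
  PSPACE_complete (weak_opacity_oERA R) /\
  PSPACE_complete (full_opacity_oERA R).
Proof.
split; split.
- exact: (opacity_in_PSPACE R true).
- exact: (opacity_hard R true).
- exact: (opacity_in_PSPACE R false).
- exact: (opacity_hard R false).
Qed.
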